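(* Let $\mathbf{k}$ be a field of characteristic $0$, let $G$ be a finite abelian group acting on a smooth affine variety $X$ over $\mathbf{k}$ with quotient $\pi : X\to Y=X/G$, and let $k$ be an integer with $1\leq k\leq\dim X$. The natural morphism $$(d\pi^{k})^{G}:\Omega^k_Y\longrightarrow(\Omega^k_X)^G$$ is surjective if and only if $Y$ is smooth.
   Context: $\Omega^k$ denotes Kähler $k$-forms over $\mathbf{k}$. $Y=\mathrm{Spec}(\mathcal O(X)^G)$, $(\Omega^k_X)^G$ is the $\mathcal O_Y$-module of $G$-invariant sections of $\pi_*\Omega^k_X$, and $(d\pi^k)^G$ is pull-back of forms along $\pi$. (In the general theory for reductive $G$ the target is the module $(\Omega^k_{X,G})^G$ of invariant horizontal forms, i.e. forms killed by contraction with the vector fields induced by the Lie algebra of $G$; for a finite group the Lie algebra is $0$, so $\Omega^k_{X,G}=\Omega^k_X$.) *)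

(* Defs.v *)
From HB Require Import structures.
From mathcomp Require Import all_boot all_order all_fingroup all_algebra.
From mathcomp Require Import generic_quotient ring_quotient.
From mathcomp Require Import boolp.
From mathcomp.multinomials Require Import freeg mpoly.

Set Implicit Arguments.
Unset Strict Implicit.
Unset Printing Implicit Defensive.

Import GRing.Theory.

Local Open Scope ring_scope.
Local Open Scope quotient_scope.

Section Span.
Variables (R : pzRingType) (V : lmodType R) (P : V -> Prop).

Definition span_pred : {pred V} :=
  [pred v | `[< forall S : {pred V}, submod_closed S ->
                  (forall u, P u -> u \in S) -> v \in S >]].

Fact span_submod_closed : submod_closed span_pred.
Proof.
split=> [|a u v /asboolP Su /asboolP Sv]; apply/asboolP => S clS PS.
  exact: clS.1.
by apply: clS.2; [apply: Su | apply: Sv].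
Qed.

HB.instance Definition _ :=
  GRing.isSubmodClosed.Build R V span_pred span_submod_closed.

Lemma mem_span u : P u -> u \in span_pred.
Proof. by move=> Pu; apply/asboolP => S _; apply. Qed.

End Span.

(* The R-module with generators T and relations [r = 0] for [rel r]. *)
Section PresentedModule.
Variables (R : nzRingType) (T : choiceType) (rel : {freeg T / R} -> Prop).

Local Notation F := {freeg T / R}.
Definition rels : zmodClosed F := span_pred rel.

Definition pres_mod := Quotient.quot rels.
HB.instance Definition _ := Choice.on pres_mod.
HB.instance Definition _ := GRing.Zmodule.on pres_mod.

Definition pres_class (v : F) : pres_mod := \pi_(Quotient.quot rels) v.

Lemma pres_classP (u v : F) :
  reflect (pres_class u = pres_class v) (u - v \in span_pred rel).
Proof.
by rewrite [u - v \in _](Quotient.idealrBE rels); apply: eqP.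
Qed.

Lemma pres_classD : {morph pres_class : u v / u + v}.
Proof. exact: (@Quotient.pi_add _ rels). Qed.

Lemma pres_class0 : pres_class 0 = 0.
Proof. by apply: (addIr (pres_class 0)); rewrite -pres_classD !add0r. Qed.

Lemma pres_class_repr (w : pres_mod) : pres_class (repr w) = w.
Proof. exact: reprK. Qed.

Definition pres_scale (a : R) (w : pres_mod) : pres_mod :=
  pres_class (a *: repr w).

Lemma pres_classZ a v : pres_class (a *: v) = pres_scale a (pres_class v).
Proof.
apply/pres_classP; rewrite -scalerBr; apply: rpredZ.
by apply/pres_classP; rewrite pres_class_repr.
Qed.

Fact pres_scaleA a b w : pres_scale a (pres_scale b w) = pres_scale (a * b) w.
Proof. by rewrite -(pres_class_repr w) -!pres_classZ scalerA. Qed.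
Fact pres_scale1 : left_id 1 pres_scale.
Proof. by move=> w; rewrite -(pres_class_repr w) -!pres_classZ scale1r. Qed.
Fact pres_scaleDr : right_distributive pres_scale +%R.
Proof.
move=> a u v; rewrite -(pres_class_repr u) -(pres_class_repr v).
by rewrite -pres_classD -!pres_classZ scalerDr pres_classD.
Qed.
Fact pres_scaleDl w : {morph pres_scale^~ w : a b / a + b}.
Proof.
by move=> a b; rewrite -(pres_class_repr w) -!pres_classZ scalerDl pres_classD.
Qed.

HB.instance Definition _ := GRing.Zmodule_isLmodule.Build R pres_mod
  pres_scaleA pres_scale1 pres_scaleDr pres_scaleDl.

Definition pres_gen (x : T) : pres_mod := pres_class << x >>.

Lemma pres_genE (x : T) (v : F) : rel (<< x >> - v) -> pres_gen x = pres_class v.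
Proof. by move=> /mem_span /pres_classP. Qed.

Lemma pres_ind (Q : pres_mod -> Prop) :
  Q 0 -> (forall a x w, Q w -> Q (a *: pres_gen x + w)) -> forall w, Q w.
Proof.
move=> Q0 Qgen w; rewrite -(pres_class_repr w) -[repr w]freeg_sumE.
elim: (dom (repr w)) => [|x r IHr]; first by rewrite big_nil pres_class0.
rewrite big_cons.
have -> : << coeff x (repr w) *g x >> = coeff x (repr w) *: << x >> :> F.
  by apply/eqP/freeg_eqP => y; rewrite coeffZ !coeffU mul1r.
by rewrite pres_classD pres_classZ; apply: Qgen.
Qed.

End PresentedModule.

(* The map of presented modules that is semilinear along [s] and sends the    *)
(* generator [x] to [h x]; it is only meaningful when [h] respects [rel].     *)
Section SemilinearLift.
Variables (R S : nzRingType) (s : {rmorphism R -> S}) (T : choiceType).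
Variables (N : lmodType S) (h : T -> N).

Definition free_lift (D : {freeg T / R}) : N :=
  \sum_(x <- dom D) s (coeff x D) *: h x.

Lemma free_liftE (D : {freeg T / R}) r : uniq r -> {subset dom D <= r} ->
  free_lift D = \sum_(x <- r) s (coeff x D) *: h x.
Proof.
move=> ur sDr; rewrite (bigID (mem (dom D))) /= [X in _ + X]big1 ?addr0.
  rewrite -big_filter; apply: perm_big; apply: uniq_perm.
  - exact: uniq_dom.
  - exact: filter_uniq.
  - by move=> x; rewrite mem_filter; case: (boolP (x \in dom D)) => // /sDr ->.
by move=> x xD; rewrite coeff_outdom // rmorph0 scale0r.
Qed.

Lemma free_liftP a (D E : {freeg T / R}) :
  free_lift (a *: D + E) = s a *: free_lift D + free_lift E.
Proof.
pose r := undup (dom D ++ dom E ++ dom (a *: D + E)).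
have ur : uniq r by apply: undup_uniq.
rewrite !(@free_liftE _ r) ?scaler_sumr -?big_split //=.
- apply: eq_bigr => x _.
  by rewrite coeffD coeffZ rmorphD rmorphM scalerDl scalerA.
- by move=> x xE; rewrite mem_undup !mem_cat xE orbT.
- by move=> x xD; rewrite mem_undup !mem_cat xD.
- by move=> x xDE; rewrite mem_undup !mem_cat xDE !orbT.
Qed.

Lemma free_lift1 x : free_lift << x >> = h x.
Proof. by rewrite /free_lift domU1 big_seq1 coeffU eqxx mulr1 rmorph1 scale1r. Qed.

Lemma free_lift0 : free_lift 0 = 0.
Proof. by rewrite /free_lift dom0 big_nil. Qed.

Lemma free_liftD D E : free_lift (D + E) = free_lift D + free_lift E.
Proof. by rewrite -[D]scale1r free_liftP rmorph1 !scale1r. Qed.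

Lemma free_liftZ a D : free_lift (a *: D) = s a *: free_lift D.
Proof. by rewrite -[a *: D]addr0 free_liftP free_lift0 addr0. Qed.

Lemma free_liftB D E : free_lift (D - E) = free_lift D - free_lift E.
Proof. by rewrite free_liftD -[- E]scaleN1r free_liftZ rmorphN1 scaleN1r. Qed.

Variable rel : {freeg T / R} -> Prop.

Definition pres_lift (w : pres_mod rel) : N := free_lift (repr w).

Hypothesis h_rel : forall D, rel D -> free_lift D = 0.

Lemma pres_lift_class D : pres_lift (pres_class rel D) = free_lift D.
Proof.
have /asboolP spanE : repr (pres_class rel D) - D \in span_pred rel.
  by apply/pres_classP; rewrite pres_class_repr.
have /eqP : repr (pres_class rel D) - D \in [pred E | free_lift E == 0].
  apply: spanE => [|E /h_rel /eqP//]; split=> [|a u v].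
    by rewrite inE free_lift0.
  by rewrite !inE free_liftP => /eqP-> /eqP->; rewrite scaler0 addr0.
by rewrite free_liftB => /eqP; rewrite subr_eq0 => /eqP.
Qed.

Lemma pres_lift_gen x : pres_lift (pres_gen rel x) = h x.
Proof. by rewrite pres_lift_class free_lift1. Qed.

Lemma pres_liftP a u v :
  pres_lift (a *: u + v) = s a *: pres_lift u + pres_lift v.
Proof.
rewrite -(pres_class_repr u) -(pres_class_repr v).
by rewrite -[a *: _]pres_classZ -pres_classD !pres_lift_class free_liftP.
Qed.

End SemilinearLift.

Arguments pres_lift {R S} s {T N} h {rel} w.

Section ExteriorPower.
Variables (R : comNzRingType) (M : lmodType R) (n : nat).

Definition subst_arg (t : {ffun 'I_n -> M}) (i : 'I_n) (u : M) :=
  [ffun j => if j == i then u else t j].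

(* Alternating means vanishing on tuples with two equal entries; antisymmetry *)
(* follows from multilinearity.                                               *)
Inductive ext_rel : {freeg {ffun 'I_n -> M} / R} -> Prop :=
| ExtLinear (t : {ffun 'I_n -> M}) (i : 'I_n) (a : R) (u v : M) :
    ext_rel (<< subst_arg t i (a *: u + v) >>
             - (a *: << subst_arg t i u >> + << subst_arg t i v >>))
| ExtAlternating (t : {ffun 'I_n -> M}) (i j : 'I_n) :
    i != j -> t i = t j -> ext_rel << t >>.

Definition ext_power := pres_mod ext_rel.
HB.instance Definition _ := GRing.Lmodule.on ext_power.

Definition wedge (t : {ffun 'I_n -> M}) : ext_power := pres_gen ext_rel t.

Lemma wedge_linear t i a u v :
  wedge (subst_arg t i (a *: u + v)) =
  a *: wedge (subst_arg t i u) + wedge (subst_arg t i v).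
Proof. by rewrite /wedge (pres_genE (ExtLinear t i a u v)) pres_classD pres_classZ. Qed.

Lemma wedge_alt (t : {ffun 'I_n -> M}) i j :
  i != j -> t i = t j -> wedge t = 0.
Proof.
move=> ij tij; have := mem_span (ExtAlternating ij tij).
rewrite -[X in X \in _]subr0 => /pres_classP; rewrite pres_class0.
exact.
Qed.

End ExteriorPower.

Section KahlerForms.
Variables (K : fieldType) (B : comAlgType K).

Inductive kahler_rel : {freeg B / B} -> Prop :=
| KahlerLinear (c : K) (a b : B) :
    kahler_rel (<< c *: a + b >> - (c%:A *: << a >> + << b >>))
| KahlerLeibniz (a b : B) :
    kahler_rel (<< a * b >> - (a *: << b >> + b *: << a >>)).

Definition kahler := pres_mod kahler_rel.
HB.instance Definition _ := GRing.Lmodule.on kahler.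

Definition dif (b : B) : kahler := pres_gen kahler_rel b.

Lemma dif_linear (c : K) a b : dif (c *: a + b) = c%:A *: dif a + dif b.
Proof. by rewrite /dif (pres_genE (KahlerLinear c a b)) pres_classD pres_classZ. Qed.

Lemma difM a b : dif (a * b) = a *: dif b + b *: dif a.
Proof. by rewrite /dif (pres_genE (KahlerLeibniz a b)) pres_classD !pres_classZ. Qed.

Definition kahler_form (k : nat) := ext_power kahler k.
HB.instance Definition _ k := GRing.Lmodule.on (kahler_form k).

End KahlerForms.

Section Pullback.
Variables (K : fieldType) (B A : comAlgType K) (f : {lrmorphism B -> A}).

Definition pullback1 : kahler B -> kahler A :=
  pres_lift f (fun b => dif (f b)).

Definition pullback (k : nat) : kahler_form B k -> kahler_form A k :=
  pres_lift f (fun t : {ffun 'I_k -> kahler B} =>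
                 wedge [ffun i => pullback1 (t i)]).

Fact pullback1_rel D :
  kahler_rel D -> free_lift f (fun b => dif (f b)) D = 0.
Proof.
case=> [c a b|a b]; rewrite free_liftB free_liftD ?free_liftZ !free_lift1.
  have fc : f c%:A = c%:A by exact: rmorph_alg.
  by rewrite linearP dif_linear -fc subrr.
by rewrite rmorphM difM subrr.
Qed.

Lemma pullback1P (a : B) u v :
  pullback1 (a *: u + v) = f a *: pullback1 u + pullback1 v.
Proof. exact: pres_liftP pullback1_rel _ _ _. Qed.

Lemma pullback1_0 : pullback1 0 = 0.
Proof.
by apply: (addrI (pullback1 0)); rewrite -{1}[pullback1 0]scale1r -(rmorph1 f)
  -pullback1P scale1r !addr0.
Qed.

Lemma pullback1_dif b : pullback1 (dif b) = dif (f b).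
Proof. exact: pres_lift_gen pullback1_rel _. Qed.

Fact pullback_rel k D : ext_rel D ->
  free_lift f (fun t : {ffun 'I_k -> kahler B} =>
                 wedge [ffun i => pullback1 (t i)]) D = 0.
Proof.
have subst t i u : [ffun j => pullback1 (subst_arg t i u j)] =
    subst_arg [ffun j => pullback1 (t j)] i (pullback1 u) :> {ffun 'I_k -> _}.
  by apply/ffunP => j; rewrite !ffunE; case: eqP.
case=> [t i a u v|t i j ij tij].
  rewrite free_liftB free_liftD free_liftZ !free_lift1.
  by rewrite !subst pullback1P wedge_linear subrr.
by rewrite free_lift1 (wedge_alt ij) // !ffunE tij.
Qed.

Lemma pullbackP k (a : B) (u v : kahler_form B k) :
  pullback (a *: u + v) = f a *: pullback u + pullback v.
Proof. exact: pres_liftP (@pullback_rel k) _ _ _. Qed.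

Lemma pullback0 k : pullback (0 : kahler_form B k) = 0.
Proof.
apply: (addrI (pullback (0 : kahler_form B k))).
by rewrite -{1}[pullback 0]scale1r -(rmorph1 f) -pullbackP scale1r !addr0.
Qed.

Lemma pullback_wedge k (t : {ffun 'I_k -> kahler B}) :
  pullback (wedge t : kahler_form B k) = wedge [ffun i => pullback1 (t i)].
Proof. exact: pres_lift_gen (@pullback_rel k) _. Qed.

End Pullback.

Section InvariantRing.
Variables (K : fieldType) (A : comAlgType K) (gT : finGroupType).
Variable rho : gT -> {lrmorphism A -> A}.

Definition invariant : {pred A} := [pred a | [forall g, rho g a == a]].

Fact invariant_subalg_closed : subalg_closed invariant.
Proof.
split=> [|c a b /forallP inv_a /forallP inv_b|a b /forallP inv_a /forallP inv_b];
  apply/forallP => g.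
- by rewrite rmorph1.
- rewrite linearP; apply/eqP; congr (_ *: _ + _); first exact/eqP/inv_a.
  exact/eqP/inv_b.
- rewrite rmorphM; apply/eqP; congr (_ * _); first exact/eqP/inv_a.
  exact/eqP/inv_b.
Qed.

HB.instance Definition _ :=
  GRing.isSubalgClosed.Build K A invariant invariant_subalg_closed.

Record inv_ring := InvRing { inv_val : A; inv_valP : inv_val \in invariant }.

HB.instance Definition _ := [isSub for inv_val].
HB.instance Definition _ := [Choice of inv_ring by <:].
HB.instance Definition _ := [SubChoice_isSubAlgebra of inv_ring by <:].
HB.instance Definition _ := [SubNzRing_isSubComNzRing of inv_ring by <:].
HB.instance Definition _ := GRing.RMorphism.copy inv_val (val : inv_ring -> A).
HB.instance Definition _ := GRing.Linear.copy inv_val (val : inv_ring -> A).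

End InvariantRing.

(* [rho g] is the comorphism of the automorphism of Spec A given by [g], so   *)
(* a left action on Spec A is a right action on A, which is [is_action].      *)
Definition is_algebra_action (K : fieldType) (A : comAlgType K)
    (gT : finGroupType) (rho : gT -> {lrmorphism A -> A}) : Prop :=
  is_action [set: gT] (fun (a : A) g => rho g a).

Section InvariantForms.
Variables (K : fieldType) (A : comAlgType K) (gT : finGroupType).
Variables (rho : gT -> {lrmorphism A -> A}) (k : nat).

Definition inv_inclusion : {lrmorphism inv_ring rho -> A} := @inv_val _ _ _ rho.

Definition invariant_form (w : kahler_form A k) : Prop :=
  forall g, pullback (rho g) w = w.

(* Pull-back of forms along Spec A -> Spec A^G; by [dpi_invariant] it takes   *)
(* values in the invariant forms. Both schemes being affine, the sheaves of   *)
(* forms are represented by their modules of global sections.                 *)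
Definition dpi : kahler_form (inv_ring rho) k -> kahler_form A k :=
  @pullback _ _ _ inv_inclusion k.

Lemma dpi_invariant eta : invariant_form (dpi eta).
Proof.
move=> g.
have fix_val b : rho g (inv_inclusion b) = inv_inclusion b.
  by apply/eqP; have /forallP := inv_valP b.
have fix1 u : pullback1 (rho g) (pullback1 inv_inclusion u)
              = pullback1 inv_inclusion u.
  elim/pres_ind: u => [|a b u IHu]; first by rewrite !pullback1_0.
  by rewrite !pullback1P -/(dif b) !pullback1_dif !fix_val IHu.
rewrite /dpi; elim/pres_ind: eta => [|a t w IHw]; first by rewrite !pullback0.
rewrite !pullbackP -/(wedge t) !pullback_wedge fix_val IHw.
by congr (_ *: wedge _ + _); apply/ffunP => i; rewrite !ffunE fix1.
Qed.

End InvariantForms.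

Section AffineVarieties.
Variables (K : fieldType) (A : comAlgType K).

Definition finite_type : Prop :=
  exists (n : nat) (f : {lrmorphism {mpoly K[n]} -> A}),
    forall a, exists p, f p = a.

Definition affine_variety : Prop :=
  finite_type /\ GRing.integral_domain_axiom A.

(* Infinitesimal lifting: K-morphisms Spec D -> Spec A extend along the       *)
(* thickening Spec D -> Spec C defined by the square-zero ideal [q = 0].      *)
Definition formally_smooth : Prop :=
  forall (C D : comAlgType K) (q : {lrmorphism C -> D})
         (f : {lrmorphism A -> D}),
    (forall d, exists c, q c = d) ->
    (forall x y, q x = 0 -> q y = 0 -> x * y = 0) ->
    exists h : {lrmorphism A -> C}, forall a, q (h a) = f a.

(* Smooth = formally smooth and locally of finite presentation (EGA IV 17.3); *)
(* over a field, finite type and finite presentation coincide.              *)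
Definition smooth : Prop := finite_type /\ formally_smooth.

Definition prime_ideal (P : {pred A}) : Prop :=
  idealr_closed P /\ prime_idealr_closed P.

Definition has_prime_chain (n : nat) : Prop :=
  exists P : nat -> {pred A},
    (forall i, (i <= n)%N -> prime_ideal (P i)) /\
    (forall i, (i < n)%N -> {subset P i <= P i.+1} /\
                            exists2 a, a \in P i.+1 & a \notin P i).

Definition krull_dim (n : nat) : Prop :=
  has_prime_chain n /\ forall m, has_prime_chain m -> (m <= n)%N.

End AffineVarieties.

(* Main.v *)
(** Both statements are equivalent to [free_inertia]: at every point of X with
    values in a field F containing the |G|-th roots of unity, the inertia group H
    scales coordinates u_1, ..., u_n of X by characters whose trivial weights form
    a monoid S of exponents generated on the axes, that is, H acts as a
    reflection group. Smoothness of X, after base change to F, gives expansions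
    of functions in the u_i to any order, and n is at least the Krull dimension.

    If the invariant k-forms are pulled back from Y, contract the average of
    u^(m - 1_I) du_I with logarithmic derivations: its coefficient at m in S is
    nonzero, so m decomposes in S so as to meet every axis of I, and comparing
    lexicographically minimal weights yields the generators of S on the axes.
    Conversely, if some invariant form is not pulled back, Nakayama's lemma gives
    a nonzero functional at some point that kills the pulled-back forms; when S is
    generated on the axes, monomial forms of trivial weight are forms in the
    invariants u_i^(d_i), and the functional vanishes.

    If S is generated on the axes, the u_i^(d_i) are local coordinates on Y. By
    Krull's intersection theorem the relations of Y are then generated near the
    point by equations with independent differentials, so Y is smooth. If Y is
    smooth, the number of independent derivations at a point of Y is constant; it
    is at most n, as derivations of the invariants extend to X at the generic
    point, but an irreducible trivial weight off the axes gives n + 1 of them. *)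

Require Import Defs.
From HB Require Import structures.
From mathcomp Require Import all_boot all_order all_fingroup all_algebra.
From mathcomp Require Import generic_quotient ring_quotient fieldext cyclic separable cyclotomic.
From mathcomp Require Import boolp.
From mathcomp.multinomials Require Import freeg mpoly.
From mathcomp Require Import ring zify.
From mathcomp Require classical_sets.

Set Implicit Arguments.
Unset Strict Implicit.
Unset Printing Implicit Defensive.

Import GRing.Theory.

Local Open Scope ring_scope.
Local Open Scope quotient_scope.

(** * Ideals, fractions and points *)

(** The field [K] need not be algebraically closed, so local arguments take place on F ⊗ A, where an
    F-valued point becomes rational. Since G is abelian, roots of unity diagonalise the whole
    inertia group at once; this turns the local question into one about a monoid of exponents.
    Completions and localisations are replaced by finite constructions. Jets modulo (x)^M are lifted
    degree by degree from formal smoothness. Explicit bounds on the power of the maximal ideal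
    replace completeness, and multiplication by an element not vanishing at the point replaces
    localisation. Invariants of G and of inertia are compared through cutoff elements: close to 1 at
    the point, while their translates by elements outside inertia vanish there to high order.
    Surjectivity is tested by linear functionals, so that the forms on the quotient of F ⊗ A never
    have to be identified with a base change of the forms on Y. *)

Record is_ideal (R : comPzRingType) (J : R -> Prop) : Prop := IsIdeal {
  ideal0 : J 0;
  idealD : forall x y, J x -> J y -> J (x + y);
  idealMl : forall a x, J x -> J (a * x) }.

Lemma idealN (R : comPzRingType) (J : R -> Prop) x : is_ideal J -> J x -> J (- x).
Proof. by move=> idJ Jx; rewrite -mulN1r; apply: (idealMl idJ). Qed.

Lemma idealB (R : comPzRingType) (J : R -> Prop) x y :
  is_ideal J -> J x -> J y -> J (x - y).
Proof. by move=> idJ Jx Jy; apply: idealD => //; apply: idealN. Qed.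

Lemma ideal_mulr (R : comPzRingType) (J : R -> Prop) a x :
  is_ideal J -> J x -> J (x * a).
Proof. by move=> idJ Jx; rewrite mulrC; apply: (idealMl idJ). Qed.

Lemma ideal_sum (R : comPzRingType) (J : R -> Prop) (I : Type) (r : seq I)
    (P : pred I) (F : I -> R) :
  is_ideal J -> (forall i, P i -> J (F i)) -> J (\sum_(i <- r | P i) F i).
Proof.
move=> idJ JF; elim/big_ind: _ => //; first exact: (ideal0 idJ).
exact: (idealD idJ).
Qed.

Section IdealQuotient.
Variables (K : fieldType) (R : comAlgType K) (J : R -> Prop).
Hypotheses (idJ : is_ideal J) (J1 : ~ J 1).

(** Ideals are handled as propositions, since most of them are defined by existential statements;
    the boolean form serves to build the quotient ring. *)
Definition ideal_pred : {pred R} := [pred x | `[< J x >]].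

Fact ideal_pred_closed : idealr_closed ideal_pred.
Proof.
split; first exact/asboolP/(ideal0 idJ).
  exact/asboolP.
move=> a x y /asboolP Jx /asboolP Jy; apply/asboolP.
by apply: (idealD idJ) => //; apply: (idealMl idJ).
Qed.

HB.instance Definition _ := isIdealr.Build R ideal_pred ideal_pred_closed.

Definition ideal_quot := {ideal_quot ideal_pred}.
HB.instance Definition _ := GRing.ComNzRing.on ideal_quot.

Definition ideal_proj (x : R) : ideal_quot := \pi_(ideal_quot) x.

Lemma ideal_projP x y : ideal_proj x = ideal_proj y <-> J (x - y).
Proof.
have := Quotient.idealrBE ideal_pred x y; rewrite inE => E.
split=> [/eqP e|j]; first by apply/asboolP; rewrite E; exact: e.
by apply/eqP; move/asboolP: j; rewrite E.
Qed.

Lemma ideal_proj_repr w : ideal_proj (repr w) = w.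
Proof. exact: reprK. Qed.

Lemma ideal_projD : {morph ideal_proj : x y / x + y}.
Proof. by move=> x y; rewrite /ideal_proj !piE. Qed.

Lemma ideal_projM : {morph ideal_proj : x y / x * y}.
Proof. by move=> x y; rewrite /ideal_proj !piE. Qed.

Lemma ideal_proj1 : ideal_proj 1 = 1.
Proof. by rewrite /ideal_proj !piE. Qed.

Definition ideal_scale (c : K) (w : ideal_quot) : ideal_quot :=
  ideal_proj c%:A * w.

Fact ideal_scaleA a b w : ideal_scale a (ideal_scale b w) = ideal_scale (a * b) w.
Proof.
by rewrite /ideal_scale mulrA -ideal_projM -scalerAl mul1r scalerA.
Qed.
Fact ideal_scale1 : left_id 1 ideal_scale.
Proof. by move=> w; rewrite /ideal_scale scale1r ideal_proj1 mul1r. Qed.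
Fact ideal_scaleDr : right_distributive ideal_scale +%R.
Proof. by move=> a u v; rewrite /ideal_scale mulrDr. Qed.
Fact ideal_scaleDl w : {morph ideal_scale^~ w : a b / a + b}.
Proof. by move=> a b; rewrite /ideal_scale scalerDl ideal_projD mulrDl. Qed.

HB.instance Definition _ := GRing.Zmodule_isLmodule.Build K ideal_quot
  ideal_scaleA ideal_scale1 ideal_scaleDr ideal_scaleDl.

Fact ideal_scaleAl (c : K) (u v : ideal_quot) : c *: (u * v) = (c *: u) * v.
Proof. exact: mulrA. Qed.

HB.instance Definition _ := GRing.Lmodule_isLalgebra.Build K ideal_quot ideal_scaleAl.

Fact ideal_scaleAr (c : K) (u v : ideal_quot) : c *: (u * v) = u * (c *: v).
Proof. exact: mulrCA. Qed.

HB.instance Definition _ := GRing.Lalgebra_isAlgebra.Build K ideal_quot ideal_scaleAr.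

Fact ideal_proj_zmod : zmod_morphism ideal_proj.
Proof.
move=> x y; apply: (addIr (ideal_proj y)).
by rewrite -ideal_projD !subrK.
Qed.
Fact ideal_proj_monoid : monoid_morphism ideal_proj.
Proof. by split; [exact: ideal_proj1 | exact: ideal_projM]. Qed.
Fact ideal_proj_scalable : scalable ideal_proj.
Proof.
by move=> c x; rewrite [RHS]/GRing.scale /= /ideal_scale -ideal_projM mulr_algl.
Qed.

HB.instance Definition _ := GRing.isZmodMorphism.Build R ideal_quot ideal_proj ideal_proj_zmod.
HB.instance Definition _ := GRing.isMonoidMorphism.Build R ideal_quot ideal_proj ideal_proj_monoid.
HB.instance Definition _ := GRing.isScalable.Build K R ideal_quot *:%R ideal_proj ideal_proj_scalable.

(** Stated existentially, so that later proofs see only a surjection with kernel [J] and never the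
    representation of the quotient. *)
Lemma quotient_algebra : exists (Q : comAlgType K) (p : {lrmorphism R -> Q}),
  (forall w, exists x, p x = w) /\ (forall x y, p x = p y <-> J (x - y)).
Proof.
exists ideal_quot, ideal_proj; split; last exact: ideal_projP.
by move=> w; exists (repr (w : ideal_quot)); exact: ideal_proj_repr.
Qed.

End IdealQuotient.

Section FractionField.
Variables (R : comNzRingType) (domR : GRing.integral_domain_axiom R).

(** A copy of [R] that can carry its own partial inverse, chosen classically, so that [{fraction _}]
    applies to it. *)
Definition dom_copy : Type := R.
HB.instance Definition _ := GRing.ComNzRing.on dom_copy.

Definition dom_unit : {pred dom_copy} := [pred x : R | `[< exists y, y * x = 1 >]].
Definition dom_inv (x : dom_copy) : dom_copy :=
  if pselect (exists y : R, y * x = 1) is left ex then projT1 (cid ex) else x.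

Fact dom_mulVx : {in dom_unit, left_inverse 1 dom_inv *%R}.
Proof.
move=> x /asboolP ux; rewrite /dom_inv; case: pselect => // ex.
by case: (cid ex).
Qed.
Fact dom_unitPl (x y : dom_copy) : y * x = 1 -> dom_unit x.
Proof. by move=> yx; apply/asboolP; exists y. Qed.
Fact dom_inv_out : {in [predC dom_unit], dom_inv =1 id}.
Proof.
move=> x /negP nu; rewrite /dom_inv; case: pselect => // ex.
by case: nu; apply/asboolP.
Qed.
HB.instance Definition _ := GRing.ComNzRing_hasMulInverse.Build dom_copy
  dom_mulVx dom_unitPl dom_inv_out.
HB.instance Definition _ := GRing.ComUnitRing_isIntegral.Build dom_copy domR.

Lemma fraction_field : exists (F : fieldType) (i : {rmorphism R -> F}), injective i.
Proof.
exists {fraction dom_copy}, (@tofrac dom_copy : {rmorphism dom_copy -> _}).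
by move=> x y /eqP; rewrite tofrac_eq => /eqP.
Qed.

End FractionField.

Lemma irreducible_factor (F : fieldType) (p : {poly F}) : (1 < size p)%N ->
  exists2 q, irreducible_poly q & q %| p.
Proof.
move=> p1; have [n] := ubnP (size p); elim: n p p1 => // n IHn p p1 pn.
have [irr|red] := pselect (irreducible_poly p); first by exists p.
have [q [q1 qp nqp]] : exists q : {poly F}, [/\ size q != 1, q %| p & ~~ (q %= p)].
  apply: contrapT => none; apply: red; split=> // q q1 qp.
  by apply: contrapT => /negP nqp; apply: none; exists q.
have p0 : p != 0 by rewrite -size_poly_gt0 (ltn_trans _ p1).
have q0 : q != 0 by apply: contraNneq p0 => q0; move: qp; rewrite q0 dvd0p.
have q1' : (1 < size q)%N by rewrite ltn_neqAle eq_sym q1 size_poly_gt0.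
have [|r irr rq] := IHn q q1'.
  rewrite -ltnS; apply: leq_trans pn; rewrite ltnS ltn_neqAle dvdp_leq // andbT.
  by rewrite -(dvdp_size_eqp qp) in nqp *.
by exists r => //; apply: dvdp_trans rq qp.
Qed.

Lemma splitting_field (F : fieldType) (p : {poly F}) : p != 0 ->
  exists (L : fieldType) (i : {rmorphism F -> L}) (rs : seq L),
    map_poly i p %= \prod_(r <- rs) ('X - r%:P).
Proof.
have [n] := ubnP (size p); elim: n F p => // n IHn F p pn p0.
have [p1|p1] := leqP (size p) 1.
  exists F, idfun, [::]; rewrite big_nil map_poly_id //.
  by rewrite -size_poly_eq1 eqn_leq p1 size_poly_gt0.
have [q irr qp] := irreducible_factor p1.
have [L _ [z rz _]] := irredp_FAdjoin irr.
pose i : {rmorphism F -> L} := in_alg L.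
have rpz : root (map_poly i p) z.
  by apply: (root_dvdp _ rz) => //; rewrite dvdp_map.
have [s Es] := factor_theorem _ _ rpz.
have p0' : map_poly i p != 0 by rewrite map_poly_eq0.
have s0 : s != 0 by apply: contraNneq p0' => s0; rewrite Es s0 mul0r.
have [|L' [j [rs Ers]]] := IHn L s _ s0.
  rewrite -ltnS; apply: leq_trans pn.
  by rewrite -(size_map_poly i p) Es size_Mmonic ?monicXsubC // size_XsubC addn2.
exists L', (j \o i), (j z :: rs).
rewrite map_poly_comp [map_poly i p]Es rmorphM /= rmorphB /= map_polyX map_polyC /=.
by rewrite big_cons mulrC eqp_mul2l // polyXsubC_eq0.
Qed.

(** In characteristic 0 the polynomial X^N - 1 is separable, so a splitting field contains N
    distinct roots of it, and a group of N such roots in a field is cyclic. *)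
Lemma primitive_root_field (F : fieldType) (N : nat) : [pchar F] =i pred0 ->
  (0 < N)%N -> exists (L : fieldType) (i : {rmorphism F -> L}) (z : L),
    N.-primitive_root z.
Proof.
move=> char0 N0; have p0 : 'X^N - 1 != 0 :> {poly F}.
  by rewrite -size_poly_gt0 size_XnsubC.
have [L [i [rs Ers]]] := splitting_field p0.
exists L, i.
have Np : (N%:R : L) != 0.
  by rewrite -(rmorph_nat i) fmorph_eq0; move/pcharf0P: char0 => ->; rewrite -lt0n.
have Ep : map_poly i ('X^N - 1) = 'X^N - 1.
  by rewrite rmorphB /= map_polyXn rmorph1.
have Erp : 'X^N - 1 = \prod_(r <- rs) ('X - r%:P) :> {poly L}.
  apply/eqP; rewrite -eqp_monic ?monicXnsubC // -?Ep //.
  exact: monic_prod_XsubC.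
have size_rs : size rs = N.
  by apply: succn_inj; rewrite -(size_prod_XsubC rs id) -Erp size_XnsubC.
have /hasP [z _ prim] : has N.-primitive_root rs.
  apply: has_prim_root => //; last by rewrite size_rs.
    apply/allP => z zrs; rewrite unity_rootE -(subr_eq0 _ 1).
    have : root ('X^N - 1) z by rewrite Erp root_prod_XsubC.
    by rewrite /root !hornerE.
  rewrite -separable_prod_XsubC -Erp.
  by rewrite separable_Xn_sub_1.
by exists z.
Qed.

Section Points.
Variables (K : fieldType) (char0 : [pchar K] =i pred0) (A : comAlgType K).

(** The residue field at [P], enlarged by roots of unity. *)
Lemma prime_point (N : nat) (P : A -> Prop) : (0 < N)%N ->
  is_ideal P -> ~ P 1 -> (forall x y, P (x * y) -> P x \/ P y) ->
  exists (F : fieldType) (e : {rmorphism A -> F}),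
    (forall a, e a = 0 <-> P a) /\ exists z : F, N.-primitive_root z.
Proof.
move=> N0 idP P1 prP; have [Q [p [p_onto pP]]] := quotient_algebra idP P1.
have p0 x : p x = 0 <-> P x by rewrite -(rmorph0 p) pP subr0.
have domQ : GRing.integral_domain_axiom Q.
  move=> u v; have [[x <-] [y <-]] := (p_onto u, p_onto v).
  rewrite -rmorphM => /p0 /prP [] /p0 ->; by rewrite eqxx ?orbT.
have [F [i inj_i]] := fraction_field domQ.
have charF : [pchar F] =i pred0.
  have: [pchar F] =i [pchar K] := fmorph_pchar (i \o in_alg Q : {rmorphism K -> F}).
  by move=> E x; rewrite E char0.
have [L [j [z prim]]] := primitive_root_field charF N0.
exists L, (j \o i \o p); split=> [a|]; last by exists z.
by rewrite -p0 /=; split=> [/eqP|->]; rewrite ?rmorph0 // fmorph_eq0 -(rmorph0 i) => /eqP/inj_i.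
Qed.

(** Zorn's lemma; of the maximal ideal it produces, only primality is recorded. *)
Lemma maximal_ideal (J : A -> Prop) : is_ideal J -> ~ J 1 ->
  exists P : A -> Prop, [/\ is_ideal P, ~ P 1, (forall x, J x -> P x) &
    forall x y, P (x * y) -> P x \/ P y].
Proof.
move=> idJ J1.
pose T := {P : A -> Prop | [/\ is_ideal P, ~ P 1 & forall x, J x -> P x]}.
pose t0 : T := exist _ J (And3 idJ J1 (fun x Jx => Jx)).
pose R : rel T := fun P Q => `[< forall x, sval P x -> sval Q x >].
have [||C tot|P maxP] := @classical_sets.ZL_preorder T t0 R.
- by move=> P; apply/asboolP.
- by move=> P Q S /asboolP PQ /asboolP QS; apply/asboolP => x /PQ /QS.
- have [[P0 CP0]|none] := pselect (exists P, C P); last first.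
    by exists t0 => P CP; case: none; exists P.
  pose U x := exists2 P : T, C P & sval P x.
  have idU : is_ideal U.
    split=> [|x y [P CP Px] [Q CQ Qy]|a x [P CP Px]].
    - by exists P0 => //; case: (svalP P0) => idP _ _; apply: (ideal0 idP).
    - case: (tot P Q CP CQ) => /asboolP sub.
        exists Q => //; case: (svalP Q) => idQ _ _.
        by apply: (idealD idQ) => //; apply: sub.
      exists P => //; case: (svalP P) => idP _ _.
      by apply: (idealD idP) => //; apply: sub.
    - by exists P => //; case: (svalP P) => idP _ _; apply: (idealMl idP).
  have U1 : ~ U 1 by move=> [P _]; case: (svalP P).
  have JU x : J x -> U x by move=> Jx; exists P0 => //; case: (svalP P0) => _ _; apply.
  exists (exist _ U (And3 idU U1 JU)) => P CP; apply/asboolP => x Px /=.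
  by exists P.
have {}maxP (S : T) : (forall x, sval P x -> sval S x) ->
    forall x, sval S x -> sval P x.
  by move=> PS; apply/asboolP/maxP/asboolP.
case: (svalP P); move: (sval P) maxP => {}P maxP idP P1 JP.
exists P; split=> // x y Pxy.
apply: contrapT => /not_orP [nPx nPy].
(* By maximality, [z] and [P] together generate the unit ideal. *)
have step z : ~ P z -> exists a p, P p /\ a * z + p = 1.
  move=> nPz; pose Q w := exists a p, P p /\ a * z + p = w.
  apply: contrapT => Q1.
  have idQ : is_ideal Q.
    split=> [|u v [a [p [Pp <-]]] [b [q [Pq <-]]]|c u [a [p [Pp <-]]]].
    - by exists 0, 0; split; [apply: (ideal0 idP) | rewrite mul0r addr0].
    - exists (a + b), (p + q); split; first exact: (idealD idP).
      by rewrite mulrDl addrACA.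
    - exists (c * a), (c * p); split; first exact: (idealMl idP).
      by rewrite mulrDr mulrA.
  have PQ u : P u -> Q u by move=> Pu; exists 0, u; rewrite mul0r add0r.
  have JQ u : J u -> Q u by move=> /JP /PQ.
  apply: nPz; apply: (maxP (exist _ Q (And3 idQ Q1 JQ)) PQ).
  by exists 1, 0; split; [apply: (ideal0 idP) | rewrite mul1r addr0].
have [a [p [Pp E1]]] := step _ nPx; have [b [q [Pq E2]]] := step _ nPy.
apply: P1; rewrite -[1]mulr1 -{1}E1 -E2.
have -> : (a * x + p) * (b * y + q) = a * b * (x * y) + (a * x * q + p * (b * y + q)).
  by ring.
apply: (idealD idP); first exact: (idealMl idP).
apply: (idealD idP); first exact: (idealMl idP).
exact: (ideal_mulr _ idP).
Qed.

Lemma point_over (N : nat) (J : A -> Prop) : (0 < N)%N -> is_ideal J -> ~ J 1 ->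
  exists (F : fieldType) (e : {rmorphism A -> F}),
    (forall a, J a -> e a = 0) /\ exists z : F, N.-primitive_root z.
Proof.
move=> N0 idJ J1; have [P [idP P1 JP prP]] := maximal_ideal idJ J1.
have [F [e [eP prim]]] := prime_point N0 idP P1 prP.
by exists F, e; split=> // a /JP /eP.
Qed.

Lemma generic_point (N : nat) : (0 < N)%N -> GRing.integral_domain_axiom A ->
  exists (F : fieldType) (e : {rmorphism A -> F}),
    injective e /\ exists z : F, N.-primitive_root z.
Proof.
move=> N0 domA.
have idP : is_ideal (fun a : A => a = 0).
  by split=> [//|x y -> ->|a x ->]; rewrite ?addr0 ?mulr0.
have [||F [e [eP prim]]] := prime_point N0 idP.
- by apply/eqP/oner_neq0.
- by move=> x y /domA /orP [/eqP|/eqP]; [left|right].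
exists F, e; split=> // x y exy; apply/eqP; rewrite -subr_eq0; apply/eqP/eP.
by rewrite rmorphB exy subrr.
Qed.

End Points.

(** * Derivations and differential forms *)

(** Taken relative to a map [s], so that one notion covers derivations of a ring, the universal
    derivation [dif] (both with [s] the identity) and tangent vectors at a point (with [s] the
    point). *)
Record derivation (K : fieldType) (A : comAlgType K) (S : comNzRingType)
    (s : A -> S) (N : lmodType S) (D : A -> N) : Prop := Derivation {
  derivation_linear : forall (c : K) x y, D (c *: x + y) = s c%:A *: D x + D y;
  derivationM : forall x y, D (x * y) = s x *: D y + s y *: D x }.

Definition fupd (k : nat) (T : Type) (g : {ffun 'I_k -> T}) i x : {ffun 'I_k -> T} :=
  [ffun j => if j == i then x else g j].

Section Semilinear.
Variables (R S : nzRingType) (s : R -> S) (V : lmodType R) (N : lmodType S).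

Definition semilinear_along (f : V -> N) : Prop :=
  forall a u v, f (a *: u + v) = s a *: f u + f v.

End Semilinear.

Section SemilinearTheory.
Variables (R S : nzRingType) (s : {rmorphism R -> S}) (V : lmodType R) (N : lmodType S).
Variables (f : V -> N) (fP : semilinear_along s f).

Lemma slinD u v : f (u + v) = f u + f v.
Proof. by have := fP 1 u v; rewrite rmorph1 !scale1r. Qed.
Lemma slin0 : f 0 = 0.
Proof. by apply: (addrI (f 0)); rewrite -slinD !addr0. Qed.
Lemma slinZ a u : f (a *: u) = s a *: f u.
Proof. by rewrite -[a *: u]addr0 fP slin0 addr0. Qed.
Lemma slin_sum (I : Type) (r : seq I) (P : pred I) (F : I -> V) :
  f (\sum_(i <- r | P i) F i) = \sum_(i <- r | P i) f (F i).
Proof. by apply: (big_morph f slinD slin0). Qed.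

End SemilinearTheory.

Section DerivationTheory.
Variables (K : fieldType) (A : comAlgType K) (S : comNzRingType).
Variables (s : {rmorphism A -> S}) (N : lmodType S) (D : A -> N).
Hypothesis derD : derivation s D.

Lemma derivationD x y : D (x + y) = D x + D y.
Proof. by have := derivation_linear derD 1 x y; rewrite !scale1r rmorph1 scale1r. Qed.
Lemma derivation0 : D 0 = 0.
Proof. by apply: (addrI (D 0)); rewrite -derivationD !addr0. Qed.
Lemma derivationZ c x : D (c *: x) = s c%:A *: D x.
Proof. by rewrite -[c *: x]addr0 (derivation_linear derD) derivation0 addr0. Qed.
Lemma derivationN x : D (- x) = - D x.
Proof. by apply/eqP; rewrite -subr_eq0 opprK -derivationD addNr derivation0. Qed.
Lemma derivationB x y : D (x - y) = D x - D y.
Proof. by rewrite derivationD derivationN. Qed.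
Lemma derivation1 : D 1 = 0.
Proof.
have := derivationM derD 1 1; rewrite mulr1 rmorph1 scale1r => E.
by apply: (addrI (D 1)); rewrite -E addr0.
Qed.
Lemma derivation_sum (I : Type) (r : seq I) (P : pred I) (F : I -> A) :
  D (\sum_(i <- r | P i) F i) = \sum_(i <- r | P i) D (F i).
Proof. by apply: (big_morph D derivationD derivation0). Qed.
Lemma derivationX x m : D (x ^+ m) = (s (x ^+ m.-1) *+ m) *: D x.
Proof.
elim: m => [|[|m] IHm]; first by rewrite expr0 derivation1 mulr0n scale0r.
  by rewrite expr1 /= rmorph1 scale1r.
rewrite exprS (derivationM derD) IHm /= -mulr_natl scalerA mulrCA -rmorphM -exprS.
by rewrite mulr_natl -scalerDl -mulrSr.
Qed.

(** The universal property of the Kähler module, with scalars moved along [s]. *)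
Lemma kahler_lift : exists L : kahler A -> N,
  semilinear_along s L /\ forall a, L (dif a) = D a.
Proof.
have rel0 E : kahler_rel E -> free_lift s D E = 0.
  case=> [c a b|a b]; rewrite free_liftB free_liftD ?free_liftZ !free_lift1.
    by rewrite (derivation_linear derD) subrr.
  by rewrite (derivationM derD) subrr.
exists (pres_lift s D); split=> [a u v|a]; first exact: pres_liftP.
exact: pres_lift_gen.
Qed.

End DerivationTheory.

Section ExteriorLift.
Variables (R S : comNzRingType) (s : {rmorphism R -> S}) (M : lmodType R).
Variables (N1 N : lmodType S) (L : M -> N1) (k : nat) (alt : {ffun 'I_k -> N1} -> N).
Hypothesis L_lin : semilinear_along s L.
Hypothesis alt_lin : forall t i a u v, alt (subst_arg t i (a *: u + v)) =
  a *: alt (subst_arg t i u) + alt (subst_arg t i v).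
Hypothesis alt_alt : forall (t : {ffun 'I_k -> N1}) i j, i != j -> t i = t j -> alt t = 0.

Lemma ext_power_lift : exists Phi : ext_power M k -> N,
  semilinear_along s Phi /\
  forall t : {ffun 'I_k -> M}, Phi (wedge t) = alt [ffun i => L (t i)].
Proof.
pose h (t : {ffun 'I_k -> M}) := alt [ffun i => L (t i)].
have substE t i u : [ffun j => L (subst_arg t i u j)] =
    subst_arg [ffun j => L (t j)] i (L u) :> {ffun 'I_k -> N1}.
  by apply/ffunP => j; rewrite !ffunE; case: eqP.
have rel0 E : ext_rel E -> free_lift s h E = 0.
  case=> [t i a u v|t i j ij tij].
    by rewrite free_liftB free_liftD free_liftZ !free_lift1 /h !substE L_lin
      alt_lin subrr.
  by rewrite free_lift1; apply: (alt_alt ij); rewrite !ffunE tij.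
exists (pres_lift s h); split=> [a u v|t]; first exact: pres_liftP.
exact: pres_lift_gen.
Qed.

End ExteriorLift.

Section WedgeArgument.
Variables (R : comNzRingType) (M : lmodType R) (k : nat).
Variables (t : {ffun 'I_k -> M}) (i : 'I_k).

Lemma wedge_arg0 : wedge (subst_arg t i 0) = 0.
Proof.
have := wedge_linear t i 1 0 0; rewrite scale1r addr0 scale1r.
by move/(congr1 (fun u => u - wedge (subst_arg t i 0))); rewrite subrr addrK.
Qed.

Lemma wedge_argZ a u : wedge (subst_arg t i (a *: u)) = a *: wedge (subst_arg t i u).
Proof. by have := wedge_linear t i a u 0; rewrite wedge_arg0 !addr0. Qed.

End WedgeArgument.

Section Forms.
Variables (K : fieldType) (A : comAlgType K) (k : nat).

Definition dwedge (g : {ffun 'I_k -> A}) : kahler_form A k :=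
  wedge [ffun i => dif (g i)].

Fact dwedge_fupd g i x :
  dwedge (fupd g i x) = wedge (subst_arg [ffun j => dif (g j)] i (dif x)).
Proof.
rewrite /dwedge; congr wedge; apply/ffunP => j; rewrite !ffunE.
by case: eqP.
Qed.

Lemma dwedge_derivation g i :
  derivation (fun a : A => a) (fun x => dwedge (fupd g i x)).
Proof.
split=> [c x y|x y]; rewrite !dwedge_fupd; first by rewrite dif_linear wedge_linear.
by rewrite difM wedge_linear wedge_argZ.
Qed.

Lemma dwedge_alt (g : {ffun 'I_k -> A}) i j : i != j -> g i = g j -> dwedge g = 0.
Proof. by move=> ij gij; apply: (wedge_alt ij); rewrite !ffunE gij. Qed.

Lemma fupd_id (g : {ffun 'I_k -> A}) i : fupd g i (g i) = g.
Proof. by apply/ffunP => j; rewrite ffunE; case: eqP => // ->. Qed.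

(* It is enough to wedge differentials of elements [Z] whose differentials    *)
(* span the Kahler module.                                                    *)
Lemma form_span_ind (Z : A -> Prop) (Q : kahler_form A k -> Prop) :
  (forall a (Q1 : kahler A -> Prop), Q1 0 ->
     (forall b z u, Z z -> Q1 u -> Q1 (b *: dif z + u)) -> Q1 (dif a)) ->
  Q 0 -> (forall a (g : {ffun 'I_k -> A}) w, (forall q, Z (g q)) -> Q w ->
    Q (a *: dwedge g + w)) -> forall w, Q w.
Proof.
move=> spanZ Q0 Qgen.
pose gen (u : kahler_form A k) := forall a w, Q w -> Q (a *: u + w).
have gen0 : gen 0 by move=> a w Qw; rewrite scaler0 add0r.
have genD a u v : gen u -> gen v -> gen (a *: u + v).
  by move=> gu gv b w Qw; rewrite scalerDr scalerA -addrA; apply/gu/gv.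
suff genW t : gen (wedge t).
  by elim/pres_ind => // a t w Qw; apply: (genW t).
(* Positions [i >= m] already carry differentials of elements of [Z]; for [m = k] this is no
   condition. *)
suff: forall m (t : {ffun 'I_k -> kahler A}),
    (forall i : 'I_k, (m <= i)%N -> exists a, Z a /\ t i = dif a) -> gen (wedge t).
  by move/(_ k t); apply=> i; rewrite leqNgt ltn_ord.
elim=> [|m IHm] {}t tm.
  have [g Eg] := choice (fun i => tm i (leq0n i)).
  have -> : wedge t = dwedge [ffun i => g i].
    by congr wedge; apply/ffunP => i; rewrite !ffunE; case: (Eg i).
  by move=> a w; apply: Qgen => q; rewrite ffunE; case: (Eg q).
have [km|mk] := leqP k m.
  by apply: IHm => i; rewrite leqNgt (leq_trans (ltn_ord i)).
pose i0 := Ordinal mk.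
have -> : t = subst_arg t i0 (t i0).
  by apply/ffunP => j; rewrite ffunE; case: eqP => // ->.
have step x : gen (wedge (subst_arg t i0 (dif x))).
  apply: (spanZ x (fun u => gen (wedge (subst_arg t i0 u)))) => [|b z u Zz gu].
    by rewrite wedge_arg0.
  rewrite wedge_linear; apply: genD => //; apply: IHm => i mi; rewrite ffunE.
  case: eqP => [_|/eqP ne]; first by exists z.
  by apply: tm; rewrite ltn_neqAle mi andbT eq_sym.
elim/pres_ind: (t i0) => [|a x u IHu].
  by rewrite wedge_arg0.
by rewrite wedge_linear; apply: genD => //; apply: (step x).
Qed.

Lemma form_ind (Q : kahler_form A k -> Prop) :
  Q 0 -> (forall a g w, Q w -> Q (a *: dwedge g + w)) -> forall w, Q w.
Proof.
move=> Q0 Qgen; apply: (@form_span_ind (fun=> True)) => // [a Q1 Q10 Q1L|a g w _].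
  by have := Q1L 1 a 0 I Q10; rewrite scale1r addr0.
exact: Qgen.
Qed.

(** Contraction with [k] derivations: they send each differential to a row vector, and the
    determinant of the [k] rows is multilinear and alternating. *)
Lemma form_contraction (S : comNzRingType) (s : {rmorphism A -> S})
    (delta : 'I_k -> A -> S) :
  (forall p, derivation s (delta p : A -> S^o)) ->
  exists Phi : kahler_form A k -> S^o, semilinear_along s Phi /\
  forall g, Phi (dwedge g) = \det (\matrix_(q, p) delta p (g q)).
Proof.
move=> der; pose D a : 'rV[S]_k := \row_p delta p a.
have derD : derivation s D.
  split=> [c x y|x y]; apply/rowP => p; rewrite !mxE.
    by rewrite (derivation_linear (der p)).
  by rewrite (derivationM (der p)).
have [L [L_lin LE]] := kahler_lift derD.
pose alt (t : {ffun 'I_k -> 'rV[S]_k}) : S^o := \det (\matrix_(q, p) t q 0 p).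
have [||Phi [Phi_lin PhiE]] := @ext_power_lift A S s _ _ _ L k alt L_lin.
- move=> t i a u v; transitivity (a * alt (subst_arg t i u) + 1 * alt (subst_arg t i v) : S).
    2: by rewrite mul1r.
  apply: (@determinant_multilinear _ _ _ _ _ i).
  - by apply/rowP => p; rewrite !mxE !ffunE eqxx !mxE mul1r.
  - by apply/matrixP => q p; rewrite !mxE !ffunE eq_sym (negPf (neq_lift _ _)).
  - by apply/matrixP => q p; rewrite !mxE !ffunE eq_sym (negPf (neq_lift _ _)).
- by move=> t i j ij tij; apply: (determinant_alternate ij) => p; rewrite !mxE tij.
exists Phi; split=> // g; rewrite PhiE; congr (\det _).
by apply/matrixP => q p; rewrite !mxE !ffunE LE mxE.
Qed.

End Forms.

Section ChangeOfBase.
Variables (K F : fieldType) (A : comAlgType K) (A' : comAlgType F).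
Variables (i : K -> F) (j : {rmorphism A -> A'}) (k : nat).
Hypothesis jA : forall c : K, j c%:A = (i c)%:A.

Lemma form_change_of_base : exists J : kahler_form A k -> kahler_form A' k,
  semilinear_along j J /\
  forall g, J (dwedge g) = dwedge [ffun p => j (g p)].
Proof.
have der : derivation j (fun a => dif (j a)).
  split=> [c x y|x y]; last by rewrite rmorphM difM.
  have -> : j (c *: x + y) = i c *: j x + j y.
    by rewrite rmorphD -[c *: x]mulr_algl rmorphM jA mulr_algl.
  by rewrite dif_linear jA.
have [L [L_lin LE]] := kahler_lift der.
have [||J [J_lin JE]] := @ext_power_lift A A' j _ _ _ L k (@wedge A' _ k) L_lin.
- exact: wedge_linear.
- exact: wedge_alt.
exists J; split=> // g; rewrite JE; congr wedge.
by apply/ffunP => p; rewrite !ffunE LE.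
Qed.

End ChangeOfBase.

Section PackMorphism.
Variables (A B : comNzRingType) (f : A -> B).
Hypotheses (fD : {morph f : x y / x + y}) (fM : {morph f : x y / x * y}) (f1 : f 1 = 1).

Fact pack_zmod : zmod_morphism f.
Proof.
have f0 : f 0 = 0 by apply: (addrI (f 0)); rewrite -fD !addr0.
move=> x y; rewrite fD; congr (_ + _); apply/eqP.
by rewrite -subr_eq0 opprK -fD addNr f0.
Qed.
Definition rmorph_fun (x : A) : B := f x.
HB.instance Definition _ := GRing.isZmodMorphism.Build A B rmorph_fun pack_zmod.
HB.instance Definition _ := GRing.isMonoidMorphism.Build A B rmorph_fun (f1, fM).

Lemma pack_rmorphism : exists g : {rmorphism A -> B}, g =1 f.
Proof. by exists rmorph_fun. Qed.

End PackMorphism.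

Section PackLRMorphism.
Variables (K : fieldType) (A B : comAlgType K) (f : {rmorphism A -> B}).
Hypothesis fA : forall c : K, f c%:A = c%:A.

Definition pack_fun (x : A) : B := f x.
HB.instance Definition _ := GRing.RMorphism.copy pack_fun f.
Fact pack_scalable : scalable pack_fun.
Proof. by move=> c x; rewrite /pack_fun -mulr_algl rmorphM fA mulr_algl. Qed.
HB.instance Definition _ := GRing.isScalable.Build K A B *:%R pack_fun pack_scalable.

Lemma pack_lrmorphism : exists g : {lrmorphism A -> B}, g =1 f.
Proof. by exists pack_fun. Qed.

End PackLRMorphism.

Lemma factor_lrmorphism (K : fieldType) (R C D : comAlgType K)
    (p : {lrmorphism R -> C}) (q : {lrmorphism R -> D}) :
  (forall w, exists x, p x = w) -> (forall x, p x = 0 -> q x = 0) ->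
  exists q' : {lrmorphism C -> D}, forall x, q' (p x) = q x.
Proof.
move=> p_onto pq; have [s sP] := choice p_onto.
have qs x : q (s (p x)) = q x.
  by apply/eqP; rewrite -subr_eq0 -rmorphB; apply/eqP/pq; rewrite rmorphB /= sP subrr.
pose f w := q (s w).
have fE x : f (p x) = q x := qs x.
have [|||g gE] := @pack_rmorphism C D f.
- by move=> u v; rewrite -(sP u) -(sP v) -rmorphD !fE rmorphD.
- by move=> u v; rewrite -(sP u) -(sP v) -rmorphM !fE rmorphM.
- by rewrite -(rmorph1 p) fE rmorph1.
have [|h hE] := @pack_lrmorphism K C D g.
  by move=> c; rewrite gE -(rmorph_alg p) fE rmorph_alg.
by exists h => x; rewrite hE gE fE.
Qed.

(** An algebra morphism from [A] to the quotient of [R] by [J], represented by a mere function into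
    [R], on which corrections can be computed. *)
Record hom_mod (K : fieldType) (A R : comAlgType K) (J : R -> Prop) (f : A -> R) :
    Prop := HomMod {
  hom_mod1 : J (f 1 - 1);
  hom_modL : forall (c : K) a b, J (f (c *: a + b) - (c *: f a + f b));
  hom_modM : forall a b, J (f (a * b) - f a * f b) }.

Section LiftModulo.
Variables (K : fieldType) (A : comAlgType K).
Hypothesis smA : formally_smooth A.

(** Modulo [J], the kernel of [q] has square zero, so infinitesimal lifting applies to the quotient
    of [R] by [J]; representatives in [R] are then chosen. *)
Lemma lift_mod (R D : comAlgType K) (q : {lrmorphism R -> D}) (J : R -> Prop)
    (f : {lrmorphism A -> D}) :
  (forall d, exists x, q x = d) -> is_ideal J -> (forall x, J x -> q x = 0) ->
  (forall x y, q x = 0 -> q y = 0 -> J (x * y)) ->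
  exists s : A -> R, (forall a, q (s a) = f a) /\ hom_mod J s.
Proof.
move=> q_onto idJ Jq Jsq.
have J1 : ~ J 1 by move/Jq; rewrite rmorph1; apply/eqP/oner_neq0.
have [C [p [p_onto pP]]] := quotient_algebra idJ J1.
have p0 x : p x = 0 <-> J x by rewrite -(rmorph0 p) pP subr0.
have [|q' q'E] := @factor_lrmorphism _ _ _ _ p q p_onto.
  by move=> x /p0 /Jq.
have q'_onto d : exists c, q' c = d.
  by have [x <-] := q_onto d; exists (p x); rewrite q'E.
have [|h hE] := smA f q'_onto.
  move=> u v; have [[x <-] [y <-]] := (p_onto u, p_onto v).
  by rewrite !q'E -rmorphM => qx qy; apply/p0/Jsq.
have [s sP] := choice (fun a => p_onto (h a)).
exists s; split=> [a|]; first by rewrite -q'E sP hE.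
split=> [|c a b|a b]; apply/pP; rewrite ?(linearP p) /= ?rmorphM /= !sP.
- by rewrite !rmorph1.
- by rewrite linearP.
- by rewrite rmorphM.
Qed.

End LiftModulo.

Section HomModTheory.
Variables (K : fieldType) (A R : comAlgType K) (J : R -> Prop) (f : A -> R).
Hypotheses (idJ : is_ideal J) (fP : hom_mod J f).

Lemma hom_mod_lrmorphism (Q : comAlgType K) (p : {lrmorphism R -> Q}) :
  (forall x, J x -> p x = 0) -> exists g : {lrmorphism A -> Q}, forall a, g a = p (f a).
Proof.
move=> Jp.
have pe x y : J (x - y) -> p x = p y.
  by move=> /Jp; rewrite rmorphB => /eqP; rewrite subr_eq0 => /eqP.
have [|||g gE] := @pack_rmorphism A Q (p \o f).
- move=> a b /=; have := pe _ _ (hom_modL fP 1 a b).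
  by rewrite !scale1r rmorphD.
- by move=> a b /=; rewrite (pe _ _ (hom_modM fP a b)) rmorphM.
- by rewrite /= (pe _ _ (hom_mod1 fP)) rmorph1.
have [|h hE] := @pack_lrmorphism K A Q g.
  move=> c; rewrite gE /=.
  have := pe _ _ (hom_modL fP c 1 (0 * 0)).
  have -> : p (c *: f 1 + f (0 * 0)) = c%:A + p (f (0 * 0)).
    by rewrite rmorphD /= linearZ /= (pe _ _ (hom_mod1 fP)) rmorph1.
  rewrite mulr0 addr0 => ->; have := pe _ _ (hom_modM fP 0 0).
  have := pe _ _ (hom_modL fP 1 0 0).
  rewrite !scale1r addr0 rmorphD => /(congr1 (fun z => z - p (f 0))).
  by rewrite subrr addrK => <-; rewrite addr0.
by exists h => a; rewrite hE gE.
Qed.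

End HomModTheory.

Lemma mderivX_id (R : nzRingType) (N : nat) (i : 'I_N) : ('X_i : {mpoly R[N]})^`M(i) = 1.
Proof.
rewrite mderivX mnm1E eqxx scale1r -mpolyX0; congr 'X_[_].
by apply/mnmP => l; rewrite mnmBE subnn mnm0E.
Qed.

Lemma mderivX_neq (R : nzRingType) (N : nat) (i l : 'I_N) : l != i ->
  ('X_i : {mpoly R[N]})^`M(l) = 0.
Proof. by move=> li; rewrite mderivX mnm1E eq_sym (negPf li) scale0r. Qed.

Lemma mpoly_gen_ind (K : fieldType) (N : nat) (Q : {mpoly K[N]} -> Prop) :
  Q 1 -> (forall (c : K) u v, Q u -> Q v -> Q (c *: u + v)) ->
  (forall i u, Q u -> Q ('X_i * u)) -> forall u, Q u.
Proof.
move=> Q1 QL QX.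
have Q0 : Q 0 by have := QL (-1) 1 1 Q1 Q1; rewrite scaleN1r addNr.
have Qm m : Q 'X_[m].
  have [d] := ubnP (mdeg m); elim: d m => // d IHd m md.
  have [->|m0] := eqVneq m 0%MM; first by rewrite mpolyX0.
  have [i mi] : exists i, (0 < m i)%N.
    apply: contrapT => none; case/eqP: m0; apply/mnmP => i; rewrite mnm0E.
    by apply/eqP; rewrite -leqn0 leqNgt; apply/negP => mi; apply: none; exists i.
  have Em : m = (U_(i) + (m - U_(i)))%MM by rewrite addmC submK // lep1mP -lt0n.
  rewrite Em mpolyXD; apply: QX; apply: IHd.
  by move: md; rewrite {1}Em mdegD mdeg1 add1n ltnS.
elim/mpolyind => // c m p _ _ Qp; exact: QL.
Qed.

Section Evaluation.
Variables (K : fieldType) (R : comAlgType K) (N : nat) (x : 'I_N -> R).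

Definition ev (p : {mpoly K[N]}) : R := mmap (in_alg R) x p.

HB.instance Definition _ := GRing.RMorphism.copy ev (mmap (in_alg R) x).
Fact ev_scalable : scalable ev.
Proof. by move=> c p; rewrite /ev mmapZ /= mulr_algl. Qed.
HB.instance Definition _ := GRing.isScalable.Build K {mpoly K[N]} R *:%R ev ev_scalable.

Lemma evX i : ev 'X_i = x i.
Proof. by rewrite /ev mmapX mmap1U. Qed.

Lemma evXm m : ev 'X_[m] = \prod_i x i ^+ m i.
Proof. by rewrite /ev mmapX. Qed.

(** Generation as an algebra, in the form of the induction principle through which it is mostly
    used; [generates_ev] gives the usual form. *)
Definition generates : Prop := forall Q : R -> Prop,
  Q 1 -> (forall (c : K) u v, Q u -> Q v -> Q (c *: u + v)) ->
  (forall i u, Q u -> Q (x i * u)) -> forall u, Q u.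

Lemma generates_ev : generates <-> forall a, exists p, ev p = a.
Proof.
split=> [gen|onto Q Q1 QL QX u].
  apply: gen => [|c u v [p <-] [q <-]|i u [p <-]].
  - by exists 1; rewrite rmorph1.
  - by exists (c *: p + q); rewrite linearP.
  - by exists ('X_i * p); rewrite rmorphM /= evX.
have [p <-] := onto u; elim/mpoly_gen_ind: p => [|c p q Qp Qq|i p Qp].
- by rewrite rmorph1.
- by rewrite linearP; apply: QL.
- by rewrite rmorphM /= evX; apply: QX.
Qed.

End Evaluation.

Lemma finite_typeP (K : fieldType) (R : comAlgType K) :
  finite_type R <-> exists (N : nat) (x : 'I_N -> R), generates x.
Proof.
split=> [[N [f onto]]|[N [x /generates_ev onto]]]; last first.
  by exists N, (ev x).
exists N, (fun i => f 'X_i); apply/generates_ev => a.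
have [p <-] := onto a; exists p; elim/mpoly_gen_ind: p => [|c p q Ep Eq|i p Ep].
- by rewrite !rmorph1.
- by rewrite !linearP /= Ep Eq.
- by rewrite !rmorphM /= evX Ep.
Qed.

Lemma derivation_ev (K : fieldType) (A : comAlgType K) (S : comNzRingType)
    (s : {rmorphism A -> S}) (M : lmodType S) (D : A -> M) (N : nat) (x : 'I_N -> A) p :
  derivation s D -> D (ev x p) = \sum_i s (ev x p^`M(i)) *: D (x i).
Proof.
move=> derD; elim/mpoly_gen_ind: p => [|c p q Ep Eq|i p Ep].
- rewrite rmorph1 (derivation1 derD) big1 // => i _.
  by rewrite -[1]/(1%:MP) mderivC !rmorph0 scale0r.
- rewrite linearP (derivation_linear derD) Ep Eq scaler_sumr -big_split /=.
  apply: eq_bigr => i _; rewrite !linearP /= -[c *: ev _ _]mulr_algl rmorphD rmorphM.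
  by rewrite scalerDl scalerA.
- rewrite rmorphM /= evX (derivationM derD) Ep scaler_sumr.
  under [RHS]eq_bigr => l _.
    rewrite mderivM rmorphD !rmorphM /= evX rmorphD !rmorphM /=.
    rewrite scalerDl addrC -scalerA.
  over.
  rewrite big_split /=; congr (_ + _).
  rewrite (bigD1 i) //= mderivX_id !rmorph1 mul1r big1 ?addr0 // => l li.
  by rewrite mderivX_neq // !rmorph0 mul0r scale0r.
Qed.

(** The square of the ideal [I], as the intersection of all ideals containing the products. *)
Definition ideal_sq (R : comPzRingType) (I : R -> Prop) (y : R) : Prop :=
  forall T : R -> Prop, is_ideal T -> (forall a b, I a -> I b -> T (a * b)) -> T y.

Lemma ideal_sq_ideal (R : comPzRingType) (I : R -> Prop) : is_ideal (ideal_sq I).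
Proof.
split=> [T idT _|x y Ix Iy T idT IT|a x Ix T idT IT].
- exact: (ideal0 idT).
- by apply: (idealD idT); [apply: Ix | apply: Iy].
- by apply: (idealMl idT); apply: Ix.
Qed.

Lemma ideal_sq_mul (R : comPzRingType) (I : R -> Prop) a b :
  I a -> I b -> ideal_sq I (a * b).
Proof. by move=> Ia Ib T _; apply. Qed.

Section DualBasis.
Variables (K : fieldType) (R : comAlgType K).
Hypotheses (ftR : finite_type R) (smR : formally_smooth R).

(* A lift of the identity to [P / I^2], for a presentation [P / I] of [R],    *)
(* splits the conormal sequence.                                              *)
Lemma dual_basis : exists (N : nat) (x : 'I_N -> R) (d : 'I_N -> R -> R),
  [/\ generates x, (forall i, derivation (fun a : R => a) (d i : R -> R^o)) &
   forall (S : comNzRingType) (s : {rmorphism R -> S}) (M : lmodType S) (D : R -> M),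
     derivation s D -> forall a, D a = \sum_i s (d i a) *: D (x i)].
Proof.
have [N [x gen]] := (finite_typeP R).1 ftR.
have onto := (generates_ev x).1 gen.
pose I (p : {mpoly K[N]}) := ev x p = 0.
have sq0 y : ideal_sq I y -> ev x y = 0 /\ forall i, ev x y^`M(i) = 0.
  move=> /(_ (fun y => ev x y = 0 /\ forall i, ev x y^`M(i) = 0)).
  apply=> [|a b Ia Ib]; last first.
    split=> [|i]; first by rewrite rmorphM /= Ia mul0r.
    by rewrite mderivM rmorphD !rmorphM /= Ia Ib mulr0 mul0r addr0.
  split=> [|u v [Iu du] [Iv dv]|u v [Iv dv]].
  - by split=> [|i]; rewrite ?mderiv0 rmorph0.
  - by split=> [|i]; rewrite ?mderivD rmorphD /= ?Iu ?Iv ?du ?dv addr0.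
  - split=> [|i]; first by rewrite rmorphM /= Iv mulr0.
    by rewrite mderivM rmorphD !rmorphM /= Iv dv !mulr0 addr0.
have [||s [sE sP]] := lift_mod smR (q := ev x) idfun onto (ideal_sq_ideal I).
- by move=> y /sq0 [].
- by move=> y z Iy Iz; apply: ideal_sq_mul.
have E0 y z i : ideal_sq I (y - z) -> ev x y^`M(i) = ev x z^`M(i).
  move=> /sq0 [_ /(_ i)]; rewrite mderivB rmorphB => /eqP.
  by rewrite subr_eq0 => /eqP.
(* Partial derivatives of elements of the square of the kernel vanish in [R], so differentiating the
   lift [s] gives well-defined derivations of [R]. *)
exists N, x, (fun i a => ev x (s a)^`M(i)); split=> // [i|S t M D derD a].
  split=> [c a b|a b].
    rewrite (E0 _ _ i (hom_modL sP c a b)) mderivD mderivZ linearP /=.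
    by congr (_ + _); rewrite -[RHS]/(_ * _) mulr_algl.
  by rewrite (E0 _ _ i (hom_modM sP a b)) mderivM rmorphD !rmorphM /= !sE addrC
    [_ * b]mulrC.
by rewrite -{1}[a](sE a); apply: derivation_ev.
Qed.

End DualBasis.

(** A full rank factorisation E = C B of an idempotent satisfies B C = 1, and the trace of B C is
    the rank. *)
Lemma mxtrace_idempotent (F : fieldType) (n : nat) (E : 'M[F]_n) :
  E *m E = E -> \tr E = (\rank E)%:R.
Proof.
move=> EE; have bases1 : row_base E *m col_base E = 1%:M.
  apply: (row_free_inj (row_base_free E)); apply: (row_full_inj (col_base_full E)).
  by rewrite /= mul1mx -mulmxA !mulmx_base mulmxA mulmx_base EE.
by rewrite -{1}(mulmx_base E) mxtrace_mulC bases1 mxtrace1.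
Qed.

Section DerivationSpace.
Variables (K : fieldType) (R : comAlgType K).

Definition independent_derivations (F : fieldType) (e : R -> F) (q : nat)
    (D : 'I_q -> R -> F) : Prop :=
  (forall i, derivation e (D i : R -> F^o)) /\
  forall c : 'I_q -> F, (forall a, \sum_i c i * D i a = 0) -> forall i, c i = 0.

(** The dimension of the space of derivations into [F], expressed by independent families so that no
    vector space of derivations has to be built. *)
Definition derivation_dim (F : fieldType) (e : R -> F) (r : nat) : Prop :=
  (exists D : 'I_r -> R -> F, independent_derivations e D) /\
  forall q (D : 'I_q -> R -> F), independent_derivations e D -> (q <= r)%N.

End DerivationSpace.

Lemma point_pchar (K F : fieldType) (R : comAlgType K) (e : {rmorphism R -> F}) :
  [pchar K] =i pred0 -> [pchar F] =i pred0.
Proof.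
move=> char0 p.
by rewrite (fmorph_pchar (e \o in_alg R : {rmorphism K -> F}) p) char0.
Qed.

(* The rank of the idempotent matrix that presents the differentials is its   *)
(* trace, an element of [R] that specializes to an integer at every point.    *)
Lemma derivation_dim_constant (K : fieldType) (char0 : [pchar K] =i pred0)
    (R : comAlgType K) : finite_type R -> formally_smooth R ->
  GRing.integral_domain_axiom R ->
  exists r, forall (F : fieldType) (e : {rmorphism R -> F}), derivation_dim e r.
Proof.
move=> ftR smR domR; have [N [x [d [gen der dE]]]] := dual_basis ftR smR.
pose E : 'M[R]_N := \matrix_(i, j) d i (x j).
have EE : E *m E = E.
  apply/matrixP => l j; rewrite !mxE.
  have := dE _ (idfun : {rmorphism R -> R}) _ _ (der l) (x j) => /= ->.
  by apply: eq_bigr => i _; rewrite !mxE mulrC.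
pose Ee (F : fieldType) (e : {rmorphism R -> F}) : 'M[F]_N := map_mx e E.
have EeEe (F : fieldType) (e : {rmorphism R -> F}) : Ee F e *m Ee F e = Ee F e.
  by rewrite /Ee -map_mxM EE.
have [F0 [e0 [inj0 _]]] := generic_point char0 (ltn0Sn 0) domR.
exists (\rank (Ee F0 e0)) => F e.
have trE : \tr E = (\rank (Ee F0 e0))%:R.
  by apply: inj0; rewrite -trace_map_mx mxtrace_idempotent ?EeEe // rmorph_nat.
have -> : \rank (Ee F0 e0) = \rank (Ee F e).
  have := congr1 e trE; rewrite -trace_map_mx mxtrace_idempotent ?EeEe // rmorph_nat.
  have /pcharf0P charF := point_pchar e char0.
  move=> /eqP; wlog le : / (\rank (Ee F0 e0) <= \rank (Ee F e))%N => [wl|].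
    case/orP: (leq_total (\rank (Ee F0 e0)) (\rank (Ee F e))) => le; first exact: wl.
    rewrite eq_sym -subr_eq0 -natrB // charF subn_eq0 => le'.
    by apply/eqP; rewrite eqn_leq le le'.
  rewrite -subr_eq0 -natrB // charF subn_eq0 => le'.
  by apply/eqP; rewrite eqn_leq le le'.
split.
  (* A vector in the row space of [E] at the point is the list of values on the generators [x l] of
     a derivation. *)
  pose B := row_base (Ee F e).
  have BE : B *m Ee F e = B.
    have /submxP [C ->] : (B <= Ee F e)%MS by rewrite eq_row_base.
    by rewrite -mulmxA EeEe.
  exists (fun i a => \sum_j B i j * e (d j a)); split=> [i|c c0 i].
    split=> [a u v|u v].
      rewrite /GRing.scale /= mulr_sumr -big_split /=; apply: eq_bigr => j _.
      by rewrite (derivation_linear (der j)) rmorphD rmorphM mulrDr mulrCA.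
    rewrite /GRing.scale /= !mulr_sumr -big_split /=; apply: eq_bigr => j _.
    by rewrite (derivationM (der j)) rmorphD !rmorphM mulrDr !(mulrCA (B i j)).
  have : \row_i c i *m B = 0.
    apply/rowP => l; rewrite mxE [RHS]mxE -[RHS](c0 (x l)); apply: eq_bigr => t _.
    rewrite mxE; congr (_ * _); rewrite -{1}BE mxE; apply: eq_bigr => j _.
    by rewrite !mxE.
  move=> /(congr1 (mulmxr (pinvmx B))); rewrite /= mul0mx -mulmxA mulmxVp ?row_base_free //.
  by rewrite mulmx1 => /rowP /(_ i); rewrite !mxE.
(* Conversely a derivation is determined by its values on the generators, which form a vector in
   this row space. *)
move=> q D [derD indD]; pose V : 'M[F]_(q, N) := \matrix_(i, l) D i (x l).
have VE : (V <= Ee F e)%MS.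
  apply/submxP; exists V; apply/matrixP => i l; rewrite !mxE (dE _ _ _ _ (derD i)).
  by apply: eq_bigr => j _; rewrite !mxE mulrC.
suff /eqP <- : row_free V by apply: mxrankS.
apply/inj_row_free => v vV; apply/rowP => i; rewrite mxE; apply: (indD (v 0)) => a.
under eq_bigr => j _ do rewrite (dE _ _ _ _ (derD j)) mulr_sumr.
rewrite exchange_big big1 // => l _.
have /rowP /(_ l) := vV; rewrite !mxE => E0.
rewrite -[RHS](mulr0 (e (d l a))) -[in RHS]E0 mulr_sumr; apply: eq_bigr => j _.
by rewrite !mxE mulrCA.
Qed.

(** * Base change to a point *)

Section PackLinear.
Variables (F : fieldType) (U V : lmodType F) (f : U -> V).
Hypothesis fP : forall a u v, f (a *: u + v) = a *: f u + f v.
Definition linear_fun (x : U) : V := f x.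
HB.instance Definition _ := GRing.isLinear.Build F U V *:%R linear_fun fP.

Lemma pack_linear : exists g : {linear U -> V}, g =1 f.
Proof. by exists linear_fun. Qed.

End PackLinear.

Section ScalarRestriction.
Variables (K F : fieldType) (i : {rmorphism K -> F}) (C : comAlgType F).

(* The phantom argument lets the K-structure of the copy depend on [i]. *)
Definition restr_along (_ : {rmorphism K -> F}) : Type := C.
Local Notation restr := (restr_along i).
HB.instance Definition _ := GRing.ComNzRing.on restr.
Definition restr_scale (c : K) (w : restr) : restr := i c *: (w : C).
Fact restr_scaleA a b w : restr_scale a (restr_scale b w) = restr_scale (a * b) w.
Proof. by rewrite /restr_scale scalerA rmorphM. Qed.
Fact restr_scale1 : left_id 1 restr_scale.
Proof. by move=> w; rewrite /restr_scale rmorph1 scale1r. Qed.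
Fact restr_scaleDr : right_distributive restr_scale +%R.
Proof. by move=> a u v; rewrite /restr_scale scalerDr. Qed.
Fact restr_scaleDl w : {morph restr_scale^~ w : a b / a + b}.
Proof. by move=> a b; rewrite /restr_scale rmorphD scalerDl. Qed.
HB.instance Definition _ := GRing.Zmodule_isLmodule.Build K restr
  restr_scaleA restr_scale1 restr_scaleDr restr_scaleDl.
Fact restr_scaleAl (c : K) (u v : restr) : c *: (u * v) = (c *: u) * v.
Proof. exact: (@scalerAl F C). Qed.
HB.instance Definition _ := GRing.Lmodule_isLalgebra.Build K restr restr_scaleAl.
Fact restr_scaleAr (c : K) (u v : restr) : c *: (u * v) = u * (c *: v).
Proof. exact: (@scalerAr F C). Qed.
HB.instance Definition _ := GRing.Lalgebra_isAlgebra.Build K restr restr_scaleAr.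

End ScalarRestriction.

Lemma restrict_scalars (K F : fieldType) (i : {rmorphism K -> F}) (C : comAlgType F) :
  exists (C0 : comAlgType K) (u : {rmorphism C0 -> C}) (v : {rmorphism C -> C0}),
    [/\ cancel u v, cancel v u & forall (c : K) x, u (c *: x) = i c *: u x].
Proof.
pose C0 : comAlgType K := restr_along C i.
by exists C0, (idfun : {rmorphism C -> C}), (idfun : {rmorphism C -> C}); split.
Qed.

Section BaseChange.
Variables (K F : fieldType) (A : comAlgType K) (e : {rmorphism A -> F}).

(** The tensor product of [F] and [A] over [K], with [K] acting on [F] through [e]. Additivity in
    [F] is already part of the free module, so the relations only concern the argument in [A]. *)
Inductive base_change_rel : {freeg A / F} -> Prop :=
| BaseChangeLinear (c : K) (a b : A) :
    base_change_rel (<< c *: a + b >> - (e c%:A *: << a >> + << b >>)).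

Definition bchange := pres_mod base_change_rel.
HB.instance Definition _ := GRing.Lmodule.on bchange.

Definition bgen (a : A) : bchange := pres_gen base_change_rel a.

Lemma bgenP c a b : bgen (c *: a + b) = e c%:A *: bgen a + bgen b.
Proof. by rewrite /bgen (pres_genE (BaseChangeLinear c a b)) pres_classD pres_classZ. Qed.

Section Lift.
Variables (V : lmodType F) (nu : A -> V).
Hypothesis nuP : forall (c : K) a b, nu (c *: a + b) = e c%:A *: nu a + nu b.

Definition blift : bchange -> V := pres_lift idfun nu.
Fact blift_rel D : base_change_rel D -> free_lift idfun nu D = 0.
Proof.
by case=> c a b; rewrite free_liftB free_liftD free_liftZ !free_lift1 nuP subrr.
Qed.
Lemma bliftP a u v : blift (a *: u + v) = a *: blift u + blift v.
Proof. exact: (pres_liftP blift_rel). Qed.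
Lemma blift_gen a : blift (bgen a) = nu a.
Proof. exact: (pres_lift_gen blift_rel). Qed.
Lemma blift0 : blift 0 = 0.
Proof.
by apply: (addrI (blift 0)); rewrite -{1}[blift 0]scale1r -bliftP scale1r !addr0.
Qed.

End Lift.

Definition bmul1 (a : A) (y : bchange) : bchange := blift (fun b => bgen (a * b)) y.
Fact bmul1_lin a c b b' :
  bgen (a * (c *: b + b')) = e c%:A *: bgen (a * b) + bgen (a * b').
Proof. by rewrite mulrDr -scalerAr bgenP. Qed.
Lemma bmul1P a c u v : bmul1 a (c *: u + v) = c *: bmul1 a u + bmul1 a v.
Proof. exact: (bliftP (bmul1_lin a)). Qed.
Lemma bmul1_gen a b : bmul1 a (bgen b) = bgen (a * b).
Proof. exact: (blift_gen (bmul1_lin a)). Qed.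
Lemma bmul1_0 a : bmul1 a 0 = 0.
Proof. exact: (blift0 (bmul1_lin a)). Qed.
Fact bmul1_lin1 y c a b : bmul1 (c *: a + b) y = e c%:A *: bmul1 a y + bmul1 b y.
Proof.
elim/pres_ind: y => [|f x y IHy]; first by rewrite !bmul1_0 scaler0 addr0.
rewrite !bmul1P IHy -/(bgen x) !bmul1_gen mulrDl -scalerAl bgenP.
by rewrite !scalerDr !scalerA [f * _]mulrC addrACA.
Qed.

Definition bmul (x y : bchange) : bchange := blift (bmul1^~ y) x.
Lemma bmulPl c u v w : bmul (c *: u + v) w = c *: bmul u w + bmul v w.
Proof. exact: (bliftP (bmul1_lin1 w)). Qed.
Lemma bmul0l w : bmul 0 w = 0.
Proof. exact: (blift0 (bmul1_lin1 w)). Qed.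
Lemma bmul_genl a w : bmul (bgen a) w = bmul1 a w.
Proof. exact: (blift_gen (bmul1_lin1 w)). Qed.
Lemma bmulC : commutative bmul.
Proof.
have sym a y : bmul y (bgen a) = bmul1 a y.
  elim/pres_ind: y => [|f x y IHy]; first by rewrite bmul0l bmul1_0.
  by rewrite bmulPl IHy bmul1P -/(bgen x) bmul_genl !bmul1_gen mulrC.
move=> x y; elim/pres_ind: x => [|f a x IHx].
  rewrite bmul0l; elim/pres_ind: y => [|g b y IHy]; first by rewrite bmul0l.
  by rewrite bmulPl -IHy addr0 -/(bgen b) bmul_genl bmul1_0 scaler0.
rewrite bmulPl IHx -/(bgen a) bmul_genl -sym.
elim/pres_ind: y {IHx} => [|g b y IHy]; first by rewrite !bmul0l scaler0 addr0.
rewrite !bmulPl -IHy -/(bgen b) !bmul_genl bmul1P.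
by rewrite !scalerDr !scalerA [f * g]mulrC addrACA.
Qed.
Lemma bmul_gen a b : bmul (bgen a) (bgen b) = bgen (a * b).
Proof. by rewrite bmul_genl bmul1_gen. Qed.
Lemma bmulPr c u v w : bmul w (c *: u + v) = c *: bmul w u + bmul w v.
Proof. by rewrite bmulC bmulPl ![bmul _ w]bmulC. Qed.
Lemma bmul0r w : bmul w 0 = 0.
Proof. by rewrite bmulC bmul0l. Qed.
Fact bmulA : associative bmul.
Proof.
move=> x y z; elim/pres_ind: x => [|f a x IHx]; first by rewrite !bmul0l.
rewrite !bmulPl IHx; congr (_ *: _ + _); rewrite -/(bgen a).
elim/pres_ind: y {IHx} => [|g b y IHy]; first by rewrite !(bmul0l, bmul0r).
rewrite !(bmulPl, bmulPr) IHy; congr (_ *: _ + _); rewrite -/(bgen b).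
elim/pres_ind: z {IHy} => [|h c z IHz]; first by rewrite !bmul0r.
by rewrite !bmulPr IHz -/(bgen c) !bmul_gen mulrA.
Qed.
Fact bmul1l : left_id (bgen 1) bmul.
Proof.
move=> y; elim/pres_ind: y => [|g b y IHy]; first by rewrite bmul0r.
by rewrite bmulPr IHy -/(bgen b) bmul_gen mul1r.
Qed.
Fact bmulDl : left_distributive bmul +%R.
Proof. by move=> x y z; have := bmulPl 1 x y z; rewrite !scale1r. Qed.
(** The map [e] extends linearly to the tensor product and sends the unit to 1. *)
Fact b1_neq0 : bgen 1 != 0.
Proof.
pose nu : A -> F^o := e.
have nuP c a b : nu (c *: a + b) = e c%:A *: nu a + nu b.
  by rewrite /nu rmorphD -[c *: a]mulr_algl rmorphM.
apply/eqP => /(congr1 (blift nu)).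
rewrite (blift0 nuP) (blift_gen nuP) /nu rmorph1 => /eqP; exact/negP/oner_neq0.
Qed.
HB.instance Definition _ := GRing.Zmodule_isComNzRing.Build bchange
  bmulA bmulC bmul1l bmulDl b1_neq0.
Fact bscaleAl (c : F) (u v : bchange) : c *: (u * v) = (c *: u) * v.
Proof. by have := bmulPl c u 0 v; rewrite bmul0l !addr0 => E; apply/esym: E. Qed.
HB.instance Definition _ := GRing.Lmodule_isLalgebra.Build F bchange bscaleAl.
Fact bscaleAr (c : F) (u v : bchange) : c *: (u * v) = u * (c *: v).
Proof. by rewrite ![u * _]mulrC bscaleAl. Qed.
HB.instance Definition _ := GRing.Lalgebra_isAlgebra.Build F bchange bscaleAr.

Lemma base_change : exists (A' : comAlgType F) (j : {rmorphism A -> A'}),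
  [/\ forall c : K, j c%:A = (e c%:A)%:A,
      forall Q : A' -> Prop, Q 0 -> (forall f a w, Q w -> Q (f *: j a + w)) ->
        forall w, Q w &
      forall (V : lmodType F) (nu : A -> V),
        (forall (c : K) a b, nu (c *: a + b) = e c%:A *: nu a + nu b) ->
        exists L : {linear A' -> V}, forall a, L (j a) = nu a].
Proof.
have [|||j jE] := @pack_rmorphism A bchange bgen.
- by move=> a b; have := bgenP 1 a b; rewrite !scale1r rmorph1 scale1r.
- by move=> a b; rewrite -bmul_gen.
- by [].
exists bchange, j; split=> [c|Q Q0 QL w|V nu nuP].
- have := bgenP c 1 0; rewrite addr0 -!jE rmorph0 addr0 rmorph1; apply.
- by elim/pres_ind: w => // f a w; rewrite -/(bgen a) -jE; apply: QL.
- have [L LE] := pack_linear (bliftP nuP).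
  by exists L => a; rewrite LE jE (blift_gen nuP).
Qed.

End BaseChange.

Record algebra_change (K F : fieldType) (A : comAlgType K) (e : A -> F)
    (A' : comAlgType F) (j : {rmorphism A -> A'}) : Prop := AlgebraChange {
  change_scalar : forall c : K, j c%:A = (e c%:A)%:A;
  change_ind : forall Q : A' -> Prop,
    Q 0 -> (forall f a w, Q w -> Q (f *: j a + w)) -> forall w, Q w;
  change_lift : forall (V : lmodType F) (nu : A -> V),
    (forall (c : K) a b, nu (c *: a + b) = e c%:A *: nu a + nu b) ->
    exists L : {linear A' -> V}, forall a, L (j a) = nu a }.

Section AlgebraChangeTheory.
Variables (K F : fieldType) (A : comAlgType K) (e : {rmorphism A -> F}).
Variables (A' : comAlgType F) (j : {rmorphism A -> A'}).
Hypothesis AA' : algebra_change e j.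

Lemma change_eq (V : lmodType F) (f g : {linear A' -> V}) :
  (forall a, f (j a) = g (j a)) -> f =1 g.
Proof.
move=> fg; apply: (change_ind AA') => [|c a w Ew]; first by rewrite !linear0.
by rewrite !linearP fg Ew.
Qed.

Lemma change_rmorphism (S : comAlgType F) (h : {rmorphism A -> S}) :
  (forall c : K, h c%:A = (e c%:A)%:A) ->
  exists h' : {lrmorphism A' -> S}, forall a, h' (j a) = h a.
Proof.
move=> hA; have [|L LE] := @change_lift _ _ _ _ _ _ AA' S h.
  move=> c a b; rewrite rmorphD; congr (_ + _).
  by rewrite -[c *: a]mulr_algl rmorphM hA mulr_algl.
have LM x y : L (x * y) = L x * L y.
  elim/(change_ind AA'): x => [|c a x IHx]; first by rewrite mul0r linear0 mul0r.
  rewrite mulrDl -scalerAl !linearP IHx LE mulrDl -scalerAl; congr (_ *: _ + _).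
  elim/(change_ind AA'): y {IHx} => [|d b y IHy]; first by rewrite mulr0 linear0 mulr0.
  by rewrite mulrDr -scalerAr -rmorphM !linearP IHy !LE mulrDr -scalerAr rmorphM.
have L1 : L 1 = 1 by rewrite -(rmorph1 j) LE rmorph1.
have [|||g gE] := @pack_rmorphism A' S L => //; first exact: linearD.
have [|g' g'E] := @pack_lrmorphism F A' S g.
  by move=> c; rewrite gE linearZ /= L1.
by exists g' => a; rewrite g'E gE LE.
Qed.

Lemma change_generates (N : nat) (x : 'I_N -> A) :
  generates x -> generates (fun i => j (x i)).
Proof.
move=> gen Q Q1 QL QX w; elim/(change_ind AA'): w => [|c a w Qw].
  by have := QL (-1) 1 1 Q1 Q1; rewrite scaleN1r addNr.
apply: (QL) => //; apply: (gen (fun a => Q (j a))) => [|d u v Qu Qv|i u Qu].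
- by rewrite rmorph1.
- rewrite rmorphD -[d *: u]mulr_algl rmorphM (change_scalar AA') mulr_algl.
  exact: QL.
- by rewrite rmorphM; apply: QX.
Qed.

(** A lifting problem over [F] is read over [K] by restriction of scalars, solved on [A], and the
    solution is extended F-linearly by the universal property. *)
Lemma change_smooth : formally_smooth A -> formally_smooth A'.
Proof.
move=> smA C D q f q_onto q_sq; pose i : {rmorphism K -> F} := e \o in_alg A.
have [C0 [u [v [uK vK uZ]]]] := restrict_scalars i C.
have [D0 [s [t [sK tK sZ]]]] := restrict_scalars i D.
have vA (c : K) : u c%:A = (i c)%:A by rewrite uZ rmorph1.
have tA (c : K) : s c%:A = (i c)%:A by rewrite sZ rmorph1.
have [|q0 q0E] := @pack_lrmorphism K C0 D0 (t \o q \o u).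
  by move=> c /=; rewrite vA linearZ /= rmorph1; apply: (can_inj sK); rewrite tK tA.
have [|f0 f0E] := @pack_lrmorphism K A D0 (t \o f \o j).
  by move=> c /=; rewrite (change_scalar AA') linearZ /= rmorph1; apply: (can_inj sK); rewrite tK tA.
have [||h hE] := smA C0 D0 q0 f0.
- move=> d; have [c Ec] := q_onto (s d).
  by exists (v c); rewrite q0E /= vK Ec sK.
- have s0 x : t x = 0 -> x = 0 by move=> /(congr1 s); rewrite tK rmorph0.
  move=> x y; rewrite !q0E => /s0 qx /s0 qy.
  by apply: (can_inj uK); rewrite rmorphM q_sq // rmorph0.
have [|h' h'E] := @change_rmorphism C (u \o h).
  by move=> c /=; rewrite rmorph_alg vA.
exists h'; apply: (@change_eq D (q \o h') f) => a /=.
rewrite h'E /=; apply: (can_inj tK).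
by have := hE a; rewrite q0E f0E.
Qed.

End AlgebraChangeTheory.

Section ActionTheory.
Variables (K : fieldType) (A : comAlgType K) (gT : finGroupType).
Variables (rho : gT -> {lrmorphism A -> A}).
Hypothesis act : is_algebra_action rho.

Lemma act_mul g h a : rho (g * h)%g a = rho h (rho g a).
Proof. by case: act => _ /(_ a g h); rewrite !inE; apply. Qed.
Lemma act_one a : rho 1%g a = a.
Proof. by case: act => inj _; apply: (inj 1%g); rewrite -act_mul mulg1. Qed.
Lemma algebra_action : (forall g h a, rho (g * h)%g a = rho h (rho g a)) ->
  (forall a, rho 1%g a = a) -> is_algebra_action rho.
Proof.
move=> actM act1; split=> [g a b /= E|a g h _ _]; last exact: actM.
by rewrite -[a]act1 -[b]act1 -(mulgV g) !actM E.
Qed.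

End ActionTheory.

(** The base change of [A] along [e], with its action. The point becomes the F-rational point [e']:
    ground field and residue field then agree, as the theory of cotangent spaces and expansions
    requires. *)
Record point_change (K F : fieldType) (A : comAlgType K) (e : A -> F)
    (gT : finGroupType) (rho : gT -> {lrmorphism A -> A})
    (A' : comAlgType F) (j : {rmorphism A -> A'}) (e' : {rmorphism A' -> F})
    (rho' : gT -> {lrmorphism A' -> A'}) : Prop := PointChange {
  change_algebra : algebra_change e j;
  change_act : is_algebra_action rho';
  change_actE : forall g a, rho' g (j a) = j (rho g a);
  change_point : forall a, e' (j a) = e a;
  change_rational : forall c : F, e' c%:A = c }.

Lemma exists_point_change (K F : fieldType) (A : comAlgType K)
    (e : {rmorphism A -> F}) (gT : finGroupType) (rho : gT -> {lrmorphism A -> A}) :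
  is_algebra_action rho ->
  exists (A' : comAlgType F) (j : {rmorphism A -> A'}) (e' : {rmorphism A' -> F})
    (rho' : gT -> {lrmorphism A' -> A'}), point_change e rho j e' rho'.
Proof.
move=> act; have [A' [j [jA ind lft]]] := base_change e.
have AA' : algebra_change e j by [].
pose eF : {rmorphism A -> F^o} := e.
have [|e' e'E] := @change_rmorphism _ _ _ e _ _ AA' (F^o : comAlgType F) eF.
  by move=> c; rewrite /eF -[RHS]/(_ * _) mulr1.
have ex g : exists r : {lrmorphism A' -> A'}, forall a, r (j a) = j (rho g a).
  apply: (@change_rmorphism _ _ _ e _ _ AA' A' (j \o rho g)) => c /=.
  by rewrite linearZ /= rmorph1 jA.
have [rho' rhoE] := choice ex.
exists A', j, e', rho'; split=> //.
- apply: algebra_action => [g h|].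
    apply: (change_eq AA' (f := rho' (g * h)%g) (g := rho' h \o rho' g)) => a /=.
    by rewrite !rhoE act_mul.
  apply: (change_eq AA' (f := rho' 1%g) (g := idfun)) => a /=.
  by rewrite rhoE act_one.
- move=> c; have E : e' (c *: 1) = c * e' 1 := linearZ_LR e' c 1.
  by rewrite [LHS]E rmorph1 mulr1.
Qed.

(** * Local coordinates and expansions *)

(** A basis, extracted from the list [s], of its span modulo the subspace [W]. An element is kept
    only if it is not in the span of those kept already. *)
Lemma independent_subfamily (K : fieldType) (V : lmodType K) (W : V -> Prop)
    (s : seq V) :
  W 0 -> (forall (c : K) x y, W x -> W y -> W (c *: x + y)) ->
  exists (n : nat) (u : 'I_n -> V), [/\ forall i, u i \in s,
    (forall c : 'I_n -> K, W (\sum_i c i *: u i) -> forall i, c i = 0) &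
    forall v, v \in s -> exists c : 'I_n -> K, W (v - \sum_i c i *: u i)].
Proof.
move=> W0 WL; elim: s => [|v s [n [u [us ufree uspan]]]].
  exists 0%N, (fun _ => 0); split=> [[]|c _ []|] //.
have [[c Wc]|nv] := pselect (exists c : 'I_n -> K, W (v - \sum_i c i *: u i)).
  exists n, u; split=> [i|//|w]; first by rewrite inE us orbT.
  by rewrite inE => /orP [/eqP ->|/uspan //]; exists c.
pose u' (i : 'I_n.+1) := oapp u v (unlift ord0 i).
have sumE (c : 'I_n.+1 -> K) : \sum_i c i *: u' i =
    c ord0 *: v + \sum_i c (fintype.lift ord0 i) *: u i.
  rewrite big_ord_recl /u' unlift_none; congr (_ + _).
  by apply: eq_bigr => i _; rewrite liftK.
exists n.+1, u'; split=> [i|c|w].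
- by rewrite inE /u'; case: unliftP => [j|] _ /=; rewrite ?us ?eqxx ?orbT.
- rewrite sumE => Wc.
  have c0 : c ord0 = 0.
    apply/eqP; apply: contrapT => /negP c0; apply: nv.
    exists (fun i => - (c ord0)^-1 * c (fintype.lift ord0 i)).
    have -> : v - \sum_i (- (c ord0)^-1 * c (fintype.lift ord0 i)) *: u i =
        (c ord0)^-1 *: (c ord0 *: v + \sum_i c (fintype.lift ord0 i) *: u i) + 0.
      rewrite addr0 scalerDr scalerA mulVf // scale1r; congr (_ + _).
      rewrite scaler_sumr -sumrN; apply: eq_bigr => i _.
      by rewrite mulNr scaleNr opprK scalerA.
    exact: WL.
  move: Wc; rewrite c0 scale0r add0r => /ufree cl i.
  by case: (unliftP ord0 i) => [j|] -> //; rewrite cl.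
- rewrite inE => /orP [/eqP ->|/uspan [c Wc]].
    exists (fun i => (i == ord0)%:R); rewrite sumE scale1r big1 ?addr0 ?subrr //.
    by move=> i _; rewrite eq_sym (negPf (neq_lift _ _)) scale0r.
  exists (fun i => oapp c 0 (unlift ord0 i)); rewrite sumE unlift_none scale0r add0r.
  by under eq_bigr do rewrite liftK.
Qed.

Lemma prim_root_sum (K : fieldType) (N : nat) (z : K) (i : nat) :
  N.-primitive_root z -> \sum_(j < N) z ^+ (i * j) = if (N %| i)%N then N%:R else 0.
Proof.
move=> prim; under eq_bigr do rewrite exprM.
case: ifP => Ni.
  have -> : z ^+ i = 1 by apply/eqP; rewrite -(prim_order_dvd prim).
  by under eq_bigr do rewrite expr1n; rewrite sumr_const card_ord.
apply/eqP; have := subrX1 (z ^+ i) N.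
rewrite -exprM mulnC exprM (prim_expr_order prim) expr1n subrr => /esym/eqP.
by rewrite mulf_eq0 subr_eq0 -(prim_order_dvd prim) Ni.
Qed.

Section IdealPowers.
Variables (K : fieldType) (A : comAlgType K) (e : {rmorphism A -> K}).

(* The powers of the maximal ideal of the rational point [e]. *)
Inductive npow : nat -> A -> Prop :=
| Npow0 a : npow 0 a
| NpowM L x y : e x = 0 -> npow L y -> npow L.+1 (x * y)
| NpowD L x y : npow L x -> npow L y -> npow L (x + y).

Lemma npow_zero L : npow L 0.
Proof.
elim: L => [|L IHL]; first exact: Npow0.
by rewrite -(mul0r 0); apply: NpowM => //; rewrite rmorph0.
Qed.

Lemma npow_mull L a x : npow L x -> npow L (a * x).
Proof.
elim=> [y|M y w ey _ IH|M y w _ IHy _ IHw]; first exact: Npow0.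
  by rewrite mulrCA; apply: NpowM.
by rewrite mulrDr; apply: NpowD.
Qed.

Lemma npow_ideal L : is_ideal (npow L).
Proof. by split; [exact: npow_zero | exact: NpowD | move=> a x; apply: npow_mull]. Qed.

Lemma npow_scale L c x : npow L x -> npow L (c *: x).
Proof. by rewrite -mulr_algl; apply: npow_mull. Qed.

Lemma npow_mul L M x y : npow L x -> npow M y -> npow (L + M) (x * y).
Proof.
move=> Lx My; elim: Lx => {L x} [a|L a b ea _ IH|L a b _ IHa _ IHb].
- exact: npow_mull.
- by rewrite -mulrA addSn; apply: NpowM.
- by rewrite mulrDl; apply: NpowD.
Qed.

Lemma npowS L x : npow L.+1 x -> npow L x.
Proof.
move E: L.+1 => M Mx; elim: Mx E => {M x} // [M x y ex My _ [->]|M x y _ IHx _ IHy E].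
  exact: npow_mull.
by apply: NpowD; [apply: IHx | apply: IHy].
Qed.

Lemma npow_le L M x : (L <= M)%N -> npow M x -> npow L x.
Proof. by move=> /subnK <-; elim: (M - L)%N => // k IH /npowS /IH. Qed.

Lemma npow1 x : npow 1 x <-> e x = 0.
Proof.
split=> [|ex]; last by rewrite -[x]mulr1; apply: NpowM => //; exact: Npow0.
move E: 1%N => M Mx; elim: Mx E => {M x} // [M x y ex _ _ _|M x y _ IHx _ IHy E].
  by rewrite rmorphM ex mul0r.
by rewrite rmorphD IHx ?IHy ?addr0.
Qed.

Lemma npow_eps L x : npow L.+1 x -> e x = 0.
Proof. by move=> Lx; apply/npow1; apply: npow_le Lx. Qed.

Lemma npow_exp L x M : npow L x -> npow (L * M) (x ^+ M).
Proof.
move=> Lx; elim: M => [|M IH]; first by rewrite muln0; apply: Npow0.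
by rewrite exprS mulnS; apply: npow_mul.
Qed.

Lemma npow_expl x M : e x = 0 -> npow M (x ^+ M).
Proof. by move=> /npow1 /(@npow_exp 1 x M); rewrite mul1n. Qed.

End IdealPowers.

Section Coordinates.
Variables (K : fieldType) (char0 : [pchar K] =i pred0) (A : comAlgType K).
Variables (gT : finGroupType) (rho : gT -> {lrmorphism A -> A}).
Hypotheses (abelG : abelian [set: gT]) (act : is_algebra_action rho).
Variables (e : {rmorphism A -> K}) (eA : forall c, e c%:A = c).
Variables (z : K) (prim : #|gT|.-primitive_root z).

(** For the rational point [e] this is its stabiliser. *)
Definition inertia (g : gT) : Prop := forall a, e (rho g a) = e a.

Lemma point_scale c a : e (c *: a) = c * e a.
Proof. by rewrite -mulr_algl rmorphM eA. Qed.

Lemma inertia_npow g L x : inertia g -> npow e L x -> npow e L (rho g x).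
Proof.
move=> gH; elim=> {L x} [a|L x y ex _ IH|L x y _ IHx _ IHy]; first exact: Npow0.
  by rewrite rmorphM; apply: NpowM => //; rewrite gH.
by rewrite rmorphD; apply: NpowD.
Qed.

Lemma act_comm g h a : rho g (rho h a) = rho h (rho g a).
Proof.
rewrite -!(act_mul act); congr (rho _ a).
by apply: (centsP abelG); rewrite inE.
Qed.

(** Simultaneous diagonalisation, one group element at a time. The projections onto eigenspaces of
    [h] commute with the rest of the abelian group, so earlier eigenvectors split into eigenvectors;
    they respect the condition [e v = 0] because [h] fixes the point. *)
Lemma eigen_decomposition (hs : seq gT) (t : A) :
  (forall h, h \in hs -> inertia h) -> e t = 0 ->
  exists s : seq A, t = \sum_(v <- s) v /\ forall v, v \in s ->
    e v = 0 /\ forall h, h \in hs -> exists l : K, rho h v = l *: v.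
Proof.
have primN := prim; set N := #|gT| in primN *; have N0 : N%:R != 0 :> K.
  by move/pcharf0P: char0 => ->; rewrite -lt0n (prim_order_gt0 primN).
elim: hs => [_ et|h hs IH hsH et].
  by exists [:: t]; rewrite big_seq1; split=> // v; rewrite inE => /eqP ->.
have [|s [Et sP]] := IH _ et; first by move=> g gs; apply: hsH; rewrite inE gs orbT.
have hH : inertia h by apply: hsH; rewrite inE eqxx.
have hN a : rho (h ^+ N)%g a = a.
  by rewrite /N -cardsT expg_cardG ?inE // (act_one act).
(* The projection onto the eigenvalue [z ^+ j]; the exponent [i * (N - j)] stands for [- i * j], as
   [z] has order [N]. *)
pose P (j : 'I_N) v := N%:R^-1 *: \sum_(i < N) (z ^+ (i * (N - j))) *: rho (h ^+ i)%g v.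
have sumP v : \sum_j P j v = v.
  rewrite -scaler_sumr exchange_big /=.
  under eq_bigr => i _.
    rewrite -scaler_suml (reindex_inj rev_ord_inj) /=.
    under eq_bigr => j _ do rewrite subKn // mulnSr exprD.
    rewrite -mulr_suml prim_root_sum //.
  over.
  have N1 := prim_order_gt0 primN.
  rewrite (bigD1 (Ordinal N1)) //= dvdn0 expr0 mulr1 (act_one act) big1 => [|i ni].
    by rewrite addr0 scalerA mulVf // scale1r.
  rewrite gtnNdvd ?ltn_ord ?mul0r ?scale0r // lt0n.
  by apply: contraNneq ni => i0; apply/eqP/val_inj.
have eP j v : e v = 0 -> e (P j v) = 0.
  move=> ev; rewrite point_scale rmorph_sum big1 ?mulr0 // => i _.
  rewrite point_scale (_ : e _ = 0) ?mulr0 //.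
  elim: (i : nat) => [|k IHk]; first by rewrite expg0 (act_one act).
  by rewrite expgSr (act_mul act) hH.
have hP j v : rho h (P j v) = z ^+ j *: P j v.
  rewrite /P linearZ scalerA mulrC -scalerA; congr (_ *: _).
  rewrite linear_sum scaler_sumr /=.
  (* Applying [h] shifts the terms of the sum by one, and the terms are periodic with period [N]. *)
  pose F (i : nat) := z ^+ j *: (z ^+ (i * (N - j)) *: rho (h ^+ i)%g v).
  have FN : F N = F 0%N.
    by rewrite /F hN expg0 (act_one act) mul0n exprM (prim_expr_order primN) expr1n.
  transitivity (\sum_(i < N) F i.+1).
    apply: eq_bigr => i _; rewrite /F linearZ scalerA -exprD expgSr (act_mul act).
    congr (_ *: _); rewrite mulSn addnA subnKC 1?ltnW //.
    by rewrite exprD (prim_expr_order primN) mul1r.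
  apply: (addrI (F 0%N)); transitivity (\sum_(i < N.+1) F i).
    by rewrite big_ord_recl.
  by rewrite big_ord_recr /= FN addrC.
exists (flatten [seq [seq P j v | j : 'I_N] | v <- s]); split.
  rewrite big_flatten big_map Et; apply: eq_bigr => v _.
  by rewrite big_map big_enum sumP.
move=> w /flattenP [_ /mapP [v vs ->] /mapP [j _ ->]].
have [ev lv] := sP v vs; split; first exact: eP.
move=> g; rewrite inE => /orP [/eqP ->|/lv [l El]]; first by exists (z ^+ j).
exists l; rewrite /P linearZ /= scalerA mulrC -scalerA; congr (_ *: _).
rewrite linear_sum scaler_sumr /=; apply: eq_bigr => i _.
by rewrite linearZ /= act_comm El linearZ /= !scalerA mulrC.
Qed.

(** Lifts of a basis of the cotangent space at the point. They are eigenvectors of inertia in [A]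
    itself, not only modulo the square of the maximal ideal. *)
Record coordinates (n : nat) (u : 'I_n -> A) (chi : 'I_n -> gT -> K) : Prop :=
  Coordinates {
    coords_eps : forall i, e (u i) = 0;
    coords_span : forall x, e x = 0 -> exists c : 'I_n -> K, npow e 2 (x - \sum_i c i *: u i);
    coords_free : forall c : 'I_n -> K, npow e 2 (\sum_i c i *: u i) -> forall i, c i = 0;
    coords_act : forall h i, inertia h -> rho h (u i) = chi i h *: u i }.

Lemma kernel_generators (N : nat) (x : 'I_N -> A) : generates x ->
  forall a, exists b : 'I_N -> A, a = (e a)%:A + \sum_i b i * (x i - (e (x i))%:A).
Proof.
move=> gen; apply: gen => [|c u v [b Eb] [d Ed]|i u [b Eb]].
- by exists (fun _ => 0); rewrite rmorph1 scale1r big1 ?addr0 // => i _; rewrite mul0r.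
- exists (fun i => c *: b i + d i); rewrite rmorphD point_scale.
  rewrite {1}Eb {1}Ed scalerDr scalerA addrACA -scalerDl; congr (_ + _).
  by rewrite scaler_sumr -big_split; apply: eq_bigr => i _; rewrite mulrDl scalerAl.
- exists (fun l => x i * b l + (e u)%:A *+ (l == i)).
  rewrite rmorphM {1}Eb mulrDr mulr_sumr.
  under [in RHS]eq_bigr => l _ do rewrite mulrDl -mulrA.
  rewrite big_split /= [RHS]addrCA addrC; congr (_ + _).
  rewrite (bigD1 i) //= eqxx mulr1n big1 => [|l /negPf ->]; last by rewrite mul0r.
  rewrite addr0 !mulr_algl mulr_algr scalerBr scalerA [e u * _]mulrC.
  by rewrite addrC subrK.
Qed.

(** The maximal ideal is generated by the translated generators [t i]; these are split into
    eigenvectors, among which a basis modulo the square of the ideal is selected. *)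
Lemma exists_coordinates : finite_type A ->
  exists (n : nat) (u : 'I_n -> A) (chi : 'I_n -> gT -> K), coordinates u chi.
Proof.
move=> /finite_typeP [N [x gen]].
pose t i := x i - (e (x i))%:A.
have et i : e (t i) = 0 by rewrite /t rmorphB eA subrr.
pose hs := [seq h <- enum gT | `[< inertia h >]].
have hsP h : h \in hs -> inertia h by rewrite mem_filter => /andP [/asboolP].
have [s sP] := choice (fun i => eigen_decomposition hsP (et i)).
pose sl := flatten [seq s i | i : 'I_N].
have W0 := npow_zero e 2.
have WL c a b : npow e 2 a -> npow e 2 b -> npow e 2 (c *: a + b).
  by move=> Wa Wb; apply: NpowD => //; apply: npow_scale.
have [n [u [us ufree uspan]]] := independent_subfamily sl W0 WL.
have uP i : e (u i) = 0 /\ forall h, h \in hs -> exists l : K, rho h (u i) = l *: u i.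
  have /flattenP [_ /mapP [j _ ->] uj] := us i.
  by have [_ /(_ _ uj)] := sP j.
have ex i h : exists l : K, inertia h -> rho h (u i) = l *: u i.
  have [hH|nH] := pselect (inertia h); last by exists 0.
  have [|l El] := (uP i).2 h; last by exists l.
  by rewrite mem_filter mem_enum andbT; apply/asboolP.
have [chi chiP] := choice (fun p : 'I_n * gT => ex p.1 p.2).
exists n, u, (fun i h => chi (i, h)); split=> [i|y ey|//|h i]; last exact: (chiP (i, h)).
  by case: (uP i).
pose sp y := exists c : 'I_n -> K, npow e 2 (y - \sum_i c i *: u i).
have spL c a b : sp a -> sp b -> sp (c *: a + b).
  move=> [d Wd] [f Wf]; exists (fun i => c * d i + f i).
  have -> : c *: a + b - \sum_i (c * d i + f i) *: u i =
    c *: (a - \sum_i d i *: u i) + (b - \sum_i f i *: u i).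
    rewrite scalerBr addrACA -opprD scaler_sumr -big_split /=; congr (_ - _).
    by apply: eq_bigr => i _; rewrite scalerDl scalerA.
  exact: WL.
have sp2 y' : npow e 2 y' -> sp y'.
  by move=> W; exists (fun _ => 0); rewrite big1 ?subr0 // => i _; rewrite scale0r.
have spD a b : sp a -> sp b -> sp (a + b) by rewrite -{2}[a]scale1r; apply: spL.
have spt i : sp (t i).
  have [-> siP] := sP i.
  rewrite big_seq; elim/big_ind: _ => [||v vs]; [exact/sp2/W0|exact: spD|].
  by apply: uspan; apply/flattenP; exists (s i) => //; apply: map_f; rewrite mem_enum.
have [b Eb] := kernel_generators gen y.
rewrite Eb ey scale0r add0r; elim/big_ind: _ => [||i _]; [exact/sp2/W0|exact: spD|].
(* Coefficients may be replaced by their values at the point, up to the square of the maximal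
   ideal. *)
have -> : b i * t i = (e (b i)) *: t i + (b i - (e (b i))%:A) * t i.
  by rewrite mulrBl mulr_algl addrC subrK.
apply: spL => //; apply: sp2; apply: NpowM; first by rewrite rmorphB eA subrr.
exact/npow1.
Qed.

End Coordinates.

Section DegreeIdeal.
Variables (K : fieldType) (n : nat).
Implicit Types p q : {mpoly K[n]}.

Definition high_degree (M : nat) p : Prop :=
  forall m : 'X_{1..n}, (mdeg m < M)%N -> p@_m = 0.

Lemma high_degreeM L M p q :
  high_degree L p -> high_degree M q -> high_degree (L + M) (p * q).
Proof.
move=> Lp Mq m mLM; rewrite (mcoeffM p q m) big1 // => -[k1 k2] /eqP /= Em.
have [k1L|Lk1] := ltnP (mdeg k1) L; first by rewrite Lp ?mul0r.
rewrite [q@__]Mq ?mulr0 // -(ltn_add2l L) (leq_ltn_trans _ mLM) //.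
by apply: leq_trans (eq_leq (esym (congr1 (@mdeg n) Em))); rewrite mdegD leq_add2r.
Qed.

Lemma high_degree0 p : high_degree 0 p.
Proof. by []. Qed.

Lemma high_degree_le L M p : (L <= M)%N -> high_degree M p -> high_degree L p.
Proof. by move=> LM Mp m mL; apply: Mp; apply: leq_trans LM. Qed.

Lemma high_degree_ideal M : is_ideal (high_degree M).
Proof.
split=> [m _|p q Mp Mq m mM|p q Mq].
- by rewrite mcoeff0.
- by rewrite mcoeffD Mp ?Mq ?addr0.
- by rewrite -[M]add0n; apply: high_degreeM.
Qed.

Lemma high_degreeX M m : (M <= mdeg m)%N -> high_degree M 'X_[m].
Proof.
move=> Mm k kM; rewrite mcoeffX; case: eqP => // E; move: kM.
by rewrite -E ltnNge Mm.
Qed.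

Lemma high_degreeU i : high_degree 1 ('X_i : {mpoly K[n]}).
Proof. by apply: high_degreeX; rewrite mdeg1. Qed.

Lemma high_degreeZ M (c : K) p : high_degree M p -> high_degree M (c *: p).
Proof. by rewrite -mul_mpolyC; apply: (idealMl (high_degree_ideal M)). Qed.

Lemma high_degree1 p : high_degree 1 p <-> p@_0 = 0.
Proof.
split=> [|p0 m]; first by apply; rewrite mdeg0.
by rewrite ltnS leqn0 mdeg_eq0 => /eqP ->.
Qed.

End DegreeIdeal.

Section SpanApproximation.
Variables (K : fieldType) (A : comAlgType K) (e : {rmorphism A -> K}).
Hypothesis eA : forall c, e c%:A = c.
Variables (n : nat) (u : 'I_n -> A).
Hypotheses (u_eps : forall i, e (u i) = 0)
  (u_span : forall x, e x = 0 -> exists c : 'I_n -> K, npow e 2 (x - \sum_i c i *: u i)).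

(** Successive approximation: modulo the next power, an element of a power of the maximal ideal is a
    polynomial in [u]. Stated for spanning families, since [local_generation] applies it where only
    spanning has been shown. *)
Lemma npow_span_approx L a : exists p : {mpoly K[n]}, npow e L (a - ev u p).
Proof.
suff main : forall M y, npow e M y -> exists p : {mpoly K[n]}, npow e M.+1 (y - ev u p).
  elim: L => [|L [p Lp]]; first by exists 0; apply: Npow0.
  by have [q Lq] := main _ _ Lp; exists (p + q); rewrite rmorphD opprD addrA.
move=> M y; elim=> {M y} [y|M x y ex My [q Mq]|M x y _ [p Mp] _ [q Mq]].
- exists (e y)%:MP; apply/npow1; rewrite rmorphB /= [ev u _](mmapC _ _) /=.
  by rewrite eA subrr.
- have [c Wc] := u_span ex.
  exists (\sum_i (c i *: 'X_i) * q).
  have -> : ev u (\sum_i (c i *: 'X_i) * q) = (\sum_i c i *: u i) * ev u q.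
    rewrite rmorph_sum mulr_suml; apply: eq_bigr => i _.
    by rewrite rmorphM /= linearZ /= evX.
  have -> : x * y - (\sum_i c i *: u i) * ev u q =
      (x - \sum_i c i *: u i) * y + (\sum_i c i *: u i) * (y - ev u q) by ring.
  apply: NpowD; first by rewrite -add2n; apply: npow_mul.
  apply: NpowM => //; rewrite rmorph_sum big1 // => i _.
  by rewrite point_scale // u_eps mulr0.
- exists (p + q); rewrite rmorphD opprD addrACA; exact: NpowD.
Qed.

Lemma high_degree_npow L p : high_degree L p -> npow e L (ev u p).
Proof.
move=> Lp; rewrite [p]mpolyE linear_sum.
refine (@ideal_sum _ _ _ _ _ _ (npow_ideal e L) _) => m _.
rewrite linearZ /=; have [mL|Lm] := ltnP (mdeg m) L.
  by rewrite Lp // scale0r; apply: npow_zero.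
apply: npow_scale; apply: npow_le Lm _.
rewrite evXm mdegE; elim/big_rec2: _ => [|i a k _ IH]; first exact: Npow0.
by apply: npow_mul IH; apply: npow_expl; apply: u_eps.
Qed.

End SpanApproximation.

Section LocalExpansion.
Variables (K : fieldType) (char0 : [pchar K] =i pred0) (A : comAlgType K).
Variables (gT : finGroupType) (rho : gT -> {lrmorphism A -> A}).
Hypothesis smA : formally_smooth A.
Variables (e : {rmorphism A -> K}) (eA : forall c, e c%:A = c).
Variables (n : nat) (u : 'I_n -> A) (chi : 'I_n -> gT -> K).
Hypothesis uP : coordinates rho e u chi.

Lemma npow_approx L a : exists p : {mpoly K[n]}, npow e L (a - ev u p).
Proof. exact: (npow_span_approx eA (coords_eps uP) (coords_span uP)). Qed.

Fact coord_derivation_ex a :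
  exists c : 'I_n -> K, npow e 2 (a - (e a)%:A - \sum_i c i *: u i).
Proof. by apply: (coords_span uP); rewrite rmorphB eA subrr. Qed.

(** The tangent vectors dual to the coordinates; the choice is harmless because [u] is free in the
    cotangent space. *)
Definition coord_derivation (i : 'I_n) (a : A) : K :=
  projT1 (cid (coord_derivation_ex a)) i.

Lemma coord_derivationP a :
  npow e 2 (a - (e a)%:A - \sum_i coord_derivation i a *: u i).
Proof. exact: (projT2 (cid (coord_derivation_ex a))). Qed.

Lemma coord_derivation_uniq a (c : 'I_n -> K) :
  npow e 2 (a - (e a)%:A - \sum_i c i *: u i) -> forall i, coord_derivation i a = c i.
Proof.
move=> Wc i; apply/eqP; rewrite eq_sym -subr_eq0; apply/eqP.
refine (@coords_free _ _ _ _ _ _ _ _ uP (fun i => c i - coord_derivation i a) _ i).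
have -> : \sum_j (c j - coord_derivation j a) *: u j =
    (a - (e a)%:A - \sum_j coord_derivation j a *: u j) -
    (a - (e a)%:A - \sum_j c j *: u j).
  transitivity (\sum_j c j *: u j - \sum_j coord_derivation j a *: u j); last by ring.
  by rewrite -sumrB; apply: eq_bigr => j _; rewrite scalerBl.
by apply: (idealB (npow_ideal e 2)) => //; apply: coord_derivationP.
Qed.

Lemma coord_derivation_linear i c a b :
  coord_derivation i (c *: a + b) = c * coord_derivation i a + coord_derivation i b.
Proof.
apply: (coord_derivation_uniq (c := fun i => c * coord_derivation i a + coord_derivation i b)).
have -> : c *: a + b - (e (c *: a + b))%:A
    - \sum_j (c * coord_derivation j a + coord_derivation j b) *: u j =
  c *: (a - (e a)%:A - \sum_j coord_derivation j a *: u j)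
  + (b - (e b)%:A - \sum_j coord_derivation j b *: u j).
  rewrite rmorphD point_scale // scalerDl -scalerA !scalerBr scaler_sumr.
  rewrite [\sum_j (_ + _) *: _](_ : _ = \sum_j c *: (coord_derivation j a *: u j)
     + \sum_j coord_derivation j b *: u j).
    by rewrite !opprD; ring.
  by rewrite -big_split; apply: eq_bigr => j _; rewrite scalerDl scalerA.
by apply: NpowD; [apply: npow_scale|]; apply: coord_derivationP.
Qed.

Lemma coord_derivationM i a b : coord_derivation i (a * b) =
  e a * coord_derivation i b + e b * coord_derivation i a.
Proof.
apply: (coord_derivation_uniq
  (c := fun i => e a * coord_derivation i b + e b * coord_derivation i a)).
set Ea := a - (e a)%:A; set Eb := b - (e b)%:A.
have -> : a * b - (e (a * b))%:A
    - \sum_j (e a * coord_derivation j b + e b * coord_derivation j a) *: u j =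
  e b *: (Ea - \sum_j coord_derivation j a *: u j)
  + (e a *: (Eb - \sum_j coord_derivation j b *: u j) + Ea * Eb).
  rewrite [\sum_j (_ + _) *: _](_ : _ = e a *: (\sum_j coord_derivation j b *: u j)
     + e b *: (\sum_j coord_derivation j a *: u j)).
    rewrite !scalerBr /Ea /Eb rmorphM mulrBl !mulrBr !mulr_algl !mulr_algr ?scalerBr.
    by rewrite !scalerA [e b * e a]mulrC; ring.
  rewrite !scaler_sumr -big_split; apply: eq_bigr => j _.
  by rewrite scalerDl !scalerA.
apply: NpowD; first by apply: npow_scale; apply: coord_derivationP.
apply: NpowD; first by apply: npow_scale; apply: coord_derivationP.
have eE x : e (x - (e x)%:A) = 0 by rewrite rmorphB eA subrr.
by apply: NpowM; [apply: eE | apply/npow1; apply: eE].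
Qed.

Lemma coord_derivation_coord i j : coord_derivation i (u j) = (i == j)%:R.
Proof.
apply: (coord_derivation_uniq (c := fun i => (i == j)%:R)).
rewrite (coords_eps uP) scale0r subr0 (bigD1 j) //= eqxx scale1r big1 => [|l /negPf ->].
  by rewrite addr0 subrr; apply: npow_zero.
by rewrite scale0r.
Qed.

(* Each step lifts modulo the next power of the maximal ideal by smoothness;  *)
(* subtracting derivations restores [f (u i) = 'X_i].                         *)
Lemma jet_expansion M : exists f : A -> {mpoly K[n]},
  [/\ hom_mod (high_degree M.+2) f, forall i, high_degree M.+2 (f (u i) - 'X_i)
    & forall a, (f a)@_0 = e a].
Proof.
elim: M => [|M [f [fP fu f0]]].
  (* Modulo degree 2 the expansion is the value at the point plus the linear part read off in the
     cotangent space. *)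
  pose D a : {mpoly K[n]} := \sum_i coord_derivation i a *: 'X_i.
  have D1 a : high_degree 1 (D a).
    rewrite /D; refine (@ideal_sum _ _ _ _ _ _ (high_degree_ideal K n 1) _) => i _.
    by apply: high_degreeZ; apply: high_degreeU.
  have DL c a b : D (c *: a + b) = c *: D a + D b.
    rewrite scaler_sumr -big_split; apply: eq_bigr => i _.
    by rewrite coord_derivation_linear scalerDl scalerA.
  have DM a b : D (a * b) = e a *: D b + e b *: D a.
    rewrite !scaler_sumr -big_split; apply: eq_bigr => i _.
    by rewrite coord_derivationM scalerDl !scalerA.
  exists (fun a => (e a)%:MP + D a); split.
  - split=> [|c a b|a b].
    + have -> : D 1 = 0.
        have := DM 1 1; rewrite mulr1 rmorph1 !scale1r => E.
        by apply: (addrI (D 1)); rewrite -E addr0.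
      rewrite rmorph1 addr0 mpolyC1 subrr; exact: (ideal0 (high_degree_ideal K n _)).
    + rewrite DL rmorphD point_scale // mpolyCD mpolyCM mul_mpolyC.
      rewrite (_ : _ - _ = 0); first exact: (ideal0 (high_degree_ideal K n _)).
      by rewrite scalerDr; ring.
    + rewrite DM rmorphM mpolyCM -!mul_mpolyC.
      rewrite (_ : _ - _ = - (D a * D b)); last by ring.
      apply: (idealN (high_degree_ideal K n _)).
      exact: (@high_degreeM _ _ 1 1).
  - move=> i; rewrite (coords_eps uP) mpolyC0 add0r /D (bigD1 i) //=.
    rewrite coord_derivation_coord eqxx scale1r big1 => [|j ji].
      by rewrite addr0 subrr; apply: (ideal0 (high_degree_ideal K n _)).
    by rewrite coord_derivation_coord (negPf ji) scale0r.
  - move=> a; rewrite mcoeffD mcoeffC eqxx mulr1 (high_degree1 _).1 ?addr0 //.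
have idJ := high_degree_ideal K n.
have J1 : ~ high_degree M.+2 (1 : {mpoly K[n]}).
  by move/(_ 0%MM); rewrite mdeg0 mcoeff1 eqxx => /(_ isT)/eqP; rewrite oner_eq0.
have [Q [p [p_onto pP]]] := quotient_algebra (idJ M.+2) J1.
have p0 x : p x = 0 <-> high_degree M.+2 x by rewrite -(rmorph0 p) pP subr0.
have [g gE] := hom_mod_lrmorphism fP (fun x => (p0 x).2).
have [|||s [sE sP]] := lift_mod smA (q := p) (J := high_degree M.+3) g p_onto.
- exact: idJ.
- by move=> x Jx; apply/p0; apply: high_degree_le Jx.
- move=> x y /p0 Jx /p0 Jy; apply: (@high_degree_le _ _ _ (M.+2 + M.+2)).
    by rewrite addSn ltnS leq_addl.
  exact: high_degreeM.
have sf a : high_degree M.+2 (s a - f a) by apply/pP; rewrite sE gE.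
have s0 a : (s a)@_0 = e a.
  by rewrite -f0; apply/eqP; rewrite -subr_eq0 -mcoeffB (sf a) ?mdeg0.
pose q i := s (u i) - 'X_i.
have Jq i : high_degree M.+2 (q i).
  rewrite /q -(subrK (f (u i)) (s (u i))) -addrA.
  by apply: (idealD (idJ _)); [exact: sf|exact: fu].
(* As [q i] has no terms below degree [M.+2], modulo degree [M.+3] its multiples depend only on the
   value of the factor at the point. Hence [D] is a derivation along [s], and [s - D] stays
   multiplicative. *)
pose D a : {mpoly K[n]} := \sum_i coord_derivation i a *: q i.
have JD a : high_degree M.+2 (D a).
  by refine (@ideal_sum _ _ _ _ _ _ (idJ _) _) => i _; apply: high_degreeZ.
have DL c a b : D (c *: a + b) = c *: D a + D b.
  rewrite scaler_sumr -big_split; apply: eq_bigr => i _.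
  by rewrite coord_derivation_linear scalerDl scalerA.
have DM a b : D (a * b) = e a *: D b + e b *: D a.
  rewrite !scaler_sumr -big_split; apply: eq_bigr => i _.
  by rewrite coord_derivationM scalerDl !scalerA.
have Js a : high_degree 1 (s a - (e a)%:MP).
  by apply/high_degree1; rewrite mcoeffB s0 mcoeffC eqxx mulr1 subrr.
exists (fun a => s a - D a); split.
- split=> [|c a b|a b].
  + have -> : D 1 = 0.
      have := DM 1 1; rewrite mulr1 rmorph1 !scale1r => E.
      by apply: (addrI (D 1)); rewrite -E addr0.
    by rewrite subr0; apply: (hom_mod1 sP).
  + rewrite DL (_ : _ - _ = s (c *: a + b) - (c *: s a + s b)).
      exact: (hom_modL sP).
    by rewrite scalerBr; ring.
  + rewrite DM -!mul_mpolyC.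
    rewrite (_ : _ - _ = (s (a * b) - s a * s b) + ((s a - (e a)%:MP) * D b
       + ((s b - (e b)%:MP) * D a - D a * D b))); last by ring.
    apply: (idealD (idJ _)); first exact: (hom_modM sP).
    apply: (idealD (idJ _)); first exact: (@high_degreeM _ _ 1 M.+2).
    apply: (idealB (idJ _)); first exact: (@high_degreeM _ _ 1 M.+2).
    apply: (@high_degree_le _ _ _ (M.+2 + M.+2)); first by rewrite addSn ltnS leq_addl.
    exact: high_degreeM.
- move=> i; rewrite /D (bigD1 i) //= coord_derivation_coord eqxx scale1r big1 => [|j ji].
    by rewrite addr0 /q opprB addrCA subrr addr0 subrr; apply: (ideal0 (idJ _)).
  by rewrite coord_derivation_coord (negPf ji) scale0r.
- by move=> a; rewrite mcoeffB s0 (JD a) ?mdeg0 // subr0.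
Qed.

End LocalExpansion.

Section LocalAction.
Variables (K : fieldType) (char0 : [pchar K] =i pred0) (A : comAlgType K).
Variables (gT : finGroupType) (rho : gT -> {lrmorphism A -> A}).
Hypotheses (abelG : abelian [set: gT]) (act : is_algebra_action rho).
Variables (e : {rmorphism A -> K}) (eA : forall c, e c%:A = c).

Definition invariant_elt (a : A) : Prop := forall g, rho g a = a.
Definition inertia_invariant (a : A) : Prop := forall h, inertia rho e h -> rho h a = a.

Definition reynolds (a : A) : A := #|gT|%:R^-1 *: \sum_g rho g a.

Lemma card_neq0 : #|gT|%:R != 0 :> K.
Proof. by move/pcharf0P: char0 => ->; rewrite -lt0n; apply/card_gt0P; exists 1%g. Qed.

Lemma sum_act_invariant a : invariant_elt (\sum_g rho g a).
Proof.
move=> h; rewrite linear_sum /= [RHS](reindex_inj (mulIg h)) /=.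
by apply: eq_bigr => g _; rewrite (act_mul act).
Qed.

Lemma invariant_eltL c a b : invariant_elt a -> invariant_elt b -> invariant_elt (c *: a + b).
Proof. by move=> ia ib g; rewrite linearP /= ia ib. Qed.
Lemma invariant_eltM a b : invariant_elt a -> invariant_elt b -> invariant_elt (a * b).
Proof. by move=> ia ib g; rewrite rmorphM /= ia ib. Qed.
Lemma invariant_elt1 : invariant_elt 1.
Proof. by move=> g; rewrite rmorph1. Qed.
Lemma invariant_elt0 : invariant_elt 0.
Proof. by move=> g; rewrite rmorph0. Qed.
Lemma invariant_eltD a b : invariant_elt a -> invariant_elt b -> invariant_elt (a + b).
Proof. by move=> ia ib g; rewrite rmorphD /= ia ib. Qed.
Lemma invariant_eltZ c a : invariant_elt a -> invariant_elt (c *: a).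
Proof. by move=> ia g; rewrite linearZ /= ia. Qed.
Lemma invariant_elt_alg c : invariant_elt c%:A.
Proof. exact/invariant_eltZ/invariant_elt1. Qed.

Lemma reynolds_invariant a : invariant_elt (reynolds a).
Proof. exact/invariant_eltZ/sum_act_invariant. Qed.

Lemma reynolds_id a : invariant_elt a -> reynolds a = a.
Proof.
move=> ia; rewrite /reynolds; under eq_bigr do rewrite ia.
by rewrite sumr_const -scaler_nat scalerA mulVf ?scale1r ?card_neq0.
Qed.

Lemma reynoldsMl b a : invariant_elt b -> reynolds (b * a) = b * reynolds a.
Proof.
move=> ib; rewrite /reynolds -scalerAr mulr_sumr; congr (_ *: _).
by apply: eq_bigr => g _; rewrite rmorphM /= ib.
Qed.

Lemma reynolds_act g a : reynolds (rho g a) = reynolds a.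
Proof.
rewrite /reynolds [in RHS](reindex_inj (mulgI g)) /=; congr (_ *: _).
by apply: eq_bigr => h _; rewrite (act_mul act).
Qed.

Lemma reynoldsP c a b : reynolds (c *: a + b) = c *: reynolds a + reynolds b.
Proof.
rewrite /reynolds scalerA mulrC -scalerA -scalerDr; congr (_ *: _).
by rewrite scaler_sumr -big_split; apply: eq_bigr => g _; rewrite linearP.
Qed.

Definition inertia_set : {set gT} := [set g | `[< inertia rho e g >]].

Lemma inertia_setP g : reflect (inertia rho e g) (g \in inertia_set).
Proof. by rewrite inE; apply: asboolP. Qed.

Lemma inertia1 : inertia rho e 1%g.
Proof. by move=> a; rewrite (act_one act). Qed.

Lemma inertia_mul g h : inertia rho e h -> inertia rho e (g * h)%g <-> inertia rho e g.
Proof.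
by move=> hH; split=> gH a; have := gH a; rewrite (act_mul act) hH.
Qed.

Lemma inertia_card_neq0 : #|inertia_set|%:R != 0 :> K.
Proof.
move/pcharf0P: char0 => ->; rewrite -lt0n; apply/card_gt0P; exists 1%g.
exact/inertia_setP/inertia1.
Qed.

(** For each [g] outside inertia some function takes the value 1 at the point and 0 at its
    translate; the product of these is made invariant by multiplying its inertia translates. *)
Lemma separating_element : exists a0 : A, [/\ inertia_invariant a0, e a0 = 1 &
  forall g, ~ inertia rho e g -> e (rho g a0) = 0].
Proof.
have sep g : exists y : A, e y = 1 /\ (~ inertia rho e g -> e (rho g y) = 0).
  have [gH|] := pselect (inertia rho e g); first by exists 1; rewrite rmorph1.
  move=> /existsNP [x /eqP nx]; have nx' : e x - e (rho g x) != 0 by rewrite subr_eq0 eq_sym.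
  exists ((e x - e (rho g x))^-1 *: (x - (e (rho g x))%:A)); split=> [|_].
    by rewrite (point_scale eA) rmorphB eA mulVf.
  rewrite linearZ (point_scale eA) linearB /= linearZ rmorph1 rmorphB eA subrr.
  by rewrite mulr0.
have [y yP] := choice sep.
pose b := \prod_(g | g \notin inertia_set) y g.
have eb : e b = 1 by rewrite rmorph_prod big1 // => g _; case: (yP g).
have gb g : ~ inertia rho e g -> e (rho g b) = 0.
  move=> ngH; rewrite !rmorph_prod (bigD1 g) /=; last by apply/inertia_setP.
  by rewrite (yP g).2 // mul0r.
exists (\prod_(h in inertia_set) rho h b); split=> [h hH||g ngH].
- rewrite rmorph_prod [RHS](reindex_inj (mulIg h)) /=.
  apply: eq_big => [g|g _]; last by rewrite (act_mul act).
  by apply/inertia_setP/inertia_setP => /(inertia_mul g hH).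
- by rewrite rmorph_prod big1 // => h /inertia_setP ->.
- rewrite !rmorph_prod (bigD1 1%g) /=; last exact/inertia_setP/inertia1.
  by rewrite (act_one act) gb // mul0r.
Qed.

(** With [a] separating the point from its translates, take 1 - (1 - a^L)^L. At the point 1 - a^L
    vanishes, so the subtracted power has order L; after a translation outside inertia, a^L has
    order L and divides the whole expression. *)
Lemma cutoff L : exists c : A, [/\ inertia_invariant c, npow e L (c - 1) &
  forall g, ~ inertia rho e g -> npow e L (rho g c)].
Proof.
have [a [ia ea ga]] := separating_element.
exists (1 - (1 - a ^+ L) ^+ L); split=> [h hH||g ngH].
- by rewrite !(rmorphB, rmorphXn, rmorph1) /= ia.
- rewrite addrAC subrr sub0r; apply: (idealN (npow_ideal e L)).
  by apply: npow_expl; rewrite rmorphB rmorph1 rmorphXn /= ea expr1n subrr.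
- rewrite !(rmorphB, rmorphXn, rmorph1) /=.
  have -> : 1 - (1 - rho g a ^+ L) ^+ L =
      rho g a ^+ L * \sum_(i < L) (1 - rho g a ^+ L) ^+ i.
    have := subrX1 (1 - rho g a ^+ L) L => /(congr1 -%R).
    by rewrite opprB => ->; rewrite addrAC subrr sub0r mulNr opprK.
  by apply: (ideal_mulr _ (npow_ideal e L)); apply: npow_expl; apply: ga.
Qed.

(** Average the product of [f] with a cutoff: up to order [L] only the inertia elements contribute,
    each of them [f] itself. *)
Lemma invariant_approximation L f : inertia_invariant f ->
  exists b, invariant_elt b /\ npow e L (b - f).
Proof.
move=> jf; have [c [ic c1 gc]] := cutoff L.
pose N : K := #|inertia_set|%:R.
exists (N^-1 *: \sum_g rho g (c * f)); split; first exact/invariant_eltZ/sum_act_invariant.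
rewrite (bigID (mem inertia_set)) /=.
have -> : \sum_(g in inertia_set) rho g (c * f) = N *: (c * f).
  under eq_bigr => h /inertia_setP hH do rewrite rmorphM /= ic // jf //.
  by rewrite sumr_const scaler_nat.
rewrite scalerDr scalerA mulVf ?inertia_card_neq0 // scale1r addrAC.
apply: NpowD; last first.
  apply: npow_scale; refine (@ideal_sum _ _ _ _ _ _ (npow_ideal e L) _) => g /negP ngH.
  rewrite rmorphM; apply: (ideal_mulr _ (npow_ideal e L)); apply: gc => gH.
  exact/ngH/inertia_setP.
by rewrite -{2}[f]mul1r -mulrBl; apply: (ideal_mulr _ (npow_ideal e L)).
Qed.

End LocalAction.

Section Weights.
Variables (K : fieldType) (char0 : [pchar K] =i pred0) (A : comAlgType K).
Variables (gT : finGroupType) (rho : gT -> {lrmorphism A -> A}).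
Hypotheses (act : is_algebra_action rho).
Variables (e : {rmorphism A -> K}) (eA : forall c, e c%:A = c).
Variables (n : nat) (u : 'I_n -> A) (chi : 'I_n -> gT -> K).
Hypothesis uP : coordinates rho e u chi.

Definition weight (m : 'X_{1..n}) (h : gT) : K := \prod_i chi i h ^+ m i.

(** The monoid of exponents of the inertia-invariant monomials. It is the trace on the exponents of
    a subgroup of Z^n, hence closed under differences that are again exponents. *)
Definition trivial_weight (m : 'X_{1..n}) : Prop :=
  forall h, inertia rho e h -> weight m h = 1.

Lemma weightD m1 m2 h : weight (m1 + m2)%MM h = weight m1 h * weight m2 h.
Proof. by rewrite -big_split; apply: eq_bigr => i _; rewrite mnmDE exprD. Qed.

Lemma act_monomial m h : inertia rho e h ->
  rho h (ev u 'X_[m]) = weight m h *: ev u 'X_[m].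
Proof.
move=> hH; rewrite evXm rmorph_prod -scaler_prod; apply: eq_bigr => i _.
by rewrite rmorphXn /= (coords_act uP) // exprZn.
Qed.

Lemma coord_neq0 i : u i != 0.
Proof.
apply/eqP => ui0; have := @coords_free _ _ _ _ _ _ _ _ uP (fun j => (j == i)%:R).
move=> free; have : (i == i)%:R = 0 :> K.
  apply: free; rewrite big1 => [|j _]; first exact: npow_zero.
  by case: eqP => [->|_]; rewrite ?ui0 ?scaler0 ?scale0r.
by rewrite eqxx => /eqP; rewrite oner_eq0.
Qed.

Lemma chi_exp i h : inertia rho e h -> chi i h ^+ #|gT| = 1.
Proof.
move=> hH; have ge k : rho (h ^+ k)%g (u i) = chi i h ^+ k *: u i.
  elim: k => [|k IH]; first by rewrite expg0 expr0 (act_one act) scale1r.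
  by rewrite expgSr (act_mul act) IH linearZ /= (coords_act uP) // scalerA exprSr.
have := ge #|gT|; rewrite -cardsT expg_cardG ?inE // (act_one act) cardsT => /eqP.
rewrite -{1}[u i]scale1r -subr_eq0 -scalerBl scaler_eq0 (negPf (coord_neq0 i)) orbF.
by rewrite subr_eq0 => /eqP.
Qed.

Lemma trivial_weight0 : trivial_weight 0%MM.
Proof. by move=> h _; rewrite /weight big1 // => i _; rewrite mnm0E. Qed.

Lemma trivial_weightD m1 m2 :
  trivial_weight m1 -> trivial_weight m2 -> trivial_weight (m1 + m2)%MM.
Proof. by move=> t1 t2 h hH; rewrite weightD t1 // t2 // mulr1. Qed.

Lemma trivial_weightB m1 m2 :
  trivial_weight m1 -> trivial_weight (m1 + m2)%MM -> trivial_weight m2.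
Proof. by move=> t1 t12 h hH; have := t12 h hH; rewrite weightD t1 // mul1r. Qed.

Lemma weightU i k h : weight (U_(i) *+ k)%MM h = chi i h ^+ k.
Proof.
rewrite /weight (bigD1 i) //= big1 => [|j ji]; last first.
  by rewrite mulmnE mnm1E eq_sym (negPf ji) mul0n.
by rewrite mulmnE mnm1E eqxx mul1n mulr1.
Qed.

Lemma trivial_weightU i : trivial_weight (U_(i) *+ #|gT|)%MM.
Proof. by move=> h hH; rewrite weightU chi_exp. Qed.

Lemma trivial_weight_monomial m : trivial_weight m ->
  inertia_invariant rho e (ev u 'X_[m]).
Proof. by move=> tm h hH; rewrite act_monomial // tm // scale1r. Qed.

Definition twist (h : gT) (q : {mpoly K[n]}) : {mpoly K[n]} :=
  ev (fun i => chi i h *: 'X_i) q.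

Lemma act_ev h q : inertia rho e h -> rho h (ev u q) = ev u (twist h q).
Proof.
move=> hH; elim/mpoly_gen_ind: q => [|c q r Eq Er|i q Eq].
- by rewrite /twist !rmorph1.
- by rewrite /twist !linearP /= Eq Er.
- by rewrite /twist !rmorphM /= !evX linearZ /= evX (coords_act uP) // Eq.
Qed.

Lemma twist_coef h q m : (twist h q)@_m = weight m h * q@_m.
Proof.
elim/mpolyind: q => [|c k q _ _ Eq]; first by rewrite /twist rmorph0 mcoeff0 mulr0.
rewrite /twist linearP /= !mcoeffD !mcoeffZ Eq mulrDr; congr (_ + _).
rewrite mulrCA; congr (_ * _).
have -> : ev (fun i => chi i h *: 'X_i) 'X_[k] = weight k h *: 'X_[k] :> {mpoly K[n]}.
  by rewrite evXm mpolyXE_id /weight -scaler_prod; apply: eq_bigr => i _; rewrite exprZn.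
rewrite mcoeffZ mcoeffX; case: eqP => [->//|_]; by rewrite !mulr0.
Qed.

End Weights.

(* [f] expands A in the coordinates [u], with values in K[x]/(x)^M, which is    *)
(* the quotient [Q] of the polynomial ring by [p].                             *)
Record expansion (K : fieldType) (A : comAlgType K) (e : {rmorphism A -> K}) (n : nat)
    (u : 'I_n -> A) (M : nat) (Q : comAlgType K) (p : {lrmorphism {mpoly K[n]} -> Q})
    (f : {lrmorphism A -> Q}) : Prop := Expansion {
  exp_onto : forall w, exists x, p x = w;
  exp_ker : forall x y, p x = p y <-> high_degree M (x - y);
  exp_coord : forall i, f (u i) = p 'X_i;
  exp_npow : forall L a, npow e L a -> exists2 q, f a = p q & high_degree L q }.

Lemma exists_expansion (K : fieldType) (A : comAlgType K)
    (gT : finGroupType) (rho : gT -> {lrmorphism A -> A}) (smA : formally_smooth A)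
    (e : {rmorphism A -> K}) (eA : forall c, e c%:A = c)
    (n : nat) (u : 'I_n -> A) (chi : 'I_n -> gT -> K) (uP : coordinates rho e u chi) M :
  exists (Q : comAlgType K) (p : {lrmorphism {mpoly K[n]} -> Q}) (f : {lrmorphism A -> Q}),
    expansion e u M.+2 p f.
Proof.
have [f [fP fu f0]] := jet_expansion smA eA uP M.
have idJ := high_degree_ideal K n.
have J1 : ~ high_degree M.+2 (1 : {mpoly K[n]}).
  by move/(_ 0%MM); rewrite mdeg0 mcoeff1 eqxx => /(_ isT)/eqP; rewrite oner_eq0.
have [Q [p [p_onto pP]]] := quotient_algebra (idJ M.+2) J1.
have [|g gE] := hom_mod_lrmorphism fP (p := p).
  by move=> x Jx; rewrite -(rmorph0 p); apply/pP; rewrite subr0.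
exists Q, p, g; split=> // [i|L a].
  by rewrite gE; apply/pP/fu.
elim=> {L a} [a|L x y ex _ [q Eq Lq]|L x y _ [q Eq Lq] _ [r Er Lr]].
- by exists (f a); rewrite ?gE.
- exists (f x * q); first by rewrite !rmorphM /= Eq gE.
  rewrite -add1n; apply: high_degreeM => //.
  by apply/high_degree1; rewrite f0.
- exists (q + r); first by rewrite !rmorphD /= Eq Er.
  exact: (idealD (idJ L)).
Qed.

Section ExpansionTheory.
Variables (K : fieldType) (A : comAlgType K).
Variables (gT : finGroupType) (rho : gT -> {lrmorphism A -> A}).
Variables (e : {rmorphism A -> K}) (eA : forall c, e c%:A = c).
Variables (n : nat) (u : 'I_n -> A) (chi : 'I_n -> gT -> K).
Hypothesis uP : coordinates rho e u chi.
Variables (M : nat) (Q : comAlgType K) (p : {lrmorphism {mpoly K[n]} -> Q}).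
Variables (f : {lrmorphism A -> Q}) (fP : expansion e u M p f).

Lemma exp_ev q : f (ev u q) = p q.
Proof.
elim/mpoly_gen_ind: q => [|c q r Eq Er|i q Eq].
- by rewrite !rmorph1.
- by rewrite !linearP /= Eq Er.
- by rewrite !rmorphM /= evX (exp_coord fP) Eq.
Qed.

(** Read on an arbitrary representative, so meaningful in degrees below [M]. *)
Definition exp_coef (m : 'X_{1..n}) (w : Q) : K := (projT1 (cid (exp_onto fP w)))@_m.

Lemma exp_coefE m x : (mdeg m < M)%N -> exp_coef m (p x) = x@_m.
Proof.
move=> mM; rewrite /exp_coef; case: cid => y /= /(exp_ker fP) /(_ m mM).
by rewrite mcoeffB => /eqP; rewrite subr_eq0 => /eqP.
Qed.

Lemma exp_coefL m c x y : (mdeg m < M)%N ->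
  exp_coef m (c *: x + y) = c * exp_coef m x + exp_coef m y.
Proof.
move=> mM; have [[x' <-] [y' <-]] := (exp_onto fP x, exp_onto fP y).
by rewrite -linearP !exp_coefE // mcoeffD mcoeffZ.
Qed.

Lemma exp_npow0 a : npow e M a -> f a = 0.
Proof.
move=> /(exp_npow fP) [q -> Jq]; rewrite -(rmorph0 p); apply/(exp_ker fP).
by rewrite subr0.
Qed.

Lemma exp_npow_coef L a m : npow e L a -> (mdeg m < L)%N -> (mdeg m < M)%N ->
  exp_coef m (f a) = 0.
Proof. by move=> /(exp_npow fP) [q -> Jq] mL mM; rewrite exp_coefE // Jq. Qed.

Lemma exp_approx a : exists2 q, npow e M (a - ev u q) & f a = p q.
Proof.
have [q Mq] := npow_approx eA uP M a; exists q => //.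
by have /eqP := exp_npow0 Mq; rewrite rmorphB /= exp_ev subr_eq0 => /eqP.
Qed.

(** No equivariance of [f] is available a priori; instead [a] is approximated by a polynomial in the
    eigenvectors [u], and invariance forces this polynomial to agree with its twist in all visible
    degrees. *)
Lemma exp_support a m : inertia_invariant rho e a -> (mdeg m < M)%N ->
  exp_coef m (f a) != 0 -> trivial_weight rho e chi m.
Proof.
move=> ia mM am h hH; have [q Mq Eq] := exp_approx a.
have : p q = p (twist chi h q).
  rewrite -[RHS]exp_ev -(act_ev uP) // -Eq.
  have := inertia_npow hH Mq; rewrite rmorphB /= ia // => /exp_npow0 /eqP.
  by rewrite rmorphB /= subr_eq0 => /eqP.
move=> /(exp_ker fP) /(_ m mM); rewrite mcoeffB twist_coef.
rewrite -{1}[q@_m]mul1r -mulrBl => /eqP; rewrite mulf_eq0.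
rewrite -(exp_coefE q mM) -Eq (negPf am) orbF subr_eq0 => /eqP; exact: esym.
Qed.

End ExpansionTheory.

(** * Monoids of exponents *)

Lemma mulm_mul (n : nat) (m : 'X_{1..n}) a b : (m *+ (a * b) = m *+ a *+ b)%MM.
Proof. by apply/mnmP => i; rewrite !mulmnE mulnA. Qed.

Section MonomialMonoid.
Variables (n : nat) (S : 'X_{1..n} -> Prop).
Hypotheses (S0 : S 0%MM) (SD : forall a b, S a -> S b -> S (a + b)%MM).
Hypothesis SB : forall a b, S a -> S (a + b)%MM -> S b.
Variable N : nat.
Hypotheses (N0 : (0 < N)%N) (SU : forall i, S (U_(i) *+ N)%MM).

Lemma monoid_sub a m : S a -> S m -> (a <= m)%MM -> S (m - a)%MM.
Proof. by move=> Sa Sm am; apply: (SB Sa); rewrite addmC submK. Qed.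

Lemma monoid_mulm a d : S a -> S (a *+ d)%MM.
Proof.
move=> Sa; elim: d => [|d IH]; first by rewrite mulm0n.
by rewrite mulmS; apply: SD.
Qed.

Lemma monoid_sum (I : Type) (r : seq I) (P : pred I) (F : I -> 'X_{1..n}) :
  (forall i, P i -> S (F i)) -> S (\big[+%MM/0%MM]_(i <- r | P i) F i)%MM.
Proof. by move=> SF; elim/big_ind: _. Qed.

Definition irreducible_monomial (m : 'X_{1..n}) : Prop :=
  m <> 0%MM /\ forall a b, S a -> S b -> m = (a + b)%MM -> a = 0%MM \/ b = 0%MM.

(* For the monoids at hand: [S] is generated by multiples of the basis vectors. *)
Definition axes_monoid : Prop := forall m i, S m -> S (U_(i) *+ m i)%MM.

Section Face.
Variables (k : nat) (t : 'I_k -> 'I_n) (inj_t : injective t).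

Definition axis_sum (P : pred 'I_k) (c : 'I_k -> nat) : 'X_{1..n} :=
  (\big[+%MM/0%MM]_(q | P q) (U_(t q) *+ c q))%MM.

Lemma axis_sumE P c i : axis_sum P c (t i) = if P i then c i else 0%N.
Proof.
rewrite mnm_sumE big_mkcond (bigD1 i) //= big1 ?addn0 => [|q qi].
  by rewrite mulmnE mnm1E eqxx mul1n.
by rewrite mulmnE mnm1E (inj_eq inj_t) (negPf qi) mul0n; case: ifP.
Qed.

Lemma axis_sum_out P c i : i \notin codom t -> axis_sum P c i = 0%N.
Proof.
move=> it; rewrite mnm_sumE big1 // => q _; rewrite mulmnE mnm1E.
by case: eqP => // E; rewrite -E codom_f in it.
Qed.

Lemma axis_sum_monoid P : S (axis_sum P (fun _ => N)).
Proof. by apply: monoid_sum. Qed.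

(** The points of [S] in the relative interior of the face spanned by the axes [t p]. *)
Definition face_interior (m : 'X_{1..n}) : Prop :=
  [/\ S m, forall i, i \notin codom t -> m i = 0%N & forall p, (0 < m (t p))%N].

(** The coordinates are minimised one after the other, starting from the interior point with all
    entries [N]. *)
Lemma lex_minimal : exists2 m, face_interior m &
  forall (j : 'I_k) m', face_interior m' -> (forall i : 'I_k, (i < j)%N -> m' (t i) = m (t i)) ->
    (m (t j) <= m' (t j))%N.
Proof.
suff /(_ k (leqnn k)) [m Tm minm] : forall d, (d <= k)%N -> exists2 m, face_interior m &
    forall (j : 'I_k) m', (j < d)%N -> face_interior m' ->
    (forall i : 'I_k, (i < j)%N -> m' (t i) = m (t i)) -> (m (t j) <= m' (t j))%N.
  by exists m => // j m'; apply: minm.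
elim=> [_|d IHd dk].
  exists (axis_sum predT (fun _ => N)) => //; split=> [|i|p]; first exact: axis_sum_monoid.
    exact: axis_sum_out.
  by rewrite axis_sumE.
have [m Tm minm] := IHd (ltnW dk).
pose jd := Ordinal dk.
pose P (v : nat) := `[< exists2 m', face_interior m' &
  (forall i : 'I_k, (i < d)%N -> m' (t i) = m (t i)) /\ m' (t jd) = v >].
have exP : exists v, P v by exists (m (t jd)); apply/asboolP; exists m.
case: (ex_minnP exP) => v /asboolP [m1 Tm1 [E1 Ev]] minv.
exists m1 => // j m'; rewrite ltnS leq_eqVlt => /orP [/eqP Ej|jd'] Tm' Em'.
  have -> : j = jd by apply/val_inj.
  rewrite Ev; apply: minv; apply/asboolP; exists m' => //; split=> // i id.
  by rewrite Em' ?Ej // E1.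
rewrite E1 //; apply: minm => // i ij; rewrite Em' // E1 //.
exact: ltn_trans jd'.
Qed.

Hypothesis decomposition : forall m, S m -> (forall p, (0 < m (t p))%N) ->
  exists s : 'I_k -> 'X_{1..n}, [/\ forall p, S (s p), forall p, (0 < s p (t p))%N &
    forall i, (\sum_p s p i <= m i)%N].

(* In a decomposition of a lexicographically minimal interior point each      *)
(* summand must lie on its own axis.                                          *)
Lemma lex_minimal_axes : exists2 m, face_interior m &
  (forall j, S (U_(t j) *+ m (t j))%MM) /\
  forall (j : 'I_k) m', face_interior m' -> (forall i : 'I_k, (i < j)%N -> m' (t i) = m (t i)) ->
    (m (t j) <= m' (t j))%N.
Proof.
have [m Tm minm] := lex_minimal; exists m => //; split=> //.
have [Sm outm posm] := Tm; have [s [Ss pos_s le_s]] := decomposition Sm posm.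
have outs p i : i \notin codom t -> s p i = 0%N.
  move=> it; apply/eqP; rewrite -leqn0 -(outm i it) (leq_trans _ (le_s i)) //.
  by rewrite (bigD1 p) //= leq_addr.
(* The summand [s j] takes the whole coordinate of [m] on its axis and the other summands vanish
   there; this is shown axis by axis in the lexicographic order. *)
have claim (j : 'I_k) : s j (t j) = m (t j) /\ forall q, q != j -> s q (t j) = 0%N.
  have [d] := ubnP (val j); elim: d j => // d IHd j; rewrite ltnS => jd.
  have IH (i : 'I_k) : (i < j)%N ->
      s i (t i) = m (t i) /\ forall q, q != i -> s q (t i) = 0%N.
    by move=> ij; apply: IHd; apply: leq_trans ij jd.
  (* [X] agrees with [m] on the axes before [j], and [U] makes the later coordinates positive. If
     [X] were positive on axis [j], then [X + U] would be an interior point contradicting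
     minimality, since [s j] takes a positive share of that coordinate. *)
  pose X := (\big[+%MM/0%MM]_(q : 'I_k | (q < j)%N) s q)%MM.
  pose U := axis_sum (fun q : 'I_k => (j < q)%N) (fun _ => N).
  have XE i : X i = (\sum_(q : 'I_k | (q < j)%N) s q i)%N by rewrite mnm_sumE.
  have SX : S X by apply: monoid_sum.
  have SU' : S U by apply: axis_sum_monoid.
  have outX i : i \notin codom t -> X i = 0%N.
    by move=> it; rewrite XE big1 // => q _; apply: outs.
  have Xlt (i : 'I_k) : (i < j)%N -> X (t i) = m (t i).
    move=> ij; have [Ei Eq] := IH i ij; rewrite XE (bigD1 i) //= Ei big1 ?addn0 //.
    by move=> q /andP [_ qi]; apply: Eq.
  have sumj : (X (t j) + s j (t j) + \sum_(q : 'I_k | ~~ (q < j)%N && (q != j)) s q (t j)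
      <= m (t j))%N.
    rewrite XE -addnA; apply: leq_trans (le_s (t j)).
    rewrite [X in (_ <= X)%N](bigID (fun q : 'I_k => (q < j)%N)) leq_add2l.
    by rewrite [X in (_ <= X)%N](bigD1 j) ?ltnn.
  have Xj : X (t j) = 0%N.
    apply/eqP; rewrite -leqn0 leqNgt; apply/negP => Xj.
    have : (m (t j) <= (X + U)%MM (t j))%N.
      apply: minm => [|i ij]; last by rewrite mnmDE Xlt // axis_sumE ltnNge ltnW //= addn0.
      split=> [|i it|p]; first exact: SD.
        by rewrite mnmDE outX // axis_sum_out.
      rewrite mnmDE axis_sumE; have [jp|pj|/val_inj <-] := ltngtP j p.
      - by rewrite addn_gt0 N0 orbT.
      - by rewrite Xlt // addn0.
      - by rewrite addn0.
    rewrite mnmDE axis_sumE ltnn addn0 => mX.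
    by have := pos_s j; move: sumj; lia.
  (* Adding [s j] restores positivity on axis [j], so minimality now says that [s j] takes all of
     it. *)
  have mj : (m (t j) <= (X + s j + U)%MM (t j))%N.
    apply: minm => [|i ij].
      split=> [|i it|p]; first exact/SD/SU'/SD.
        by rewrite !mnmDE outX // outs // axis_sum_out.
      rewrite !mnmDE axis_sumE; have [jp|pj|/val_inj <-] := ltngtP j p.
      - by rewrite addn_gt0 N0 orbT.
      - by rewrite Xlt // addn0 addn_gt0 posm.
      - by rewrite addn0 addn_gt0 pos_s orbT.
    rewrite !mnmDE Xlt // axis_sumE ltnNge (ltnW ij) addn0 (IH i ij).2 ?addn0 //.
    by rewrite eq_sym -(inj_eq val_inj) neq_ltn ij.
  rewrite !mnmDE axis_sumE ltnn addn0 Xj add0n in mj.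
  have rest0 : (\sum_(q : 'I_k | ~~ (q < j)%N && (q != j)) s q (t j) = 0)%N by move: sumj; lia.
  split; first by move: sumj; lia.
  move=> q qj; have [qltj|jq] := boolP (q < j)%N.
    apply/eqP; rewrite -leqn0 -Xj XE (bigD1 q) //=; exact: leq_addr.
  apply/eqP; rewrite -leqn0 -rest0 (bigD1 q) ?jq ?qj //=; exact: leq_addr.
move=> j; have -> // : (U_(t j) *+ m (t j))%MM = s j.
apply/mnmP => i; rewrite mulmnE mnm1E; have [it|it] := boolP (i \in codom t); last first.
  rewrite outs //; case: eqP => // E; by rewrite -E codom_f in it.
have [q ->] := codomP it; rewrite (inj_eq inj_t); case: eqP => [<-|/eqP jq].
  by rewrite mul1n (claim j).1.
by rewrite mul0n (claim q).2.
Qed.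

(** Every coordinate of a point of the face is divisible by that of the lexicographically minimal
    interior point: division with remainder would otherwise give a smaller one. *)
Lemma face_axes m : S m -> (forall i, i \notin codom t -> m i = 0%N) ->
  forall p, S (U_(t p) *+ m (t p))%MM.
Proof.
have [m0 [Sm0 out0 pos0] [Sd minm]] := lex_minimal_axes => Sm outm.
suff dvd (j : 'I_k) : (m0 (t j) %| m (t j))%N.
  move=> p; have /dvdnP [q ->] := dvd p.
  by rewrite mulnC mulm_mul; apply: monoid_mulm.
have [d] := ubnP (val j); elim: d j => // d IHd j; rewrite ltnS => jd.
have IH (i : 'I_k) : (i < j)%N -> (m0 (t i) %| m (t i))%N.
  by move=> ij; apply: IHd; apply: leq_trans ij jd.
pose r := (m (t j) %% m0 (t j))%N.
have [r0|r0] := posnP r; first by apply/eqP.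
(* Subtracting [a] from [m] clears the axes before [j], known to be divisible, and leaves the
   remainder [r] on axis [j]. *)
pose c (q : 'I_k) := (if (q < j)%N then m (t q) else m (t j) - r)%N.
pose a := axis_sum (fun q : 'I_k => (q <= j)%N) c.
have r_le : (r <= m (t j))%N by apply: leq_mod.
have Sa : S a.
  apply: monoid_sum => q qj; rewrite /c; case: ifP => [qltj|jq].
    have /dvdnP [b ->] := IH q qltj.
    by rewrite mulnC mulm_mul; apply: monoid_mulm.
  have -> : q = j by apply/val_inj/eqP; rewrite eqn_leq qj leqNgt jq.
  rewrite /r {1}(divn_eq (m (t j)) (m0 (t j))) addnK.
  by rewrite mulnC mulm_mul; apply: monoid_mulm.
have am : (a <= m)%MM.
  apply/mnm_lepP => i; have [it|it] := boolP (i \in codom t); last by rewrite axis_sum_out.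
  have [q ->] := codomP it; rewrite axis_sumE; case: ifP => // qj; rewrite /c.
  case: ifP => // jq; have -> : q = j by apply/val_inj/eqP; rewrite eqn_leq qj leqNgt jq.
  exact: leq_subr.
(* [b] puts back the minimal values before [j] and [U] fills the later axes, giving an interior
   point whose coordinate on axis [j] is [r], smaller than the minimal one. *)
pose b := axis_sum (fun q : 'I_k => (q < j)%N) (fun q => m0 (t q)).
pose U := axis_sum (fun q : 'I_k => (j < q)%N) (fun _ => N).
have Sb : S b by apply: monoid_sum.
have : (m0 (t j) <= (m - a + b + U)%MM (t j))%N.
  apply: minm => [|i ij]; last first.
    rewrite !mnmDE mnmBE !axis_sumE (ltnW ij) ij (ltnNge j i) (ltnW ij) /= addn0 /c ij.
    by rewrite subnn.
  split=> [|i it|p].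
  - by apply: SD (axis_sum_monoid _); apply: SD Sb; apply: monoid_sub.
  - by rewrite !mnmDE mnmBE !axis_sum_out // outm.
  - rewrite !mnmDE mnmBE !axis_sumE; have [jp|pj|/val_inj <-] := ltngtP j p.
    + by rewrite addn_gt0 N0 orbT.
    + by rewrite addn0 addn_gt0 pos0 orbT.
    + by rewrite /c ltnn subKn // !addn0.
rewrite !mnmDE mnmBE !axis_sumE leqnn ltnn /c ltnn subKn // !addn0.
by rewrite leqNgt ltn_mod pos0.
Qed.

End Face.

Variables (k : nat) (k1 : (1 <= k)%N) (kn : (k <= n)%N).
Hypothesis decomposition : forall m (t : 'I_k -> 'I_n), injective t -> S m ->
  (forall p, (0 < m (t p))%N) ->
  exists s : 'I_k -> 'X_{1..n}, [/\ forall p, S (s p), forall p, (0 < s p (t p))%N &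
    forall i, (\sum_p s p i <= m i)%N].
Hypothesis line_case : k = 1%N -> forall m, S m -> irreducible_monomial m ->
  forall i j, (0 < m i)%N -> (0 < m j)%N -> i = j.

Lemma nth_ord_injection (L : seq 'I_n) : uniq L -> (k <= size L)%N ->
  exists2 t : 'I_k -> 'I_n, injective t & codom t =i take k L.
Proof.
move=> uL kL; have n0 : (0 < n)%N by apply: leq_trans kn.
pose x0 := Ordinal n0.
have inL (p : 'I_k) : (p < size L)%N by apply: leq_trans kL.
exists (fun p => nth x0 L p) => [p q /eqP|i].
  by rewrite nth_uniq // => /eqP /val_inj.
have sz : size (take k L) = k by rewrite size_takel.
apply/codomP/(nthP x0) => [[p ->]|[p]].
  by exists p; rewrite ?sz // nth_take.
by rewrite sz => pk <-; exists (Ordinal pk); rewrite nth_take.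
Qed.

(** By induction on the degree [m] may be taken irreducible. With at most [k] axes in its support it
    lies on a face and [face_axes] applies. With more, a decomposition along [k] of them has at
    least two nonzero summands when [k > 1], against irreducibility; for [k = 1] a decomposition
    carries no information, hence the separate [line_case]. *)
Lemma monoid_axes : axes_monoid.
Proof.
move=> m; have [d] := ubnP (mdeg m); elim: d m => // d IHd m; rewrite ltnS => md i Sm.
have [/eqP ->|m0] := boolP (m == 0%MM); first by rewrite mnm0E mulm0n.
have [irr|red] := pselect (irreducible_monomial m); last first.
  have /not_andP [nn|/existsNP [a /existsNP [b]]] := red.
    by case: nn; apply/eqP.
  move=> /not_implyP [Sa /not_implyP [Sb /not_implyP [Em /not_orP [a0 b0]]]].
  have posdeg (x : 'X_{1..n}) : x <> 0%MM -> (0 < mdeg x)%N.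
    by move=> /eqP; rewrite lt0n mdeg_eq0.
  have := posdeg _ a0; have := posdeg _ b0; have Ed := congr1 (@mdeg n) Em.
  rewrite mdegD in Ed => b1 a1.
  have -> : (U_(i) *+ m i = U_(i) *+ a i + U_(i) *+ b i)%MM.
    by apply/mnmP => l; rewrite mnmDE !mulmnE Em mnmDE mulnDr.
  by apply: SD; apply: IHd => //; lia.
pose supp := [set j | (0 < m j)%N].
have suppP j : (j \in supp) = (0 < m j)%N by rewrite inE.
have [lk|kl] := leqP #|supp| k.
  pose L := enum supp ++ enum (~: supp).
  have uL : uniq L.
    rewrite cat_uniq !enum_uniq andbT /=; apply/hasPn => j; rewrite !mem_enum inE.
    by move=> /negPf ->.
  have sL : size L = n by rewrite size_cat -!cardE cardsC card_ord.
  have [|t inj_t tE] := nth_ord_injection uL; first by rewrite sL.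
  have outm j : j \notin codom t -> m j = 0%N.
    rewrite tE => jL; apply/eqP; rewrite -leqn0 leqNgt -suppP; apply: contra jL => js.
    rewrite take_cat; case: ltnP => [|_]; first by rewrite -cardE ltnNge lk.
    by rewrite mem_cat mem_enum js.
  have [it|it] := boolP (i \in codom t); last by rewrite outm // mulm0n.
  have [p ->] := codomP it; apply: (face_axes inj_t) => // m' Sm'.
  exact: decomposition.
have [|t inj_t tE] := @nth_ord_injection (enum supp) (enum_uniq _).
  by rewrite -cardE ltnW.
have post p : (0 < m (t p))%N.
  by rewrite -suppP -mem_enum (mem_take (n0 := k)) // -tE codom_f.
have [k2|k2] := ltnP 1 k; last first.
  have k1' : k = 1%N by apply/eqP; rewrite eqn_leq k2.
  have /card_gt1P [x [y [xs ys xy]]] : (1 < #|supp|)%N by rewrite -k1'.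
  by case/eqP: xy; apply: (line_case k1' Sm irr); rewrite -suppP.
have [s [Ss pos_s le_s]] := decomposition inj_t Sm post.
pose p0 : 'I_k := Ordinal k1; pose p1 : 'I_k := Ordinal k2.
have s0m : (s p0 <= m)%MM.
  apply/mnm_lepP => j; apply: leq_trans (le_s j).
  by rewrite (bigD1 p0) //= leq_addr.
have Em : m = (s p0 + (m - s p0))%MM by rewrite addmC submK.
have [|z|z] := irr.2 _ _ (Ss p0) _ Em.
- exact: monoid_sub.
- by have := pos_s p0; rewrite z mnm0E.
- have := congr1 (fun x : 'X_{1..n} => x (t p1)) z; rewrite mnmBE mnm0E => /eqP.
  have := le_s (t p1); rewrite (bigD1 p0) //= (bigD1 p1) //= subn_eq0 => le1 le2.
  by have := pos_s p1; move: le1 le2; lia.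
Qed.

End MonomialMonoid.

(** * Pulled-back forms and reflections *)

Section Euler.
Variables (K : fieldType) (n : nat).
Implicit Types (l : 'I_n -> K) (x y : {mpoly K[n]}).

(** The logarithmic derivation with coefficients [l i] along x_i d/dx_i; it is diagonal on
    monomials, with eigenvalue [mlin l m]. *)
Definition euler l x : {mpoly K[n]} := \sum_i l i *: ('X_i * x^`M(i)).

Definition mlin l (m : 'X_{1..n}) : K := \sum_i l i * (m i)%:R.

Lemma euler_linear l (c : K) x y : euler l (c *: x + y) = c *: euler l x + euler l y.
Proof.
rewrite /euler scaler_sumr -big_split; apply: eq_bigr => i _ /=.
by rewrite mderivD mderivZ mulrDr scalerDr -scalerAr !scalerA mulrC.
Qed.

Lemma eulerM l x y : euler l (x * y) = x * euler l y + y * euler l x.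
Proof.
rewrite /euler !mulr_sumr -big_split; apply: eq_bigr => i _ /=.
rewrite -!scalerAr -scalerDr mderivM; congr (_ *: _); ring.
Qed.

Lemma eulerXm l m : euler l 'X_[m] = mlin l m *: 'X_[m].
Proof.
rewrite /mlin scaler_suml; apply: eq_bigr => i _.
rewrite mderivX -scalerAr scalerA; have [->|mi] := posnP (m i).
  by rewrite mulr0 !scale0r.
by congr (_ *: _); rewrite -mpolyXD addmC submK // lep1mP -lt0n.
Qed.

Lemma euler_coef l x m : (euler l x)@_m = mlin l m * x@_m.
Proof.
elim/mpolyind: x => [|c k x _ _ IH].
  have := euler_linear l (-1) 0 0; rewrite scaler0 addr0 scaleN1r addNr => ->.
  by rewrite mcoeff0 mulr0.
rewrite euler_linear !mcoeffD !mcoeffZ IH mulrDr eulerXm mcoeffZ mcoeffX.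
by congr (_ + _); case: eqP => [->|_]; rewrite ?mulr0 // mulrCA.
Qed.

Lemma mcoeffM_neq0 x y m : (x * y)@_m != 0 ->
  exists m1 m2, [/\ m = (m1 + m2)%MM, x@_m1 != 0 & y@_m2 != 0].
Proof.
move=> nz; apply: contrapT => none; case/eqP: nz.
rewrite (mcoeffM x y m) big1 // => -[k1 k2] /= /eqP Em; apply/eqP; apply: contrapT => /negP.
by rewrite mulf_eq0 negb_or => /andP [x1 y2]; apply: none; exists k1, k2.
Qed.

Lemma mcoeff_prod_neq0 k (x : 'I_k -> {mpoly K[n]}) m : (\prod_q x q)@_m != 0 ->
  exists s : 'I_k -> 'X_{1..n}, (forall q, (x q)@_(s q) != 0) /\
    m = (\big[+%MM/0%MM]_q s q)%MM.
Proof.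
elim: k x m => [|k IH] x m.
  rewrite big_ord0 mcoeff1 => nz; exists (fun _ => 0%MM); split=> [[]//|].
  by rewrite big_ord0; move: nz; case: (m =P 0%MM) => // _; rewrite eqxx.
rewrite big_ord_recl => /mcoeffM_neq0 [m1 [m2 [-> nz1 /IH [s [sP ->]]]]].
exists (fun q => oapp s m1 (unlift ord0 q)); split=> [q|].
  by case: unliftP => [j|] -> /=; rewrite ?sP.
rewrite big_ord_recl unlift_none; congr (_ + _)%MM.
by apply: eq_bigr => q _; rewrite liftK.
Qed.

End Euler.

Section PullbackForms.
Variables (K : fieldType) (k : nat).

Lemma pullback_dwedge (A B : comAlgType K) (f : {lrmorphism A -> B}) a
    (g : {ffun 'I_k -> A}) (w : kahler_form A k) :
  pullback f (a *: dwedge g + w) = f a *: dwedge [ffun q => f (g q)] + pullback f w.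
Proof.
rewrite pullbackP pullback_wedge; congr (_ *: wedge _ + _).
by apply/ffunP => q; rewrite !ffunE pullback1_dif.
Qed.

Lemma pullbackD (A B : comAlgType K) (f : {lrmorphism A -> B}) (v w : kahler_form A k) :
  pullback f (v + w) = pullback f v + pullback f w.
Proof. by have := pullbackP f 1 v w; rewrite !scale1r rmorph1 scale1r. Qed.

Lemma pullbackZ (A B : comAlgType K) (f : {lrmorphism A -> B}) a (w : kahler_form A k) :
  pullback f (a *: w) = f a *: pullback f w.
Proof. by have := pullbackP f a w 0; rewrite !pullback0 !addr0. Qed.

Lemma pullback_sum (A B : comAlgType K) (f : {lrmorphism A -> B}) (I : Type) (r : seq I)
    (P : pred I) (F : I -> kahler_form A k) :
  pullback f (\sum_(i <- r | P i) F i) = \sum_(i <- r | P i) pullback f (F i).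
Proof. by apply: (big_morph (@pullback K A B f k) (pullbackD f) (pullback0 f k)). Qed.

Lemma pullback_act (A : comAlgType K) (gT : finGroupType) (rho : gT -> {lrmorphism A -> A})
    (act : is_algebra_action rho) g h (w : kahler_form A k) :
  pullback (rho (g * h)%g) w = pullback (rho h) (pullback (rho g) w).
Proof.
elim/form_ind: w => [|a f w IH]; first by rewrite !pullback0.
rewrite !pullback_dwedge (act_mul act) IH; congr (_ *: dwedge _ + _).
by apply/ffunP => q; rewrite !ffunE (act_mul act).
Qed.

Lemma sum_pullback_invariant (A : comAlgType K) (gT : finGroupType)
    (rho : gT -> {lrmorphism A -> A}) (act : is_algebra_action rho) (w : kahler_form A k) :
  invariant_form rho (\sum_g pullback (rho g) w).
Proof.
move=> h; rewrite pullback_sum [RHS](reindex_inj (mulIg h)) /=.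
by apply: eq_bigr => g _; rewrite pullback_act.
Qed.

End PullbackForms.

Section LocalSurjectivity.
Variables (K : fieldType) (char0 : [pchar K] =i pred0) (A : comAlgType K).
Variables (gT : finGroupType) (rho : gT -> {lrmorphism A -> A}).
Hypotheses (abelG : abelian [set: gT]) (act : is_algebra_action rho).
Hypothesis smA : formally_smooth A.
Variables (e : {rmorphism A -> K}) (eA : forall c, e c%:A = c).
Variables (n : nat) (u : 'I_n -> A) (chi : 'I_n -> gT -> K).
Hypothesis uP : coordinates rho e u chi.
Variable k : nat.

(* Generation of the invariant forms by pulled-back forms, as seen by linear   *)
(* functionals.                                                                *)
Definition invariant_generated : Prop := forall L : kahler_form A k -> K,
  (forall (c : K) x y, L (c%:A *: x + y) = c * L x + L y) ->
  (forall f (g : {ffun 'I_k -> A}), invariant_elt rho f ->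
     (forall q, invariant_elt rho (g q)) -> L (f *: dwedge g) = 0) ->
  forall w, invariant_form rho w -> L w = 0.

Hypothesis gen : invariant_generated.

(** Logarithmic derivations do not lower degrees, so they are well defined on truncated expansions
    without loss of order. *)
Let dlog (l : 'I_n -> K) M (Q : comAlgType K) (p : {lrmorphism {mpoly K[n]} -> Q})
    (f : {lrmorphism A -> Q}) (fP : expansion e u M p f) (a : A) : Q :=
  p (euler l (projT1 (cid (exp_onto fP (f a))))).

(* The average of u^(m - 1_I) du_I, contracted with the logarithmic derivations *)
(* [lam p], has a nonzero coefficient at [m]; a form f dg only contributes to   *)
(* it through decompositions of [m] into trivial weights.                       *)
Lemma nonvanishing_coefficient (lam : 'I_k -> 'I_n -> K) (m : 'X_{1..n})
    (I : 'I_k -> 'I_n) : trivial_weight rho e chi m ->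
  (\big[+%MM/0%MM]_q U_(I q) <= m)%MM -> \det (\matrix_(q, p) lam p (I q)) != 0 ->
  exists (a : {mpoly K[n]}) (b : 'I_k -> {mpoly K[n]}),
    [/\ forall s, (mdeg s <= mdeg m)%N -> a@_s != 0 -> trivial_weight rho e chi s,
        forall q s, (mdeg s <= mdeg m)%N -> (b q)@_s != 0 -> trivial_weight rho e chi s &
        (a * \det (\matrix_(q, p) euler (lam p) (b q)))@_m != 0].
Proof.
move=> tm Im det0; pose M := (mdeg m).+2.
have mM : (mdeg m < M)%N by rewrite /M ltnW.
have [Q [p [f fP]]] := exists_expansion smA eA uP (mdeg m).
have dlogE l a x : f a = p x -> dlog l fP a = p (euler l x).
  move=> Ea; rewrite /dlog; case: cid => y /= Ey; apply/(exp_ker fP) => s sM.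
  rewrite mcoeffB !euler_coef -mulrBr -mcoeffB.
  by have /(exp_ker fP) -> // : p y = p x; rewrite ?mulr0 // Ey Ea.
have scaleE (c : K) (x : Q) : f c%:A * x = c *: x by rewrite linearZ /= rmorph1 mulr_algl.
have der q : derivation f (dlog (lam q) fP : A -> Q^o).
  split=> [c a b|a b]; have [[x Ex] [y Ey]] := (exp_onto fP (f a), exp_onto fP (f b)).
    rewrite (dlogE _ _ _ (esym Ex)) (dlogE _ _ _ (esym Ey)).
    rewrite (dlogE _ _ (c *: x + y)) ?linearP /= ?Ex ?Ey // euler_linear linearP /=.
    by congr (_ + _); rewrite -[RHS]/(_ * _) scaleE.
  rewrite (dlogE _ _ _ (esym Ex)) (dlogE _ _ _ (esym Ey)).
  rewrite (dlogE _ _ (x * y)) ?rmorphM /= ?Ex ?Ey //.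
  by rewrite eulerM rmorphD !rmorphM /= Ex Ey.
have [Phi [PhiL PhiE]] := form_contraction der.
pose L w := exp_coef fP m (Phi w).
apply: contrapT => none.
(* The cutoff makes the translates of [w0] by elements outside inertia invisible modulo (x)^M. *)
have [c [ic c1 gc]] := cutoff act eA M.
pose m' := (m - \big[+%MM/0%MM]_q U_(I q))%MM.
have Em : (m' + \big[+%MM/0%MM]_q U_(I q))%MM = m by rewrite submK.
pose w0 : kahler_form A k := (c * ev u 'X_[m']) *: dwedge [ffun q => u (I q)].
(* By [none], no form built from invariants has a contraction reaching the coefficient at [m]; so
   [gen] kills the invariant sum of the translates. *)
have Lw : L (\sum_g pullback (rho g) w0) = 0.
  apply: gen; last exact: sum_pullback_invariant.
    move=> d x y; rewrite /L PhiL -[_ *: _]/(_ * _) scaleE; exact: (exp_coefL fP).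
  move=> a g ia ig; apply/eqP; apply: contrapT => /negP nz; apply: none.
  have [x Ex] := exp_onto fP (f a).
  have [y Ey] := choice (fun q => exp_onto fP (f (g q))).
  have supp b z s : invariant_elt rho b -> p z = f b -> (mdeg s <= mdeg m)%N ->
      z@_s != 0 -> trivial_weight rho e chi s.
    move=> ib Eb sm; have sM : (mdeg s < M)%N by apply: leq_ltn_trans mM.
    have jb : inertia_invariant rho e b by move=> h _; apply: ib.
    rewrite -(exp_coefE fP z sM) Eb; exact: (exp_support eA uP jb sM).
  exists x, y; split=> [s|q s|]; [exact: (supp _ _ s ia Ex)|exact: (supp _ _ s (ig q) (Ey q))|].
  rewrite -(exp_coefE fP _ mM) rmorphM /= Ex -det_map_mx.
  move: nz; rewrite /L (slinZ PhiL) PhiE -[_ *: _]/(_ * _).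
  congr (exp_coef _ _ (_ * \det _) != 0); apply/matrixP => q r.
  by rewrite !mxE (dlogE _ _ _ (esym (Ey q))).
(* Each inertia element contributes the same [d], because the form has the weight of [m], which is
   trivial. *)
pose d := \det (\matrix_(q, p) lam p (I q)).
have Lg g : L (pullback (rho g) w0) = if g \in inertia_set rho e then d else 0.
  rewrite /L /w0 pullbackZ.
  have -> : pullback (rho g) (dwedge [ffun q => u (I q)]) =
      dwedge [ffun q => rho g (u (I q))].
    have := pullback_dwedge (rho g) 1 [ffun q => u (I q)] 0.
    rewrite rmorph1 !scale1r pullback0 !addr0 => ->; congr dwedge.
    by apply/ffunP => q; rewrite !ffunE.
  rewrite (slinZ PhiL) PhiE -[_ *: _]/(_ * _) !rmorphM /=; case: ifPn => gH.
    move/inertia_setP: gH => gH; rewrite ic //.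
    have -> : f c = 1.
      by apply/eqP; rewrite -subr_eq0 -(rmorph1 f) -rmorphB; apply/eqP/(exp_npow0 fP).
    rewrite mul1r (act_monomial uP) // linearZ /= (exp_ev fP).
    have -> : \det (\matrix_(q, r) dlog (lam r) fP ([ffun q0 => rho g (u (I q0))] q)) =
        \det (diag_mx (\row_q p (chi (I q) g *: 'X_(I q))) *m
              map_mx (in_alg Q) (\matrix_(q, r) lam r (I q))).
      congr (\det _); rewrite mul_diag_mx; apply/matrixP => q r; rewrite !mxE ffunE.
      rewrite (dlogE _ _ (chi (I q) g *: 'X_(I q))); last first.
        by rewrite (coords_act uP) // !linearZ /= (exp_coord fP).
      have -> : euler (lam r) (chi (I q) g *: 'X_(I q)) =
          lam r (I q) *: (chi (I q) g *: 'X_(I q)).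
        rewrite -[chi _ _ *: _]addr0 euler_linear eulerXm.
        have -> : euler (lam r) 0 = 0.
          by have := euler_linear (lam r) (-1) 0 0; rewrite scaler0 addr0 scaleN1r addNr.
        rewrite !addr0 /mlin (bigD1 (I q)) //= mnm1E eqxx mulr1 big1 ?addr0.
          by rewrite !scalerA mulrC.
        by move=> i /negPf ni; rewrite mnm1E eq_sym ni mulr0.
      by rewrite linearZ /= mulr_algr.
    rewrite det_mulmx det_diag det_map_mx -/d /=.
    have -> : \prod_q (\row_q p (chi (I q) g *: 'X_(I q))) 0 q =
        weight chi (\big[+%MM/0%MM]_q U_(I q))%MM g *:
          p 'X_[\big[+%MM/0%MM]_q U_(I q)]%MM.
      have -> : 'X_[\big[+%MM/0%MM]_q U_(I q)]%MM = \prod_q 'X_(I q) :> {mpoly K[n]}.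
        by elim/big_ind2: _ => [|x y x' y' <- <-|//]; rewrite ?mpolyX0 ?mpolyXD.
      rewrite rmorph_prod /=.
      have -> : weight chi (\big[+%MM/0%MM]_q U_(I q))%MM g = \prod_q chi (I q) g.
        elim/big_ind2: _ => [|x y x' y' Ex Ey|q _].
        - by rewrite /weight big1 // => i _; rewrite mnm0E.
        - by rewrite weightD Ex Ey.
        - by have := weightU chi (I q) 1 g; rewrite mulm1n expr1.
      by rewrite -scaler_prod; apply: eq_bigr => q _; rewrite mxE linearZ.
    set a1 := weight chi m' g; set a2 := weight chi _ g.
    have -> : a1 *: p 'X_[m'] * (a2 *: p 'X_[\big[+%MM/0%MM]_q U_(I q)]%MM * d%:A) =
        (a1 * a2 * d) *: p 'X_[m].
      rewrite -{1}Em mpolyXD rmorphM /= mulr_algr -!(scalerAl, scalerAr) !scalerA.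
      by congr (_ *: _); ring.
    rewrite -weightD Em tm // mul1r -linearZ /= (exp_coefE fP) //.
    by rewrite mcoeffZ mcoeffX eqxx mulr1.
  have -> : f (rho g c) = 0.
    by apply: (exp_npow0 fP); apply: gc => gH'; case/negP: gH; apply/inertia_setP.
  by rewrite !mul0r -(rmorph0 p) (exp_coefE fP) // mcoeff0.
have LD x y : L (x + y) = L x + L y.
  rewrite /L -[x]scale1r PhiL rmorph1 scale1r.
  have := exp_coefL fP 1 (Phi (1 *: x)) (Phi y) mM.
  by rewrite !scale1r mul1r.
have L0 : L 0 = 0 by apply: (addrI (L 0)); rewrite -LD !addr0.
move: Lw; rewrite (big_morph L LD L0); under eq_bigr do rewrite Lg.
rewrite -big_mkcond /= sumr_const -mulr_natr => /eqP.
by rewrite mulf_eq0 (negPf det0) (negPf (inertia_card_neq0 char0 act e)).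
Qed.

Hypotheses (k1 : (1 <= k)%N) (kn : (k <= n)%N).

(** For distinct axes [t], contraction with the x_{t p} d/dx_{t p} makes the determinant that of the
    identity matrix, and a nonzero term of the expanded determinant supplies the decomposition. For
    [k = 1] a derivation killing u^m is used instead. *)
Lemma generated_axes : axes_monoid (trivial_weight rho e chi).
Proof.
have /pcharf0P char0' := char0.
apply: (@monoid_axes n (trivial_weight rho e chi) _ _ _ #|gT| _ _ k k1 kn).
- exact: trivial_weight0.
- by move=> a b; apply: trivial_weightD.
- by move=> a b; apply: trivial_weightB.
- by apply/card_gt0P; exists 1%g.
- by move=> i; apply: (trivial_weightU act uP).
- move=> m t inj_t tm post.
  have [||a [b [ta tb nz]]] := @nonvanishing_coefficient
      (fun p i => (i == t p)%:R) m t tm.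
  + apply/mnm_lepP => i; rewrite mnm_sumE.
    have [it|it] := boolP (i \in codom t); last first.
      rewrite big1 // => q _; rewrite mnm1E; case: eqP => // E.
      by rewrite -E codom_f in it.
    have [q ->] := codomP it; rewrite (bigD1 q) //= mnm1E eqxx big1 ?addn0 //.
    by move=> r rq; rewrite mnm1E (inj_eq inj_t) (negPf rq).
  + have -> : \matrix_(q, p) (t q == t p)%:R = 1%:M :> 'M[K]_k.
      by apply/matrixP => q p; rewrite !mxE (inj_eq inj_t).
    by rewrite det1 oner_neq0.
  have : exists s : 'S_k, (a * \prod_q euler (fun i => (i == t (s q))%:R) (b q))@_m != 0.
    apply: contrapT => none; case/eqP: nz; rewrite mulr_sumr raddf_sum big1 // => s _.
    apply/eqP; apply: contrapT => /negP nz; apply: none; exists s.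
    apply: contraNneq nz => E0; rewrite mulrCA.
    rewrite (eq_bigr (fun q => euler (fun i => (i == t (s q))%:R) (b q))) => [|q _].
      2: by rewrite mxE.
    rewrite /=; by case: (odd_perm s); rewrite ?expr0 ?expr1 ?mul1r ?mulN1r ?mcoeffN E0 ?oppr0.
  move=> [s /mcoeffM_neq0 [m1 [m2 [Em a1 /mcoeff_prod_neq0 [r [rP Er]]]]]].
  (* The supports are controlled only in degrees up to that of [m], which bounds every summand. *)
  have rm q : (mdeg (r q) <= mdeg m)%N.
    rewrite Em Er mdegD mdeg_sum (bigD1 q) //= addnCA; exact: leq_addr.
  exists (fun p => r ((s^-1)%g p)); split=> [p|p|i].
  + apply: (tb ((s^-1)%g p) _ (rm _)); apply: contraNneq (rP ((s^-1)%g p)) => z.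
    by rewrite euler_coef z mulr0.
  + rewrite lt0n; apply: contraNneq (rP ((s^-1)%g p)) => z.
    rewrite euler_coef permKV /mlin (bigD1 (t p)) //= z mulr0 big1 ?addr0 ?mul0r //.
    by move=> i /negPf ->; rewrite mul0r.
  + rewrite Em Er mnmDE mnm_sumE (reindex_inj (@perm_inj _ s)) /=.
    by under eq_bigr do rewrite permK; rewrite leq_addl.
- move=> k_1 m tm irr i j mi mj; apply/eqP; apply: contrapT => /negP ij.
  (* The derivation m_j x_i d/dx_i - m_i x_j d/dx_j has eigenvalue 0 at both [m] and 0, the
     exponents that irreducibility leaves for the differentiated factor. Yet its coefficient on du_i
     is m_j, nonzero in characteristic 0. *)
  have [||a [b [ta tb nz]]] := @nonvanishing_coefficient
      (fun p l => (m j)%:R * (l == i)%:R - (m i)%:R * (l == j)%:R) m (fun _ => i) tm.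
  + apply/mnm_lepP => l; rewrite mnm_sumE sum_nat_const card_ord k_1 mul1n mnm1E.
    by case: eqP => [<-|].
  + have -> : \matrix_(q, p) ((m j)%:R * (i == i)%:R - (m i)%:R * (i == j)%:R)
        = const_mx (m j)%:R :> 'M[K]_k.
      by apply/matrixP => q p; rewrite !mxE eqxx (negPf ij) mulr0 subr0 mulr1.
    by clear -k_1 char0' mj; subst k; rewrite det_mx11 mxE char0' -lt0n.
  have : exists q, (a * euler (fun l => (m j)%:R * (l == i)%:R - (m i)%:R * (l == j)%:R)
       (b q))@_m != 0.
    clear -nz k_1; subst k; exists 0; by move: nz; rewrite det_mx11 mxE.
  move=> [q /mcoeffM_neq0 [m1 [m2 [Em a1 b2]]]].
  have m1m : (mdeg m1 <= mdeg m)%N by rewrite Em mdegD leq_addr.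
  have m2m : (mdeg m2 <= mdeg m)%N by rewrite Em mdegD leq_addl.
  have t1 := ta _ m1m a1.
  have t2 : trivial_weight rho e chi m2.
    by apply: (tb q _ m2m); apply: contraNneq b2 => z; rewrite euler_coef z mulr0.
  have mlinE s : mlin (fun l => (m j)%:R * (l == i)%:R - (m i)%:R * (l == j)%:R) s =
      (m j)%:R * (s i)%:R - (m i)%:R * (s j)%:R :> K.
    rewrite /mlin; under eq_bigr do rewrite mulrBl.
    rewrite sumrB; congr (_ - _).
      rewrite (bigD1 i) //= eqxx mulr1 big1 ?addr0 // => l /negPf ->.
      by rewrite mulr0 mul0r.
    rewrite (bigD1 j) //= eqxx mulr1 big1 ?addr0 // => l /negPf ->.
    by rewrite mulr0 mul0r.
  case/eqP: b2; rewrite euler_coef mlinE; case: (irr.2 _ _ t1 t2 Em) => z.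
    by rewrite Em z add0m [X in X - _]mulrC subrr mul0r.
  by rewrite z !mnm0E !mulr0 subrr mul0r.
Qed.

End LocalSurjectivity.

(** * Functionals on forms *)

Section WedgeProduct.
Variables (K : fieldType) (A : comAlgType K) (k : nat).

Lemma dwedge_mul (x y : {ffun 'I_k -> A}) (a : 'I_k -> A) :
  (forall g q, dwedge (fupd g q (y q)) = a q *: dwedge (fupd g q (x q))) ->
  dwedge y = (\prod_q a q) *: dwedge x.
Proof.
move=> yx; have main (r : seq 'I_k) : uniq r ->
    dwedge [ffun q => if q \in r then y q else x q] = (\prod_(q <- r) a q) *: dwedge x.
  elim: r => [_|q r IH /= /andP [qr ur]].
    by rewrite big_nil scale1r; congr dwedge; apply/ffunP => q; rewrite ffunE.
  rewrite big_cons -scalerA -IH //.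
  pose g' := [ffun q0 => if q0 \in r then y q0 else x q0].
  transitivity (dwedge (fupd g' q (y q))).
    by congr dwedge; apply/ffunP => p; rewrite !ffunE inE; case: (p =P q) => [->|_].
  rewrite yx; congr (_ *: dwedge _); apply/ffunP => p; rewrite !ffunE.
  by case: (p =P q) => // ->; rewrite (negPf qr).
have := main (index_enum 'I_k) (index_enum_uniq _).
move=> <-; congr dwedge; apply/ffunP => q; by rewrite ffunE mem_index_enum.
Qed.

Lemma dwedge_scale (x : {ffun 'I_k -> A}) (c : 'I_k -> K) :
  dwedge [ffun q => c q *: x q] = (\prod_q c q)%:A *: dwedge x.
Proof.
rewrite (@dwedge_mul x _ (fun q => (c q)%:A)) => [|g q].
  by congr (_ *: _); rewrite -(rmorph_prod (in_alg A)).
by rewrite ffunE (derivationZ (s := idfun) (dwedge_derivation g q)).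
Qed.

Lemma dwedge_exp (x : {ffun 'I_k -> A}) (m : 'I_k -> nat) :
  dwedge [ffun q => x q ^+ m q] = (\prod_q (x q ^+ (m q).-1 *+ m q)) *: dwedge x.
Proof.
rewrite (@dwedge_mul x _ (fun q => x q ^+ (m q).-1 *+ m q)) // => g q.
by rewrite ffunE (derivationX (s := idfun) (dwedge_derivation g q)).
Qed.

End WedgeProduct.

Section LocalNilpotency.
Variables (K : fieldType) (A : comAlgType K).
Variables (gT : finGroupType) (rho : gT -> {lrmorphism A -> A}).
Hypotheses (act : is_algebra_action rho).

(** The monic equation of [r] over the invariants. *)
Definition orbit_poly (r : A) : {poly A} := \prod_g ('X - (rho g r)%:P).

Lemma orbit_poly_invariant r i : invariant_elt rho (orbit_poly r)`_i.
Proof.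
move=> h; have {2}<- : map_poly (rho h) (orbit_poly r) = orbit_poly r.
  rewrite rmorph_prod /orbit_poly [RHS](reindex_inj (mulIg h)); apply: eq_bigr => g _.
  by rewrite rmorphB /= map_polyX map_polyC /= (act_mul act).
by rewrite coef_map.
Qed.

Lemma orbit_poly_root r : r ^+ #|gT| = \sum_(i < #|gT|) - (orbit_poly r)`_i * r ^+ i.
Proof.
have sP : size (orbit_poly r) = #|gT|.+1.
  by rewrite size_prod_XsubC -sum1_size sum1_card.
have mP : orbit_poly r \is monic by apply: monic_prod_XsubC.
have : (orbit_poly r).[r] = 0.
  by rewrite horner_prod (bigD1 1%g) //= hornerXsubC (act_one act) subrr mul0r.
rewrite horner_coef sP big_ord_recr /=.
have -> : (orbit_poly r)`_#|gT| = 1 by have := monicP mP; rewrite lead_coefE sP.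
rewrite mul1r => /eqP; rewrite addrC addr_eq0 => /eqP ->; rewrite -sumrN.
by apply: eq_bigr => i _; rewrite mulNr.
Qed.

Variables (e : {rmorphism A -> K}) (eA : forall c, e c%:A = c).

(** If [r] vanishes on the whole orbit of the point, its orbit polynomial reduces to a power of X
    there, so the lower coefficients vanish at the point. *)
Lemma orbit_power r : (forall g, e (rho g r) = 0) ->
  exists c : 'I_#|gT| -> A, (forall i, invariant_elt rho (c i) /\ e (c i) = 0) /\
    r ^+ #|gT| = \sum_i c i * r ^+ i.
Proof.
move=> er; exists (fun i => - (orbit_poly r)`_i); split=> [i|]; last exact: orbit_poly_root.
split=> [h|]; first by rewrite rmorphN /= orbit_poly_invariant.
have Ee : map_poly e (orbit_poly r) = 'X^#|gT|.
  rewrite rmorph_prod (eq_bigr (fun _ => 'X)) => [|g _]; first by rewrite prodr_const.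
  by rewrite rmorphB /= map_polyX map_polyC /= er subr0.
have := coef_map e (orbit_poly r) i; rewrite Ee coefXn; have := ltn_ord i.
by rewrite ltn_neqAle => /andP [/negPf -> _]; rewrite rmorphN => <-; rewrite oppr0.
Qed.

Variables (N : nat) (x : 'I_N -> A) (gen : generates x).
Variables (J : A -> Prop) (idJ : is_ideal J) (E : nat).
Hypothesis JE : forall r, (forall g, e (rho g r) = 0) -> J (r ^+ E).
Variable a0 : A.
Hypothesis ga0 : forall g, ~ inertia rho e g -> e (rho g a0) = 0.

(** Each [a0 * (x i - e (x i))] vanishes on the whole orbit. An element of the [L]-th power of the
    maximal ideal times [a0 ^+ L] is a combination of products of [L] of these, and with more than
    [N * E] factors one of the [N] occurs at least [E] times. *)
Lemma cutoff_power L y : (N * E < L)%N -> npow e L y -> J (a0 ^+ L * y).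
Proof.
pose r i := a0 * (x i - (e (x i))%:A).
have Jr i : J (r i ^+ E).
  apply: JE => g; rewrite /r rmorphM rmorphM /=.
  have [gH|gH] := pselect (inertia rho e g); last by rewrite ga0 // mul0r.
  by rewrite [X in _ * X]gH rmorphB eA subrr mulr0.
(* The monomial in [r] records the factors already split off from [y], each paired with one factor
   [a0]. *)
suff main m : npow e L y -> (N * E < mdeg m + L)%N ->
    J (ev r 'X_[m] * (a0 ^+ L * y)).
  move=> NL Ly; have := main 0%MM Ly; rewrite mdeg0 => /(_ NL).
  by rewrite mpolyX0 rmorph1 mul1r.
move=> Ly; elim: Ly m => {L y} [y|L z y ez Ly IH|L z y _ IHz _ IHy] m.
- rewrite addn0 => Nm; have [i Ei] : exists i, (E <= m i)%N.
    apply: contrapT => none; move: Nm; rewrite ltnNge mdegE; case/negP.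
    apply: (@leq_trans (\sum_(i < N) E)); last by rewrite sum_nat_const card_ord.
    apply: leq_sum => i _; rewrite leqNgt; apply/negP => iE; apply: none.
    by exists i; apply: ltnW.
  apply: (ideal_mulr _ idJ); rewrite evXm (bigD1 i) //=.
  apply: (ideal_mulr _ idJ); rewrite -(subnK Ei) exprD.
  exact: (idealMl idJ).
- move=> NL; have [b Eb] := kernel_generators eA gen z.
  rewrite {1}Eb ez scale0r add0r mulr_suml mulr_sumr mulr_sumr.
  refine (@ideal_sum _ _ _ _ _ _ idJ _) => i _.
  have -> : ev r 'X_[m] * (a0 ^+ L.+1 * (b i * (x i - (e (x i))%:A) * y)) =
      b i * (ev r 'X_[m + U_(i)] * (a0 ^+ L * y)).
    by rewrite mpolyXD rmorphM /= evX exprS /r; ring.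
  by apply: (idealMl idJ); apply: IH; rewrite mdegD mdeg1 addn1 addSnnS.
- by move=> NL; rewrite !mulrDr; apply: (idealD idJ); [apply: IHz | apply: IHy].
Qed.

End LocalNilpotency.

Section LocalForms.
Variables (K : fieldType) (char0 : [pchar K] =i pred0) (A : comAlgType K).
Variables (gT : finGroupType) (rho : gT -> {lrmorphism A -> A}).
Hypotheses (act : is_algebra_action rho) (ftA : finite_type A).
Variables (e : {rmorphism A -> K}) (eA : forall c, e c%:A = c).
Variables (n : nat) (u : 'I_n -> A) (chi : 'I_n -> gT -> K).
Hypotheses (uP : coordinates rho e u chi) (axes : axes_monoid (trivial_weight rho e chi)).
Variables (k : nat) (mu : kahler_form A k -> K).
Hypothesis mu_lin : forall (c : K) v w, mu (c%:A *: v + w) = c * mu v + mu w.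
Hypothesis mu_inv : forall b w, invariant_elt rho b -> mu (b *: w) = e b * mu w.
Hypothesis mu_act : forall g w, mu (pullback (rho g) w) = mu w.
Hypothesis mu_im : forall f (g : {ffun 'I_k -> A}), invariant_elt rho f ->
  (forall q, invariant_elt rho (g q)) -> mu (f *: dwedge g) = 0.

Let muD v w : mu (v + w) = mu v + mu w.
Proof. by have := mu_lin 1 v w; rewrite !scale1r mul1r. Qed.
Let mu0 : mu 0 = 0.
Proof. by apply: (addrI (mu 0)); rewrite -muD !addr0. Qed.
Let muZ c v : mu (c%:A *: v) = c * mu v.
Proof. by have := mu_lin c v 0; rewrite mu0 !addr0. Qed.
Let mu_sum (I : Type) (r : seq I) (P : pred I) (F : I -> kahler_form A k) :
  mu (\sum_(i <- r | P i) F i) = \sum_(i <- r | P i) mu (F i).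
Proof. exact: (big_morph mu muD mu0). Qed.

(* Some multiple of a power of the maximal ideal kills [mu], so it is enough   *)
(* to treat monomial forms u^(m - 1_I) du_I. Those of nontrivial weight average *)
(* to zero; the others are, by [axes], pulled back up to high order.            *)
Lemma functional_vanish w : mu w = 0.
Proof.
have [N [x gen]] := (finite_typeP A).1 ftA.
have [a0 [ia0 ea0 ga0]] := separating_element act eA.
pose J a := forall w, mu (a *: w) = 0.
have idJ : is_ideal J.
  split=> [v|a b Ja Jb v|a b Jb v]; first by rewrite scale0r mu0.
    by rewrite scalerDl muD Ja Jb addr0.
  by rewrite mulrC -scalerA Jb.
have JE r : (forall g, e (rho g r) = 0) -> J (r ^+ #|gT|).
  move=> /(orbit_power act) [c [cP ->]] v; rewrite scaler_suml mu_sum big1 // => i _.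
  by have [ic ec] := cP i; rewrite -scalerA mu_inv // ec mul0r.
pose L := (N * #|gT|).+1.
have JL := cutoff_power eA gen idJ JE ga0 (ltnSn (N * #|gT|)).
(* Multiplied by [a0 ^+ L], the functional depends only on finite jets at the point. *)
pose nu v := mu (a0 ^+ L *: v).
have nuD v v' : nu (v + v') = nu v + nu v' by rewrite /nu scalerDr muD.
have nu0 : nu 0 = 0 by rewrite /nu scaler0 mu0.
have nu_npow y v : npow e L y -> nu (y *: v) = 0.
  by move=> /JL Jy; rewrite /nu scalerA Jy.
have nu_sum (I : Type) (r : seq I) (P : pred I) (F : I -> kahler_form A k) :
    nu (\sum_(i <- r | P i) F i) = \sum_(i <- r | P i) nu (F i).
  exact: (big_morph nu nuD nu0).
have nuN v : nu (- v) = - nu v.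
  by apply/eqP; rewrite -subr_eq0 opprK -nuD addNr nu0.
(* The invariant [s] has value the order of inertia at the point, hence nonzero. As [mu] is
   invariant, [e s * mu w] is a sum of values of [nu] on translates of [w], so vanishing of [nu]
   suffices. *)
pose s := \sum_g rho g (a0 ^+ L).
have is_ : invariant_elt rho s := sum_act_invariant act (a0 ^+ L).
have es : e s != 0.
  rewrite rmorph_sum (bigID (mem (inertia_set rho e))) /= [X in _ + X]big1 => [|g gH].
    rewrite addr0 (eq_bigr (fun _ => 1)) => [|g /inertia_setP ->].
      by rewrite sumr_const; apply: (inertia_card_neq0 char0 act).
    by rewrite rmorphXn ea0 expr1n.
  rewrite !rmorphXn /= ga0 ?expr0n // => gH'; case/negP: gH; exact/inertia_setP.
have pullK g (v : kahler_form A k) : pullback (rho g) (pullback (rho g^-1%g) v) = v.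
  rewrite -pullback_act // mulVg; elim/form_ind: v => [|a h v IH]; first by rewrite pullback0.
  rewrite pullback_dwedge IH (act_one act); congr (_ *: dwedge _ + _).
  by apply/ffunP => q; rewrite ffunE (act_one act).
suff nu_all v : nu v = 0.
  apply: (mulfI es); rewrite mulr0 -mu_inv // /s scaler_suml mu_sum big1 // => g _.
  rewrite -{1}[w](pullK g) -pullbackZ mu_act; exact: nu_all.
(* By the Leibniz rule a differential lowers the order of vanishing by at most one. *)
have nu_derivation g q f b r : npow e b r -> forall a y, npow e a y -> (L < a + b)%N ->
    nu ((f * y) *: dwedge (fupd g q r)) = 0.
  have der := dwedge_derivation g q.
  elim=> {b r} [r|b z r ez br IH|b z r _ IHz _ IHr] a y ay Lab.
  - apply: nu_npow; apply: npow_mull; apply: npow_le ay; move: Lab.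
    by rewrite addn0; apply: ltnW.
  - rewrite (derivationM der) scalerDr nuD !scalerA.
    have -> : f * y * z = f * (z * y) by rewrite -mulrA [y * z]mulrC.
    rewrite (IH a.+1); [|exact: NpowM|by rewrite addSnnS].
    rewrite add0r nu_npow // -mulrA; apply: npow_mull.
    by apply: (@npow_le _ _ _ _ (a + b)); [rewrite -ltnS -addnS|apply: npow_mul].
  - by rewrite (derivationD (s := idfun) der) scalerDr nuD (IHz a) // (IHr a) // addr0.
have nu_small g q f r : npow e L.+1 r -> nu (f *: dwedge (fupd g q r)) = 0.
  move=> Lr; have := nu_derivation g q f _ _ Lr 0%N 1 (Npow0 _ _).
  by rewrite mulr1 add0n; apply.
suff nu_coord (t : 'I_k -> 'I_n) f : nu (f *: dwedge [ffun q => u (t q)]) = 0.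
  have nu_gen d (g : {ffun 'I_k -> A}) :
      (forall q : 'I_k, (d <= q)%N -> exists i, g q = u i) ->
      forall f, nu (f *: dwedge g) = 0.
    elim: d g => [|d IH] g gu f.
      have [t tE] := choice (fun q => gu q (leq0n q)).
      have -> : g = [ffun q => u (t q)] by apply/ffunP => q; rewrite ffunE.
      exact: nu_coord.
    have [kd|dk] := leqP k d.
      by apply: IH => q dq; have := ltn_ord q; rewrite ltnNge (leq_trans kd).
    pose q0 := Ordinal dk; rewrite -(fupd_id g q0).
    have der := dwedge_derivation g q0.
    have [p Lp] := npow_approx eA uP L.+1 (g q0).
    rewrite -(subrK (ev u p) (g q0)) (derivationD (s := idfun) der) scalerDr nuD.
    rewrite nu_small // add0r (derivation_ev (s := idfun) _ _ der) scaler_sumr nu_sum.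
    rewrite big1 // => i _; rewrite scalerA; apply: IH => q dq; rewrite ffunE.
    case: eqP => [_|/eqP ne]; first by exists i.
    by apply: gu; rewrite ltn_neqAle dq andbT; apply: contraNneq ne => E; apply/eqP/val_inj.
  elim/form_ind: v => [|a g v IH]; first exact: nu0.
  by rewrite nuD IH addr0; apply: (nu_gen k) => q; rewrite leqNgt ltn_ord.
have nuZ c v' : nu (c%:A *: v') = c * nu v'.
  by rewrite /nu scalerA mulrC -scalerA muZ.
(* Inertia-invariant entries are replaced one at a time by global invariants that approximate them.
   Once all entries are global, averaging the factor [a0 ^+ L] over the group gives a form killed by
   [mu_im]. *)
have nu_inertia d (g : {ffun 'I_k -> A}) : (forall q, inertia_invariant rho e (g q)) ->
    (forall q : 'I_k, (d <= q)%N -> invariant_elt rho (g q)) ->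
    forall f', invariant_elt rho f' -> nu (f' *: dwedge g) = 0.
  elim: d g => [|d IH] g jg ig f' if'.
    apply: (mulfI (card_neq0 char0 gT)); rewrite mulr0 mulr_natl -sumr_const.
    rewrite (eq_bigr (fun h => mu (rho h (a0 ^+ L) *: (f' *: dwedge g)))) => [|h _].
      rewrite -mu_sum -scaler_suml scalerA; apply: mu_im => [|q]; last exact: ig.
      exact: invariant_eltM.
    rewrite -[LHS](mu_act h) pullbackZ; congr (mu (_ *: _)).
    have := pullback_dwedge (rho h) f' g 0; rewrite pullback0 !addr0 => ->.
    rewrite if'; congr (_ *: dwedge _); apply/ffunP => q; rewrite ffunE; exact: ig.
  have [kd|dk] := leqP k d.
    by apply: IH => // q dq; have := ltn_ord q; rewrite ltnNge (leq_trans kd).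
  pose q0 := Ordinal dk; rewrite -(fupd_id g q0).
  have [y [iy Ly]] := invariant_approximation char0 act eA L.+1 (jg q0).
  have der := dwedge_derivation g q0.
  rewrite -[g q0](subKr y) (derivationB (s := idfun) der) scalerBr.
  rewrite nuD nuN (nu_small _ _ _ _ Ly) oppr0 addr0.
  apply: IH => // [q|q dq]; rewrite ffunE; case: eqP => // ne.
    by move=> h _; apply: iy.
  apply: ig; rewrite ltn_neqAle dq andbT.
  by apply: contra_notN ne => /eqP E; apply: val_inj.
have [p Lp] := npow_approx eA uP L f.
rewrite -(subrK (ev u p) f) scalerDl nuD nu_npow // add0r.
rewrite [p]mpolyE rmorph_sum scaler_suml nu_sum big1 // => m _.
rewrite /= linearZ /= -mulr_algl -scalerA nuZ.
suff -> : nu (ev u 'X_[m] *: dwedge [ffun q => u (t q)]) = 0 by rewrite mulr0.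
have [inj_t|ninj] := pselect (injective t); last first.
  have [q [r [qr Er]]] : exists q r, q != r /\ t q = t r.
    apply: contrapT => none; apply: ninj => q r E; apply/eqP; apply: contrapT => /negP qr.
    by apply: none; exists q, r.
  by rewrite (dwedge_alt qr) ?ffunE ?Er // scaler0 nu0.
(* The exponent of the weight of u^m du_t. If this weight is nontrivial, some inertia element scales
   the value of [nu] by a factor other than 1. *)
pose mt := (m + \big[+%MM/0%MM]_q U_(t q))%MM.
have [tmt|nt] := pselect (trivial_weight rho e chi mt); last first.
  move/existsNP: nt => [h /not_implyP [hH hne]].
  have chiE : weight chi (\big[+%MM/0%MM]_q U_(t q))%MM h = \prod_q chi (t q) h.
    elim/big_ind2: _ => [|y y' z z' Ey Ez|q _].
    - by rewrite /weight big1 // => i _; rewrite mnm0E.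
    - by rewrite weightD Ey Ez.
    - by have := weightU chi (t q) 1 h; rewrite mulm1n expr1.
  have := mu_act h (a0 ^+ L *: (ev u 'X_[m] *: dwedge [ffun q => u (t q)])).
  rewrite pullbackZ.
  have := pullback_dwedge (rho h) (ev u 'X_[m]) [ffun q => u (t q)] 0.
  rewrite pullback0 !addr0 => ->.
  have -> : [ffun q => rho h ([ffun q0 => u (t q0)] q)] =
      [ffun q => chi (t q) h *: [ffun q0 => u (t q0)] q] :> {ffun 'I_k -> A}.
    by apply/ffunP => q; rewrite !ffunE (coords_act uP).
  rewrite dwedge_scale (act_monomial uP) // rmorphXn /= ia0 // -[_ *: ev _ _]mulr_algl.
  rewrite -[(_ * ev _ _) *: _]scalerA [ev _ _ *: (_ *: _)]scalerA [ev _ _ * _]mulrC.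
  rewrite -[(_ * ev _ _) *: _]scalerA -!/(nu _).
  rewrite !nuZ mulrA -chiE -weightD => E.
  have /eqP := congr1 (fun z => z - nu (ev u 'X_[m] *: dwedge [ffun q => u (t q)])) E.
  rewrite subrr -{2}[nu _]mul1r -mulrBl mulf_eq0 subr_eq0 => /orP [/eqP //|/eqP //].
have mtE q : mt (t q) = (m (t q)).+1.
  rewrite mnmDE mnm_sumE (bigD1 q) //= mnm1E eqxx big1 ?addn0 ?addn1 // => r rq.
  by rewrite mnm1E (inj_eq inj_t) (negPf rq).
have mtE' i : i \notin codom t -> mt i = m i.
  move=> it; rewrite mnmDE mnm_sumE big1 ?addn0 // => q _; rewrite mnm1E.
  by case: eqP => // E; rewrite -E codom_f in it.
(* By [axes], u^m0 and each [z q], a power of u_{t q} with exponent m_{t q} + 1, are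
   inertia-invariant, and u^m0 dz is u^m du_t up to the product of these exponents, invertible in
   characteristic 0. *)
pose m0 := (\big[+%MM/0%MM]_(i | i \notin codom t) (U_(i) *+ m i))%MM.
have tm0 : trivial_weight rho e chi m0.
  apply: (big_ind (trivial_weight rho e chi)) => [|a b|i it].
  - exact: trivial_weight0.
  - exact: trivial_weightD.
  by rewrite -mtE' //; apply: axes.
pose z : {ffun 'I_k -> A} := [ffun q => [ffun q0 => u (t q0)] q ^+ (m (t q)).+1].
have uX i d : ev u 'X_[U_(i) *+ d] = u i ^+ d by rewrite -mpolyXn rmorphXn /= evX.
have jz q : inertia_invariant rho e (z q).
  rewrite !ffunE -mtE -uX; apply: (trivial_weight_monomial uP); exact: axes.
have j0 : inertia_invariant rho e (ev u 'X_[m0]) by apply: (trivial_weight_monomial uP).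
have zero : nu (ev u 'X_[m0] *: dwedge z) = 0.
  have [y [iy Ly]] := invariant_approximation char0 act eA L j0.
  rewrite -[ev u _](subKr y) scalerBl nuD nuN (nu_npow _ _ Ly) oppr0 addr0.
  by apply: (nu_inertia k) => // q; rewrite leqNgt ltn_ord.
move: zero; rewrite dwedge_exp scalerA.
have -> : ev u 'X_[m0] * \prod_q ([ffun q0 => u (t q0)] q ^+ (m (t q)).+1.-1 *+ (m (t q)).+1)
   = (\prod_q ((m (t q)).+1)%:R : K)%:A * ev u 'X_[m].
  rewrite (eq_bigr (fun q => ((m (t q)).+1)%:R * u (t q) ^+ m (t q))) => [|q _]; last first.
    by rewrite ffunE -mulr_natl.
  rewrite big_split /= mulrCA; congr (_ * _).
    rewrite -[RHS]/(in_alg A _) rmorph_prod; apply: eq_bigr => q _.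
    by rewrite /= scaler_nat.
  rewrite [in RHS]evXm (bigID (fun i => i \in codom t)) /= mulrC; congr (_ * _).
    rewrite [RHS](eq_bigl (fun i => i \in t @: [set: 'I_k])) => [|i].
      rewrite big_imset /=; last by move=> q r _ _; apply: inj_t.
      by apply: eq_bigl => q; rewrite inE.
    by apply/codomP/imsetP => [[q ->]|[q _ ->]]; exists q.
  rewrite /m0; elim/big_ind2: _ => [|y y' z1 z2 <- <-|i _]; last exact: uX.
    by rewrite mpolyX0 rmorph1.
  by rewrite mpolyXD rmorphM.
rewrite -scalerA nuZ => /eqP; rewrite mulf_eq0 => /orP [|/eqP //].
move/pcharf0P: char0 => char0' /prodf_eq0 [q _].
by rewrite char0'.
Qed.

End LocalForms.

(** * Invariants near a point *)

(* A derivation of the invariants at the point [e], extended linearly to A. *)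
Record inv_derivation (K : fieldType) (A : comAlgType K) (gT : finGroupType)
    (rho : gT -> {lrmorphism A -> A}) (e nu : A -> K) : Prop := InvDerivation {
  inv_derivationL : forall c a b, nu (c *: a + b) = c * nu a + nu b;
  inv_derivationM : forall a b, invariant_elt rho a -> invariant_elt rho b ->
    nu (a * b) = e a * nu b + e b * nu a }.

Section InvDerivationTheory.
Variables (K : fieldType) (A : comAlgType K) (gT : finGroupType).
Variables (rho : gT -> {lrmorphism A -> A}) (e : {rmorphism A -> K}).
Hypothesis eA : forall c, e c%:A = c.
Variables (nu : A -> K) (nuP : inv_derivation rho e nu).

Lemma inv_derivationD a b : nu (a + b) = nu a + nu b.
Proof. by have := inv_derivationL nuP 1 a b; rewrite scale1r mul1r. Qed.
Lemma inv_derivation0 : nu 0 = 0.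
Proof. by apply: (addrI (nu 0)); rewrite -inv_derivationD !addr0. Qed.
Lemma inv_derivationZ c a : nu (c *: a) = c * nu a.
Proof. by rewrite -[c *: a]addr0 (inv_derivationL nuP) inv_derivation0 addr0. Qed.
Lemma inv_derivation_sum (I : Type) (r : seq I) (P : pred I) (F : I -> A) :
  nu (\sum_(i <- r | P i) F i) = \sum_(i <- r | P i) nu (F i).
Proof. by apply: (big_morph nu inv_derivationD inv_derivation0). Qed.
Lemma inv_derivation1 : nu 1 = 0.
Proof.
have := inv_derivationM nuP (invariant_elt1 rho) (invariant_elt1 rho).
rewrite mulr1 rmorph1 mul1r => E; by apply: (addrI (nu 1)); rewrite -E addr0.
Qed.

Lemma ev_invariant n (y : 'I_n -> A) q :
  (forall i, invariant_elt rho (y i)) -> invariant_elt rho (ev y q).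
Proof.
move=> iy; elim/mpoly_gen_ind: q => [|c q r iq ir|i q iq].
- by rewrite rmorph1; apply: invariant_elt1.
- by rewrite linearP; apply: invariant_eltL.
- by rewrite rmorphM /= evX; apply: invariant_eltM.
Qed.

Lemma point_ev n (y : 'I_n -> A) q : (forall i, e (y i) = 0) -> e (ev y q) = q@_0%MM.
Proof.
move=> ey; elim/mpoly_gen_ind: q => [|c q r Eq Er|i q Eq].
- by rewrite (rmorph1 (ev y)) (rmorph1 e) mcoeff1 eqxx.
- by rewrite linearP rmorphD (point_scale eA) mcoeffD mcoeffZ Eq Er.
- rewrite rmorphM rmorphM /= evX ey mul0r; symmetry.
  by apply: (high_degreeM (@high_degreeU K n i) (high_degree0 q)); rewrite mdeg0.
Qed.

Lemma inv_derivation_ev n (y : 'I_n -> A) q : (forall i, invariant_elt rho (y i)) ->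
  (forall i, e (y i) = 0) -> nu (ev y q) = \sum_i q@_(U_(i))%MM * nu (y i).
Proof.
move=> iy ey; elim/mpoly_gen_ind: q => [|c q r Eq Er|i q Eq].
- rewrite rmorph1 inv_derivation1 big1 // => i _.
  by rewrite mcoeff1 mnm1_eq0 mul0r.
- rewrite linearP (inv_derivationL nuP) Eq Er mulr_sumr -big_split.
  by apply: eq_bigr => i _; rewrite mcoeffD mcoeffZ mulrDl mulrA.
- rewrite rmorphM /= evX (inv_derivationM nuP) ?ey ?mul0r ?add0r //; last exact: ev_invariant.
  rewrite point_ev //.
  have coefE j : ('X_i * q)@_(U_(j))%MM = if j == i then q@_0%MM else 0.
    rewrite mulrC; case: eqP => [->|/eqP ji].
      by have := mcoeffMX q U_(i)%MM 0%MM; rewrite addm0.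
    apply/eqP; apply: contrapT => /negP /mcoeffM_neq0 [m1 [m2 [E _]]].
    rewrite mcoeffX; have [Em2 _|_] := U_(i)%MM =P m2; last by rewrite eqxx.
    have := congr1 (fun m : 'X_{1..n} => m i) E.
    by rewrite /= mnmDE -Em2 !mnm1E eqxx (negPf ji) addn1.
  rewrite (bigD1 i) //= coefE eqxx big1 ?addr0 // => j ji.
  by rewrite coefE (negPf ji) mul0r.
Qed.

End InvDerivationTheory.

Section LocalInvariants.
Variables (K : fieldType) (char0 : [pchar K] =i pred0) (A : comAlgType K).
Variables (gT : finGroupType) (rho : gT -> {lrmorphism A -> A}).
Hypotheses (act : is_algebra_action rho) (ftA : finite_type A).
Hypothesis smA : formally_smooth A.
Variables (e : {rmorphism A -> K}) (eA : forall c, e c%:A = c).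
Variables (n : nat) (u : 'I_n -> A) (chi : 'I_n -> gT -> K).
Hypotheses (uP : coordinates rho e u chi).

Local Notation S := (trivial_weight rho e chi).

(** A derivation at the point kills products of two invariants vanishing there, hence, by
    [orbit_power] used twice, all multiples of 2|G|-th powers of functions vanishing on the orbit;
    [cutoff_power] turns this into a bound independent of [nu]. *)
Lemma inv_derivation_npow : exists L, forall nu, inv_derivation rho e nu ->
  (forall g a, nu (rho g a) = nu a) -> forall b, invariant_elt rho b -> npow e L b -> nu b = 0.
Proof.
have [N [x gen]] := (finite_typeP A).1 ftA.
have [a0 [ia0 ea0 ga0]] := separating_element act eA.
pose L := (N * (#|gT| + #|gT|)).+1; exists L => nu nuP nu_act b ib Lb.
have nuR a : nu (reynolds rho a) = nu a.
  rewrite /reynolds (inv_derivationZ nuP) (inv_derivation_sum nuP).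
  under eq_bigr do rewrite nu_act.
  by rewrite sumr_const -[nu a *+ _]mulr_natl mulrA mulVf ?mul1r ?(card_neq0 char0).
pose J a := forall a', nu (a * a') = 0.
have idJ : is_ideal J.
  split=> [a|a a' Ja Ja' c|a a' Ja c]; first by rewrite mul0r (inv_derivation0 nuP).
    by rewrite mulrDl (inv_derivationD nuP) Ja Ja' addr0.
  by rewrite mulrAC mulrC; apply: Ja.
have JE r : (forall g, e (rho g r) = 0) -> J (r ^+ (#|gT| + #|gT|)).
  move=> /(orbit_power act) [c [cP Er]]; rewrite exprD Er mulr_suml.
  refine (@ideal_sum _ _ _ _ _ _ idJ _) => i _; rewrite mulr_sumr.
  refine (@ideal_sum _ _ _ _ _ _ idJ _) => j _ a'.
  have [[ci eci] [cj ecj]] := (cP i, cP j).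
  rewrite -nuR (_ : _ * a' = c i * (c j * (r ^+ i * r ^+ j * a'))); last by ring.
  rewrite (reynoldsMl _ ci) (reynoldsMl _ cj); set w := reynolds rho _.
  have iw : invariant_elt rho w by apply: (reynolds_invariant act).
  rewrite (inv_derivationM nuP) //; last exact: invariant_eltM.
  by rewrite rmorphM eci ecj !mul0r addr0.
have Jb := cutoff_power eA gen idJ JE ga0 (ltnSn _) Lb.
pose s := \sum_g rho g (a0 ^+ L).
have is_ : invariant_elt rho s := sum_act_invariant act (a0 ^+ L).
have es : e s != 0.
  rewrite rmorph_sum (bigID (mem (inertia_set rho e))) /= [X in _ + X]big1 => [|g gH].
    rewrite addr0 (eq_bigr (fun _ => 1)) => [|g /inertia_setP ->].
      by rewrite sumr_const; apply: (inertia_card_neq0 char0 act).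
    by rewrite rmorphXn ea0 expr1n.
  rewrite !rmorphXn /= ga0 ?expr0n // => gH'; case/negP: gH; exact/inertia_setP.
have eb : e b = 0 by apply: npow_eps Lb.
apply: (mulfI es); rewrite mulr0.
have := inv_derivationM nuP is_ ib; rewrite eb mul0r addr0 => <-.
rewrite mulr_suml (inv_derivation_sum nuP) big1 // => g _.
by rewrite -[b](ib g) -rmorphM nu_act -[_ * b]mulr1.
Qed.

(** A cross term in the product of two invariants without constant terms would decompose the
    irreducible [m] into two nonzero trivial weights; only the two products with a constant term
    remain. *)
Lemma jet_derivation M (Q : comAlgType K) (p : {lrmorphism {mpoly K[n]} -> Q})
    (f : {lrmorphism A -> Q}) (fP : expansion e u M p f) m :
  irreducible_monomial S m -> (mdeg m < M)%N ->
  inv_derivation rho e (fun a => exp_coef fP m (f a)).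
Proof.
move=> [m0 irr] mM; split=> [c a b|a b ia ib].
  by rewrite linearP (exp_coefL fP).
have jP c : invariant_elt rho c -> inertia_invariant rho e c by move=> ic h _; apply: ic.
have [[x Ex] [y Ey]] := (exp_onto fP (f a), exp_onto fP (f b)).
have M0 : (mdeg (0%MM : 'X_{1..n}) < M)%N by rewrite mdeg0 (leq_ltn_trans _ mM).
have cst c z : p z = f c -> z@_0%MM = e c.
  move=> Ez; rewrite -(exp_coefE fP z M0) Ez.
  have -> : f c = e c *: p 1 + f (c - (e c)%:A).
    by rewrite linearB linearZ /= !rmorph1 addrC subrK.
  rewrite (exp_coefL fP) // (exp_coefE fP) // mcoeff1 eqxx mulr1.
  rewrite (exp_npow_coef fP (L := 1) _ _ M0) ?mdeg0 // ?addr0 //.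
  by apply/npow1; rewrite rmorphB eA subrr.
have [Ex0 Ey0] := (cst _ _ Ex, cst _ _ Ey).
have supp c z s : invariant_elt rho c -> p z = f c -> (mdeg s < M)%N -> z@_s != 0 -> S s.
  move=> ic Ez sM; rewrite -(exp_coefE fP z sM) Ez.
  exact: (exp_support eA uP (jP _ ic) sM).
rewrite rmorphM /= -Ex -Ey -rmorphM !(exp_coefE fP) //.
have -> : x * y = (x - (e a)%:MP) * (y - (e b)%:MP) + e a *: y + e b *: x - (e a * e b)%:MP.
  by rewrite mpolyCM -!mul_mpolyC; ring.
rewrite !(mcoeffB, mcoeffD) !mcoeffZ mcoeffC.
have -> : (m == 0%MM) = false by apply/eqP.
rewrite mulr0 subr0; suff -> : ((x - (e a)%:MP) * (y - (e b)%:MP))@_m = 0 by rewrite add0r.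
apply/eqP; apply: contrapT => /negP /mcoeffM_neq0 [m1 [m2 [Em x1 y2]]].
have m1M : (mdeg m1 < M)%N by apply: leq_ltn_trans mM; rewrite Em mdegD leq_addr.
have m2M : (mdeg m2 < M)%N by apply: leq_ltn_trans mM; rewrite Em mdegD leq_addl.
have nz (c : K) (z : {mpoly K[n]}) s : z@_0%MM = c -> (z - c%:MP)@_s != 0 -> s <> 0%MM /\ z@_s != 0.
  move=> Ec; rewrite mcoeffB mcoeffC; have [->|ns] := s =P 0%MM.
    by rewrite mulr1 Ec subrr eqxx.
  by rewrite mulr0 subr0.
have [n1 x1'] := nz _ _ _ Ex0 x1; have [n2 y2'] := nz _ _ _ Ey0 y2.
by case: (irr _ _ (supp _ _ _ ia Ex m1M x1') (supp _ _ _ ib Ey m2M y2') Em).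
Qed.

(** The least positive multiple on the axis; the bound by the order of the group is what makes the
    order of truncation explicit later. *)
Lemma axis_order i : exists d, [/\ (0 < d)%N, (d <= #|gT|)%N, S (U_(i) *+ d)%MM &
  irreducible_monomial S (U_(i) *+ d)%MM].
Proof.
have exd : exists d, (0 < d)%N && `[< S (U_(i) *+ d)%MM >].
  exists #|gT|; apply/andP; split; first by apply/card_gt0P; exists 1%g.
  by apply/asboolP; apply: (trivial_weightU act uP).
case: (ex_minnP exd) => d /andP [d0 /asboolP Sd] mind; exists d; split=> //.
  apply: mind; apply/andP; split; first by apply/card_gt0P; exists 1%g.
  by apply/asboolP; apply: (trivial_weightU act uP).
split=> [z|a b Sa Sb Eab].
  by have := congr1 (fun m : 'X_{1..n} => m i) z; rewrite mulmnE mnm1E eqxx mul1n mnm0E; case: d d0 {Sd mind z}.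
have axis (a' b' : 'X_{1..n}) : (U_(i) *+ d = a' + b')%MM -> a' = (U_(i) *+ a' i)%MM.
  move=> E; apply/mnmP => j; rewrite mulmnE mnm1E; case: eqP => [<-|/eqP ij].
    by rewrite mul1n.
  have := congr1 (fun m : 'X_{1..n} => m j) E.
  rewrite mulmnE mnm1E (negPf ij) mnmDE => /esym/eqP.
  by rewrite addn_eq0 => /andP [/eqP -> _].
have Ea := axis _ _ Eab.
have Eb : b = (U_(i) *+ b i)%MM by apply: (axis b a); rewrite addmC.
have Ed := congr1 (fun m : 'X_{1..n} => m i) Eab.
rewrite mulmnE mnm1E eqxx mul1n mnmDE in Ed.
have [a0|a0] := posnP (a i); first by left; rewrite Ea a0 mulm0n.
have [b0|b0] := posnP (b i); first by right; rewrite Eb b0 mulm0n.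
have : (d <= a i)%N by apply: mind; rewrite a0; apply/asboolP; rewrite -Ea.
by rewrite Ed -{2}[a i]addn0 leq_add2l leqNgt b0.
Qed.

(* When the monoid is generated on the axes, the invariants have the local    *)
(* coordinates [y i], which expand to [u i ^ d i].                            *)
Lemma free_coordinates M0 : axes_monoid S ->
  exists (M : nat) (Q : comAlgType K) (p : {lrmorphism {mpoly K[n]} -> Q})
    (f : {lrmorphism A -> Q}) (y : 'I_n -> A) (d : 'I_n -> nat) (delta : 'I_n -> A -> K),
  [/\ (M0 <= M)%N, expansion e u M p f,
      forall i, [/\ (0 < d i)%N, (d i <= #|gT|)%N, invariant_elt rho (y i),
                    e (y i) = 0 & f (y i) = p ('X_i ^+ d i)],
      forall i, inv_derivation rho e (delta i) /\ forall j, delta i (y j) = (i == j)%:R &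
      forall nu, inv_derivation rho e nu -> (forall g a, nu (rho g a) = nu a) ->
        forall b, invariant_elt rho b -> nu b = \sum_i delta i b * nu (y i)].
Proof.
move=> axes; have [L Lnu] := inv_derivation_npow.
have [d dP] := choice axis_order.
(* Large enough for the requested order, for the vanishing bound [L], and for every exponent [d i]
   to be visible. *)
pose M := (maxn M0 (maxn L #|gT|)).+2.
have M0M : (M0 <= M)%N by rewrite /M !leqW // leq_maxl.
have LM : (L <= M)%N by rewrite /M !leqW // leq_max leq_maxl orbT.
have GM : (#|gT| < M)%N by rewrite /M ltnS leqW // !leq_max leqnn !orbT.
have [Q [p [f fP]]] := exists_expansion smA eA uP (maxn M0 (maxn L #|gT|)).
rewrite -/M in fP.
have uX i k : ev u 'X_[U_(i) *+ k] = u i ^+ k by rewrite -mpolyXn rmorphXn /= evX.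
have ex i : exists y, invariant_elt rho y /\ npow e M (y - u i ^+ d i).
  apply: (invariant_approximation char0 act eA); rewrite -uX.
  by apply: (trivial_weight_monomial uP); case: (dP i).
have [y yP] := choice ex.
have fy i : f (y i) = p ('X_i ^+ d i).
  have [_ /(exp_npow0 fP) /eqP] := yP i.
  by rewrite rmorphB subr_eq0 /= => /eqP ->; rewrite -uX (exp_ev fP) -mpolyXn.
have iy i : invariant_elt rho (y i) by case: (yP i).
have M1 : (0 < M)%N by [].
have ey i : e (y i) = 0.
  have [_ Ly] := yP i; have := npow_eps Ly; rewrite rmorphB rmorphXn /=.
  rewrite (coords_eps uP) expr0n; case: (dP i) => di _ _ _.
  by rewrite eqn0Ngt di subr0.
have dM i : (mdeg (U_(i) *+ d i)%MM < M)%N.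
  by rewrite mdegMn mdeg1 mul1n; case: (dP i) => _ dG _ _; apply: leq_ltn_trans GM.
pose delta i a := exp_coef fP (U_(i) *+ d i)%MM (f a).
have deltaP i : inv_derivation rho e (delta i).
  by apply: jet_derivation => //; case: (dP i).
have deltay i j : delta i (y j) = (i == j)%:R.
  rewrite /delta fy (exp_coefE fP) // mcoeffXn.
  have [<-|ij] := eqVneq i j; first by rewrite eqxx.
  case: eqP => // E.
  have := congr1 (fun m : 'X_{1..n} => m j) E; rewrite !mulmnE !mnm1E eqxx (negPf ij).
  by rewrite mul1n => dj0; case: (dP j); rewrite dj0.
exists M, Q, p, f, y, d, delta; split=> // [i|nu nuP nu_act b ib].
  by case: (dP i).
have [q Mq Eq] := exp_approx eA uP fP b.
have jb : inertia_invariant rho e b by move=> h _; apply: ib.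
(* Every exponent in the expansion of [b] has trivial weight; by [axes] and the minimality of [d i]
   its entries are divisible by the [d i], so the expansion is a polynomial in the u_i^(d_i). *)
have [q' Jq'] : exists q' : {mpoly K[n]},
    high_degree M (q - ev (fun i => 'X_i ^+ d i) q').
  pose div (m : 'X_{1..n}) := [multinom (m i %/ d i)%N | i < n].
  exists (\sum_(m <- msupp q | (mdeg m < M)%N) q@_m *: 'X_[div m]).
  rewrite [X in X - _]mpolyE (bigID (fun m => (mdeg m < M)%N)) /= addrAC.
  apply: (idealD (high_degree_ideal K n M)); last first.
    refine (@ideal_sum _ _ _ _ _ _ (high_degree_ideal K n M) _) => m mM.
    by apply: high_degreeZ; apply: high_degreeX; rewrite leqNgt.
  rewrite (linear_sum (ev (fun i => 'X_i ^+ d i))) -sumrB /= big_seq_cond.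
  refine (@ideal_sum _ _ _ _ _ _ (high_degree_ideal K n M) _) => m /andP [mq mM].
  rewrite linearZ /= -scalerBr; apply: high_degreeZ.
  suff -> : ev (fun i => 'X_i ^+ d i) 'X_[div m] = 'X_[m] :> {mpoly K[n]}.
    by rewrite subrr; apply: (ideal0 (high_degree_ideal K n M)).
  rewrite evXm mpolyXE_id; apply: eq_bigr => i _; rewrite -exprM mnmE.
  congr (_ ^+ _); rewrite mulnC divnK //.
  have Sm : S m.
    apply: (exp_support eA uP (fP := fP) jb mM).
    by rewrite Eq (exp_coefE fP) // -mcoeff_msupp.
  have Smi := axes m i Sm; case: (dP i) => di _ Sd irr.
  rewrite /dvdn; apply: contrapT => /negP; rewrite -lt0n => r0.
  have Sr : S (U_(i) *+ (m i %% d i))%MM.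
    apply: (@trivial_weightB _ _ _ _ _ _ _ (U_(i) *+ d i *+ (m i %/ d i))%MM).
      refine (@monoid_mulm n S (@trivial_weight0 _ _ _ rho e _ chi) _ _ _ Sd).
      by move=> a1 a2; apply: trivial_weightD.
    rewrite (_ : (_ + _)%MM = (U_(i) *+ m i)%MM) //.
    apply/mnmP => j; rewrite mnmDE !mulmnE; rewrite {3}(divn_eq (m i) (d i)).
    by rewrite mulnDr -mulnA [(d i * _)%N]mulnC.
  have [] := irr.2 (U_(i) *+ (m i %% d i))%MM (U_(i) *+ (d i - m i %% d i))%MM Sr.
  - apply: (@trivial_weightB _ _ _ _ _ _ _ (U_(i) *+ (m i %% d i))%MM) => //.
    rewrite (_ : (_ + _)%MM = (U_(i) *+ d i)%MM) //.
    by apply/mnmP => j; rewrite mnmDE !mulmnE -mulnDr subnKC // ltnW // ltn_mod.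
  - by apply/mnmP => j; rewrite mnmDE !mulmnE -mulnDr subnKC // ltnW // ltn_mod.
  - move/(congr1 (fun m : 'X_{1..n} => m i)); rewrite mulmnE mnm1E eqxx mul1n mnm0E.
    by move=> z; rewrite z in r0.
  - move/(congr1 (fun m : 'X_{1..n} => m i)); rewrite mulmnE mnm1E eqxx mul1n mnm0E.
    by move=> /eqP; rewrite subn_eq0 leqNgt ltn_mod di.
have fb : f b = f (ev y q').
  rewrite Eq; have -> : f (ev y q') = p (ev (fun i => 'X_i ^+ d i) q').
    elim/mpoly_gen_ind: q' {Jq'} => [|c q1 q2 E1 E2|i q1 E1].
    - by rewrite !rmorph1.
    - by rewrite !linearP /= E1 E2.
    - by rewrite !rmorphM /= !evX fy E1.
  exact/(exp_ker fP).
have ib' : invariant_elt rho (b - ev y q').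
  move=> g; rewrite rmorphB /= ib; congr (_ - _); exact: ev_invariant.
(* Equal expansions mean a difference of high order, which [nu] kills. *)
have Mb : npow e M (b - ev y q').
  have [r Mr Er] := exp_approx eA uP fP (b - ev y q').
  have r0 : p r = p 0 by rewrite rmorph0 -Er rmorphB /= fb subrr.
  rewrite -(subrK (ev u r) (_ - _)); apply: NpowD => //.
  apply: (high_degree_npow (coords_eps uP)) => m mM.
  by have /(exp_ker fP) /(_ m mM) := r0; rewrite mcoeffB mcoeff0 subr0.
have zero : nu (b - ev y q') = 0 by apply: Lnu => //; apply: npow_le Mb.
rewrite -[b](subrK (ev y q')) (inv_derivationD nuP) zero add0r.
rewrite (inv_derivation_ev eA nuP) //; apply: eq_bigr => i _; congr (_ * _).
rewrite /delta rmorphD /= rmorphB /= fb subrr add0r -/(delta i _).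
rewrite (inv_derivation_ev eA (deltaP i)) // (bigD1 i) //= deltay eqxx mulr1 big1 ?addr0 //.
by move=> j ji; rewrite deltay eq_sym (negPf ji) mulr0.
Qed.

(** An irreducible exponent off the axes, together with the [n] irreducible ones on them, gives
    [n.+1] coefficient derivations; they are dual to invariants approximating the corresponding
    monomials. *)
Lemma nonfree_derivations : ~ axes_monoid S ->
  exists (delta : 'I_n.+1 -> A -> K) (b : 'I_n.+1 -> A),
    forall i, [/\ inv_derivation rho e (delta i), invariant_elt rho (b i) &
                  forall j, delta i (b j) = (i == j)%:R].
Proof.
move=> naxes; have [d dP] := choice axis_order.
have [m [Sm irr noaxis]] : exists m, [/\ S m, irreducible_monomial S m &
    forall i k, m <> (U_(i) *+ k)%MM].
  apply: contrapT => none; apply: naxes => m; have [D] := ubnP (mdeg m).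
  elim: D m => // D IHD m; rewrite ltnS => mD i Sm.
  have [/eqP ->|m0] := boolP (m == 0%MM).
    by rewrite mnm0E mulm0n; apply: trivial_weight0.
  have [irr|red] := pselect (irreducible_monomial S m).
    have [[j [k Em]]|na] := pselect (exists j k, m = (U_(j) *+ k)%MM).
      rewrite Em mulmnE mnm1E; case: eqP => [<-|_]; first by rewrite mul1n -Em.
      by rewrite mul0n mulm0n; apply: trivial_weight0.
    by case: none; exists m; split=> // j k Em; apply: na; exists j, k.
  have /not_andP [nn|/existsNP [a /existsNP [b]]] := red; first by case: nn; apply/eqP.
  move=> /not_implyP [Sa /not_implyP [Sb /not_implyP [Em /not_orP [a0 b0]]]].
  have posdeg (x : 'X_{1..n}) : x <> 0%MM -> (0 < mdeg x)%N.
    by move=> /eqP; rewrite lt0n mdeg_eq0.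
  have b1 := posdeg _ b0; have a1 := posdeg _ a0; have Ed := congr1 (@mdeg n) Em.
  rewrite mdegD in Ed.
  have -> : (U_(i) *+ m i = U_(i) *+ a i + U_(i) *+ b i)%MM.
    by apply/mnmP => l; rewrite mnmDE !mulmnE Em mnmDE mulnDr.
  apply: trivial_weightD; apply: IHD => //; apply: leq_trans mD.
    by rewrite Ed -[X in (X < _)%N]addn0 ltn_add2l.
  by rewrite Ed -[X in (X < _)%N]add0n ltn_add2r.
pose E (i : 'I_n.+1) : 'X_{1..n} := oapp (fun j => U_(j) *+ d j)%MM m (unlift ord0 i).
have EP i : S (E i) /\ irreducible_monomial S (E i).
  by rewrite /E; case: unliftP => [j|] _ //=; case: (dP j).
have injE : injective E.
  move=> i j; rewrite /E; case: unliftP => [i'|] ->; case: unliftP => [j'|] -> //=.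
  - move=> E'; congr fintype.lift; apply/eqP; apply: contrapT => /negP ij.
    have := congr1 (fun m : 'X_{1..n} => m i') E'; rewrite !mulmnE !mnm1E eqxx.
    by rewrite eq_sym (negPf ij) mul1n => d0; case: (dP i'); rewrite d0.
  - by move/esym/noaxis.
  - by move/noaxis.
pose D := \max_i mdeg (E i).
have [Q [p [f fP]]] := exists_expansion smA eA uP D.
have EM i : (mdeg (E i) < D.+2)%N by rewrite ltnS leqW // leq_bigmax.
have ex i : exists y, invariant_elt rho y /\ npow e D.+2 (y - ev u 'X_[E i]).
  apply: (invariant_approximation char0 act eA).
  by apply: (trivial_weight_monomial uP); case: (EP i).
have [b bP] := choice ex.
exists (fun i a => exp_coef fP (E i) (f a)), b => i; split.
- by apply: jet_derivation => //; case: (EP i).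
- by case: (bP i).
- move=> j; have [_ /(exp_npow0 fP) /eqP] := bP j.
  rewrite rmorphB subr_eq0 /= => /eqP ->; rewrite (exp_ev fP) (exp_coefE fP) // mcoeffX.
  by rewrite (inj_eq injE) eq_sym.
Qed.

End LocalInvariants.

(** * Extension of derivations and dimension *)

Section DerivationExtension.
Variable L : fieldType.
Hypothesis charL : [pchar L] =i pred0.

(** A derivation of the subring [phi] cuts out of [L], described on the source [R]; [pder_ker] is
    what lets it descend to the image. *)
Record partial_derivation (R : comNzRingType) (phi : R -> L) (D : R -> L) : Prop :=
  PartialDerivation {
    pderD : forall x y, D (x + y) = D x + D y;
    pderM : forall x y, D (x * y) = phi x * D y + phi y * D x;
    pder_ker : forall x, phi x = 0 -> D x = 0 }.

Section Step.
Variables (R : comNzRingType) (phi : {rmorphism R -> L}) (D : R -> L).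
Hypothesis DP : partial_derivation phi D.
Variable y : L.

Let D0 : D 0 = 0.
Proof. by apply: (pder_ker DP); rewrite rmorph0. Qed.

Let phiy : {rmorphism {poly R} -> L} := horner_eval y \o map_poly phi.
Let phiyE p : phiy p = (map_poly phi p).[y].
Proof. by []. Qed.
Let phiyC c : phiy c%:P = phi c.
Proof. by rewrite phiyE map_polyC hornerC. Qed.
Let phiyX : phiy 'X = y.
Proof. by rewrite phiyE map_polyX hornerX. Qed.

Let phiyD p q : phiy (p + q) = phiy p + phiy q.
Proof. exact: rmorphD. Qed.
Let phiyM p q : phiy (p * q) = phiy p * phiy q.
Proof. exact: rmorphM. Qed.

(** The extension of [D] to R[X], evaluated at [y], with value [d] on X. *)
Let Dy (d : L) (p : {poly R}) : L := (map_poly D p).[y] + phiy p^`() * d.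

Let DmapD p q : map_poly D (p + q) = map_poly D p + map_poly D q.
Proof. by apply/polyP => i; rewrite coefD !coef_map_id0 // coefD (pderD DP). Qed.

Let DyD d p q : Dy d (p + q) = Dy d p + Dy d q.
Proof. by rewrite /Dy DmapD hornerD derivD rmorphD mulrDl addrACA. Qed.

Let DyC d c : Dy d c%:P = D c.
Proof.
rewrite /Dy derivC rmorph0 mul0r addr0.
have -> : map_poly D c%:P = (D c)%:P; last by rewrite hornerC.
by apply/polyP => i; rewrite coef_map_id0 // !coefC; case: eqP.
Qed.

Let DyX d p : Dy d (p * 'X) = y * Dy d p + phiy p * d.
Proof.
have -> : Dy d (p * 'X) = (map_poly D p * 'X).[y] + phiy (p^`() * 'X + p) * d.
  rewrite /Dy derivM derivX mulr1; congr (_.[y] + _).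
  by apply/polyP => i; rewrite coef_map_id0 // !coefMX; case: eqP => // _; rewrite coef_map_id0.
rewrite hornerMX phiyD phiyM phiyX /Dy; ring.
Qed.

Let DyZ d c q : Dy d (c%:P * q) = phi c * Dy d q + phiy q * D c.
Proof.
rewrite {1}/Dy.
have -> : map_poly D (c%:P * q) = (phi c)%:P * map_poly D q + (D c)%:P * map_poly phi q.
  apply/polyP => i; rewrite coefD !coefCM !coef_map_id0 ?rmorph0 // coefCM (pderM DP).
  by rewrite [phi _ * D c]mulrC.
rewrite hornerD !hornerM !hornerC -phiyE derivM derivC mul0r add0r phiyM phiyC /Dy; ring.
Qed.

Let DyM d p q : Dy d (p * q) = phiy p * Dy d q + phiy q * Dy d p.
Proof.
elim/poly_ind: p => [|p c IH]; first by rewrite mul0r rmorph0 -polyC0 DyC D0; ring.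
have -> : (p * 'X + c%:P) * q = p * q * 'X + c%:P * q by ring.
rewrite !DyD !DyX DyZ IH DyC !phiyD !phiyM phiyX phiyC; ring.
Qed.

Let Dy_coef0 d (p : {poly R}) : (forall i, phi p`_i = 0) -> Dy d p = 0.
Proof.
move=> p0; have -> : p = \sum_(i < size p) (p`_i)%:P * 'X^i.
  by rewrite -[LHS]coefK poly_def; apply: eq_bigr => i _; rewrite mul_polyC.
elim/big_ind: _ => [|u v Eu Ev|i _]; first by rewrite -polyC0 DyC D0.
  by rewrite DyD Eu Ev addr0.
by rewrite DyM DyC (pder_ker DP (p0 i)) phiyC p0; ring.
Qed.

(** Terms whose coefficient dies under [phi] can be removed from the top one at a time. *)
Let small_kernel n : (forall p : {poly R}, (size p <= n)%N -> phiy p = 0 -> phi (lead_coef p) = 0) ->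
  forall p : {poly R}, (size p <= n)%N -> phiy p = 0 -> forall i, phi p`_i = 0.
Proof.
elim: n => [|n IHn] min p pn py i.
  by move: pn; rewrite leqn0 size_poly_eq0 => /eqP ->; rewrite coef0 rmorph0.
have [pn'|np] := leqP (size p) n.
  by apply: IHn pn' py i => q qn; apply: min; apply: leqW.
have sp : size p = n.+1 by apply/eqP; rewrite eqn_leq pn np.
have l0 : phi p`_n = 0 by have := min p pn py; rewrite /lead_coef sp.
have [->//|ni] := eqVneq i n.
pose q := p - (p`_n)%:P * 'X^n.
have qi j : q`_j = if j == n then 0 else p`_j.
  by rewrite coefB coefCM coefXn; case: eqP => [->|_]; rewrite ?mulr1 ?subrr // mulr0 subr0.
have -> : p`_i = q`_i by rewrite qi (negPf ni).
apply: IHn => [r rn||]; first by apply: min; apply: leqW.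
  apply/leq_sizeP => j nj; rewrite qi; case: eqP => // /eqP jn.
  by apply: nth_default; rewrite sp ltn_neqAle eq_sym jn.
by rewrite rmorphB phiyM py phiyC l0 mul0r subr0.
Qed.

(** Any [d] works if [y] is transcendental over the image of [phi]. If [y] is algebraic, its minimal
    equation [g] prescribes [d], and the derivative of [g] at [y] is nonzero in characteristic 0. *)
Lemma extend_partial_derivation : exists (R' : comNzRingType) (i : {rmorphism R -> R'})
    (phi' : {rmorphism R' -> L}) (D' : R' -> L),
  [/\ partial_derivation phi' D', forall x, phi' (i x) = phi x,
      forall x, D' (i x) = D x & exists z, phi' z = y].
Proof.
suff [d dP] : exists d, forall p, phiy p = 0 -> Dy d p = 0.
  exists {poly R}, polyC, phiy, (Dy d); split=> [|x|x|].
  - by split; [apply: DyD | apply: DyM | ].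
  - exact: phiyC.
  - exact: DyC.
  - by exists 'X; apply: phiyX.
(* A size at which some relation for [y] has a leading coefficient that survives under [phi]; the
   least one plays the role of the minimal polynomial. *)
pose bad n := `[< exists p : {poly R}, [/\ size p = n, phiy p = 0 & phi (lead_coef p) != 0] >].
have [ex|none] := pselect (exists n, bad n); last first.
  exists 0 => p py; apply: Dy_coef0; apply: (@small_kernel (size p)) => // q _ qy.
  by apply/eqP; apply: contrapT => /negP ql; apply: none; exists (size q); apply/asboolP; exists q.
case: (ex_minnP ex) => m /asboolP [g [gm gy gl]] minm.
have minP (p : {poly R}) : (size p < m)%N -> phiy p = 0 -> phi (lead_coef p) = 0.
  move=> pm py; apply/eqP; apply: contrapT => /negP pl.
  by move: pm; rewrite ltnNge minm //; apply/asboolP; exists p.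
have small (p : {poly R}) : (size p < m)%N -> phiy p = 0 -> forall i, phi p`_i = 0.
  case: m {gm minm} minP => // m minP; rewrite ltnS => pm.
  by apply: (@small_kernel m) => // q qm; apply: minP.
have m0 : (0 < m)%N by rewrite -gm size_poly_gt0; apply: contraNneq gl => ->; rewrite lead_coef0 rmorph0.
have m1 : (1 < m)%N.
  rewrite ltn_neqAle m0 andbT; apply: contraNneq gl => m1.
  have /size_poly1P [c _ Eg] : size g == 1%N by rewrite gm -m1.
  by rewrite Eg lead_coefC -phiyC -Eg gy.
have gy' : phiy g^`() != 0.
  apply/eqP => g'0; have : phi g^`()`_m.-2 = 0.
    by apply: small g'0 _; rewrite -gm lt_size_deriv // -size_poly_gt0 gm.
  rewrite coef_deriv rmorphMn -mulr_natr prednK ?ltn_predRL // => /eqP.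
  have -> : g`_m.-1 = lead_coef g by rewrite /lead_coef gm.
  rewrite mulf_eq0 (negPf gl) /=; move/pcharf0P: charL => ->.
  by rewrite -subn1 subn_eq0 leqNgt m1.
exists (- (map_poly D g).[y] / phiy g^`()) => p py.
set d := _ / _; have Dg : Dy d g = 0 by rewrite /Dy /d mulrC divfK // addrN.
(* Pseudo-division, because the leading coefficient of [g] need not be invertible; its powers are
   nonzero in [L] and can be cancelled at the end. *)
have := Pdiv.ComRing.rdivp_eq g p; rewrite -mul_polyC => E.
have sr : (size (Pdiv.Ring.rmodp p g) < m)%N.
  by rewrite -gm Pdiv.Ring.ltn_rmodpN0 // -size_poly_gt0 gm.
have ry : phiy (Pdiv.Ring.rmodp p g) = 0.
  have := congr1 phiy E; rewrite phiyM phiyD phiyM py gy !mulr0 add0r.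
  by move=> <-.
have Dr := Dy_coef0 d (small _ sr ry).
have := congr1 (Dy d) E; rewrite DyD !DyM Dr Dg gy py !(mulr0, mul0r, addr0) => /eqP.
by rewrite phiyC rmorphXn mulf_eq0 expf_eq0 (negPf gl) andbF /= => /eqP.
Qed.

End Step.

Lemma extend_partial_derivations (R : comNzRingType) (phi : {rmorphism R -> L}) (D : R -> L)
    (ys : seq L) : partial_derivation phi D ->
  exists (R' : comNzRingType) (i : {rmorphism R -> R'})
    (phi' : {rmorphism R' -> L}) (D' : R' -> L),
  [/\ partial_derivation phi' D', forall x, phi' (i x) = phi x,
      forall x, D' (i x) = D x & forall y, y \in ys -> exists z, phi' z = y].
Proof.
move=> DP; elim: ys => [|y ys [R1 [i1 [phi1 [D1 [DP1 iphi1 iD1 zs]]]]]].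
  by exists R, idfun, phi, D; split.
have [R2 [i2 [phi2 [D2 [DP2 iphi2 iD2 zy]]]]] := extend_partial_derivation DP1 y.
exists R2, (i2 \o i1), phi2, D2; split=> // [x|x|w] /=; rewrite ?iphi2 ?iD2 //.
rewrite inE => /orP [/eqP -> //|/zs [z <-]].
by exists (i2 z); rewrite iphi2.
Qed.

(** After adjoining the values at the finitely many generators, every value of [e] on [A] lifts to
    the enlarged ring; the derivation does not depend on the lift. *)
Lemma extend_derivation (K : fieldType) (R A : comAlgType K) (h : {lrmorphism R -> A})
    (e : {rmorphism A -> L}) (D : R -> L) : finite_type A ->
  derivation (fun r => e (h r)) (D : R -> L^o) -> (forall r, e (h r) = 0 -> D r = 0) ->
  exists D' : A -> L, derivation e (D' : A -> L^o) /\ forall r, D' (h r) = D r.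
Proof.
move=> /finite_typeP [N [x gen]] derD kerD.
have derD' : derivation (e \o h) (D : R -> L^o) by [].
have DP : partial_derivation (e \o h) D.
  split=> // [r s|r s]; first exact: (derivationD derD').
  exact: (derivationM derD').
have [R' [i [phi [D' [DP' iphi iD zs]]]]] :=
  extend_partial_derivations [seq e (x l) | l : 'I_N] DP.
have ex : forall a, exists z, phi z = e a.
  apply: gen => [|c u v [z Ez] [w Ew]|l u [z Ez]].
  - by exists 1; rewrite !rmorph1.
  - exists (i c%:A * z + w); rewrite !rmorphD rmorphM iphi /= Ez Ew linearZ /= rmorph1.
    by rewrite -[c *: u]mulr_algl rmorphM.
  - have [|w Ew] := zs (e (x l)); first by apply: map_f; rewrite mem_enum.
    by exists (w * z); rewrite !rmorphM Ez Ew.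
have [s sP] := choice ex.
have D'E z a : phi z = e a -> D' (s a) = D' z.
  move=> Ez; have := pder_ker DP' (x := s a - z).
  rewrite rmorphB /= sP Ez subrr => /(_ erefl) E.
  by rewrite -[s a](subrK z) (pderD DP') E add0r.
exists (fun a => D' (s a)); split=> [|r]; last first.
  by rewrite -iD; apply: D'E; rewrite iphi.
split=> [c a b|a b]; last first.
  by rewrite (@D'E (s a * s b)) ?rmorphM ?sP // (pderM DP') !sP.
rewrite (@D'E (i c%:A * s a + s b)).
  rewrite (pderD DP') (pderM DP') iD (derivationZ derD') (derivation1 derD') scaler0 mulr0 addr0.
  by rewrite iphi /= linearZ /= rmorph1.
by rewrite rmorphD rmorphM iphi /= !sP linearZ /= rmorph1 rmorphD -[c *: a]mulr_algl rmorphM.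
Qed.

End DerivationExtension.

Section PrimeChain.
Variables (K : fieldType) (A : comAlgType K) (n : nat) (P : nat -> {pred A}).
Hypothesis primeP : forall i, (i <= n)%N -> prime_ideal (P i).
Hypothesis chainP : forall i, (i < n)%N -> {subset P i <= P i.+1}.
Variable a : 'I_n -> A.
Hypotheses (aP : forall i, a i \in P i.+1) (aN : forall i, a i \notin P i).

Let PM i x y : (i <= n)%N -> y \in P i -> x * y \in P i.
Proof.
move=> /primeP [[P0 _ Pl] _] Py.
by rewrite -[x * y]addr0; apply: Pl.
Qed.
Let P0 i : (i <= n)%N -> 0 \in P i.
Proof. by move=> /primeP [[]]. Qed.
Let PD i x y : (i <= n)%N -> x \in P i -> y \in P i -> x + y \in P i.
Proof. by move=> /primeP [[_ _ Pl] _] Px Py; rewrite -[x]mul1r; apply: Pl. Qed.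
Let Psum i (r : seq 'X_{1..n}) (Q : pred 'X_{1..n}) F : (i <= n)%N ->
  (forall m, Q m -> F m \in P i) -> \sum_(m <- r | Q m) F m \in P i.
Proof. by move=> ni QF; elim/big_ind: _ => [|x y|]; [apply: P0 | apply: PD | ]. Qed.

(* Order monomials lexicographically, the variable of the smallest prime      *)
(* first: the leading term of a relation would survive in every [P i].        *)
Lemma chain_algebraically_independent (G : {mpoly K[n]}) : ev a G = 0 -> G = 0.
Proof.
move=> evG; apply/eqP; apply: contrapT => /negP G0.
(* At stage [i], the terms agreeing with [m0] in the first [i] exponents, stripped of these
   variables, sum to an element of [P i]. At stage [n] a single nonzero scalar is left in the proper
   ideal [P n]. *)
pose agree i (m m' : 'X_{1..n}) := [forall j : 'I_n, (j < i)%N ==> (m j == m' j)].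
pose tl i (m : 'X_{1..n}) : A := \prod_(j < n | (i <= j)%N) a j ^+ m j.
suff main i : (i <= n)%N -> exists2 m0, m0 \in msupp G &
    \sum_(m <- msupp G | agree i m m0) G@_m *: tl i m \in P i.
  have [m0 m0G] := main n (leqnn n).
  rewrite (eq_bigl (fun m => m == m0)) => [|m]; last first.
    apply/forallP/eqP => [E|-> j]; last by rewrite eqxx implybT.
    by apply/mnmP => j; apply/eqP; have /implyP := E j; apply.
  rewrite -big_filter (filter_pred1_uniq (msupp_uniq G) m0G) big_seq1 /tl big_pred0 => [|j].
    move=> Pc; have [[_ P1 _] _] := primeP (leqnn n); case/negP: P1.
    rewrite -[1](scale1r 1) -(mulVf (x := G@_m0)) -?mcoeff_msupp // -scalerA -mulr_algl.
    exact: PM.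
  by rewrite leqNgt ltn_ord.
elim: i => [_|i IH ni].
  have [m0 m0G] : exists m0, m0 \in msupp G.
    apply: contrapT => none; case/negP: G0; rewrite -msupp_eq0.
    by case E: (msupp G) => [//|m0 s]; case: none; exists m0; rewrite E inE eqxx.
  exists m0 => //; rewrite (eq_bigl predT) => [|m]; last by apply/forallP.
  suff -> : \sum_(m <- msupp G) G@_m *: tl 0 m = ev a G by rewrite evG; apply: P0.
  rewrite [in RHS](mpolyE G) linear_sum; apply: eq_bigr => m _.
  by rewrite linearZ /= evXm.
have [m1 m1G Pm1] := IH (ltnW ni); pose i' := Ordinal ni.
have exk : exists k, has (fun m : 'X_{1..n} => agree i m m1 && (m i' == k)) (msupp G).
  exists (m1 i'); apply/hasP; exists m1 => //; rewrite eqxx andbT.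
  by apply/forallP => j; rewrite eqxx implybT.
case: (ex_minnP exk) => k /hasP [m0 m0G /andP [am0 /eqP m0k]] mink; exists m0 => //.
have agreeE m : agree i m m1 = agree i m m0.
  apply: eq_forallb => j; case: ltnP => //= ji.
  by have /forallP /(_ j) := am0; rewrite ji => /eqP ->.
have tlE m : tl i m = a i' ^+ m i' * tl i.+1 m.
  rewrite /tl (bigD1 i') //=; congr (_ * _); apply: eq_bigl => j.
  by rewrite -(inj_eq val_inj) /= [in RHS]ltn_neqAle eq_sym andbC.
(* The common power of [a i'] can be divided out, as it is not in the prime [P i]. The terms still
   divisible by [a i'] lie in [P i.+1], so the others do too. *)
pose x := \sum_(m <- msupp G | agree i m m0) G@_m *: (a i' ^+ (m i' - k) * tl i.+1 m).
have Px : x \in P i.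
  have E : a i' ^+ k * x \in P i.
    move: Pm1; rewrite (eq_bigl _ _ agreeE) (_ : \sum_(m <- _ | _) _ = a i' ^+ k * x) //.
    rewrite big_seq_cond /x [in RHS]big_seq_cond mulr_sumr.
    apply: eq_bigr => m /andP [mG am]; rewrite -scalerAr mulrA -exprD tlE subnKC //.
    by apply: mink; apply/hasP; exists m => //; rewrite agreeE am eqxx.
  have [_ prM] := primeP (ltnW ni).
  elim: (k) E => [|q IHq]; first by rewrite expr0 mul1r.
  by rewrite exprS -mulrA => /prM /orP [|//]; rewrite (negPf (aN i')).
have {}Px := chainP ni Px.
rewrite /x (bigID (fun m : 'X_{1..n} => m i' == m0 i')) /= in Px.
have P2 : \sum_(m <- msupp G | agree i m m0 && (m i' != m0 i'))
    G@_m *: (a i' ^+ (m i' - k) * tl i.+1 m) \in P i.+1.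
  rewrite big_seq_cond; apply: Psum => // m /andP [mG /andP [am ne]].
  have : (k < m i')%N.
    rewrite ltn_neqAle -m0k eq_sym ne m0k; apply: mink; apply/hasP; exists m => //.
    by rewrite agreeE am eqxx.
  rewrite -subn_gt0; case: (m i' - k)%N => // q _.
  by rewrite exprSr -mulrA [a i' * _]mulrC mulrA -mulr_algl mulrA; apply: PM.
have := PD ni Px (PM (-1) ni P2); rewrite mulN1r addrK.
rewrite (_ : \sum_(m <- _ | _) _ = \sum_(m <- msupp G | agree i.+1 m m0) G@_m *: tl i.+1 m) //.
apply: eq_big => [m|m /andP [_ /eqP ->]]; last by rewrite m0k subnn expr0 mul1r.
apply/andP/forallP => [[/forallP am /eqP mi] j|am].
  apply/implyP; rewrite ltnS leq_eqVlt => /orP [/eqP ji|]; last by apply/implyP.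
  by rewrite (_ : j = i') ?mi //; apply: val_inj.
split; last by have /implyP := am i'; apply; rewrite ltnS.
by apply/forallP => j; apply/implyP => ji; have /implyP := am j; apply; rewrite leqW.
Qed.

End PrimeChain.

(** Elements chosen along the chain are algebraically independent, so the partial derivatives of the
    polynomial ring they generate extend to [A] at the generic point and stay independent. *)
Lemma prime_chain_derivations (K : fieldType) (char0 : [pchar K] =i pred0)
    (A : comAlgType K) (n r : nat) (F : fieldType) (e : {rmorphism A -> F}) :
  finite_type A -> injective e -> has_prime_chain A n -> derivation_dim e r -> (n <= r)%N.
Proof.
move=> ftA inj_e [P [primeP chainP]] [_ maxr].
have ex (i : 'I_n) : exists2 a, a \in P i.+1 & a \notin P i by case: (chainP i (ltn_ord i)).
have [a aP] := choice (fun i => let: ex_intro2 x p q := ex i in ex_intro _ x (conj p q)).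
have indep G : ev a G = 0 -> G = 0.
  apply: (@chain_algebraically_independent _ _ _ P) => // [i /chainP []//|i|i];
    by case: (aP i).
have e0 x : e x = 0 -> x = 0 by rewrite -(rmorph0 e) => /inj_e.
have exD (i : 'I_n) : exists D : A -> F, derivation e (D : A -> F^o) /\
    forall G, D (ev a G) = e (ev a G^`M(i)).
  apply: (@extend_derivation F (point_pchar e char0) K {mpoly K[n]} A (ev a) e
    (fun G => e (ev a G^`M(i)))) => //.
    split=> [c G H|G H].
      rewrite mderivD mderivZ !linearP /= rmorphD; congr (_ + _).
      by rewrite linearZ /= rmorph1 -[c *: _]mulr_algl rmorphM.
    by rewrite mderivM rmorphD !rmorphM /= rmorphD !rmorphM /= addrC; congr (_ + _); apply: mulrC.
  by move=> G /e0 /indep ->; rewrite mderiv0 !rmorph0.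
have [D DP] := choice exD; apply: (maxr n D); split=> [i|c c0 i].
  by case: (DP i).
rewrite -[RHS](c0 (a i)) (bigD1 i) //= big1 => [|l li]; rewrite -(evX a i) (DP _).2.
  by rewrite mderivX_id !rmorph1 mulr1 addr0.
by rewrite mderivX_neq // !rmorph0 mulr0.
Qed.

Section PointDerivations.
Variables (K F : fieldType) (A : comAlgType K) (e : {rmorphism A -> F}).
Variables (A' : comAlgType F) (j : {rmorphism A -> A'}) (e' : {rmorphism A' -> F}).
Hypotheses (AA' : algebra_change e j) (ee' : forall a, e' (j a) = e a).
Hypothesis e'A : forall c, e' c%:A = c.

Lemma derivation_change (D : A -> F) : derivation e (D : A -> F^o) ->
  exists D' : A' -> F, derivation e' (D' : A' -> F^o) /\ forall a, D' (j a) = D a.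
Proof.
move=> derD; have [|D' D'E] := @change_lift _ _ _ _ _ _ AA' F^o D.
  by move=> c a b; rewrite (derivation_linear derD).
exists D'; split=> //; split=> [c a b|a b]; first by rewrite e'A linearP.
elim/(change_ind AA'): a => [|c a x IHx].
  by rewrite mul0r linear0 rmorph0 scale0r scaler0 addr0.
rewrite mulrDl -scalerAl !linearP IHx rmorphD (point_scale e'A) ee' /=.
have -> : D' (j a * b) = e a *: D' b + e' b *: D' (j a).
  elim/(change_ind AA'): b {IHx} => [|d b y IHy].
    by rewrite mulr0 linear0 rmorph0 scale0r scaler0 addr0.
  rewrite mulrDr -scalerAr -rmorphM !linearP IHy !D'E rmorphD (point_scale e'A) ee' /=.
  rewrite (derivationM derD) /GRing.scale /=; ring.
by rewrite /GRing.scale /=; ring.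
Qed.

Lemma derivation_npow2 (D : A' -> F) w : derivation e' (D : A' -> F^o) -> npow e' 2 w -> D w = 0.
Proof.
move=> derD; move E2: 2%N => L Lw; elim: Lw E2 => {L w} // [L x y ex Ly _ [E]|L x y _ IHx _ IHy E].
  rewrite (derivationM derD) ex scale0r add0r (_ : e' y = 0) ?scale0r //.
  by apply/npow1; rewrite E.
by rewrite (derivationD derD) IHx // IHy // addr0.
Qed.

(** After base change a derivation at the point factors through the cotangent space, of dimension
    [n]. *)
Lemma derivations_le_coordinates (gT : finGroupType) (rho : gT -> {lrmorphism A' -> A'})
    n (u : 'I_n -> A') chi q (D : 'I_q -> A -> F) :
  coordinates rho e' u chi -> independent_derivations e D -> (q <= n)%N.
Proof.
move=> uP [derD indD]; have [D' D'P] := choice (fun i => derivation_change (derD i)).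
pose V : 'M[F]_(q, n) := \matrix_(i, l) D' i (u l).
suff /eqP <- : row_free V by apply: rank_leq_col.
apply/inj_row_free => v vV; apply/rowP => i; rewrite mxE; apply: (indD (v 0)) => a.
have Vl l : \sum_i v 0 i * D' i (u l) = 0.
  have /rowP /(_ l) := vV; rewrite !mxE => E0; rewrite -[RHS]E0.
  by apply: eq_bigr => p _; rewrite mxE.
have [|c Wc] := coords_span uP (x := j a - (e a)%:A); first by rewrite rmorphB /= ee' e'A subrr.
have E p : D p a = \sum_l c l * D' p (u l).
  have [derp <-] := D'P p; have := derivation_npow2 derp Wc.
  rewrite !(derivationB derp) (derivationZ derp) (derivation1 derp) scaler0 subr0.
  move/eqP; rewrite subr_eq0 => /eqP ->; rewrite (derivation_sum derp).
  by apply: eq_bigr => l _; rewrite (derivationZ derp) e'A.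
under eq_bigr => p _ do rewrite E mulr_sumr.
rewrite exchange_big big1 // => l _; transitivity (c l * 0); last exact: mulr0.
rewrite -[in RHS](Vl l) mulr_sumr.
by apply: eq_bigr => p _; rewrite mulrCA.
Qed.

End PointDerivations.

(** * Finiteness over the invariants *)

Lemma lrmorph_ev (K : fieldType) (R A : comAlgType K) (h : {lrmorphism R -> A})
    (N : nat) (z : 'I_N -> R) p : h (ev z p) = ev (fun i => h (z i)) p.
Proof.
elim/mpoly_gen_ind: p => [|c p q Ep Eq|i p Ep].
- by rewrite !rmorph1.
- by rewrite !linearP /= Ep Eq.
- by rewrite !rmorphM /= !evX Ep.
Qed.

Section Noether.
Variables (K : fieldType) (char0 : [pchar K] =i pred0) (A : comAlgType K).
Variables (gT : finGroupType) (rho : gT -> {lrmorphism A -> A}).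
Hypothesis act : is_algebra_action rho.
Variables (N : nat) (x : 'I_N -> A) (gen : generates x).

Local Notation exponents := {ffun 'I_N -> 'I_#|gT|}.
Let xm (t : exponents) : A := \prod_i x i ^+ t i.

Section Module.
Variable S : A -> Prop.
Hypotheses (S0 : S 0) (S1 : S 1).
Hypotheses (SD : forall a b, S a -> S b -> S (a + b)).
Hypotheses (SZ : forall c a, S a -> S (c *: a)).
Hypotheses (SM : forall a b, S a -> S b -> S (a * b)).
Hypothesis Sorbit : forall i l, S (orbit_poly rho (x i))`_l.

(** The orbit polynomials lower exponents below the order of the group. [S] is left abstract because
    the statement serves both for all invariants and for the subalgebra in the proof of finite
    generation. *)
Lemma orbit_module a :
  exists b : exponents -> A, (forall t, S (b t)) /\ a = \sum_t b t * xm t.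
Proof.
pose Q a := exists b : exponents -> A, (forall t, S (b t)) /\ a = \sum_t b t * xm t.
have Q0 : Q 0 by exists (fun=> 0); split=> //; rewrite big1 // => t _; rewrite mul0r.
have QD u v : Q u -> Q v -> Q (u + v).
  move=> [b [Sb ->]] [d [Sd ->]]; exists (fun t => b t + d t); split=> [t|].
    exact: SD.
  by rewrite -big_split; apply: eq_bigr => t _; rewrite mulrDl.
have QM s u : S s -> Q u -> Q (s * u).
  move=> Ss [b [Sb ->]]; exists (fun t => s * b t); split=> [t|]; first exact: SM.
  by rewrite mulr_sumr; apply: eq_bigr => t _; rewrite mulrA.
have Qm t : Q (xm t).
  exists (fun t' => if t' == t then 1 else 0); split=> [t'|]; first by case: ifP.
  rewrite (bigD1 t) //= eqxx mul1r big1 ?addr0 // => t' /negPf ->; exact: mul0r.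
have G0 : (0 < #|gT|)%N by apply/card_gt0P; exists 1%g.
suff: forall u, Q u by apply.
apply: gen => [|c u v Qu Qv|i u [b [Sb ->]]].
- rewrite (_ : 1 = xm [ffun=> Ordinal G0]) //.
  by rewrite /xm big1 // => i _; rewrite ffunE.
- by apply: QD => //; rewrite -mulr_algl; apply: QM => //; apply: SZ.
- rewrite mulr_sumr; elim/big_ind: _ => // t _; rewrite mulrCA; apply: (QM) => //.
  have upd (l : 'I_#|gT|) : xm (fupd t i l) = x i ^+ l * \prod_(i' | i' != i) x i' ^+ t i'.
    rewrite /xm (bigD1 i) //= ffunE eqxx; congr (_ * _); apply: eq_bigr => i' ne.
    by rewrite ffunE (negPf ne).
  have Et : x i * xm t = x i ^+ (t i).+1 * \prod_(i' | i' != i) x i' ^+ t i'.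
    by rewrite /xm (bigD1 i) //= mulrA -exprS.
  rewrite Et; have := ltn_ord (t i); rewrite leq_eqVlt => /orP [/eqP ti|ti].
    rewrite ti (orbit_poly_root act) mulr_suml; apply: (big_ind Q) => // l _.
    rewrite -mulrA -upd; apply: (QM) => //.
    by rewrite -scaleN1r; apply: SZ.
  by rewrite -(upd (Ordinal ti)).
Qed.

End Module.

Lemma inv_lift a : invariant_elt rho a -> exists b : inv_ring rho, inv_val b = a.
Proof.
move=> ia; have ia' : a \in Defs.invariant rho by apply/forallP => g; rewrite ia.
by exists (InvRing ia').
Qed.

Lemma inv_val_invariant (b : inv_ring rho) : invariant_elt rho (inv_val b).
Proof. by move=> g; apply/eqP; have /forallP := inv_valP b. Qed.

Lemma invariant_module a : exists b : exponents -> inv_ring rho, a = \sum_t inv_val (b t) * xm t.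
Proof.
have [||||||b [ib ->]] := @orbit_module (invariant_elt rho) _ _ _ _ _ _ a.
- exact: invariant_elt0.
- exact: invariant_elt1.
- exact: invariant_eltD.
- exact: invariant_eltZ.
- exact: invariant_eltM.
- by move=> i l; apply: orbit_poly_invariant.
have [d dP] := choice (fun t => inv_lift (ib t)).
by exists d; apply: eq_bigr => t _; rewrite dP.
Qed.

(** Noether's argument: write an invariant in the finite spanning set of monomials, with
    coefficients in the algebra of orbit coefficients and averaged monomials, then average. The
    coefficients come out of the average, and the averaged monomials are themselves generators. *)
Lemma inv_ring_finite_type : finite_type (inv_ring rho).
Proof.
pose T : finType := ('I_N * 'I_#|gT| + exponents)%type.
pose zA (t : T) : A := match t with
  | inl (i, l) => (orbit_poly rho (x i))`_l | inr t => reynolds rho (xm t) end.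
have izA t : invariant_elt rho (zA t).
  case: t => [[i l]|t]; first exact: orbit_poly_invariant.
  exact: (reynolds_invariant act).
have [z zP] := choice (fun t => inv_lift (izA t)).
pose y (i : 'I_#|T|) := z (enum_val i).
apply/finite_typeP; exists #|T|, y; apply/generates_ev => b.
pose S a := exists p, inv_val (ev y p) = a.
have Sz t : S (zA t).
  exists 'X_(enum_rank t); rewrite evX /y enum_rankK; exact: zP.
have SD a a' : S a -> S a' -> S (a + a').
  by move=> [p <-] [q <-]; exists (p + q); rewrite !rmorphD.
have SZ c a : S a -> S (c *: a).
  by move=> [p <-]; exists (c *: p); rewrite !linearZ.
have SM a a' : S a -> S a' -> S (a * a').
  by move=> [p <-] [q <-]; exists (p * q); rewrite !rmorphM.
have S0 : S 0 by exists 0; rewrite !rmorph0.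
have S1 : S 1 by exists 1; rewrite !rmorph1.
have [|a [Sa Ea]] := orbit_module S0 S1 SD SZ SM _ (inv_val b).
  move=> i l; have [lG|Gl] := ltnP l #|gT|; first exact: (Sz (inl (i, Ordinal lG))).
  have [->|nl] := eqVneq l #|gT|.
    have := monicP (monic_prod_XsubC (index_enum gT) predT (fun g => rho g (x i))).
    by rewrite lead_coefE size_prod_XsubC -sum1_size sum1_card /= => ->.
  rewrite nth_default // size_prod_XsubC -sum1_size sum1_card.
  by rewrite ltn_neqAle eq_sym nl.
have [p Ep] : S (inv_val b).
  rewrite -(reynolds_id char0 (inv_val_invariant b)) Ea.
  have -> : reynolds rho (\sum_t a t * xm t) = \sum_t a t * reynolds rho (xm t).
    have ia t : invariant_elt rho (a t).
      by have [p <-] := Sa t; apply: inv_val_invariant.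
    elim/big_rec2: _ => [|t u v _ <-].
      by have := reynoldsP rho (-1) 0 0; rewrite scaler0 addr0 scaleN1r addNr.
    by rewrite -(reynoldsMl _ (ia t)) -[a t * _ in LHS]scale1r reynoldsP scale1r.
  elim/big_ind: _ => // t _; apply: SM => //; exact: (Sz (inr t)).
by exists p; apply: val_inj; rewrite /= Ep.
Qed.

Section Forms.
Variable k : nat.

Lemma generated_span a (Q1 : kahler A -> Prop) : Q1 0 ->
  (forall b z u, (exists i, z = x i) -> Q1 u -> Q1 (b *: dif z + u)) -> Q1 (dif a).
Proof.
move=> Q10 Q1L; have [p <-] := (generates_ev x).1 gen a.
have der : derivation (fun a : A => a) (@dif K A).
  by split=> [c b d|b d]; rewrite ?dif_linear ?difM.
rewrite (@derivation_ev _ _ _ idfun _ _ _ x p der).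
by elim/big_rec: _ => // i u _; apply: Q1L; exists i.
Qed.

Lemma invariant_form_module : exists (q : nat) (v : 'I_q -> kahler_form A k),
  forall w, exists b : 'I_q -> inv_ring rho, w = \sum_i inv_val (b i) *: v i.
Proof.
pose T : finType := (exponents * {ffun 'I_k -> 'I_N})%type.
pose vT (t : T) : kahler_form A k := xm t.1 *: dwedge [ffun p => x (t.2 p)].
suff main w : exists b : T -> inv_ring rho, w = \sum_t inv_val (b t) *: vT t.
  exists #|T|, (fun i => vT (enum_val i)) => w; have [b ->] := main w.
  exists (fun i => b (enum_val i)); rewrite (reindex (@enum_val T predT)) //=.
  exact/onW_bij/enum_val_bij.
pose Q w := exists b : T -> inv_ring rho, w = \sum_t inv_val (b t) *: vT t.
suff: forall w, Q w by apply.
apply: (form_span_ind generated_span) => [|a g {}w gx [b ->]].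
  by exists (fun=> 0); rewrite big1 // => t _; rewrite rmorph0 scale0r.
have [s sP] := choice gx; have [d ->] := invariant_module a.
exists (fun t => b t + (if t.2 == [ffun p => s p] then d t.1 else 0)).
under [RHS]eq_bigr do rewrite rmorphD /= scalerDl.
rewrite big_split /= addrC; congr (_ + _).
rewrite scaler_suml -(pair_bigA _ (fun t1 t2 => inv_val (if t2 == [ffun p => s p] then d t1 else 0)
  *: vT (t1, t2))) /=.
apply: eq_bigr => t _; rewrite (bigD1 [ffun p => s p]) //= eqxx big1 ?addr0 => [|t2 /negPf ->].
  rewrite /vT /= scalerA; congr (_ *: dwedge _).
  by apply/ffunP => p; rewrite !ffunE.
by rewrite rmorph0 scale0r.
Qed.

End Forms.
End Noether.

(** * Forms after base change *)

Section FormChange.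
Variables (K F : fieldType) (A : comAlgType K) (e : {rmorphism A -> F}).
Variables (gT : finGroupType) (rho : gT -> {lrmorphism A -> A}).
Variables (A' : comAlgType F) (j : {rmorphism A -> A'}) (e' : {rmorphism A' -> F}).
Variables (rho' : gT -> {lrmorphism A' -> A'}).
Hypothesis PC : point_change e rho j e' rho'.
Variables (k : nat) (J : kahler_form A k -> kahler_form A' k).
Hypotheses (J_lin : semilinear_along j J).
Hypothesis JE : forall g, J (dwedge g) = dwedge [ffun p => j (g p)].

Let AA' := change_algebra PC.

Lemma change_span a (Q1 : kahler A' -> Prop) : Q1 0 ->
  (forall b z u, (exists a, z = j a) -> Q1 u -> Q1 (b *: dif z + u)) -> Q1 (dif a).
Proof.
move=> Q10 Q1L; elim/(change_ind AA'): a => [|f a w Qw].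
  suff -> : dif (0 : A') = 0 by [].
  have der : derivation (fun a : A' => a) (@dif F A').
    by split=> [c b d|b d]; rewrite ?dif_linear ?difM.
  exact: (@derivation0 _ _ _ idfun _ _ der).
by rewrite dif_linear; apply: Q1L => //; exists a.
Qed.

Lemma change_form_ind (Q : kahler_form A' k -> Prop) : Q 0 ->
  (forall (f : F) v w, Q w -> Q (f%:A *: J v + w)) -> forall w, Q w.
Proof.
move=> Q0 QL; apply: (form_span_ind change_span) => // a g w gj.
have [s sP] := choice gj.
have -> : dwedge g = J (dwedge [ffun p => s p]).
  by rewrite JE; congr dwedge; apply/ffunP => p; rewrite !ffunE.
elim/(change_ind AA'): a => [|f a x IH Qw]; first by rewrite scale0r add0r.
rewrite scalerDl -addrA -mulr_algl -scalerA -(slinZ J_lin).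
by apply: QL; apply: IH.
Qed.

Lemma pullback_change g w : pullback (rho' g) (J w) = J (pullback (rho g) w).
Proof.
elim/form_ind: w => [|a h w IH]; first by rewrite !(pullback0, slin0 J_lin).
rewrite pullback_dwedge !J_lin JE pullback_dwedge IH JE (change_actE PC).
by congr (_ *: dwedge _ + _); apply/ffunP => p; rewrite !ffunE (change_actE PC).
Qed.

End FormChange.

(** Averages of forms after base change are F-combinations of images of invariant forms on [A],
    which are pulled back by assumption; an invariant form is, up to the nonzero group order, its
    own average. *)
Lemma surjective_invariant_generated (K F : fieldType) (char0 : [pchar K] =i pred0)
    (A : comAlgType K) (e : {rmorphism A -> F}) (gT : finGroupType)
    (rho : gT -> {lrmorphism A -> A}) (act : is_algebra_action rho)
    (A' : comAlgType F) (j : {rmorphism A -> A'}) (e' : {rmorphism A' -> F})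
    (rho' : gT -> {lrmorphism A' -> A'}) (k : nat) :
  point_change e rho j e' rho' ->
  (forall w : kahler_form A k, invariant_form rho w ->
     exists eta : kahler_form (inv_ring rho) k, dpi eta = w) ->
  invariant_generated rho' k.
Proof.
move=> PC surj L L_lin L_im w invw.
have [J [J_lin JE]] := form_change_of_base k (change_scalar (change_algebra PC)).
have LD u v : L (u + v) = L u + L v by have := L_lin 1 u v; rewrite !scale1r mul1r.
have L0 : L 0 = 0 by apply: (addrI (L 0)); rewrite -LD !addr0.
have LJ v : invariant_form rho v -> L (J v) = 0.
  move=> /surj [eta <-]; rewrite /dpi; elim/form_ind: eta => [|a g eta IH].
    by rewrite pullback0 (slin0 J_lin).
  rewrite pullback_dwedge J_lin LD IH addr0 JE; apply: L_im => [g'|q g'].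
    by rewrite (change_actE PC) inv_val_invariant.
  by rewrite !ffunE (change_actE PC) inv_val_invariant.
have avg v : L (\sum_g pullback (rho' g) v) = 0.
  apply: (change_form_ind PC J_lin JE (Q := fun v => L (\sum_g pullback (rho' g) v) = 0)).
    by rewrite big1 // => g _; rewrite pullback0.
  move=> f {}v u Eu; under eq_bigr do
    rewrite pullbackP (pullback_change PC J_lin JE) linearZ /= rmorph1.
  rewrite big_split LD Eu addr0 -scaler_sumr -(slin_sum J_lin).
  have := L_lin f (J (\sum_i pullback (rho i) v)) 0.
  by rewrite L0 !addr0 => ->; rewrite LJ ?mulr0 //; apply: sum_pullback_invariant.
have := avg w; under eq_bigr do rewrite invw; rewrite sumr_const -scaler_nat.
have := L_lin #|gT|%:R w 0; rewrite L0 !addr0.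
rewrite (_ : (#|gT|%:R)%:A = #|gT|%:R :> A'); last by rewrite scaler_nat.
move=> -> /eqP; rewrite mulf_eq0 (negPf (card_neq0 (point_pchar e char0) gT)) /=.
by move/eqP.
Qed.

Section ExteriorExpansion.
Variables (R : comNzRingType) (M : lmodType R) (k : nat).
Implicit Types (t : {ffun 'I_k -> M}).

Lemma wedge_argD t i u v :
  wedge (subst_arg t i (u + v)) = wedge (subst_arg t i u) + wedge (subst_arg t i v).
Proof. by have := wedge_linear t i 1 u v; rewrite !scale1r. Qed.

Lemma subst_arg_id t i : subst_arg t i (t i) = t.
Proof. by apply/ffunP => j; rewrite ffunE; case: eqP => // ->. Qed.

Lemma wedge_arg_sum t i (I : Type) (r : seq I) (P : pred I) (F : I -> M) :
  wedge (subst_arg t i (\sum_(l <- r | P l) F l)) =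
  \sum_(l <- r | P l) wedge (subst_arg t i (F l)).
Proof.
exact: (big_morph (fun u => wedge (subst_arg t i u)) (wedge_argD t i) (wedge_arg0 t i)).
Qed.

Lemma wedge_expand (N : nat) (a : 'I_k -> 'I_N -> R) (u : 'I_N -> M) :
  wedge [ffun q => \sum_i a q i *: u i] =
  \sum_(t : {ffun 'I_k -> 'I_N}) (\prod_q a q (t q)) *: wedge [ffun q => u (t q)].
Proof.
(* [r] lists the positions that still carry a sum; the other arguments are single vectors, encoded
   by coefficient rows equal to basis vectors. *)
suff main (r : seq 'I_k) : forall a : 'I_k -> 'I_N -> R,
    (forall q, q \notin r -> exists i, forall l, a q l = (l == i)%:R) ->
    wedge [ffun q => \sum_i a q i *: u i] =
    \sum_(t : {ffun 'I_k -> 'I_N}) (\prod_q a q (t q)) *: wedge [ffun q => u (t q)].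
  by apply: (main (index_enum 'I_k)) => q; rewrite mem_index_enum.
elim: r => [|q0 r IH] {}a ar.
  have [s sP] := choice (fun q => ar q isT).
  rewrite (bigD1 [ffun q => s q]) //= [\prod_q _]big1 => [|q _]; last first.
    by rewrite sP ffunE eqxx.
  rewrite scale1r [X in _ = _ + X]big1 ?addr0 => [|t ts].
    congr wedge; apply/ffunP => q; rewrite !ffunE (bigD1 (s q)) //= sP eqxx scale1r.
    by rewrite big1 ?addr0 // => l /negPf ls; rewrite sP ls scale0r.
  have [q tq] : exists q, t q != s q.
    apply: contrapT => none; case/eqP: ts; apply/ffunP => q; rewrite ffunE.
    by apply/eqP; apply: contrapT => /negP ne; apply: none; exists q.
  by rewrite (bigD1 q) //= sP (negPf tq) mul0r scale0r.
pose ai i q l := if q == q0 then (l == i)%:R else a q l.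
set T := [ffun q => _].
transitivity (\sum_i a q0 i *: wedge (subst_arg T q0 (u i))).
  rewrite -[in LHS](subst_arg_id T q0) [T q0]ffunE wedge_arg_sum.
  by apply: eq_bigr => i _; rewrite wedge_argZ.
have E i : wedge (subst_arg T q0 (u i)) =
    \sum_(t : {ffun 'I_k -> 'I_N}) (\prod_q ai i q (t q)) *: wedge [ffun q => u (t q)].
  rewrite -IH => [|q qr].
    congr wedge; apply/ffunP => q; rewrite !ffunE /ai; case: eqP => [_|//].
    rewrite (bigD1 i) //= eqxx scale1r big1 ?addr0 // => l /negPf ->.
    by rewrite scale0r.
  rewrite /ai; case: eqP => [_|/eqP ne]; first by exists i.
  by apply: ar; rewrite inE negb_or ne.
under eq_bigr do rewrite E scaler_sumr.
rewrite exchange_big; apply: eq_bigr => t _; under eq_bigr do rewrite scalerA.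
rewrite -scaler_suml; congr (_ *: _); rewrite (bigD1 (t q0)) //= [X in _ + X]big1 ?addr0 => [|i it].
  rewrite (bigD1 q0) //= /ai !eqxx mul1r [RHS](bigD1 q0) //=; congr (_ * _).
  by apply: eq_bigr => q /negPf ->.
by rewrite (bigD1 q0) //= /ai eqxx eq_sym (negPf it) mul0r mulr0.
Qed.

Lemma wedge_tperm t i j : i != j ->
  wedge [ffun q => t (tperm i j q)] = - wedge t.
Proof.
move=> ij; pose f u v := wedge (subst_arg (subst_arg t i u) j v).
have fC u v : f u v = wedge (subst_arg (subst_arg t j v) i u).
  congr wedge; apply/ffunP => q; rewrite !ffunE.
  by case: (q =P j) => // ->; rewrite eq_sym (negPf ij).
have f0 u : f u u = 0 by apply: (wedge_alt ij); rewrite !ffunE eqxx (negPf ij) eqxx.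
have := f0 (t i + t j); rewrite {1}/f wedge_argD -!/(f _ _) !fC !wedge_argD -!fC !f0.
rewrite add0r addr0 => /eqP; rewrite addrC addr_eq0 => /eqP E.
have -> : wedge t = f (t i) (t j).
  congr wedge; apply/ffunP => q; rewrite !ffunE.
  by case: eqP => [->//|_]; case: eqP => [->|].
rewrite E opprK; congr wedge; apply/ffunP => q; rewrite !ffunE.
case: tpermP => [->|->|/eqP qi /eqP qj]; rewrite ?eqxx ?(negPf ij) //.
by rewrite (negPf qi) (negPf qj).
Qed.

Lemma wedge_perm t (s : {perm 'I_k}) :
  wedge [ffun q => t (s q)] = (-1) ^+ s *: wedge t.
Proof.
have [ts -> dts] := prod_tpermP s; elim: ts t dts => [|[i j] ts IH] t /=.
  move=> _; rewrite big_nil odd_perm1 expr0 scale1r; congr wedge.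
  by apply/ffunP => q; rewrite ffunE perm1.
move=> /andP [ij dts]; rewrite big_cons odd_permM odd_tperm [_ != _]ij signr_addb expr1.
pose t' := [ffun q => t ((\prod_(p <- ts) tperm p.1 p.2)%g q)].
have -> : [ffun q => t ((tperm i j * \prod_(p <- ts) tperm p.1 p.2)%g q)] =
    [ffun q => t' (tperm i j q)] by apply/ffunP => q; rewrite !ffunE permM.
by rewrite wedge_tperm // IH // mulN1r scaleNr.
Qed.

End ExteriorExpansion.

(** Each permutation in the determinant contributes one copy of the form: reindexing the tuple
    changes the wedge by the same sign as in the determinant. The sum runs over all tuples, whence
    the factorial. *)
Lemma contraction_sum (K : fieldType) (A : comAlgType K) (N : nat) (x : 'I_N -> A)
    (d : 'I_N -> A -> A) (k : nat) (g : {ffun 'I_k -> A}) :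
  (forall a, dif a = \sum_i d i a *: dif (x i) :> kahler A) ->
  \sum_(t : {ffun 'I_k -> 'I_N}) \det (\matrix_(q, p) d (t p) (g q)) *:
    dwedge [ffun p => x (t p)] = k`!%:R *: dwedge g.
Proof.
move=> dE; rewrite /determinant; under eq_bigr do rewrite scaler_suml.
rewrite exchange_big /=.
transitivity (\sum_(s : {perm 'I_k}) dwedge g); last first.
  by rewrite sumr_const -scaler_nat card_Sn.
apply: eq_bigr => s _.
have -> : dwedge g = \sum_(t : {ffun 'I_k -> 'I_N}) (\prod_q d (t q) (g q)) *:
    dwedge [ffun q => x (t q)].
  rewrite {1}/dwedge (_ : [ffun i => _] = [ffun q => \sum_i d i (g q) *: dif (x i)]).
    rewrite (wedge_expand (fun q i => d i (g q))); apply: eq_bigr => t _.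
    by congr (_ *: wedge _); apply/ffunP => q; rewrite !ffunE.
  by apply/ffunP => q; rewrite !ffunE dE.
pose sh (s : {perm 'I_k}) (t : {ffun 'I_k -> 'I_N}) := [ffun q => t (s q)].
have shK : cancel (sh s) (sh s^-1%g).
  by move=> t; apply/ffunP => q; rewrite !ffunE permKV.
have shKV : cancel (sh s^-1%g) (sh s).
  by move=> t; apply/ffunP => q; rewrite !ffunE permK.
rewrite [RHS](reindex (sh s)) /=; last by exists (sh s^-1%g) => t _.
apply: eq_bigr => t _.
have -> : dwedge [ffun q => x (sh s t q)] = (-1) ^+ s *: dwedge [ffun p => x (t p)].
  rewrite /dwedge -wedge_perm; congr wedge; apply/ffunP => q; by rewrite !ffunE.
rewrite scalerA mulrC; congr (_ * _ *: _); apply: eq_bigr => q _.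
by rewrite mxE ffunE.
Qed.

Section FunctionalChange.
Variables (K F : fieldType) (char0 : [pchar K] =i pred0) (A : comAlgType K).
Hypotheses (ftA : finite_type A) (smA : formally_smooth A).
Variables (e : {rmorphism A -> F}) (A' : comAlgType F) (j : {rmorphism A -> A'}).
Hypothesis AA' : algebra_change e j.
Variables (k : nat) (J : kahler_form A k -> kahler_form A' k).
Hypotheses (J_lin : semilinear_along j J).
Hypothesis JE : forall g, J (dwedge g) = dwedge [ffun p => j (g p)].

Lemma derivation_scalars (d : A -> A) : derivation (fun a : A => a) (d : A -> A^o) ->
  exists d' : A' -> A', derivation (fun a : A' => a) (d' : A' -> A'^o) /\
    forall a, d' (j a) = j (d a).
Proof.
move=> der; have derd : derivation idfun (d : A -> A^o) by [].
have dM u v : d (u * v) = u * d v + v * d u := derivationM der u v.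
have [|d' d'E] := @change_lift _ _ _ _ _ _ AA' A' (fun a => j (d a)).
  move=> c a b; rewrite (derivationD derd) (derivationZ derd) /= rmorphD; congr (_ + _).
  by rewrite -[c%:A *: _]/(c%:A * _) rmorphM (change_scalar AA') mulr_algl.
exists d'; split=> //; split=> [c a b|a b].
  by rewrite linearP -[(c%:A : A') *: _]/(_ * _) mulr_algl.
rewrite -[_ *: _]/(a * d' b) -[b *: _]/(b * d' a).
elim/(change_ind AA'): a => [|c a x IHx].
  by rewrite !mul0r linear0 mulr0 addr0.
rewrite mulrDl -scalerAl !linearP IHx.
have -> : d' (j a * b) = j a * d' b + b * d' (j a).
  elim/(change_ind AA'): b {IHx} => [|f b y IHy].
    by rewrite mulr0 linear0 mulr0 mul0r addr0.
  rewrite mulrDr -scalerAr -rmorphM !linearP IHy !d'E dM rmorphD !rmorphM.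
  by rewrite mulrDr mulrDl -scalerAr -scalerAl scalerDr addrACA.
by rewrite mulrDl mulrDr -scalerAl -scalerAr scalerDr addrACA.
Qed.

(* [mu] is recovered from its values on [a *: dx_t], so it extends through    *)
(* the contractions against the extended dual basis.                          *)
Lemma functional_change (mu : kahler_form A k -> F) :
  (forall c v w, mu (c%:A *: v + w) = e c%:A * mu v + mu w) ->
  exists mu' : kahler_form A' k -> F,
    (forall c v w, mu' (c%:A *: v + w) = c * mu' v + mu' w) /\ forall v, mu' (J v) = mu v.
Proof.
move=> mu_lin; have [N [x [d [gen der dE]]]] := dual_basis ftA smA.
have [d' d'P] := choice (fun i => derivation_scalars (der i)).
have difE a : dif a = \sum_i d i a *: dif (x i) :> kahler A.
  apply: (dE A idfun (kahler A) (@dif K A)).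
  by split=> [c b f|b f]; rewrite ?dif_linear ?difM.
have exPhi (t : {ffun 'I_k -> 'I_N}) : exists Phi : kahler_form A' k -> A',
    (forall a v w, Phi (a *: v + w) = a * Phi v + Phi w) /\
    forall g, Phi (dwedge g) = \det (\matrix_(q, p) d' (t p) (g q)).
  have [|Phi [Phi_lin PhiE]] := @form_contraction F A' k A' idfun (fun p => d' (t p)).
    by move=> p; case: (d'P (t p)).
  by exists Phi; split.
have [Phi PhiP] := choice exPhi.
have exmu (t : {ffun 'I_k -> 'I_N}) : exists m : {linear A' -> F^o},
    forall a, m (j a) = mu (a *: dwedge [ffun p => x (t p)]).
  apply: (@change_lift _ _ _ _ _ _ AA' F^o (fun a => mu (a *: dwedge [ffun p => x (t p)]))).
  move=> c a b; rewrite scalerDl -[c *: a]mulr_algl -scalerA.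
  exact: mu_lin.
have [m mP] := choice exmu.
have kF : (k`!%:R : F) != 0.
  by move/pcharf0P: (point_pchar e char0) => ->; rewrite -lt0n fact_gt0.
have muD v w : mu (v + w) = mu v + mu w.
  by have := mu_lin 1 v w; rewrite !scale1r rmorph1 mul1r.
have mu0 : mu 0 = 0 by apply: (addrI (mu 0)); rewrite -muD !addr0.
exists (fun w => k`!%:R^-1 * \sum_t m t (Phi t w)); split=> [c v w|v].
  rewrite mulrCA -mulrDr; congr (_ * _); rewrite mulr_sumr -big_split.
  by apply: eq_bigr => t _; rewrite (PhiP t).1 mulr_algl linearP.
elim/form_ind: v => [|a g w IH].
  rewrite (slin0 J_lin) mu0 big1 ?mulr0 // => t _.
  have -> : Phi t 0 = 0; last exact: linear0.
  apply: (addrI (Phi t 0)); have := (PhiP t).1 1 0 0.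
  by rewrite scale1r mul1r !addr0 => <-.
rewrite J_lin JE muD -IH; apply: (mulfI kF).
rewrite mulrDr 2!mulrA mulfV // !mul1r.
under eq_bigr => t _ do rewrite (PhiP t).1 linearD.
rewrite big_split /=; congr (_ + _).
have -> : k`!%:R * mu (a *: dwedge g) = mu (a *: (k`!%:R *: dwedge g)).
  have := mu_lin k`!%:R (a *: dwedge g) 0; rewrite mu0 !addr0 !scaler_nat.
  by rewrite rmorphMn /= rmorph1 => <-; rewrite scalerMnr.
rewrite -(contraction_sum g difE) scaler_sumr (big_morph mu muD mu0).
apply: eq_bigr => t _; rewrite scalerA -mP rmorphM; congr (m t (_ * _)).
rewrite (PhiP t).2 -det_map_mx; congr (\det _); apply/matrixP => q p.
by rewrite !mxE ffunE (d'P _).2.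
Qed.

End FunctionalChange.

(** * Free inertia implies surjectivity *)

Section NakayamaFunctional.
Variables (K F : fieldType) (A : comAlgType K).
Variables (gT : finGroupType) (rho : gT -> {lrmorphism A -> A}).
Variables (e : {rmorphism A -> F}) (V : lmodType A) (M L : V -> Prop).

Local Notation B := (inv_ring rho).

Hypotheses (L0 : L 0) (LD : forall u v, L u -> L v -> L (u + v)).
Hypothesis LZ : forall (b : B) v, L v -> L (inv_val b *: v).
Hypotheses (MD : forall u v, M u -> M v -> M (u + v)).
Hypothesis MZ : forall (b : B) v, M v -> M (inv_val b *: v).
Hypothesis LM : forall v, L v -> M v.
Variables (q : nat) (v : 'I_q -> V).
Hypotheses (Mv : forall i, M (v i)).
Hypothesis Mgen : forall m, M m -> exists b : 'I_q -> B, m = \sum_i inv_val (b i) *: v i.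
Hypothesis proper : forall b : B, (forall m, M m -> L (inv_val b *: m)) -> e (inv_val b) = 0.

Let eB (b : B) : F := e (inv_val b).
Let LB u w : L u -> L w -> L (u - w).
Proof.
by move=> Lu Lw; apply: LD => //; have := LZ (-1) Lw; rewrite rmorphN1 scaleN1r.
Qed.

(** Localisation is avoided by multiplying with elements not vanishing at the point: among the
    numbers of generators then sufficient modulo [L], the least is positive by [proper], and the
    coefficient of the last generator is the functional. *)
Lemma nakayama_functional : exists mu : V -> F,
  [/\ forall u w, M u -> M w -> mu (u + w) = mu u + mu w,
      forall (b : B) m, M m -> mu (inv_val b *: m) = e (inv_val b) * mu m,
      forall l, L l -> mu l = 0 & exists2 m, M m & mu m != 0].
Proof.
(* [P t] says that, near the point, the first [t] generators suffice modulo [L]. *)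
pose below t (b : 'I_q -> B) := forall i : 'I_q, (t <= i)%N -> b i = 0.
pose P t := `[< exists s : B, eB s != 0 /\ forall m, M m -> exists b : 'I_q -> B,
  below t b /\ L (inv_val s *: m - \sum_i inv_val (b i) *: v i) >].
have Pq : P q.
  apply/asboolP; exists 1; split; first by rewrite /eB !rmorph1 oner_neq0.
  move=> m /Mgen [b Eb]; exists b; split=> [i|]; first by rewrite leqNgt ltn_ord.
  by rewrite rmorph1 scale1r Eb subrr.
have exP : exists t, P t by exists q.
case: (ex_minnP exP) => t /asboolP [s [es sM]] mint.
have tq : (t <= q)%N := mint q Pq.
have t0 : (0 < t)%N.
  rewrite lt0n; apply/eqP => t0; case/eqP: es; apply: proper => m /sM [b [bt]].
  by rewrite t0 in bt; rewrite big1 ?subr0 // => i _; rewrite bt // rmorph0 scale0r.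
have tq' : (t.-1 < q)%N by rewrite prednK.
pose i0 := Ordinal tq'.
have uniq (c : 'I_q -> B) : below t c -> L (\sum_i inv_val (c i) *: v i) -> eB (c i0) = 0.
  move=> ct Lc; apply/eqP; apply: contrapT => /negP ec.
  suff : (t <= t.-1)%N by rewrite leqNgt prednK // leqnn.
  apply: mint; apply/asboolP; exists (c i0 * s); split.
    by rewrite /eB !rmorphM mulf_neq0.
  move=> m /sM [b [bt Lb]]; exists (fun i => c i0 * b i - b i0 * c i); split=> [i|].
    rewrite leq_eqVlt => /orP [/eqP ti|]; last first.
      by rewrite prednK // => ti; rewrite (bt i ti) (ct i ti) !mulr0 subrr.
    by rewrite (_ : i = i0) ?[b i0 * _]mulrC ?subrr //; apply: val_inj.
  rewrite rmorphM -scalerA.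
  have -> : \sum_i inv_val (c i0 * b i - b i0 * c i) *: v i =
    inv_val (c i0) *: (\sum_i inv_val (b i) *: v i) -
    inv_val (b i0) *: (\sum_i inv_val (c i) *: v i).
    rewrite !scaler_sumr -sumrB; apply: eq_bigr => i _.
    by rewrite !scalerA -scalerBl rmorphB !rmorphM.
  rewrite opprB addrA [_ + inv_val (b i0) *: _]addrC -addrA -scalerBr.
  by apply: LD; apply: LZ.
have exb m : exists b : 'I_q -> B, M m ->
    below t b /\ L (inv_val s *: m - \sum_i inv_val (b i) *: v i).
  by have [/sM [b bP]|nM] := pselect (M m); [exists b | exists (fun=> 0)].
have [b bP] := choice exb.
have key m (c : 'I_q -> B) : M m -> below t c ->
    L (inv_val s *: m - \sum_i inv_val (c i) *: v i) -> eB (b m i0) = eB (c i0).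
  move=> /bP [bt Lb] ct Lc.
  have := uniq (fun i => b m i - c i); rewrite /eB !rmorphB /= => E.
  apply/eqP; rewrite -subr_eq0 E // => [i ti|]; first by rewrite bt // ct // subrr.
  have -> : \sum_i inv_val (b m i - c i) *: v i =
    inv_val s *: m - \sum_i inv_val (c i) *: v i -
    (inv_val s *: m - \sum_i inv_val (b m i) *: v i).
    rewrite opprB addrC addrA subrK -sumrB; apply: eq_bigr => i _.
    by rewrite rmorphB scalerBl.
  exact: LB.
exists (fun m => eB (b m i0) / eB s); split=> [u w Mu Mw|d m Mm|l Ll|].
- rewrite -mulrDl; congr (_ / _); have [[bu Lu] [bw Lw]] := (bP _ Mu, bP _ Mw).
  rewrite (key _ (fun i => b u i + b w i)); first by rewrite /eB !rmorphD.
  - exact: MD.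
  - by move=> i ti; rewrite bu // bw // addr0.
  - have -> : \sum_i inv_val (b u i + b w i) *: v i =
      \sum_i inv_val (b u i) *: v i + \sum_i inv_val (b w i) *: v i.
      by rewrite -big_split; apply: eq_bigr => i _; rewrite rmorphD scalerDl.
    by rewrite scalerDr opprD addrACA; apply: LD.
- rewrite mulrA; congr (_ / _); have [bm Lm] := bP _ Mm.
  rewrite (key _ (fun i => d * b m i)); first by rewrite /eB !rmorphM.
  - exact: MZ.
  - by move=> i ti; rewrite bm // mulr0.
  - have -> : \sum_i inv_val (d * b m i) *: v i =
      inv_val d *: \sum_i inv_val (b m i) *: v i.
      by rewrite scaler_sumr; apply: eq_bigr => i _; rewrite rmorphM scalerA.
    by rewrite scalerA mulrC -scalerA -scalerBr; apply: LZ.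
- rewrite (key _ (fun=> 0)); first by rewrite /eB !rmorph0 mul0r.
  - exact: LM.
  - by [].
  - by rewrite big1 ?subr0 => [|i _]; rewrite ?rmorph0 ?scale0r //; apply: LZ.
- exists (v i0) => //.
  rewrite (key _ (fun i => if i == i0 then s else 0)) //.
  - by rewrite eqxx mulfV ?oner_neq0.
  - move=> i ti; case: eqP => // Ei; move: ti; rewrite Ei /=.
    by rewrite leqNgt prednK // leqnn.
  - rewrite (bigD1 i0) //= eqxx big1 ?addr0 ?subrr // => i /negPf ->.
    by rewrite rmorph0 scale0r.
Qed.

End NakayamaFunctional.

(* At every point over a field with enough roots of unity the inertia group    *)
(* acts on the cotangent space as a group generated by reflections.            *)
Definition free_inertia (K : fieldType) (A : comAlgType K) (gT : finGroupType)
    (rho : gT -> {lrmorphism A -> A}) : Prop :=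
  forall (F : fieldType) (e : {rmorphism A -> F}) (z : F)
    (A' : comAlgType F) (j : {rmorphism A -> A'}) (e' : {rmorphism A' -> F})
    (rho' : gT -> {lrmorphism A' -> A'}) n (u : 'I_n -> A') chi,
  #|gT|.-primitive_root z -> point_change e rho j e' rho' ->
  coordinates rho' e' u chi -> axes_monoid (trivial_weight rho' e' chi).

Section FreeSurjective.
Variables (K : fieldType) (char0 : [pchar K] =i pred0) (A : comAlgType K).
Variables (gT : finGroupType) (rho : gT -> {lrmorphism A -> A}).
Hypotheses (abelG : abelian [set: gT]) (act : is_algebra_action rho).
Hypotheses (ftA : finite_type A) (smA : formally_smooth A).

(** Lying over: if [aa] generated the unit ideal of [A], averaging an expression of 1 would put 1 in
    [aa]. *)
Lemma point_over_invariants (aa : inv_ring rho -> Prop) : is_ideal aa -> ~ aa 1 ->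
  exists (F : fieldType) (e : {rmorphism A -> F}),
    (forall b, aa b -> e (inv_val b) = 0) /\ exists z : F, #|gT|.-primitive_root z.
Proof.
move=> idaa aa1.
pose I a := exists (r : nat) (b : 'I_r -> inv_ring rho) (c : 'I_r -> A),
  (forall i, aa (b i)) /\ a = \sum_i inv_val (b i) * c i.
have idI : is_ideal I.
  split=> [|a1 a2 [r [b [c [ab ->]]]] [r' [b' [c' [ab' ->]]]]|a1 a2 [r [b [c [ab ->]]]]].
  - by exists 0%N, (fun=> 0), (fun=> 0); split=> [[]|] //; rewrite big_ord0.
  - exists (r + r')%N, (fun i => match split i with inl i => b i | inr i => b' i end).
    exists (fun i => match split i with inl i => c i | inr i => c' i end); split=> [i|].
      by case: split.
    rewrite big_split_ord /=; congr (_ + _); apply: eq_bigr => i _.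
      by rewrite (unsplitK (inl i)).
    by rewrite (unsplitK (inr i)).
  - exists r, b, (fun i => a1 * c i); split=> //; rewrite mulr_sumr.
    by apply: eq_bigr => i _; rewrite mulrCA.
have I1 : ~ I 1.
  move=> [r [b [c [ab E1]]]]; apply: aa1.
  have [c' cP] := choice (fun i => inv_lift (reynolds_invariant act (c i))).
  suff -> : 1 = \sum_i b i * c' i.
    refine (@ideal_sum _ _ _ _ _ _ idaa _) => i _.
    by apply: (ideal_mulr _ idaa).
  apply: val_inj; rewrite /= -(reynolds_id char0 (invariant_elt1 rho)) E1.
  rewrite (rmorph_sum (@inv_val _ _ _ rho)).
  transitivity (\sum_i inv_val (b i) * reynolds rho (c i)); last first.
    by apply: eq_bigr => i _; rewrite rmorphM /= cP.
  elim/big_rec2: _ => [|i u1 u2 _ <-].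
    by have := reynoldsP rho (-1) 0 0; rewrite scaler0 addr0 scaleN1r addNr.
  rewrite -(reynoldsMl _ (inv_val_invariant (b i))) -[inv_val _ * _ in LHS]scale1r.
  by rewrite reynoldsP scale1r.
have G0 : (0 < #|gT|)%N by apply/card_gt0P; exists 1%g.
have [F [e [eI prim]]] := point_over char0 G0 idI I1.
exists F, e; split=> // b ab; apply: eI; exists 1%N, (fun=> b), (fun=> 1); split=> //.
by rewrite big_ord1 mulr1.
Qed.

Section Point.
Variables (F : fieldType) (e : {rmorphism A -> F}).
Variables (A' : comAlgType F) (j : {rmorphism A -> A'}) (e' : {rmorphism A' -> F}).
Variables (rho' : gT -> {lrmorphism A' -> A'}).
Hypothesis PC : point_change e rho j e' rho'.

Let AA' := change_algebra PC.

Lemma change_scale c a : j (c *: a) = e c%:A *: j a.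
Proof. by rewrite -[c *: a]mulr_algl rmorphM (change_scalar AA') mulr_algl. Qed.

Lemma change_reynolds a : reynolds rho' (j a) = j (reynolds rho a).
Proof.
rewrite /reynolds change_scale rmorph_sum; congr (_ *: _); last first.
  by apply: eq_bigr => g _; rewrite (change_actE PC).
have E c : e c^-1%:A = (e c%:A)^-1 := fmorphV (e \o in_alg A : {rmorphism K -> F}) c.
by rewrite E scaler_nat rmorph_nat.
Qed.

Lemma change_finite_type : finite_type A'.
Proof.
have [N [x gen]] := (finite_typeP A).1 ftA; apply/finite_typeP.
by exists N, (fun i => j (x i)); apply: (change_generates AA').
Qed.

(** Averaging commutes with base change, so the invariants of [A'] are spanned over [F] by those of
    [A]. *)
Lemma inv_change_ind (Q : inv_ring rho' -> Prop) : Q 0 ->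
  (forall f (a : inv_ring rho) (z w : inv_ring rho'), inv_val z = j (inv_val a) -> Q w ->
    Q (f *: z + w)) -> forall b, Q b.
Proof.
move=> Q0 QL b.
suff main a : forall b, inv_val b = reynolds rho' a -> Q b.
  apply: (main (inv_val b)).
  rewrite (reynolds_id (point_pchar e char0)) //; exact: inv_val_invariant.
elim/(change_ind AA'): a => [|f a w IH] {}b Eb.
  suff -> : b = 0 by [].
  by apply: val_inj; rewrite /= Eb /reynolds big1 ?scaler0 // => g _; rewrite rmorph0.
have [c Ec] := inv_lift (reynolds_invariant act a).
have [b2 Eb2] := inv_lift (reynolds_invariant (change_act PC) w).
have [z Ez] := inv_lift (reynolds_invariant (change_act PC) (j a)).
have -> : b = f *: z + b2.
  by apply: val_inj; rewrite /= Eb Ez Eb2 reynoldsP.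
by apply: (QL f c); [rewrite Ez change_reynolds Ec | apply: IH].
Qed.

(** A functional on the forms of [A] with values in [F] is extended to [A'], where the point is
    rational; its invariance properties extend by F-linearity and [functional_vanish] applies. *)
Lemma descended_functional_vanish n (u : 'I_n -> A') chi k (mu : kahler_form A k -> F) :
  coordinates rho' e' u chi -> axes_monoid (trivial_weight rho' e' chi) ->
  (forall c v w, mu (c%:A *: v + w) = e c%:A * mu v + mu w) ->
  (forall b w, invariant_elt rho b -> mu (b *: w) = e b * mu w) ->
  (forall g w, mu (pullback (rho g) w) = mu w) ->
  (forall g : {ffun 'I_k -> A}, (forall q, invariant_elt rho (g q)) -> mu (dwedge g) = 0) ->
  forall w, mu w = 0.
Proof.
move=> uP axes mu_lin mu_inv mu_act mu_im w.
have [J [J_lin JE]] := form_change_of_base k (change_scalar AA').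
have [mu' [mu'_lin mu'J]] := functional_change char0 ftA smA AA' J_lin JE mu_lin.
rewrite -mu'J.
have mu'D u1 v1 : mu' (u1 + v1) = mu' u1 + mu' v1.
  by have := mu'_lin 1 u1 v1; rewrite !scale1r mul1r.
have mu'0 : mu' 0 = 0 by apply: (addrI (mu' 0)); rewrite -mu'D !addr0.
have mu'Z c v1 : mu' (c%:A *: v1) = c * mu' v1.
  by have := mu'_lin c v1 0; rewrite mu'0 !addr0.
have mu'_inv b v : invariant_elt rho' b -> mu' (b *: v) = e' b * mu' v.
  move=> /inv_lift [{}b <-].
  elim/(change_form_ind PC J_lin JE): v => [|f v {}w IH].
    by rewrite scaler0 mu'0 mulr0.
  rewrite scalerDr mu'D IH mu'_lin mulrDr; congr (_ + _).
  rewrite scalerA mulrC -scalerA mu'Z mulrCA; congr (_ * _).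
  elim/inv_change_ind: b {IH} => [|f' a z {}b Ez Eb].
    by rewrite !rmorph0 scale0r mu'0 mul0r.
  rewrite linearP /= Ez scalerDl mu'D Eb rmorphD mulrDl; congr (_ + _).
  rewrite -mulr_algl -scalerA mu'Z rmorphM (change_rational PC) (change_point PC) -mulrA.
  congr (_ * _); rewrite -(slinZ J_lin) !mu'J.
  exact/mu_inv/inv_val_invariant.
apply: (functional_vanish (point_pchar e char0) (change_act PC) change_finite_type
  (change_rational PC) uP axes mu'_lin mu'_inv) => [g v|f g inf ing].
  elim/(change_form_ind PC J_lin JE): v => [|f v {}w IH]; first by rewrite pullback0.
  rewrite pullbackP linearZ /= rmorph1 (pullback_change PC J_lin JE) !mu'_lin IH !mu'J.
  by rewrite mu_act.
rewrite mu'_inv //.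
have [b bP] := choice (fun q => inv_lift (ing q)).
(* Seen as a form on the invariants of [A'], it can be expanded in differentials of invariants of
   [A]. *)
have -> : dwedge g = pullback (inv_inclusion rho') (1 *: dwedge [ffun q => b q] + 0).
  rewrite pullback_dwedge pullback0 addr0 rmorph1 scale1r; congr dwedge.
  by apply/ffunP => q; rewrite !ffunE -bP.
move: (1 *: _ + _) => eta.
have span c (Q1 : kahler (inv_ring rho') -> Prop) : Q1 0 ->
    (forall b z u, (exists a, inv_val z = j (inv_val (a : inv_ring rho))) -> Q1 u ->
      Q1 (b *: dif z + u)) -> Q1 (dif c).
  move=> Q10 Q1L; elim/inv_change_ind: c => [|f' a z c Ez Qc].
    suff -> : dif (0 : inv_ring rho') = 0 by [].
    have der : derivation (fun a : inv_ring rho' => a) (@dif F _).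
      by split=> [? ? ?|? ?]; rewrite ?dif_linear ?difM.
    exact: (@derivation0 _ _ _ idfun _ _ der).
  by rewrite dif_linear; apply: Q1L => //; exists a.
suff -> : mu' (pullback (inv_inclusion rho') eta) = 0 by rewrite mulr0.
pose Q (eta : kahler_form (inv_ring rho') k) := mu' (pullback (inv_inclusion rho') eta) = 0.
suff: forall eta, Q eta by apply.
apply: (form_span_ind span) => [|c h {}eta hP IH]; first by rewrite /Q pullback0.
rewrite /Q pullback_dwedge mu'D IH addr0 mu'_inv; last exact: inv_val_invariant.
have [d dP] := choice hP.
have -> : dwedge [ffun q => inv_inclusion rho' (h q)] = J (dwedge [ffun q => inv_val (d q)]).
  by rewrite JE; congr dwedge; apply/ffunP => q; rewrite !ffunE -dP.
rewrite mu'J mu_im ?mulr0 // => q; rewrite ffunE; exact: inv_val_invariant.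
Qed.

End Point.

Hypothesis axes : free_inertia rho.

Lemma axes_surjective k (w : kahler_form A k) : invariant_form rho w ->
  exists eta : kahler_form (inv_ring rho) k, dpi eta = w.
Proof.
move=> invw; apply: contrapT => nw.
pose M (v : kahler_form A k) := invariant_form rho v.
pose L v := exists eta : kahler_form (inv_ring rho) k, dpi eta = v.
have LD u v : L u -> L v -> L (u + v).
  by move=> [a <-] [b <-]; exists (a + b); rewrite /dpi pullbackD.
have LZ (b : inv_ring rho) v : L v -> L (inv_val b *: v).
  by move=> [a <-]; exists (b *: a); rewrite /dpi pullbackZ.
have L0 : L 0 by exists 0; rewrite /dpi pullback0.
have MD u v : M u -> M v -> M (u + v).
  by move=> Mu Mv g; rewrite pullbackD Mu Mv.
have MZ (b : inv_ring rho) v : M v -> M (inv_val b *: v).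
  by move=> Mv g; rewrite pullbackZ Mv inv_val_invariant.
have LM v : L v -> M v by move=> [a <-]; apply: dpi_invariant.
pose N := #|gT|%:R : K; have N0 : N != 0 by apply: card_neq0.
pose avg (v : kahler_form A k) := (N^-1)%:A *: \sum_g pullback (rho g) v.
have avgM v : M (avg v).
  move=> g; rewrite pullbackZ (sum_pullback_invariant act); congr (_ *: _).
  by rewrite linearZ /= rmorph1.
have avg_id v : M v -> avg v = v.
  move=> Mv; rewrite /avg (eq_bigr (fun=> v)) => [|g _]; last exact: Mv.
  rewrite sumr_const -scaler_nat scalerA -(rmorph_nat (in_alg A)) -(rmorphM (in_alg A)).
  by rewrite mulVf // rmorph1 scale1r.
have avgL a u v : (forall g, rho g a = a) -> avg (a *: u + v) = a *: avg u + avg v.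
  move=> ia; rewrite /avg scalerA mulrC -scalerA -scalerDr; congr (_ *: _).
  rewrite scaler_sumr -big_split; apply: eq_bigr => g _.
  by rewrite pullbackP ia.
have avg0 : avg 0 = 0 by rewrite /avg big1 ?scaler0 // => g _; rewrite pullback0.
have [Nx [x gen]] := (finite_typeP A).1 ftA.
have [q [v vP]] := invariant_form_module act gen k.
have Mgen m : M m -> exists b : 'I_q -> inv_ring rho, m = \sum_i inv_val (b i) *: avg (v i).
  move=> Mm; have [b Eb] := vP m; exists b; rewrite -[LHS](avg_id _ Mm) Eb.
  elim/big_rec2: _ => // i u1 u2 _ <-; apply: avgL => g; exact: inv_val_invariant.
(* The annihilator of invariant forms modulo pulled-back ones: it is proper exactly when
   surjectivity fails, and [mu] is found at a point above it. *)
pose aa (b : inv_ring rho) := forall m, M m -> L (inv_val b *: m).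
have idaa : is_ideal aa.
  split=> [m _|b c ab ac m Mm|b c ac m Mm]; first by rewrite rmorph0 scale0r.
    by rewrite rmorphD scalerDl; apply: LD; [apply: ab | apply: ac].
  by rewrite rmorphM -scalerA; apply: LZ; apply: ac.
have aa1 : ~ aa 1 by move=> /(_ w invw); rewrite rmorph1 scale1r.
have [F [e [proper [z prim]]]] := point_over_invariants idaa aa1.
have [mu [muD muZ muL [m Mm mu_m]]] :=
  nakayama_functional L0 LD LZ MD MZ LM (fun i => avgM (v i)) Mgen proper.
have [A' [j [e' [rho' PC]]]] := exists_point_change e act.
have [n [u [chi uP]]] := exists_coordinates (point_pchar e char0) abelG (change_act PC)
  (change_rational PC) prim (change_finite_type PC).
case/eqP: mu_m; rewrite -(avg_id _ Mm).
have muE b t : invariant_elt rho b -> M t -> mu (b *: t) = e b * mu t.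
  by move=> /inv_lift [{}b <-]; apply: muZ.
(* The functional is defined on invariant forms; precomposing with the average extends it to all
   forms. *)
apply: (descended_functional_vanish PC (mu := fun t => mu (avg t)) uP (axes prim PC uP)) => [c s t|b t ib|g t|g ig].
- rewrite avgL => [|g]; last by rewrite linearZ /= rmorph1.
  have Mc : M (c%:A *: avg s).
    by have [c' <-] := inv_lift (invariant_elt_alg rho c); apply: MZ.
  by rewrite (muD _ _ Mc (avgM t)) (muE _ _ (invariant_elt_alg rho c) (avgM s)).
- have := avgL b t 0 ib; rewrite !addr0 avg0 addr0 => ->.
  exact: (muE _ _ ib (avgM t)).
- congr mu; rewrite /avg [in RHS](reindex_inj (mulgI g)) /=; congr (_ *: _).
  by apply: eq_bigr => h _; rewrite (pullback_act act).
- apply: muL; have [b bP] := choice (fun q => inv_lift (ig q)).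
  have Lg : L (dwedge g).
    exists (dwedge [ffun q => b q]); rewrite /dpi pullback_wedge; congr wedge.
    by apply/ffunP => p; rewrite !ffunE pullback1_dif -bP.
  by rewrite avg_id //; apply: LM.
Qed.

End FreeSurjective.

(** * Noetherian rings *)

Section NoetherianRings.

Definition gen_ideal (R : comPzRingType) (S : R -> Prop) (x : R) : Prop :=
  forall T : R -> Prop, is_ideal T -> (forall y, S y -> T y) -> T x.

Lemma gen_ideal_ideal (R : comPzRingType) (S : R -> Prop) : is_ideal (gen_ideal S).
Proof.
split=> [T idT _|x y Sx Sy T idT ST|a x Sx T idT ST].
- exact: (ideal0 idT).
- by apply: (idealD idT); [apply: Sx | apply: Sy].
- by apply: (idealMl idT); apply: Sx.
Qed.

Lemma gen_ideal_mem (R : comPzRingType) (S : R -> Prop) x : S x -> gen_ideal S x.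
Proof. by move=> Sx T _; apply. Qed.

Definition noetherian (R : comNzRingType) : Prop :=
  forall I : R -> Prop, is_ideal I -> exists s : seq R,
    (forall x, x \in s -> I x) /\ forall x, I x -> gen_ideal (fun y => y \in s) x.

(** The ascending chain condition, in the form common to Hilbert's basis theorem and to the Rees
    algebra argument. *)
Lemma noetherian_seq (R : comNzRingType) (g : nat -> R) : noetherian R ->
  exists (M : nat) (c : nat -> R), g M = \sum_(i < M) c i * g i.
Proof.
move=> noeR; pose I M x := exists c : nat -> R, x = \sum_(i < M) c i * g i.
have I_le M M' x : (M <= M')%N -> I M x -> I M' x.
  move=> MM' [c ->]; exists (fun i => if (i < M)%N then c i else 0).
  rewrite (big_ord_widen M' (fun i => c i * g i) MM') big_mkcond; apply: eq_bigr => i _.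
  by case: ifP => // _; rewrite mul0r.
have idI M : is_ideal (I M).
  split=> [|x y [c ->] [d ->]|a x [c ->]].
  - by exists (fun=> 0); rewrite big1 // => i _; rewrite mul0r.
  - exists (fun i => c i + d i); rewrite -big_split.
    by apply: eq_bigr => i _; rewrite mulrDl.
  - exists (fun i => a * c i); rewrite mulr_sumr.
    by apply: eq_bigr => i _; rewrite mulrA.
have idU : is_ideal (fun x => exists M, I M x).
  split=> [|x y [M Mx] [M' My]|a x [M Mx]].
  - by exists 0%N; apply: (ideal0 (idI _)).
  - exists (maxn M M'); apply: (idealD (idI _)).
      by apply: I_le Mx; apply: leq_maxl.
    by apply: I_le My; apply: leq_maxr.
  - by exists M; apply: (idealMl (idI _)).
have [s [sI gens]] := noeR _ idU.
have [M sM] : exists M, forall x, x \in s -> I M x.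
  elim: s sI {gens} => [|y s IH] sI; first by exists 0%N.
  have [x xs|M sM] := IH; first by apply: sI; rewrite inE xs orbT.
  have [M' My] := sI y (mem_head _ _).
  exists (maxn M M') => x; rewrite inE => /orP [/eqP ->|/sM Mx].
    by apply: I_le My; apply: leq_maxr.
  by apply: I_le Mx; apply: leq_maxl.
exists M; suff : I M (g M) by [].
apply: (gens (g M) _ (I M)) => //; exists M.+1, (fun i => (i == M)%:R).
rewrite big_ord_recr /= eqxx mul1r big1 ?add0r // => i _.
by rewrite ltn_eqF ?ltn_ord // mul0r.
Qed.

Lemma noetherian_onto (R A : comNzRingType) (phi : {rmorphism R -> A}) :
  (forall a, exists r, phi r = a) -> noetherian R -> noetherian A.
Proof.
move=> onto noeR I idI; have [|s [sI gens]] := noeR (fun r => I (phi r)).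
  split=> [|x y Ix Iy|a x Ix]; rewrite ?rmorph0 ?rmorphD ?rmorphM.
  - exact: (ideal0 idI).
  - exact: (idealD idI).
  - exact: (idealMl idI).
exists (map phi s); split=> [x /mapP [r /sI Ir ->] //|x].
have [r <-] := onto x => /gens genr T idT sT.
apply: (genr (fun r => T (phi r))) => [|y ys]; last by apply: sT; apply: map_f.
split=> [|u v Tu Tv|a u Tu]; rewrite ?rmorph0 ?rmorphD ?rmorphM.
- exact: (ideal0 idT).
- exact: (idealD idT).
- exact: (idealMl idT).
Qed.

Lemma noetherian_field (K : fieldType) : noetherian K.
Proof.
move=> I idI; have [[x Ix x0]|none] := pselect (exists2 x, I x & x != 0).
  exists [:: x]; split=> [y|y _ T idT Tx]; first by rewrite inE => /eqP ->.
  by rewrite -(divfK x0 y); apply: (idealMl idT); apply: Tx; apply: mem_head.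
exists [::]; split=> // x Ix T idT _; suff -> : x = 0 by apply: (ideal0 idT).
by apply/eqP; apply: contrapT => /negP x0; apply: none; exists x.
Qed.

(** Hilbert's basis theorem: pick successively elements of least degree outside the ideal generated
    so far, and use a relation among their leading coefficients. *)
Lemma noetherian_poly (R : comNzRingType) : noetherian R -> noetherian {poly R}.
Proof.
move=> noeR I idI; apply: contrapT => notfg.
pose gens (s : seq {poly R}) := gen_ideal (fun y => y \in s).
have exnext (s : seq {poly R}) : exists p, (forall x, x \in s -> I x) ->
    [/\ I p, ~ gens s p & forall p', I p' -> ~ gens s p' -> (size p <= size p')%N].
  have [sI|nI] := pselect (forall x, x \in s -> I x); last by exists 0 => /nI.
  have ex : exists n, `[< exists p : {poly R}, [/\ I p, ~ gens s p & size p = n] >].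
    apply: contrapT => none; apply: notfg; exists s; split=> // x Ix.
    by apply: contrapT => nx; apply: none; exists (size x); apply/asboolP; exists x.
  case: (ex_minnP ex) => n /asboolP [p [Ip np sp]] minn; exists p => _; split=> // p' Ip' np'.
  by rewrite sp; apply: minn; apply/asboolP; exists p'.
have [next nextP] := choice exnext.
pose fix L k := if k is k'.+1 then rcons (L k') (next (L k')) else [::].
have LI k : forall x, x \in L k -> I x.
  elim: k => [//|k IH] x; rewrite /= mem_rcons inE => /orP [/eqP ->|/IH //].
  by case: (nextP _ IH).
pose f k := next (L k).
have fP k := nextP _ (LI k).
have L_le k k' : (k <= k')%N -> {subset L k <= L k'}.
  move=> /subnK <-; elim: (k' - k)%N => // n IH x /IH xL.
  by rewrite addSn /= mem_rcons inE xL orbT.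
have fL i m : (i < m)%N -> f i \in L m.
  by move=> im; apply: (L_le _ _ im); rewrite /= mem_rcons mem_head.
have gens_le k k' x : (k <= k')%N -> gens (L k) x -> gens (L k') x.
  by move=> kk' gx T idT T'; apply: gx => // y /(L_le _ _ kk') /T'.
have f_size i m : (i <= m)%N -> (size (f i) <= size (f m))%N.
  move=> im; have [_ _ mini] := fP i; have [Im nm _] := fP m.
  by apply: mini => // /(gens_le _ _ _ im).
have f0 m : (0 < size (f m))%N.
  rewrite size_poly_gt0; apply/eqP => E; have [_ nm _] := fP m; apply: nm.
  by rewrite -/(f m) E; apply: (ideal0 (gen_ideal_ideal _)).
have [m [c Ec]] := noetherian_seq (fun k => lead_coef (f k)) noeR.
(* It has the leading term of [f m], so [f m - q] has smaller degree although it still avoids the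
   earlier ideal. *)
pose q : {poly R} := \sum_(i < m) (c i)%:P * ('X^(size (f m) - size (f i)) * f i).
have genq : gens (L m) q.
  refine (@ideal_sum _ _ _ _ _ _ (gen_ideal_ideal _) _) => i _.
  do 2!apply: (idealMl (gen_ideal_ideal _)).
  by apply: gen_ideal_mem; apply: fL.
have Iq : I q.
  refine (@ideal_sum _ _ _ _ _ _ idI _) => i _; do 2!apply: (idealMl idI).
  by case: (fP i).
have [Im nm minm] := fP m.
have : (size (f m) <= size (f m - q)%R)%N.
  apply: minm => [|gp]; first exact: idealB.
  by apply: nm; rewrite -(subrK q (next _)); apply: (idealD (gen_ideal_ideal _)).
have qj j : q`_j = \sum_(i < m) c i *
    (if (j < size (f m) - size (f i))%N then 0 else (f i)`_(j - (size (f m) - size (f i)))).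
  by rewrite coef_sum; apply: eq_bigr => i _; rewrite coefCM coefXnM.
rewrite leqNgt; case/negP; rewrite -(prednK (f0 m)) ltnS; apply/leq_sizeP => j.
rewrite leq_eqVlt => /orP [/eqP <-|jm]; rewrite coefB qj.
  rewrite -/(lead_coef (f m)) Ec -sumrB big1 // => i _.
  have [fi fm] := (f0 i, f_size i m (ltnW (ltn_ord i))).
  have -> : ((size (f m)).-1 < size (f m) - size (f i))%N = false.
    by apply/negbTE; rewrite -leqNgt -subn1 leq_sub2l.
  have -> : ((size (f m)).-1 - (size (f m) - size (f i)) = (size (f i)).-1)%N.
    by rewrite -!subn1 subnAC subKn.
  exact: subrr.
rewrite prednK // in jm; rewrite nth_default // big1 ?subr0 // => i _.
case: ifP => _; rewrite ?mulr0 // nth_default ?mulr0 //.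
rewrite leq_subRL; last by apply: leq_trans jm; apply: leq_subr.
by rewrite subnK // f_size // ltnW.
Qed.

(** The subring generated by the image of [psi] and by [ts] is presented as the image of an iterated
    polynomial ring; the last clause is induction over that subring. *)
Lemma noetherian_presentation (R0 T : comNzRingType) (psi : {rmorphism R0 -> T}) (ts : seq T) :
  noetherian R0 -> exists (R : comNzRingType) (phi : {rmorphism R -> T}),
  [/\ noetherian R, forall c, exists r, phi r = psi c,
      forall t, t \in ts -> exists r, phi r = t &
      forall Q : T -> Prop, (forall c, Q (psi c)) -> (forall t, t \in ts -> Q t) ->
        (forall u v, Q u -> Q v -> Q (u + v)) -> (forall u v, Q u -> Q v -> Q (u * v)) ->
        forall r, Q (phi r)].
Proof.
move=> noe0; elim: ts => [|t ts [R [phi [noeR cP tP QP]]]].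
  by exists R0, psi; split=> // c; exists c.
pose phi' : {rmorphism {poly R} -> T} := horner_eval t \o map_poly phi.
have phi'C c : phi' c%:P = phi c.
  by rewrite -[LHS]/((map_poly phi c%:P).[t]) map_polyC hornerC.
have phi'X : phi' 'X = t.
  by rewrite -[LHS]/((map_poly phi 'X).[t]) map_polyX hornerX.
exists {poly R}, phi'; split=> [|c|u|Q Qc Qt QD QM r].
- exact: noetherian_poly.
- by have [r <-] := cP c; exists r%:P.
- rewrite inE => /orP [/eqP ->|/tP [r <-]]; first by exists 'X.
  by exists r%:P.
- have QC c : Q (phi c).
    by apply: QP => // u ut; apply: Qt; rewrite inE ut orbT.
  elim/poly_ind: r => [|p c Qp]; first by rewrite -polyC0 phi'C.
  rewrite rmorphD rmorphM phi'C phi'X; apply: (QD) => //; apply: QM => //.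
  by apply: Qt; apply: mem_head.
Qed.

End NoetherianRings.

Lemma finite_type_noetherian (K : fieldType) (A : comAlgType K) :
  finite_type A -> noetherian A.
Proof.
move=> /finite_typeP [N [x gen]].
have [R [phi [noeR cP tP _]]] := noetherian_presentation (in_alg A)
  [seq x i | i : 'I_N] (@noetherian_field K).
apply: (noetherian_onto (phi := phi)) noeR.
apply: gen => [|c u v [r <-] [s <-]|i u [r <-]].
- by exists 1; rewrite rmorph1.
- have [d Ed] := cP c; exists (d * r + s).
  by rewrite rmorphD rmorphM Ed /= mulr_algl.
- have [|d Ed] := tP (x i); first by apply: map_f; rewrite mem_enum.
  by exists (d * r); rewrite rmorphM Ed.
Qed.

(* The Rees algebra is a quotient of a polynomial ring: a relation            *)
(* z_M t^M = \sum_(i < M) c_i z_i t^i between lifts z_i of x in the powers of *)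
(* the maximal ideal puts x in (maximal ideal) x modulo J.                    *)
Lemma krull_intersection (K : fieldType) (A : comAlgType K) (e : {rmorphism A -> K})
    (eA : forall c, e c%:A = c) (J : A -> Prop) (x : A) :
  finite_type A -> is_ideal J ->
  (forall M, exists z, npow e M z /\ J (x - z)) -> exists h, e h = 0 /\ J (x - h * x).
Proof.
move=> /finite_typeP [N [a gen]] idJ /choice [z zP].
pose psi : {rmorphism K -> {poly A}} := polyC \o in_alg A.
pose ts := [seq (a i)%:P | i : 'I_N] ++ [seq (a i - (e (a i))%:A)%:P * 'X | i : 'I_N].
have [R [phi [noeR cP tP QP]]] := noetherian_presentation psi ts (@noetherian_field K).
pose im p := exists r, phi r = p.
have imD p q : im p -> im q -> im (p + q).
  by move=> [r <-] [s <-]; exists (r + s); rewrite rmorphD.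
have imM p q : im p -> im q -> im (p * q).
  by move=> [r <-] [s <-]; exists (r * s); rewrite rmorphM.
have imC : forall b, im b%:P.
  apply: gen => [|c u v iu iv|i u iu].
  - by exists 1; rewrite rmorph1.
  - rewrite polyCD -mulr_algl polyCM; apply: (imD) => //; apply: (imM) => //; exact: cP.
  - rewrite polyCM; apply: (imM) => //; apply: tP.
    by rewrite mem_cat; apply/orP; left; apply/mapP; exists i; rewrite ?mem_enum.
have imX M y : npow e M y -> im (y%:P * 'X^M).
  elim=> {M y} [y|M y w ey _ IH|M y w _ IHy _ IHw].
  - by rewrite expr0 mulr1.
  - have -> : (y * w)%:P * 'X^(M.+1) = (y%:P * 'X) * (w%:P * 'X^M) :> {poly A}.
      by rewrite polyCM exprS; ring.
    apply: (imM) => //; have [b Eb] := kernel_generators eA gen y.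
    rewrite {1}Eb ey scale0r add0r rmorph_sum mulr_suml.
    elim/big_ind: _ => [||i _]; [by exists 0; rewrite rmorph0 | exact: imD |].
    rewrite /= polyCM -mulrA; apply: (imM) => //; apply: tP.
    by rewrite mem_cat; apply/orP; right; apply/mapP; exists i; rewrite ?mem_enum.
  - by rewrite polyCD mulrDl; apply: imD.
have [g gP] := choice (fun M => imX M _ (zP M).1).
have [M [c Ec]] := noetherian_seq g noeR.
(* In the Rees algebra the coefficient of degree [m] lies in the [m]-th power of the maximal
   ideal. *)
have rees r m : npow e m (phi r)`_m.
  apply: (QP (fun p => forall m, npow e m p`_m)) m => [d m|t|u v Qu Qv m|u v Qu Qv m].
  - rewrite /psi /= coefC; case: eqP => [->|_]; [exact: Npow0 | exact: npow_zero].
  - rewrite mem_cat => /orP [/mapP [i _ ->] m|/mapP [i _ ->] m].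
      rewrite coefC; case: eqP => [->|_]; [exact: Npow0 | exact: npow_zero].
    rewrite coefMX coefC; case: m => [|[|m]] /=; [exact: Npow0 | | exact: npow_zero].
    by apply/npow1; rewrite rmorphB eA subrr.
  - by rewrite coefD; apply: NpowD.
  - rewrite coefM; refine (@ideal_sum _ _ _ _ _ _ (npow_ideal e m) _) => i _.
    by rewrite -{1}(subnKC (leq_ord i)); apply: npow_mul.
have EM : z M = \sum_(i < M) (phi (c i))`_(M - i) * z i.
  have := congr1 (fun p : {poly A} => p`_M) (congr1 phi Ec).
  rewrite gP coefMXn ltnn subnn coefC eqxx rmorph_sum coef_sum => ->.
  apply: eq_bigr => i _; rewrite rmorphM gP mulrA coefMXn ltnNge ltnW ?ltn_ord //=.
  by rewrite coefMC.
exists (\sum_(i < M) (phi (c i))`_(M - i)); split.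
  rewrite rmorph_sum big1 // => i _; have := rees (c i) (M - i)%N.
  have : (0 < M - i)%N by rewrite subn_gt0.
  by case: (M - i)%N => // d _ /npow_eps.
have -> : x - (\sum_(i < M) (phi (c i))`_(M - i)) * x =
    (x - z M) - \sum_(i < M) (phi (c i))`_(M - i) * (x - z i).
  rewrite [in RHS](eq_bigr (fun i : 'I_M => (phi (c i))`_(M - i) * x -
    (phi (c i))`_(M - i) * z i)) => [|i _]; last by rewrite mulrBr.
  by rewrite sumrB -EM -mulr_suml; ring.
apply: (idealB idJ); first by case: (zP M).
refine (@ideal_sum _ _ _ _ _ _ idJ _) => i _.
by apply: (idealMl idJ); case: (zP i).
Qed.

(** * Smoothness of the quotient *)

Lemma npow_lrmorph (K : fieldType) (A1 A2 : comAlgType K) (h : {lrmorphism A1 -> A2})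
    (e1 : {rmorphism A1 -> K}) (e2 : {rmorphism A2 -> K}) L a :
  (forall x, e2 (h x) = e1 x) -> npow e1 L a -> npow e2 L (h a).
Proof.
move=> eh; elim=> {L a} [a|L x y ex _ IH|L x y _ IHx _ IHy]; first exact: Npow0.
  by rewrite rmorphM; apply: NpowM => //; rewrite eh.
by rewrite rmorphD; apply: NpowD.
Qed.

Section PolynomialPoint.
Variables (F : fieldType) (N : nat) (v : 'I_N -> F).

Definition poly_point : {rmorphism {mpoly F[N]} -> F} := meval v.

Lemma poly_point_alg c : poly_point c%:A = c.
Proof. by have := mevalZ v c 1; rewrite meval1 mulr1. Qed.

Lemma poly_pointX l : poly_point 'X_l = v l.
Proof. exact: mevalXU. Qed.

Lemma taylor_npow (q : {mpoly F[N]}) : npow poly_point 2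
  (q - (poly_point q)%:A - \sum_l poly_point q^`M(l) *: ('X_l - (v l)%:A)).
Proof.
elim/mpoly_gen_ind: q => [|c p q Ep Eq|i q IH].
- rewrite rmorph1 scale1r subrr add0r big1 ?oppr0 => [|l _]; first exact: npow_zero.
  by rewrite -[1]/(1%:MP) mderivC rmorph0 scale0r.
- set s := (X in _ - X); have -> : s = c *: \sum_l poly_point p^`M(l) *: ('X_l - (v l)%:A) +
      \sum_l poly_point q^`M(l) *: ('X_l - (v l)%:A).
    rewrite scaler_sumr -big_split; apply: eq_bigr => l _.
    by rewrite mderivD mderivZ rmorphD (point_scale poly_point_alg) scalerDl scalerA.
  have -> : c *: p + q - (poly_point (c *: p + q))%:A - (c *: \sum_l poly_point p^`M(l) *:
      ('X_l - (v l)%:A) + \sum_l poly_point q^`M(l) *: ('X_l - (v l)%:A)) =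
    c *: (p - (poly_point p)%:A - \sum_l poly_point p^`M(l) *: ('X_l - (v l)%:A)) +
    (q - (poly_point q)%:A - \sum_l poly_point q^`M(l) *: ('X_l - (v l)%:A)).
    rewrite rmorphD (point_scale poly_point_alg).
    move: (\sum_l _) (\sum_l _) => S1 S2; rewrite -!mul_mpolyC mpolyCD mpolyCM; ring.
  by apply: NpowD => //; apply: npow_scale.
- have -> : \sum_l poly_point ('X_i * q)^`M(l) *: ('X_l - (v l)%:A) =
      poly_point q *: ('X_i - (v i)%:A) +
      v i *: \sum_l poly_point q^`M(l) *: ('X_l - (v l)%:A).
    under eq_bigr => l _.
      rewrite mderivM rmorphD !rmorphM /= poly_pointX scalerDl -!scalerA.
    over.
    rewrite big_split /= -scaler_sumr; congr (_ + _).
    rewrite (bigD1 i) //= big1 ?addr0 => [|l li].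
      by rewrite mderivX_id rmorph1 scale1r.
    by rewrite mderivX_neq // rmorph0 scale0r.
  rewrite rmorphM poly_pointX; set S := \sum_l _.
  have -> : 'X_i * q - (v i * poly_point q)%:A - (poly_point q *: ('X_i - (v i)%:A) + v i *: S) =
      v i *: (q - (poly_point q)%:A - S) + ('X_i - (v i)%:A) * (q - (poly_point q)%:A).
    rewrite -!mul_mpolyC !mulr1 mpolyCM; ring.
  apply: NpowD; first exact: npow_scale.
  apply: NpowM; first by rewrite rmorphB poly_point_alg poly_pointX subrr.
  by apply/npow1; rewrite rmorphB poly_point_alg subrr.
Qed.

Lemma gradient_npow (q : {mpoly F[N]}) : poly_point q = 0 ->
  (forall l, poly_point q^`M(l) = 0) -> npow poly_point 2 q.
Proof.
move=> q0 dq; have := taylor_npow q; rewrite q0 scale0r subr0 big1 ?subr0 // => l _.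
by rewrite dq scale0r.
Qed.

End PolynomialPoint.

(* A K-rational system of linear equations over polynomials that is solvable  *)
(* over F is solvable over K: compare coefficients along elements of F        *)
(* independent over K.                                                        *)
Lemma polynomial_descent (K F : fieldType) (i : {rmorphism K -> F}) (N r : nat)
    (w : 'I_N -> F) (x : {mpoly K[N]}) (f : 'I_r -> {mpoly K[N]})
    (s : {mpoly F[N]}) (g : 'I_r -> {mpoly F[N]}) :
  s * map_mpoly i x = \sum_t g t * map_mpoly i (f t) -> poly_point w s != 0 ->
  exists (s' : {mpoly K[N]}) (g' : 'I_r -> {mpoly K[N]}),
    poly_point w (map_mpoly i s') != 0 /\ s' * x = \sum_t g' t * f t.
Proof.
move=> E ws; have [C0 [u [v [uK vK uZ]]]] := restrict_scalars i (F^o : comAlgType F).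
pose cs := msupp s ++ flatten [seq msupp (g t) | t : 'I_r].
pose co q := [seq v q@_m | m <- cs] : seq C0.
pose l := co s ++ flatten [seq co (g t) | t : 'I_r].
have [//||a [om [_ om_free om_span]]] := @independent_subfamily K C0 (fun c => c = 0) l.
  by move=> c z1 z2 -> ->; rewrite scaler0 addr0.
have split_coef q : {subset msupp q <= cs} -> {subset co q <= l} ->
    exists q' : 'I_a -> {mpoly K[N]}, q = \sum_b u (om b) *: map_mpoly i (q' b).
  move=> qs ql; have ex m : exists c : 'I_a -> K, q@_m = \sum_b u (om b) * i (c b).
    have [mq|mq] := boolP (m \in msupp q); last first.
      exists (fun=> 0); rewrite memN_msupp_eq0 // big1 // => b _.
      by rewrite rmorph0 mulr0.
    have [|c /eqP] := om_span (v q@_m); first by apply/ql/map_f/qs.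
    rewrite subr_eq0 => /eqP /(congr1 u); rewrite vK => ->; exists c.
    rewrite rmorph_sum; apply: eq_bigr => b _; by rewrite uZ mulrC.
  have [c cP] := choice ex.
  exists (fun b => \sum_(m <- msupp q) c m b *: 'X_[m]).
  rewrite [LHS]mpolyE; under [RHS]eq_bigr do rewrite rmorph_sum scaler_sumr.
  rewrite exchange_big /=; apply: eq_bigr => m _; rewrite cP scaler_suml.
  by apply: eq_bigr => b _; rewrite map_mpolyZ map_mpolyX scalerA.
have [||s' Es] := split_coef s.
- by move=> m ms; rewrite mem_cat ms.
- by move=> c cs'; rewrite mem_cat cs'.
have exg t : exists q' : 'I_a -> {mpoly K[N]}, g t = \sum_b u (om b) *: map_mpoly i (q' b).
  apply: split_coef => [m mt|c ct]; rewrite mem_cat; apply/orP; right; apply/flattenP.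
    by exists (msupp (g t)) => //; apply/mapP; exists t; rewrite ?mem_enum.
  by exists (co (g t)) => //; apply/mapP; exists t; rewrite ?mem_enum.
have [g' Eg] := choice exg.
have [b sb] : exists b, poly_point w (map_mpoly i (s' b)) != 0.
  apply: contrapT => none; case/eqP: ws; rewrite Es rmorph_sum big1 // => b _.
  rewrite (point_scale (poly_point_alg w)) (_ : poly_point _ _ = 0) ?mulr0 //.
  by apply/eqP; apply: contrapT => /negP nz; apply: none; exists b.
exists (s' b), (fun t => g' t b); split=> //.
have Z : \sum_b u (om b) *: map_mpoly i (s' b * x - \sum_t g' t b * f t) = 0.
  under eq_bigr do rewrite rmorphB rmorphM rmorph_sum scalerBr.
  rewrite sumrB; apply/eqP; rewrite subr_eq0; apply/eqP.
  transitivity (s * map_mpoly i x).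
    by rewrite Es mulr_suml; apply: eq_bigr => b' _; rewrite scalerAl.
  rewrite E; under eq_bigr do rewrite Eg mulr_suml.
  rewrite exchange_big; apply: eq_bigr => b' _; rewrite scaler_sumr.
  by apply: eq_bigr => t _; rewrite rmorphM -scalerAl.
apply/eqP; rewrite -subr_eq0; apply/eqP/mpolyP => m; rewrite mcoeff0.
apply: (om_free (fun b => (s' b * x - \sum_t g' t b * f t)@_m)).
apply: (can_inj uK); rewrite rmorph0 rmorph_sum.
have := congr1 (mcoeff m) Z; rewrite linear_sum mcoeff0 => Zm.
rewrite -[RHS]Zm; apply: eq_bigr => b' _.
apply: etrans (esym (@mcoeffZ N F _ _ _)).
by rewrite mcoeff_map_mpoly uZ; apply: mulrC.
Qed.

(* Subtracting the [v i] from a lift to polynomials makes it kill the relations. *)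
Lemma smooth_splitting (K : fieldType) (B : comAlgType K) (N : nat) (b : 'I_N -> B)
    (v : 'I_N -> {mpoly K[N]}) : generates b ->
  (forall i, ev b (v i) = 0) ->
  (forall x, ev b x = 0 -> ideal_sq (fun p => ev b p = 0) (x - \sum_i x^`M(i) * v i)) ->
  formally_smooth B.
Proof.
move=> gen v0 vP C D q f q_onto q_sq.
have [c0 c0P] := choice (fun i => q_onto (f (b i))).
have qh p : q (ev c0 p) = f (ev b p).
  by rewrite !lrmorph_ev; congr mmap; apply/funext => i.
pose z i := ev c0 (v i); have qz i : q (z i) = 0 by rewrite qh v0 rmorph0.
(* Since products of the corrections [z i] vanish, the corrected lift is given by the first-order
   Taylor formula. *)
pose h1 := ev (fun i => c0 i - z i) : {lrmorphism {mpoly K[N]} -> C}.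
have h1E p : h1 p = ev c0 p - \sum_i ev c0 p^`M(i) * z i.
  elim/mpoly_gen_ind: p => [|c p r Ep Er|i p Ep].
  - rewrite !rmorph1 big1 ?subr0 // => i _.
    by rewrite -[1]/(1%:MP) mderivC !rmorph0 mul0r.
  - rewrite !linearP /= Ep Er scalerBr addrACA -opprD; congr (_ - _).
    rewrite scaler_sumr -big_split.
    by apply: eq_bigr => i _; rewrite !linearP /= mulrDl scalerAl.
  - rewrite !rmorphM /= !evX Ep.
    have -> : \sum_l ev c0 ('X_i * p)^`M(l) * z l = ev c0 p * z i +
        c0 i * \sum_l ev c0 p^`M(l) * z l.
      under eq_bigr do rewrite mderivM rmorphD !rmorphM /= evX mulrDl -!mulrA.
      rewrite big_split /= -mulr_sumr; congr (_ + _).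
      rewrite (bigD1 i) //= big1 ?addr0 => [|l li].
        by rewrite mderivX_id rmorph1 mul1r.
      by rewrite mderivX_neq // rmorph0 mul0r.
    rewrite mulrBl !mulrBr; have -> : z i * \sum_l ev c0 p^`M(l) * z l = 0.
      by apply: q_sq => //; rewrite rmorph_sum big1 // => l _; rewrite rmorphM /= qz mulr0.
    ring.
have qh1 p : q (h1 p) = f (ev b p).
  rewrite h1E rmorphB /= qh (rmorph_sum q) big1 ?subr0 // => i _.
  by rewrite rmorphM /= qz mulr0.
have [||h hE] := @factor_lrmorphism K {mpoly K[N]} B C (ev b) h1.
- exact: (generates_ev b).1 gen.
- move=> x x0; rewrite h1E.
  have -> : ev c0 x - \sum_i ev c0 x^`M(i) * z i = ev c0 (x - \sum_i x^`M(i) * v i).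
    rewrite rmorphB rmorph_sum; congr (_ - _); apply: eq_bigr => i _.
    by rewrite rmorphM.
  apply: (vP x x0 (fun p => ev c0 p = 0)) => [|s t s0 t0].
    split=> [|s t s0 t0|s t t0]; first by rewrite rmorph0.
      by rewrite rmorphD /= s0 t0 addr0.
    by rewrite rmorphM /= t0 mulr0.
  by rewrite rmorphM; apply: q_sq; rewrite qh ?s0 ?t0 rmorph0.
exists h => a; have [p <-] := (generates_ev b).1 gen a.
by rewrite hE qh1.
Qed.

Section Relations.
Variables (K : fieldType) (R : comAlgType K) (N : nat) (b : 'I_N -> R).

Lemma polynomial_relations : exists s : seq {mpoly K[N]}, (forall p, p \in s -> ev b p = 0) /\
  forall p, ev b p = 0 -> gen_ideal (fun q => q \in s) p.
Proof.
have ftP : finite_type {mpoly K[N]}.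
  by exists N, (idfun : {lrmorphism {mpoly K[N]} -> {mpoly K[N]}}) => p; exists p.
apply: (finite_type_noetherian ftP); split=> [|p q p0 q0|a p p0].
- by rewrite rmorph0.
- by rewrite rmorphD /= p0 q0 addr0.
- by rewrite rmorphM /= p0 mulr0.
Qed.

(* The elements [s] for which the conormal sequence of the presentation [ev b] *)
(* splits after multiplication by [s].                                         *)
Definition jacobian_ideal (s : {mpoly K[N]}) : Prop := exists v : 'I_N -> {mpoly K[N]},
  (forall i, ev b (v i) = 0) /\ forall x, ev b x = 0 ->
    ideal_sq (fun p => ev b p = 0) (s * x - \sum_i x^`M(i) * v i).

End Relations.

Section FreePoint.
Variables (K : fieldType) (char0 : [pchar K] =i pred0) (A : comAlgType K).
Variables (gT : finGroupType) (rho : gT -> {lrmorphism A -> A}).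
Hypotheses (act : is_algebra_action rho) (ftA : finite_type A) (smA : formally_smooth A).
Variables (N : nat) (b : 'I_N -> inv_ring rho) (gen : generates b).
Variables (F : fieldType) (e : {rmorphism A -> F}).
Variables (A' : comAlgType F) (j : {rmorphism A -> A'}) (e' : {rmorphism A' -> F}).
Variables (rho' : gT -> {lrmorphism A' -> A'}).
Hypothesis PC : point_change e rho j e' rho'.
Variables (n : nat) (u : 'I_n -> A') (chi : 'I_n -> gT -> F).
Hypotheses (uP : coordinates rho' e' u chi).
Hypothesis axes : axes_monoid (trivial_weight rho' e' chi).

Local Notation P := {mpoly K[N]}.
Local Notation B := (inv_ring rho).

Let AA' := change_algebra PC.
Variables (w : 'I_N -> F) (iF : {rmorphism K -> F}) (eP : {rmorphism P -> F}).
Hypotheses (wE : forall l, w l = e (inv_val (b l))) (iFE : forall c, iF c = e c%:A).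
Hypothesis ePE : forall p, eP p = e (inv_val (ev b p)).
Local Notation bc := (map_mpoly iF).
Variables (hF : {lrmorphism {mpoly F[N]} -> A'}).
Hypothesis hFX : forall l, hF 'X_l = j (inv_val (b l)).
Local Notation eF := (poly_point w).
Let eFA := poly_point_alg w.

Let hF_bc p : hF (bc p) = j (inv_val (ev b p)).
Proof.
elim/mpoly_gen_ind: p => [|c p q Ep Eq|l p Ep].
- by rewrite !rmorph1.
- rewrite rmorphD /= map_mpolyZ linearP /= Ep Eq linearP /= rmorphD; congr (_ + _).
  by rewrite (change_scale PC) iFE.
- rewrite !rmorphM /= Ep map_mpolyX hFX; congr (_ * _).
  by rewrite evX.
Qed.

Let e'_hF q : e' (hF q) = eF q.
Proof.
elim/mpoly_gen_ind: q => [|c p q Ep Eq|l p Ep].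
- by rewrite !rmorph1.
- by rewrite linearP !rmorphD (point_scale (change_rational PC)) Ep Eq (point_scale eFA).
- by rewrite !rmorphM /= Ep hFX (change_point PC) poly_pointX wE.
Qed.

Let eF_bc p : eF (bc p) = eP p.
Proof. by rewrite -e'_hF hF_bc (change_point PC) ePE. Qed.

Let mderiv_bc (p : P) l : (bc p)^`M(l) = bc p^`M(l).
Proof.
by apply/mpolyP => m; rewrite mcoeff_mderiv !mcoeff_map_mpoly mcoeff_mderiv raddfMn.
Qed.

Let hF_invariant q : invariant_elt rho' (hF q).
Proof.
elim/mpoly_gen_ind: q => [|c p q ip iq|l p ip].
- by rewrite rmorph1; apply: invariant_elt1.
- by rewrite linearP; apply: invariant_eltL.
- rewrite rmorphM /= hFX; apply: invariant_eltM => // g.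
  by rewrite (change_actE PC) inv_val_invariant.
Qed.

Let lift_invariant (z : inv_ring rho') : exists q, hF q = inv_val z.
Proof.
elim/(inv_change_ind char0 act PC): z => [|f a z y Ez [q Eq]].
  by exists 0; rewrite rmorph0.
have [p Ep] := (generates_ev b).1 gen a; exists (f *: bc p + q).
by rewrite linearP /= hF_bc Ep Eq -Ez.
Qed.

Let ePL c p q : eP (c *: p + q) = iF c * eP p + eP q.
Proof. by rewrite rmorphD -mul_mpolyC rmorphM !ePE [ev b _](mmapC _ _) iFE. Qed.

Let eP_ker p : ev b p = 0 -> eP p = 0.
Proof. by rewrite ePE => ->; rewrite !rmorph0. Qed.

Let grad (p : P) : 'rV[F]_N := \row_l eP p^`M(l).

Let grad_mul a p : ev b p = 0 -> grad (a * p) = eP a *: grad p.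
Proof.
move=> p0; apply/rowP => l; rewrite !mxE mderivM rmorphD !rmorphM.
by rewrite (eP_ker p0) mulr0 add0r.
Qed.

(** Relations whose gradients at the point form a basis of all gradients of relations; extracted
    from a finite generating list. *)
Let exists_equations : exists (r : nat) (f : 'I_r -> P),
  [/\ forall t, ev b (f t) = 0,
      forall c : 'I_r -> F, \sum_t c t *: grad (f t) = 0 -> forall t, c t = 0 &
      forall x, ev b x = 0 -> exists c : 'I_r -> F, grad x = \sum_t c t *: grad (f t)].
Proof.
have [s [sI gens]] := polynomial_relations b.
have [//||r [v [vs vfree vspan]]] := @independent_subfamily F 'rV[F]_N (fun v => v = 0)
  [seq grad p | p <- s].
  by move=> c x y -> ->; rewrite scaler0 addr0.
have exf t : exists p, p \in s /\ v t = grad p.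
  by have /mapP [p ps ->] := vs t; exists p.
have [f fP] := choice exf; exists r, f.
have vE (c : 'I_r -> F) : \sum_t c t *: grad (f t) = \sum_t c t *: v t.
  by apply: eq_bigr => t _; rewrite -(fP t).2.
split=> [t|c|x Ix]; first by apply: sI; case: (fP t).
  by rewrite vE; apply: vfree.
pose T p := ev b p = 0 /\ exists c : 'I_r -> F, grad p = \sum_t c t *: grad (f t).
suff [] : T x by [].
apply: (gens x Ix) => [|p ps].
  split=> [|p q [p0 [c Ec]] [q0 [d Ed]]|a p [p0 [c Ec]]]; split.
  - by rewrite rmorph0.
  - exists (fun=> 0); rewrite big1 => [|t _]; last exact: scale0r.
    by apply/rowP => l; rewrite !mxE mderiv0 rmorph0.
  - by rewrite rmorphD /= p0 q0 addr0.
  - exists (fun t => c t + d t).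
    have -> : grad (p + q) = grad p + grad q.
      by apply/rowP => l; rewrite !mxE mderivD rmorphD.
    by rewrite Ec Ed -big_split; apply: eq_bigr => t _; rewrite scalerDl.
  - by rewrite rmorphM /= p0 mulr0.
  - exists (fun t => eP a * c t); rewrite grad_mul // Ec scaler_sumr.
    by apply: eq_bigr => t _; rewrite scalerA.
split; first exact: sI.
have [|c /eqP] := vspan (grad p); first exact: map_f.
by rewrite subr_eq0 => /eqP ->; exists c; rewrite vE.
Qed.

Section Equations.
Variables (r : nat) (f : 'I_r -> P).
Hypotheses (f0 : forall t, ev b (f t) = 0).
Hypothesis fspan : forall x, ev b x = 0 ->
  exists c : 'I_r -> F, grad x = \sum_t c t *: grad (f t).

(* A direction [d] killing all the equations is a tangent vector of the       *)
(* quotient at the point, averaged to an invariant functional [nu] on A'.     *)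
Let tangent_functional (d : 'I_N -> F) :
  (forall t, \sum_l grad (f t) 0 l * d l = 0) ->
  exists nu : A' -> F, [/\ inv_derivation rho' e' nu, forall g a, nu (rho' g a) = nu a &
    forall q, nu (hF q) = \sum_l eF q^`M(l) * d l].
Proof.
move=> df; pose D p := \sum_l eP p^`M(l) * d l.
have D0 p : ev b p = 0 -> D p = 0.
  move=> p0; have [c Ec] := fspan p0.
  have -> : D p = \sum_l grad p 0 l * d l by apply: eq_bigr => l _; rewrite mxE.
  under eq_bigr do rewrite Ec summxE mulr_suml.
  rewrite exchange_big big1 // => t _.
  under eq_bigr do rewrite mxE -mulrA.
  by rewrite -mulr_sumr df mulr0.
have DL c p q : D (c *: p + q) = iF c * D p + D q.
  rewrite /D mulr_sumr -big_split; apply: eq_bigr => l _.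
  by rewrite mderivD mderivZ ePL mulrDl mulrA.
have DM p q : D (p * q) = eP p * D q + eP q * D p.
  rewrite /D !mulr_sumr -big_split /=; apply: eq_bigr => l _.
  rewrite mderivM rmorphD !rmorphM; ring.
have DE p q : ev b p = ev b q -> D p = D q.
  move=> pq; have := DL (-1) q p; rewrite rmorphN1 mulN1r.
  rewrite D0 => [/esym/eqP|]; last by rewrite linearP /= pq scaleN1r addNr.
  by rewrite addrC subr_eq0 => /eqP.
have [s sP] := choice ((generates_ev b).1 gen).
have [R RP] := choice (fun a => inv_lift (reynolds_invariant act a)).
have R_lin c x y : R (c *: x + y) = c *: R x + R y.
  by apply: val_inj; rewrite /= !RP reynoldsP.
(* [D] depends only on the element of the quotient; it is extended to [A] by averaging and then
   F-linearly to [A']. *)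
have [|nu nuE] := @change_lift _ _ _ _ _ _ AA' F^o (fun a => D (s (R a))).
  move=> c x y; rewrite -iFE -[RHS]/(iF c * _ + _) -DL; apply: DE.
  by rewrite sP linearP /= !sP R_lin.
have nuB (a : B) : nu (j (inv_val a)) = D (s a).
  rewrite nuE; congr (D (s _)); apply: val_inj.
  by rewrite /= RP (reynolds_id char0 (@inv_val_invariant _ _ _ _ a)).
have nuM (x y : inv_ring rho') : nu (inv_val x * inv_val y) =
    e' (inv_val x) * nu (inv_val y) + e' (inv_val y) * nu (inv_val x).
  elim/(inv_change_ind char0 act PC): x => [|c a z x Ez IHx].
    by rewrite !rmorph0 mul0r linear0 mul0r mulr0 addr0.
  rewrite linearP /= mulrDl -scalerAl !linearP IHx rmorphD (point_scale (change_rational PC)) Ez.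
  have -> : nu (j (inv_val a) * inv_val y) =
      e' (j (inv_val a)) * nu (inv_val y) + e' (inv_val y) * nu (j (inv_val a)).
    elim/(inv_change_ind char0 act PC): y {IHx} => [|c' a' z' y Ez' IHy].
      by rewrite !rmorph0 mulr0 linear0 mul0r mulr0 addr0.
    rewrite linearP /= mulrDr -scalerAr !linearP IHy rmorphD (point_scale (change_rational PC)) Ez'.
    have -> : nu (j (inv_val a) * j (inv_val a')) =
        e' (j (inv_val a)) * nu (j (inv_val a')) + e' (j (inv_val a')) * nu (j (inv_val a)).
      rewrite -rmorphM -(rmorphM (@inv_val _ _ _ rho)) !nuB !(change_point PC).
      rewrite (DE (s (a * a')) (s a * s a')); last by rewrite rmorphM /= !sP.
      by rewrite DM !ePE !sP.
    by rewrite -![_ *: _]/(_ * _); ring.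
  by rewrite -![_ *: _]/(_ * _); ring.
exists nu; split=> [|g a|q].
- split=> [c x y|x y ix iy]; first by rewrite linearP.
  by have [[x' <-] [y' <-]] := (inv_lift ix, inv_lift iy); apply: nuM.
- elim/(change_ind AA'): a => [|c a x IH]; first by rewrite rmorph0.
  rewrite !linearP /= IH (change_actE PC) !nuE.
  have -> // : R (rho g a) = R a.
  by apply: val_inj; rewrite /= !RP (reynolds_act act).
- elim/mpoly_gen_ind: q => [|c p q Ep Eq|l q Eq].
  + rewrite rmorph1 big1 => [|l _]; last by rewrite -[1]/(1%:MP) mderivC rmorph0 mul0r.
    have := nuM 1 1; rewrite !rmorph1 mulr1 mul1r => E.
    by apply: (addrI (nu 1)); rewrite -E addr0.
  + rewrite !linearP Ep Eq -[_ *: _]/(c * _) mulr_sumr -big_split; apply: eq_bigr => l _.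
    by rewrite mderivD mderivZ rmorphD (point_scale eFA) mulrDl mulrA.
  + have [q' Eq'] := inv_lift (hF_invariant q).
    have [x Ex] := inv_lift (hF_invariant 'X_l).
    rewrite rmorphM /= -Eq' -Ex nuM Ex Eq' Eq !e'_hF.
    rewrite hFX nuB.
    have -> : D (s (b l)) = d l.
      rewrite (DE _ 'X_l) ?sP ?evX // /D (bigD1 l) //= big1 ?addr0 => [|i il].
        by rewrite mderivX_id rmorph1 mul1r.
      by rewrite mderivX_neq // rmorph0 mul0r.
    rewrite mulr_sumr; under [RHS]eq_bigr do rewrite mderivM rmorphD !rmorphM /= mulrDl -mulrA.
    rewrite big_split /= addrC; congr (_ + _).
      by apply: eq_bigr => i _; rewrite mulrA.
    rewrite (bigD1 l) //= big1 ?addr0 => [|i il].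
      by rewrite mderivX_id meval1 mul1r.
    by rewrite mderivX_neq // meval0 mul0r.
Qed.

(** In the algebra [C] cut out over [F] by the chosen equations, [x] has infinite order at the
    point; Krull's theorem makes it vanish after multiplication by a function nonzero there, and
    [polynomial_descent] returns to [K]. *)
Lemma local_generation x : ev b x = 0 ->
  exists s (g : 'I_r -> P), eP s != 0 /\ s * x = \sum_t g t * f t.
Proof.
move=> x0.
pose Jf q := exists g : 'I_r -> {mpoly F[N]}, q = \sum_t g t * bc (f t).
have idJ : is_ideal Jf.
  split=> [|q1 q2 [g ->] [h ->]|a q [g ->]].
  - by exists (fun=> 0); rewrite big1 // => t _; rewrite mul0r.
  - by exists (fun t => g t + h t); rewrite -big_split; apply: eq_bigr => t _; rewrite mulrDl.
  - by exists (fun t => a * g t); rewrite mulr_sumr; apply: eq_bigr => t _; rewrite mulrA.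
have hJ q : Jf q -> hF q = 0.
  move=> [g ->]; rewrite rmorph_sum big1 // => t _.
  by rewrite rmorphM /= hF_bc f0 !rmorph0 mulr0.
have eJ q : Jf q -> eF q = 0 by move=> /hJ E; rewrite -e'_hF E rmorph0.
have J1 : ~ Jf 1 by move=> /eJ; rewrite rmorph1; apply/eqP/oner_neq0.
have [C [pi [pi_onto piP]]] := quotient_algebra idJ J1.
have pi0 q : pi q = 0 <-> Jf q by rewrite -(rmorph0 pi) piP subr0.
have [|hC hCE] := @factor_lrmorphism F _ C A' pi hF pi_onto.
  by move=> q /pi0 /hJ.
have [|eF' eF'E] := @pack_lrmorphism F {mpoly F[N]} F^o eF.
  by move=> c; rewrite eFA -[RHS]/(_ * _) mulr1.
have [|eC0 eC0E] := @factor_lrmorphism F _ C F^o pi eF' pi_onto.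
  by move=> q /pi0 /eJ; rewrite eF'E.
pose eC : {rmorphism C -> F} := eC0.
have eCE q : eC (pi q) = eF q by rewrite -eF'E -eC0E.
have eCA c : eC c%:A = c by rewrite -(rmorph_alg pi) eCE eFA.
have e'hC c : e' (hC c) = eC c by have [q <-] := pi_onto c; rewrite hCE eCE e'_hF.
pose X := pi (bc x).
have X_npow M : npow eC M X.
  have [M1 [Q [p [fx [y [d [delta [M01 fP yP deltaP nuP]]]]]]]] :=
    free_coordinates (point_pchar e char0) (change_act PC) (change_finite_type ftA PC)
      (change_smooth AA' smA) (change_rational PC) uP (M * #|gT|) axes.
  have exY i : exists q, hF q = y i.
    by have [_ _ /inv_lift [z <-] _ _] := yP i; apply: lift_invariant.
  have [Y YP] := choice exY.
  pose v i := pi (Y i).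
  have v_eps i : eC (v i) = 0.
    by rewrite /v eCE -e'_hF YP; case: (yP i).
  (* A direction killed by all rows defines an invariant tangent functional vanishing on every
     [y i], hence zero; so the gradients of the [Y i] and of the equations span. *)
  pose G : 'M[F]_(n + r, N) := col_mx (\matrix_(i, l) eF (Y i)^`M(l)) (\matrix_(t, l) grad (f t) 0 l).
  have fullG : row_full G.
    rewrite /row_full -mxrank_tr; apply/inj_row_free => dv dG.
    have dG' : G *m dv^T = 0 by apply: trmx_inj; rewrite trmx_mul trmxK dG trmx0.
    move: dG'; rewrite mul_col_mx -col_mx0 => /eq_col_mx [dY df].
    have [|nu [nuD nu_act nuE]] := @tangent_functional (dv 0).
      move=> t; have /colP /(_ t) := df; rewrite !mxE => E; rewrite -[RHS]E.
      by apply: eq_bigr => l _; rewrite !mxE.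
    have nuy i : nu (y i) = 0.
      rewrite -YP nuE; have /colP /(_ i) := dY; rewrite !mxE => E; rewrite -[RHS]E.
      by apply: eq_bigr => l _; rewrite !mxE.
    apply/rowP => l; rewrite mxE; transitivity (nu (hF 'X_l)).
      rewrite nuE (bigD1 l) //= big1 ?addr0 => [|i il].
        by rewrite mderivX_id meval1 mul1r.
      by rewrite mderivX_neq // meval0 mul0r.
    by rewrite (nuP nu nuD nu_act) // big1 // => i _; rewrite nuy mulr0.
  have v_span c : eC c = 0 -> exists a : 'I_n -> F, npow eC 2 (c - \sum_i a i *: v i).
    have [q <-] := pi_onto c; rewrite eCE => q0.
    have /submxP [D ED] : (\row_l eF q^`M(l) <= G)%MS by apply: submx_full.
    rewrite -[D]hsubmxK mul_row_col in ED.
    pose a i := lsubmx D 0 i; pose g t := rsubmx D 0 t.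
    have Eq l : eF q^`M(l) = \sum_i a i * eF (Y i)^`M(l) + \sum_t g t * eP (f t)^`M(l).
      have /rowP /(_ l) := ED; rewrite !mxE => ->; congr (_ + _).
        by apply: eq_bigr => i _; rewrite /a !mxE.
      by apply: eq_bigr => t _; rewrite /g !mxE.
    exists a; pose q' := q - (\sum_i a i *: Y i + \sum_t g t *: bc (f t)).
    have -> : pi q - \sum_i a i *: v i = pi q'.
      rewrite /q' rmorphB rmorphD; congr (_ - _); rewrite [X in _ + X](_ : _ = 0).
        by rewrite addr0 rmorph_sum; apply: eq_bigr => i _; rewrite /= linearZ.
      apply/pi0; exists (fun t => (g t)%:MP).
      by apply: eq_bigr => t _; rewrite mul_mpolyC.
    apply: (npow_lrmorph eCE); apply: gradient_npow => [|l].
      rewrite rmorphB rmorphD !rmorph_sum q0 !big1 ?addr0 ?subr0 // => [t _|i _].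
        by rewrite (point_scale eFA) eF_bc eP_ker ?mulr0.
      by rewrite (point_scale eFA) -e'_hF YP; case: (yP i) => _ _ _ -> _; rewrite mulr0.
    have mderiv_sum m (h : 'I_m -> {mpoly F[N]}) : (\sum_i h i)^`M(l) = \sum_i (h i)^`M(l).
      exact: (big_morph (mderiv l) (mderivD l) (mderiv0 _ l)).
    rewrite mderivB mderivD !mderiv_sum rmorphB Eq rmorphD !rmorph_sum.
    apply/eqP; rewrite subr_eq0; apply/eqP; congr (_ + _); apply: eq_bigr => i _.
      by rewrite mderivZ (point_scale eFA).
    by rewrite mderivZ (point_scale eFA) mderiv_bc eF_bc.
  (* [x] vanishes in [A'], so [T] evaluated at [y] has high order there; as [y i] expands to
     X_i^(d_i), the low-degree coefficients of [T] vanish. *)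
  have [T XT] := npow_span_approx eCA v_eps v_span M1 X.
  suff MT : high_degree M T.
    rewrite -(subrK (ev v T) X); apply: NpowD; last exact: high_degree_npow.
    apply: npow_le XT; apply: leq_trans M01; apply: leq_pmulr.
    by apply/card_gt0P; exists 1%g.
  pose T' : {mpoly F[n]} := ev (fun i => 'X_i ^+ d i) T.
  have fT : fx (ev y T) = p T'.
    rewrite lrmorph_ev /T' lrmorph_ev; congr mmap; apply/funext => i.
    by case: (yP i).
  have [z Ez Mz] : exists2 z, p T' = p z & high_degree M1 z.
    have := npow_lrmorph e'hC XT; rewrite rmorphB /= {1}/X hCE hF_bc x0 !rmorph0 sub0r.
    have -> : hC (ev v T) = ev y T.
      by rewrite lrmorph_ev; congr mmap; apply/funext => i; rewrite /v hCE YP.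
    move=> /(exp_npow fP) [z Ez Mz]; exists (- z).
      by rewrite rmorphN /= -Ez rmorphN opprK /= fT.
    by move=> m mM; rewrite mcoeffN Mz ?oppr0.
  move: Ez => /(exp_ker fP) T'z al alM.
  (* The substitution multiplies degrees by at most the order of the group, which explains the order
     [M * #|gT|] requested above. *)
  pose da := [multinom (d i * al i)%N | i < n].
  have daM : (mdeg da < M1)%N.
    apply: leq_trans M01; apply: (@leq_ltn_trans (mdeg al * #|gT|)%N).
      rewrite !mdegE big_distrl /=; apply: leq_sum => i _; rewrite mnmE mulnC leq_mul2l.
      by case: (yP i) => _ -> _ _ _; rewrite orbT.
    by rewrite ltn_mul2r alM andbT; apply/card_gt0P; exists 1%g.
  have T'E : T' = \sum_(m <- msupp T) ev (fun i => 'X_i ^+ d i) (T@_m *: 'X_[m]).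
    by rewrite /T' {1}(mpolyE T) (linear_sum (ev (fun i => 'X_i ^+ d i))).
  have := T'z da daM; rewrite mcoeffB (Mz da daM) subr0 => T'0; rewrite -[RHS]T'0 T'E.
  rewrite (big_morph (mcoeff da) (mcoeffD da) (mcoeff0 _ da)).
  have coefE m : (ev (fun i => 'X_i ^+ d i) (T@_m *: 'X_[m]) : {mpoly F[n]})@_da =
      if m == al then T@_m else 0.
    rewrite linearZ /= evXm.
    have -> : \prod_i ('X_i ^+ d i) ^+ m i = 'X_[[multinom (d i * m i)%N | i < n]] :> {mpoly F[n]}.
      rewrite mpolyXE_id; apply: eq_bigr => i _; by rewrite -exprM mnmE.
    rewrite mcoeffZ mcoeffX.
    have -> : ([multinom (d i * m i)%N | i < n] == da) = (m == al).
      apply/eqP/eqP => [E|-> //]; apply/mnmP => i.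
      have := congr1 (fun m : 'X_{1..n} => m i) E; rewrite /= !mnmE => /eqP.
      by rewrite eqn_pmul2l; [move/eqP | case: (yP i)].
    by case: eqP => _; rewrite ?mulr1 ?mulr0.
  have [aT|aT] := boolP (al \in msupp T).
    rewrite (bigD1_seq al) ?msupp_uniq //= coefE eqxx big1 ?addr0 // => m /negPf ne.
    by rewrite coefE ne.
  rewrite big_seq big1 ?memN_msupp_eq0 // => m mT; rewrite coefE.
  by case: eqP => // E; rewrite E (negPf aT) in mT.
have ftC : finite_type C by exists N, pi.
have id0 : is_ideal (fun c : C => c = 0).
  by split=> [|c1 c2 -> ->|c1 c2 ->]; rewrite ?addr0 ?mulr0.
have [|h [eh Xh]] := krull_intersection eCA (J := fun c => c = 0) (x := X) ftC id0.
  by move=> M; exists X; rewrite subrr.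
have [q Eq] := pi_onto h.
have /pi0 [g Eg] : pi ((1 - q) * bc x) = 0.
  by rewrite rmorphM rmorphB rmorph1 /= Eq mulrBl mul1r.
have [|s [g' [es Es]]] := polynomial_descent Eg (w := w).
  by rewrite rmorphB rmorph1 -eCE Eq eh subr0 oner_neq0.
by exists s, g'; split=> //; rewrite -eF_bc.
Qed.

End Equations.
(** The Jacobian criterion: near the point the relations are generated by equations with a
    nonvanishing maximal minor, and Cramer's rule for this minor produces the splitting. *)
Lemma jacobian_point : exists s, eP s != 0 /\ jacobian_ideal b s.
Proof.
have [r [f [f0 ffree fspan]]] := exists_equations.
have [s [es sI]] : exists s, eP s != 0 /\ forall x, ev b x = 0 ->
    exists g : 'I_r -> P, s * x = \sum_t g t * f t.
  have [ps [psI gens]] := polynomial_relations b.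
  pose T s x := exists g : 'I_r -> P, s * x = \sum_t g t * f t.
  have TM a s x : T s x -> T (a * s) x.
    move=> [g Eg]; exists (fun t => a * g t); rewrite -mulrA Eg mulr_sumr.
    by apply: eq_bigr => t _; rewrite mulrA.
  have [s [es sps]] : exists s, eP s != 0 /\ forall p, p \in ps -> T s p.
    elim: ps psI {gens} => [|p ps IH] psI; first by exists 1; rewrite rmorph1 oner_neq0.
    have [q qps|s [es sps]] := IH; first by apply: psI; rewrite inE qps orbT.
    have [s' [g [es' Eg]]] := local_generation f0 fspan (psI p (mem_head _ _)).
    exists (s * s'); split=> [|q]; first by rewrite rmorphM mulf_neq0.
    rewrite inE => /orP [/eqP ->|/sps qs]; first by apply: TM; exists g.
    by rewrite mulrC; apply: TM.
  exists s; split=> // x x0; apply: (gens x x0 (T s)) => //.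
  split=> [|p q [g Eg] [h Eh]|a p [g Eg]].
  - by exists (fun=> 0); rewrite mulr0 big1 // => t _; rewrite mul0r.
  - exists (fun t => g t + h t); rewrite mulrDr Eg Eh -big_split.
    by apply: eq_bigr => t _; rewrite mulrDl.
  - exists (fun t => a * g t); rewrite mulrCA Eg mulr_sumr.
    by apply: eq_bigr => t _; rewrite mulrA.
pose G : 'M[F]_(r, N) := \matrix_(t, l) grad (f t) 0 l.
have fullG : row_full G^T.
  rewrite /row_full mxrank_tr; apply/inj_row_free => c cG; apply/rowP => t; rewrite mxE.
  apply: (ffree (c 0)); apply/rowP => l; have /rowP /(_ l) := cG.
  rewrite !mxE => E; rewrite -[RHS]E summxE; apply: eq_bigr => t' _.
  by rewrite !mxE.
pose sg := fullrankfun fullG.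
pose Dm : 'M[P]_r := \matrix_(t, l) (f t)^`M(sg l).
have eD : eP (\det Dm) != 0.
  rewrite -det_map_mx -det_tr -unitfE.
  have := fullrowsub_unit fullG; rewrite unitmxE -/sg; congr (\det _ \is a GRing.unit).
  by apply/matrixP => l t; rewrite !mxE.
(* Built from the adjugate of the minor, so that the differential of each equation, paired with [v],
   returns the equation times the determinant. *)
pose v i : P := \sum_l (i == sg l)%:R * \sum_t (\adj Dm) l t * f t.
have v0 i : ev b (v i) = 0.
  rewrite rmorph_sum big1 // => l _; rewrite rmorphM rmorph_sum big1 ?mulr0 // => t _.
  by rewrite rmorphM /= f0 mulr0.
have vf t : \sum_i (f t)^`M(i) * v i = \det Dm * f t.
  transitivity (\sum_l Dm t l * \sum_t' (\adj Dm) l t' * f t').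
    under eq_bigr do rewrite mulr_sumr.
    rewrite exchange_big; apply: eq_bigr => l _ /=.
    rewrite (bigD1 (sg l)) //= eqxx mul1r mxE [X in _ + X]big1 ?addr0 // => i /negPf ->.
    by rewrite mul0r mulr0.
  under eq_bigr do rewrite mulr_sumr; rewrite exchange_big /=.
  transitivity (\sum_t' (Dm *m \adj Dm) t t' * f t').
    apply: eq_bigr => t' _; rewrite mxE mulr_suml.
    by apply: eq_bigr => l _; rewrite mulrA.
  rewrite mul_mx_adj (bigD1 t) //= mxE eqxx mulr1n big1 ?addr0 // => t' /negPf ne.
  by rewrite mxE eq_sym ne mulr0n mul0r.
exists (\det Dm * s); split; first by rewrite rmorphM mulf_neq0.
exists (fun i => s * v i); split=> [i|x x0]; first by rewrite rmorphM /= v0 mulr0.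
have [g Eg] := sI x x0.
(* Differentiating the expression of [s * x]; the terms with derivatives of [g] and of [s]
   contribute only to the square of the relation ideal. *)
have Edx i : s * x^`M(i) = \sum_t (g t)^`M(i) * f t + \sum_t g t * (f t)^`M(i) - x * s^`M(i).
  have := congr1 (mderiv i) Eg; rewrite mderivM.
  rewrite (big_morph (mderiv i) (mderivD i) (mderiv0 _ i)).
  under eq_bigr do rewrite mderivM.
  rewrite big_split /= => <-; ring.
have idS := ideal_sq_ideal (fun p : P => ev b p = 0).
have -> : \det Dm * s * x - \sum_i x^`M(i) * (s * v i) =
    \sum_i x * s^`M(i) * v i - \sum_i (\sum_t (g t)^`M(i) * f t) * v i.
  have -> : \sum_i x^`M(i) * (s * v i) = \sum_i (\sum_t (g t)^`M(i) * f t) * v i +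
      \sum_i (\sum_t g t * (f t)^`M(i)) * v i - \sum_i x * s^`M(i) * v i.
    rewrite -big_split -sumrB; apply: eq_bigr => i _ /=.
    by rewrite mulrA [_ * s]mulrC Edx !mulrDl mulNr.
  have -> : \sum_i (\sum_t g t * (f t)^`M(i)) * v i = \det Dm * s * x.
    rewrite -mulrA Eg mulr_sumr; under eq_bigr do rewrite mulr_suml.
    rewrite exchange_big; apply: eq_bigr => t _ /=.
    by rewrite mulrCA -vf mulr_sumr; apply: eq_bigr => i _; rewrite mulrA.
  ring.
apply: (idealB idS); refine (@ideal_sum _ _ _ _ _ _ idS _) => i _.
  by rewrite mulrAC mulrC; apply: (idealMl idS); apply: ideal_sq_mul.
rewrite mulr_suml; refine (@ideal_sum _ _ _ _ _ _ idS _) => t _.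
by rewrite -mulrA; apply: (idealMl idS); apply: ideal_sq_mul.
Qed.

End FreePoint.

(** * The equivalence *)

Section Equivalence.
Variables (K : fieldType) (char0 : [pchar K] =i pred0) (A : comAlgType K).
Variables (gT : finGroupType) (rho : gT -> {lrmorphism A -> A}).
Hypotheses (abelG : abelian [set: gT]) (act : is_algebra_action rho).
Hypotheses (ftA : finite_type A) (smA : formally_smooth A).
Hypothesis domA : GRing.integral_domain_axiom A.

Let ftB : finite_type (inv_ring rho).
Proof.
have [N [x gen]] := (finite_typeP A).1 ftA.
exact: (inv_ring_finite_type char0 act gen).
Qed.

Let G0 : (0 < #|gT|)%N.
Proof. by apply/card_gt0P; exists 1%g. Qed.

(** The multipliers that split the conormal sequence form an ideal. A point above it would
    contradict [jacobian_point], so it contains 1. *)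
Lemma free_inertia_smooth : free_inertia rho -> formally_smooth (inv_ring rho).
Proof.
move=> axes; have [N [b gen]] := (finite_typeP _).1 ftB.
pose aa c := exists s, ev b s = c /\ jacobian_ideal b s.
have idS := ideal_sq_ideal (fun p : {mpoly K[N]} => ev b p = 0).
have jacD s t : jacobian_ideal b s -> jacobian_ideal b t -> jacobian_ideal b (s + t).
  move=> [v [v0 vP]] [v' [v'0 v'P]]; exists (fun i => v i + v' i); split=> [i|x x0].
    by rewrite rmorphD /= v0 v'0 addr0.
  have -> : (s + t) * x - \sum_i x^`M(i) * (v i + v' i) =
      (s * x - \sum_i x^`M(i) * v i) + (t * x - \sum_i x^`M(i) * v' i).
    rewrite addrACA -opprD -big_split mulrDl; congr (_ - _).
    by apply: eq_bigr => i _; rewrite mulrDr.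
  by apply: (idealD idS); [apply: vP | apply: v'P].
have jacM a s : jacobian_ideal b s -> jacobian_ideal b (a * s).
  move=> [v [v0 vP]]; exists (fun i => a * v i); split=> [i|x x0].
    by rewrite rmorphM /= v0 mulr0.
  have -> : a * s * x - \sum_i x^`M(i) * (a * v i) = a * (s * x - \sum_i x^`M(i) * v i).
    rewrite mulrBr mulrA mulr_sumr; congr (_ - _).
    by apply: eq_bigr => i _; rewrite mulrCA.
  by apply: (idealMl idS); apply: vP.
have jacI s : ev b s = 0 -> jacobian_ideal b s.
  move=> s0; exists (fun=> 0); split=> [i|x x0]; first by rewrite rmorph0.
  rewrite big1 ?subr0 => [|i _]; last by rewrite mulr0.
  exact: ideal_sq_mul.
have onto := (generates_ev b).1 gen.
have idaa : is_ideal aa.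
  split=> [|c1 c2 [s [<- Us]] [t [<- Ut]]|c c1 [s [<- Us]]].
  - by exists 0; split; [rewrite rmorph0 | apply: jacI; rewrite rmorph0].
  - by exists (s + t); split; [rewrite rmorphD | apply: jacD].
  - by have [p <-] := onto c; exists (p * s); split; [rewrite rmorphM | apply: jacM].
have [[s [s1 Us]]|aa1] := pselect (aa 1).
  have [v [v0 vP]] : jacobian_ideal b 1.
    rewrite -(subrK s 1); apply: jacD => //.
    by apply: jacI; rewrite rmorphB rmorph1 /= s1 subrr.
  by apply: (smooth_splitting gen v0) => x /vP; rewrite mul1r.
have [F [e [eaa [z prim]]]] := point_over_invariants char0 act idaa aa1.
have [A' [j [e' [rho' PC]]]] := exists_point_change e act.
have [n [u [chi uP]]] := exists_coordinates (point_pchar e char0) abelG (change_act PC)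
  (change_rational PC) prim (change_finite_type ftA PC).
pose eP : {rmorphism {mpoly K[N]} -> F} := e \o inv_inclusion rho \o ev b.
pose hF : {lrmorphism {mpoly F[N]} -> A'} := ev (fun l => j (inv_val (b l))).
have [||||s [es Us]] := @jacobian_point K char0 A gT rho act ftA smA N b gen F e A' j e' rho' PC
  n u chi uP (axes _ _ _ _ _ _ _ _ _ _ prim PC uP) (fun l => e (inv_val (b l)))
  (e \o in_alg A) eP _ _ _ hF.
- by [].
- by [].
- by [].
- by move=> l; apply: evX.
by case/eqP: es; apply: (eaa (ev b s)); exists s.
Qed.

Lemma smooth_free_inertia : formally_smooth (inv_ring rho) -> free_inertia rho.
Proof.
move=> smB F e z A' j e' rho' n u chi prim PC uP; apply: contrapT => naxes.
have domB : GRing.integral_domain_axiom (inv_ring rho).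
  move=> x y /(congr1 (@inv_val _ _ _ rho)); rewrite rmorphM rmorph0 => /domA.
  by rewrite -(rmorph0 (@inv_val _ _ _ rho)) !(inj_eq val_inj).
have [rA rAP] := derivation_dim_constant char0 ftA smA domA.
have [rB rBP] := derivation_dim_constant char0 ftB smB domB.
have [[D indD] _] := rAP F e.
have rAn : (rA <= n)%N.
  exact: (derivations_le_coordinates (change_algebra PC) (change_point PC)
    (change_rational PC) uP indD).
have [F0 [e0 [inj_e0 _]]] := generic_point char0 (ltn0Sn 0) domA.
have rBA : (rB <= rA)%N.
  have [[DB [derB indB]] _] := rBP F0 (e0 \o inv_inclusion rho).
  have exD i : exists D' : A -> F0, derivation e0 (D' : A -> F0^o) /\
      forall r, D' (inv_inclusion rho r) = DB i r.
    apply: (extend_derivation (point_pchar e0 char0) ftA (derB i)) => r.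
    move=> r0; have -> : r = 0.
      by apply: val_inj; apply: inj_e0; rewrite [LHS]r0 !rmorph0.
    have derBi : derivation (e0 \o inv_inclusion rho) (DB i : _ -> F0^o) := derB i.
    exact: (derivation0 derBi).
  have [D' D'P] := choice exD; apply: ((rAP F0 e0).2 _ D'); split=> [i|c c0].
    by case: (D'P i).
  apply: indB => r; rewrite -[RHS](c0 (inv_inclusion rho r)).
  by apply: eq_bigr => i _; rewrite (D'P i).2.
have [delta [bb dP]] := nonfree_derivations (point_pchar e char0) (change_act PC)
  (change_smooth (change_algebra PC) smA) (change_rational PC) uP naxes.
suff : (n.+1 <= rB)%N by move=> nB; have := leq_trans nB (leq_trans rBA rAn); rewrite ltnn.
apply: ((rBP F (e \o inv_inclusion rho)).2 _ (fun i a => delta i (j (inv_val a)))).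
split=> [i|c c0 i].
  have [derd _ _] := dP i; split=> [k x y|x y].
    by rewrite linearP rmorphD (change_scale PC) (inv_derivationL derd).
  rewrite !rmorphM (inv_derivationM derd) ?(change_point PC) // => g;
    by rewrite (change_actE PC) inv_val_invariant.
(* Independence has to be tested on the invariants of [A], while the dual elements live in [A'];
   F-linearity carries a relation from the former to the latter. *)
have main (y : inv_ring rho') : \sum_i c i * delta i (inv_val y) = 0.
  elim/(inv_change_ind char0 act PC): y => [|f a x y Ex IH].
    by rewrite big1 // => l _; have [derd _ _] := dP l; rewrite rmorph0 (inv_derivation0 derd) mulr0.
  transitivity (f * \sum_l c l * delta l (j (inv_val a)) + \sum_l c l * delta l (inv_val y)).
    rewrite mulr_sumr -big_split; apply: eq_bigr => l _; have [derd _ _] := dP l.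
    by rewrite linearP (inv_derivationL derd) /= Ex mulrDr mulrCA.
  by rewrite c0 IH mulr0 addr0.
have [_ /inv_lift [y Ey] db] := dP i.
rewrite -[RHS](main y) Ey (bigD1 i) //= db eqxx mulr1 big1 ?addr0 // => l li.
by have [_ _ ->] := dP l; rewrite (negPf li) mulr0.
Qed.

(** The chain length bounds the rank of derivations at the generic point, which equals the rank at
    [e] and is at most the number of local coordinates; so [k] is small enough for
    [generated_axes]. *)
Lemma surjective_free_inertia n k : has_prime_chain A n -> (1 <= k <= n)%N ->
  (forall w : kahler_form A k, invariant_form rho w ->
     exists eta : kahler_form (inv_ring rho) k, dpi eta = w) -> free_inertia rho.
Proof.
move=> chain /andP [k0 kn] surj F e z A' j e' rho' n' u chi prim PC uP.
have [rA rAP] := derivation_dim_constant char0 ftA smA domA.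
have [F0 [e0 [inj_e0 _]]] := generic_point char0 (ltn0Sn 0) domA.
have nr := prime_chain_derivations char0 ftA inj_e0 chain (rAP F0 e0).
have [[D indD] _] := rAP F e.
have rn := derivations_le_coordinates (change_algebra PC) (change_point PC)
  (change_rational PC) uP indD.
apply: (generated_axes (point_pchar e char0) (change_act PC)
  (change_smooth (change_algebra PC) smA) (change_rational PC) uP _ k0).
  exact: (surjective_invariant_generated char0 act PC surj).
exact: leq_trans kn (leq_trans nr rn).
Qed.

End Equivalence.

Theorem theorem6p1 (K : fieldType) (char0 : [pchar K] =i pred0)
    (A : comAlgType K) (varA : affine_variety A) (smoothA : smooth A)
    (gT : finGroupType) (abelG : abelian [set: gT])
    (rho : gT -> {lrmorphism A -> A}) (actG : is_algebra_action rho)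
    (n : nat) (dimA : krull_dim A n) (k : nat) (k_range : (1 <= k <= n)%N) :
  (forall w : kahler_form A k, invariant_form rho w ->
     exists eta : kahler_form (inv_ring rho) k, dpi eta = w)
  <-> smooth (inv_ring rho).
Proof.
have [[ftA domA] [[_ smA] [chain _]]] := (varA, (smoothA, dimA)).
split=> [surj|[_ smB]].
  split; last first.
    apply: free_inertia_smooth => //.
    exact: (surjective_free_inertia char0 actG ftA smA domA chain k_range surj).
  have [N [x gen]] := (finite_typeP A).1 ftA.
  exact: (inv_ring_finite_type char0 actG gen).
apply: (axes_surjective char0 abelG actG ftA smA).
exact: smooth_free_inertia.
Qed.
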